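(* Let $\psi:\mathbb{R}\to\mathbb{C}$ be a $2\pi$-periodic function satisfying the Lipschitz condition $|\psi(u)-\psi(v)|\le C|u-v|$ for all $u,v\in[-\pi,\pi]$, with some constant $C>0$. Put $\varphi(u)=\psi(u)\sinh(2u)$ and let $f$ be the function on $(0,\infty)$ given by $$f(x)=x\int_{-\pi}^{\pi}J_0(2x\cosh u)\,\varphi(u)\,du,\qquad x>0.$$ Define, for $n\in\mathbb{N}$, $$a_n=\int_0^\infty\left[J^2_{in/2}(x)+Y^2_{in/2}(x)\right]f(x)\,dx,$$ and $$\Phi_n(x)=x\int_0^\pi J_0(2x\cosh u)\,\sinh(2u)\,\sin(nu)\,du,\qquad x>0.$$ Then for all $x>0$, $$f(x)=\sum_{n=1}^\infty \sinh\left(\frac{\pi n}{2}\right)\Phi_n(x)\,a_n.$$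
   Context: $J_\nu$ and $Y_\nu$ denote the Bessel functions of the first and second kind of (complex) order $\nu$; the orders $in/2$ are purely imaginary. *)

(* Defs.v *)
From Stdlib Require Import Reals Factorial.
From Coquelicot Require Import Coquelicot.
Open Scope R_scope.

Definition Cexp (z : C) : C :=
  (exp (Re z) * cos (Im z), exp (Re z) * sin (Im z)).
Definition Ccos (z : C) : C :=
  (cos (Re z) * cosh (Im z), - (sin (Re z) * sinh (Im z))).
Definition Csin (z : C) : C :=
  (sin (Re z) * cosh (Im z), cos (Re z) * sinh (Im z)).

Definition cpow_pos (x : R) (nu : C) : C := Cexp (Cmult nu (RtoC (ln x))).

Definition CLim_seq (u : nat -> C) : C :=
  (real (Lim_seq (fun n => Re (u n))), real (Lim_seq (fun n => Im (u n)))).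
Definition CSeries (a : nat -> C) : C :=
  (Series (fun n => Re (a n)), Series (fun n => Im (a n))).

(* 1/Gamma(z) via Euler/Gauss: lim_m z(z+1)...(z+m) / (m! m^z)  (entire) *)
Fixpoint Cpoch (z : C) (m : nat) : C :=
  match m with
  | O => z
  | S k => Cmult (Cpoch z k) (Cplus z (RtoC (INR (S k))))
  end.
Definition rgamma (z : C) : C :=
  CLim_seq (fun m => Cmult (Cpoch z m)
                       (Cinv (Cmult (RtoC (INR (fact m))) (cpow_pos (INR m) z)))).

Definition besselJ (nu : C) (x : R) : C :=
  Cmult (cpow_pos (x / 2) nu)
    (CSeries (fun k => Cmult (RtoC ((-1) ^ k * (x / 2) ^ (2 * k) / INR (fact k)))
                             (rgamma (Cplus nu (RtoC (INR k + 1)))))).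

(* Bessel function of the second kind for non-integer order nu
   (sin(nu pi) <> 0): Y_nu = (J_nu cos(nu pi) - J_{-nu}) / sin(nu pi).
   Only used here for nu = i n / 2 with n >= 1. *)
Definition besselY (nu : C) (x : R) : C :=
  Cdiv (Cminus (Cmult (besselJ nu x) (Ccos (Cmult nu (RtoC PI))))
               (besselJ (Copp nu) x))
       (Csin (Cmult nu (RtoC PI))).

Definition iord (n : nat) : C := (0, INR n / 2).

Definition phi (psi : R -> C) (u : R) : C := Cmult (psi u) (RtoC (sinh (2 * u))).

Definition f_of (psi : R -> C) (x : R) : C :=
  Cmult (RtoC x)
    (RInt (V := C_R_CompleteNormedModule)
       (fun u => Cmult (besselJ (RtoC 0) (2 * x * cosh u)) (phi psi u)) (- PI) PI).

Definition a_coef (psi : R -> C) (n : nat) : C :=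
  RInt_gen (V := C_R_CompleteNormedModule)
    (fun x => Cmult (Cplus (Cmult (besselJ (iord n) x) (besselJ (iord n) x))
                           (Cmult (besselY (iord n) x) (besselY (iord n) x)))
                    (f_of psi x))
    (at_right 0) (Rbar_locally p_infty).

Definition Phi_n (n : nat) (x : R) : C :=
  Cmult (RtoC x)
    (RInt (V := C_R_CompleteNormedModule)
       (fun u => Cmult (besselJ (RtoC 0) (2 * x * cosh u))
                       (RtoC (sinh (2 * u) * sin (INR n * u)))) 0 PI).

(* Main.v *)
(** Let n = 2 mu and kap w = 2 K_0 (2 sqrt w). Nicholson's formula for imaginary order reads
      J_{i mu}(x)^2 + Y_{i mu}(x)^2 = 4/PI^2 int_0^oo kap (x^2 sinh^2 t) cos (n t) dt.
    With theta = x d/dx, both sides satisfy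
      theta^3 N + n^2 theta N + 4 x^2 (theta N + N) = 0,
    and they have the same asymptotics at 0, where an energy estimate gives uniqueness.
    Lommel's antiderivative of X K_0(2 X sinh t) J_0(2 X cosh u) then reduces the
    integral defining a_n to
      int_0^oo cos (n t) / (sinh^2 t + cosh^2 u) dt,
    which is a multiple of sin (n u) / (sinh u cosh u), so that
      a_n = 2 / (PI sinh (PI n / 2)) int_{-PI}^{PI} psi (u) sin (n u) du.
    The series is therefore the sine expansion of the smooth odd function
    J_0 (2 x cosh u) sinh (2 u), integrated against psi. After an integration by parts it
    converges because the partial sums of the sawtooth series sum sin (n w) / n converge in L^1.

    No property of the Gamma function beyond Gauss's product is used: the moments of kap and
    the integrals of cos (n t) sech^{2 m} t satisfy the recurrences of the partial products,
    so that |Gamma (1 + i mu)|^2 = int_0^oo cos (n t) sech^2 t dt. *)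

Require Import Defs.
From Stdlib Require Import Reals Factorial Lra Lia Psatz FunctionalExtensionality.
From Coquelicot Require Import Coquelicot.
Open Scope R_scope.

(** * Absolutely convergent integrals over the half line *)

(** Every half-line integral is controlled by one majorant, [delta], with an explicit primitive;
    differentiation under the integral sign then rests on Taylor's remainder instead of dominated
    convergence. K_0 enters as the decaying solution produced by reduction of order from the I_0
    series, so its sign, decay and derivatives follow from elementary inequalities. Two obstacles
    shape the rest. Near x = 0 both sides of Nicholson's formula oscillate in ln x without
    converging, so asymptotics are stated as differences tending to 0, and amplitude and phase must
    match exactly: hence the Mellin moments, which fix the argument of Gamma (1 + i mu), and the
    evaluation |Gamma (1 + i mu)|^2 = PI mu / sinh (PI mu), read off from the same kernel integral
    as its parameter tends to 0. Secondly, the integral defining a_n is not handled by absolute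
    convergence: the order of integration is exchanged on compact x-intervals only, and Lommel's
    antiderivative gives limits at 0 and at infinity that are uniform in u. *)

Notation at_infty := (Rbar_locally p_infty).

(** The value carries information only when the integral converges, which [integrable]
    guarantees. *)
Definition half_int (f : R -> R) : R := RInt_gen f (at_right 0) at_infty.
Definition cont_pos (f : R -> R) := forall t, 0 < t -> continuous f t.
(** The common majorant: its primitive is [2 * atan (sqrt t)], so its integral over the half line is
    PI. The root at 0 leaves room for logarithmic singularities, and the decay like [t^(-3/2)] at
    infinity is weak enough to dominate every integrand that occurs. *)
Definition delta (t : R) : R := / (sqrt t * (1 + t)).
Definition dominated (K : R) (f : R -> R) :=
  cont_pos f /\ forall t, 0 < t -> Rabs (f t) <= K * delta t.
Definition integrable (f : R -> R) := exists K, dominated K f.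

Lemma at_right0_pos : at_right 0 (fun t => 0 < t).
Proof. exists (mkposreal 1 Rlt_0_1). intros; assumption. Qed.

Lemma at_right0_lt (e : R) : 0 < e -> at_right 0 (fun t => 0 < t < e).
Proof.
  intros He. exists (mkposreal e He). intros y Hy Hp.
  unfold ball in Hy; simpl in Hy; unfold AbsRing_ball in Hy; simpl in Hy.
  unfold minus, plus, opp, abs in Hy; simpl in Hy.
  rewrite Rabs_pos_eq in Hy; lra.
Qed.

Lemma at_infty_gt (M : R) : at_infty (fun t => M < t).
Proof. exists M. auto. Qed.

Lemma filter_prod_pos : filter_prod (at_right 0) at_infty
  (fun ab : R * R => 0 < fst ab /\ fst ab < 1 /\ 1 < snd ab).
Proof.
  apply (Filter_prod _ _ _ (fun t => 0 < t < 1) (fun t => 1 < t)).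
  apply at_right0_lt; lra. apply at_infty_gt. simpl; intros; lra.
Qed.

Lemma lim_at_spec {T} (F : (T -> Prop) -> Prop) {FF : Filter F} (f : T -> R) (l : R) :
  filterlim f F (locally l) <-> forall e, 0 < e -> F (fun x => Rabs (f x - l) < e).
Proof.
  split.
  - intros H e He. apply (H (fun y => Rabs (y - l) < e)).
    exists (mkposreal e He). intros y Hy. exact Hy.
  - intros H P [e He]. unfold filtermap. apply (filter_imp (fun x => Rabs (f x - l) < e)).
    intros x Hx. apply He. exact Hx. apply H. apply cond_pos.
Qed.

Lemma lim_at_squeeze {T} (F : (T -> Prop) -> Prop) {FF : Filter F} (f g : T -> R) (l : R) :
  F (fun x => Rabs (f x - l) <= g x) -> filterlim g F (locally 0) -> filterlim f F (locally l).
Proof.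
  intros H1 H2. apply lim_at_spec; trivial. intros e He.
  generalize (proj1 (lim_at_spec F g 0) H2 e He). intros H3.
  generalize (filter_and _ _ H1 H3). apply filter_imp. intros x [Ha Hb].
  rewrite Rminus_0_r in Hb. eapply Rle_lt_trans. apply Ha.
  eapply Rle_lt_trans. apply Rle_abs. apply Hb.
Qed.

Section Limits.
Context {T : Type} (F : (T -> Prop) -> Prop) {FF : Filter F}.

Lemma lim_plus (f g : T -> R) (l m : R) : filterlim f F (locally l) -> filterlim g F (locally m) ->
  filterlim (fun x => f x + g x) F (locally (l + m)).
Proof.
  intros Hf Hg. apply (filterlim_comp_2 (H := locally m) (G := locally l) f g Rplus); trivial.
  apply (filterlim_plus (V := R_NormedModule)).
Qed.

Lemma lim_mult (f g : T -> R) (l m : R) : filterlim f F (locally l) -> filterlim g F (locally m) ->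
  filterlim (fun x => f x * g x) F (locally (l * m)).
Proof.
  intros Hf Hg. apply (filterlim_comp_2 (H := locally m) (G := locally l) f g Rmult); trivial.
  apply (filterlim_mult (K := R_AbsRing)).
Qed.

Lemma lim_const (c : R) : filterlim (fun _ : T => c) F (locally c).
Proof. apply filterlim_const. Qed.

Lemma lim_scal (c : R) (f : T -> R) (l : R) : filterlim f F (locally l) ->
  filterlim (fun x => c * f x) F (locally (c * l)).
Proof. intros H. apply lim_mult; trivial. apply lim_const. Qed.

Lemma lim_scal0 (c : R) (f : T -> R) : filterlim f F (locally 0) ->
  filterlim (fun x => c * f x) F (locally 0).
Proof. intros H. rewrite <- (Rmult_0_r c). apply lim_scal. exact H. Qed.

Lemma lim_minus (f g : T -> R) (l m : R) : filterlim f F (locally l) -> filterlim g F (locally m) ->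
  filterlim (fun x => f x - g x) F (locally (l - m)).
Proof.
  intros Hf Hg. apply lim_plus; trivial.
  apply (filterlim_comp _ _ _ g Ropp F (locally m)); trivial.
  apply (filterlim_opp (V := R_NormedModule)).
Qed.

Lemma lim_continuous (f : T -> R) (g : R -> R) (l : R) : filterlim f F (locally l) -> continuous g l ->
  filterlim (fun x => g (f x)) F (locally (g l)).
Proof. intros Hf Hg. apply (filterlim_comp _ _ _ f g F (locally l)); trivial. Qed.
End Limits.

Ltac drw H := match type of H with is_derive ?f ?x ?l =>
  let E := fresh in assert (E : Derive (fun y => f y) x = l) by (apply is_derive_unique; exact H);
  rewrite E; clear E end.

Lemma lim_abs0 {T} (F : (T -> Prop) -> Prop) {FF : Filter F} (f : T -> R) :
  filterlim f F (locally 0) -> filterlim (fun x => Rabs (f x)) F (locally 0).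
Proof.
  intros H. apply lim_at_spec; trivial. intros e He.
  generalize (proj1 (lim_at_spec F f 0) H e He). apply filter_imp. intros x.
  rewrite !Rminus_0_r, Rabs_Rabsolu. trivial.
Qed.

Lemma continuous_at_right (f : R -> R) (x : R) : continuous f x -> filterlim f (at_right x) (locally (f x)).
Proof.
  intros H P HP. specialize (H P HP). unfold filtermap, at_right, within in *.
  revert H. apply filter_imp. auto.
Qed.

Lemma lim_sqrt_0 : filterlim sqrt (at_right 0) (locally 0).
Proof. rewrite <- sqrt_0 at 2. apply continuous_at_right, continuous_sqrt. Qed.

Lemma is_derive_continuous (f : R -> R) (x l : R) : is_derive f x l -> continuous f x.
Proof. intros H. apply (ex_derive_continuous f). exists l. exact H. Qed.

Lemma ex_RInt_pos (f : R -> R) (a b : R) : cont_pos f -> 0 < a -> 0 < b -> ex_RInt f a b.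
Proof.
  intros Hf Ha Hb. apply (ex_RInt_continuous (V:=R_CompleteNormedModule)). intros z Hz. apply Hf.
  destruct Hz as [Hz _]. eapply Rlt_le_trans; [|exact Hz]. apply Rmin_glb_lt; lra.
Qed.

Lemma is_RInt_gen_half (f : R -> R) (l : R) : cont_pos f ->
  filterlim (fun ab => RInt f (fst ab) (snd ab)) (filter_prod (at_right 0) at_infty) (locally l)
  -> is_RInt_gen f (at_right 0) at_infty l.
Proof.
  intros Hf Hl P HP. unfold filtermapi.
  specialize (Hl P HP). unfold filtermap in Hl.
  generalize (filter_and _ _ Hl filter_prod_pos). apply filter_imp.
  intros [a b] [H1 H2]. simpl in *. exists (RInt f a b). split; trivial.
  apply (RInt_correct (V:=R_CompleteNormedModule)). apply ex_RInt_pos; trivial; lra.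
Qed.

Lemma is_RInt_gen_half_inv (f : R -> R) (l : R) :
  is_RInt_gen f (at_right 0) at_infty l ->
  filterlim (fun ab => RInt f (fst ab) (snd ab)) (filter_prod (at_right 0) at_infty) (locally l).
Proof.
  intros H P HP. generalize (H P HP). unfold filtermapi, filtermap. apply filter_imp.
  intros [a b] [y [H1 H2]]. simpl in *.
  rewrite (is_RInt_unique _ _ _ _ H1). exact H2.
Qed.

Lemma half_int_unique (f : R -> R) (l : R) :
  is_RInt_gen f (at_right 0) at_infty l -> half_int f = l.
Proof. intros H. unfold half_int. apply is_RInt_gen_unique. exact H. Qed.

Lemma is_derive_Delta (t : R) : 0 < t -> is_derive (fun t => 2 * atan (sqrt t)) t (delta t).
Proof.
  intros Ht. pose proof (sqrt_lt_R0 t Ht).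
  auto_derive. trivial. unfold delta. rewrite Rmult_1_r, sqrt_sqrt by lra.
  field. split; lra.
Qed.

Lemma delta_pos (t : R) : 0 < t -> 0 < delta t.
Proof.
  intros Ht. unfold delta. pose proof (sqrt_lt_R0 t Ht).
  apply Rinv_0_lt_compat. apply Rmult_lt_0_compat; lra.
Qed.

Lemma cont_pos_delta : cont_pos delta.
Proof.
  intros t Ht. pose proof (sqrt_lt_R0 t Ht).
  apply (ex_derive_continuous delta). unfold delta. auto_derive. repeat split; trivial.
  assert (0 < sqrt t * (1 + t)) by (apply Rmult_lt_0_compat; lra). lra.
Qed.

Lemma Delta_lim0 : filterlim (fun t => 2 * atan (sqrt t)) (at_right 0) (locally 0).
Proof.
  replace 0 with (2 * atan (sqrt 0)) at 2 by (rewrite sqrt_0, atan_0; ring).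
  apply (continuous_at_right (fun t => 2 * atan (sqrt t))).
  apply (continuous_scal_r 2 (fun t => atan (sqrt t))).
  apply continuous_comp. apply continuous_sqrt. apply continuous_atan.
Qed.

Lemma Delta_lim1 : filterlim (fun t => 2 * atan (sqrt t)) at_infty (locally PI).
Proof.
  replace PI with (2 * (PI/2)) by field.
  apply lim_scal. apply Rbar_locally_filter. apply lim_at_spec. apply Rbar_locally_filter.
  intros e He.
  pose proof PI2_1.
  destruct (Rlt_dec (PI/2 - e) 0) as [Hn|Hn].
  - exists 0. intros t Ht. pose proof (atan_bound (sqrt t)).
    assert (0 < atan (sqrt t)). { rewrite <- atan_0. apply atan_increasing. apply sqrt_lt_R0; lra. }
    rewrite Rabs_left; lra.
  - set (d := PI/2 - e). assert (0 <= d < PI/2) by (unfold d; lra).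
    exists (tan d * tan d).
    intros t Ht. pose proof (atan_bound (sqrt t)).
    assert (Htd : 0 <= tan d). { destruct (Req_dec d 0) as [->|]. rewrite tan_0; lra. left. apply tan_gt_0; lra. }
    assert (d < atan (sqrt t)).
    { rewrite <- (atan_tan d) by lra. apply atan_increasing.
      rewrite <- (sqrt_square (tan d)) by trivial. apply sqrt_lt_1_alt. split; trivial. nra. }
    rewrite Rabs_left; unfold d in *; lra.
Qed.

Lemma RInt_abs_le (f g : R -> R) (a b : R) : a <= b -> ex_RInt f a b -> ex_RInt g a b ->
  (forall t, a < t < b -> Rabs (f t) <= g t) -> Rabs (RInt f a b) <= RInt g a b.
Proof.
  intros Hab Hf Hg H. apply Rabs_le. split.
  - rewrite <- (RInt_opp (V:=R_CompleteNormedModule)) by trivial. apply RInt_le; trivial.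
    apply (ex_RInt_opp (V:=R_NormedModule)); trivial.
    intros t Ht. specialize (H t Ht). apply Rabs_le_between in H.
    unfold opp; simpl; lra.
  - apply RInt_le; trivial. intros t Ht. specialize (H t Ht). apply Rabs_le_between in H. lra.
Qed.

(** The limits of the primitive [G] make the integrals over [[a, b]] Cauchy along the product
    filter; the bound [l1 - l0] then passes to the limit. *)
Lemma is_RInt_gen_dominated_comparison (f G g : R -> R) (l0 l1 : R) :
  cont_pos f -> cont_pos g -> (forall t, 0 < t -> is_derive G t (g t)) ->
  (forall t, 0 < t -> Rabs (f t) <= g t) ->
  filterlim G (at_right 0) (locally l0) -> filterlim G at_infty (locally l1) ->
  exists l, is_RInt_gen f (at_right 0) at_infty l /\ Rabs l <= l1 - l0.
Proof.
  intros Hf Hgc HG Hfg H0 H1.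
  assert (Hint : forall a b, 0 < a -> 0 < b -> a <= b -> Rabs (RInt f a b) <= G b - G a).
  { intros a b Ha Hb Hab.
    assert (HR : is_RInt g a b (G b - G a)).
    { apply (is_RInt_derive G g). intros; apply HG. destruct H as [Hx _].
      eapply Rlt_le_trans; [|exact Hx]. apply Rmin_glb_lt; lra.
      intros; apply Hgc. destruct H as [Hx _].
      eapply Rlt_le_trans; [|exact Hx]. apply Rmin_glb_lt; lra. }
    rewrite <- (is_RInt_unique _ _ _ _ HR).
    apply RInt_abs_le; trivial. apply ex_RInt_pos; trivial. eexists; exact HR.
    intros; apply Hfg; lra. }
  (* In the Cauchy estimate two lower ends, or two upper ends, are compared in no particular
     order. *)
  assert (Hint' : forall a b, 0 < a -> 0 < b -> Rabs (RInt f a b) <= Rabs (G b - G a)).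
  { intros a b Ha Hb. destruct (Rle_dec a b) as [H|H].
    - eapply Rle_trans. apply Hint; trivial. apply Rle_abs.
    - rewrite <- opp_RInt_swap by (apply ex_RInt_pos; trivial).
      unfold opp; simpl. rewrite Rabs_Ropp, Rabs_minus_sym. eapply Rle_trans. apply Hint; lra. apply Rle_abs. }
  assert (HC : exists l, filterlim (fun ab => RInt f (fst ab) (snd ab)) (filter_prod (at_right 0) at_infty) (locally l)).
  { apply (filterlim_locally_cauchy (U := R_CompleteSpace)). intros eps.
    assert (He : 0 < eps / 4). { pose proof (cond_pos eps). lra. }
    pose proof (proj1 (lim_at_spec _ _ _) H0 _ He) as E0.
    pose proof (proj1 (lim_at_spec _ _ _) H1 _ He) as E1.
    exists (fun ab : R * R => (0 < fst ab /\ Rabs (G (fst ab) - l0) < eps/4) /\ (0 < snd ab /\ Rabs (G (snd ab) - l1) < eps/4)).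
    split.
    - apply (Filter_prod _ _ _ _ _ (filter_and _ _ at_right0_pos E0) (filter_and _ _ (at_infty_gt 0) E1)).
      intros; split; trivial.
    - intros [a b] [a' b'] [[P1 P2] [P3 P4]] [[P5 P6] [P7 P8]]. simpl in *.
      assert (E : RInt f a' b' = RInt f a' a + RInt f a b + RInt f b b').
      { rewrite <- (RInt_Chasles f a' a b') by (apply ex_RInt_pos; trivial).
        rewrite <- (RInt_Chasles f a b b') by (apply ex_RInt_pos; trivial).
        unfold plus; simpl; ring. }
      unfold ball; simpl; unfold AbsRing_ball, minus, plus, opp, abs; simpl.
      rewrite E. replace (RInt f a' a + RInt f a b + RInt f b b' + - RInt f a b) with (RInt f a' a + RInt f b b') by ring.
      eapply Rle_lt_trans. apply Rabs_triang.
      pose proof (Hint' a' a P5 P1). pose proof (Hint' b b' P3 P7).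
      assert (Rabs (G a - G a') < eps/2). { replace (G a - G a') with ((G a - l0) + - (G a' - l0)) by ring.
        eapply Rle_lt_trans. apply Rabs_triang. rewrite Rabs_Ropp. lra. }
      assert (Rabs (G b' - G b) < eps/2). { replace (G b' - G b) with ((G b' - l1) + - (G b - l1)) by ring.
        eapply Rle_lt_trans. apply Rabs_triang. rewrite Rabs_Ropp. lra. }
      lra. }
  destruct HC as [l Hl]. exists l. split.
  apply is_RInt_gen_half; trivial.
  apply le_epsilon. intros e He.
  assert (He' : 0 < e/3) by lra.
  pose proof (proj1 (lim_at_spec _ _ _) Hl _ He') as E.
  pose proof (proj1 (lim_at_spec _ _ _) H0 _ He') as E0.
  pose proof (proj1 (lim_at_spec _ _ _) H1 _ He') as E1.
  assert (EE : filter_prod (at_right 0) at_infty (fun ab : R * R => Rabs (G (fst ab) - l0) < e/3 /\ Rabs (G (snd ab) - l1) < e/3)).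
  { apply (Filter_prod _ _ _ _ _ E0 E1). intros; split; trivial. }
  pose proof (filter_and _ _ (filter_and _ _ E EE) filter_prod_pos) as E3.
  apply filter_ex in E3. destruct E3 as [[a b] [[P1 [P2 P3]] P4]]. simpl in *.
  assert (Hab : a <= b) by lra.
  pose proof (Hint a b ltac:(lra) ltac:(lra) Hab).
  replace l with (-(RInt f a b - l) + RInt f a b) by ring.
  eapply Rle_trans. apply Rabs_triang. rewrite Rabs_Ropp.
  apply Rabs_def2 in P2. apply Rabs_def2 in P3. lra.
Qed.

(** The majorants [lam * delta (lam * t)] all have integral PI, so the bound does not depend on
    [lam]. This later bounds the integrals of [X * kap (X ^ 2 * sinh t ^ 2)] uniformly in [X]. *)
Lemma half_int_scaled (f : R -> R) (K lam : R) : 0 < lam -> cont_pos f ->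
  (forall t, 0 < t -> Rabs (f t) <= K * (lam * delta (lam * t))) ->
  is_RInt_gen f (at_right 0) at_infty (half_int f) /\ Rabs (half_int f) <= K * PI.
Proof.
  intros Hl Hf Hb.
  destruct (is_RInt_gen_dominated_comparison f (fun t => K * (2 * atan (sqrt (lam * t))))
     (fun t => K * (lam * delta (lam * t))) 0 (K * PI)) as [l [H1 H2]]; trivial.
  - intros t Ht. apply (continuous_scal_r K (fun t => lam * delta (lam * t))).
    apply (continuous_scal_r lam (fun t => delta (lam * t))).
    apply (continuous_comp (fun t => lam * t) delta).
    apply (is_derive_continuous (fun t => lam * t) t lam). auto_derive; trivial; ring.
    apply cont_pos_delta. apply Rmult_lt_0_compat; lra.
  - intros t Ht. apply (is_derive_scal (fun t => 2 * atan (sqrt (lam * t))) t K).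
    apply (is_derive_comp (fun t => 2 * atan (sqrt t)) (fun t => lam * t)).
    apply is_derive_Delta. apply Rmult_lt_0_compat; lra.
    auto_derive; trivial; ring.
  - replace 0 with (K * 0) at 2 by ring. apply lim_scal. apply within_filter, locally_filter.
    apply (filterlim_comp _ _ _ (fun t => lam * t) (fun t => 2 * atan (sqrt t)) _ (at_right 0)).
    2: apply Delta_lim0.
    intros P [e He]. unfold filtermap.
    assert (0 < e / lam). { apply Rdiv_lt_0_compat; trivial. apply cond_pos. }
    generalize (at_right0_lt (e/lam) H). apply filter_imp. intros x Hx.
    assert (0 < lam * x) by (apply Rmult_lt_0_compat; lra).
    apply He; trivial. unfold ball; simpl; unfold AbsRing_ball, minus, plus, opp, abs; simpl.
    rewrite Ropp_0, Rplus_0_r, Rabs_pos_eq by lra.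
    apply (Rmult_lt_reg_r (/lam)). apply Rinv_0_lt_compat; lra.
    replace (lam * x * / lam) with x by (field; lra). apply Hx.
  - apply lim_scal. apply Rbar_locally_filter.
    apply (filterlim_comp _ _ _ (fun t => lam * t) (fun t => 2 * atan (sqrt t)) _ at_infty).
    2: apply Delta_lim1.
    intros P [M HM]. exists (M / lam). intros x Hx. apply HM.
    apply (Rmult_lt_reg_r (/lam)). apply Rinv_0_lt_compat; lra.
    replace (lam * x * / lam) with x by (field; lra). apply Hx.
  - rewrite (half_int_unique _ _ H1). split; trivial. lra.
Qed.

Lemma half_int_dominated (f : R -> R) (K : R) : dominated K f ->
  is_RInt_gen f (at_right 0) at_infty (half_int f) /\ Rabs (half_int f) <= K * PI.
Proof.
  intros [H1 H2]. apply (half_int_scaled f K 1); trivial. lra.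
  intros t Ht. rewrite !Rmult_1_l. auto.
Qed.

Lemma half_int_correct (f : R -> R) : integrable f ->
  is_RInt_gen f (at_right 0) at_infty (half_int f).
Proof. intros [K H]. apply (half_int_dominated f K H). Qed.

Lemma half_int_ext (f g : R -> R) : (forall t, 0 < t -> f t = g t) -> integrable f -> half_int f = half_int g.
Proof.
  intros H Hf. symmetry. apply half_int_unique.
  apply (is_RInt_gen_ext f); [|apply half_int_correct; trivial].
  generalize filter_prod_pos. apply filter_imp. intros [a b] Hab x Hx. simpl in *. apply H.
  rewrite Rmin_left in Hx by lra. lra.
Qed.

Lemma dominated_plus (f g : R -> R) (K L : R) : dominated K f -> dominated L g -> dominated (K + L) (fun t => f t + g t).
Proof.
  intros [F1 F2] [G1 G2]. split.
  - intros t Ht. apply (continuous_plus f g); auto.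
  - intros t Ht. eapply Rle_trans. apply Rabs_triang. specialize (F2 t Ht). specialize (G2 t Ht). lra.
Qed.

Lemma dominated_scal (f : R -> R) (k K : R) : dominated K f -> dominated (Rabs k * K) (fun t => k * f t).
Proof.
  intros [F1 F2]. split.
  - intros t Ht. apply (continuous_scal_r k f); auto.
  - intros t Ht. rewrite Rabs_mult. specialize (F2 t Ht). pose proof (Rabs_pos k).
    rewrite Rmult_assoc. apply Rmult_le_compat_l; trivial.
Qed.

Lemma integrable_plus (f g : R -> R) : integrable f -> integrable g -> integrable (fun t => f t + g t).
Proof. intros [K F] [L G]. exists (K + L). apply dominated_plus; trivial. Qed.

Lemma integrable_scal (f : R -> R) (k : R) : integrable f -> integrable (fun t => k * f t).
Proof. intros [K F]. exists (Rabs k * K). apply dominated_scal; trivial. Qed.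

Lemma integrable_minus (f g : R -> R) : integrable f -> integrable g -> integrable (fun t => f t - g t).
Proof.
  intros [K F] [L G]. exists (K + L). destruct F as [F1 F2], G as [G1 G2]. split.
  - intros t Ht. apply (continuous_minus f g); auto.
  - intros t Ht. eapply Rle_trans. apply Rabs_triang. rewrite Rabs_Ropp. specialize (F2 t Ht). specialize (G2 t Ht). lra.
Qed.

Lemma half_int_plus (f g : R -> R) : integrable f -> integrable g ->
  half_int (fun t => f t + g t) = half_int f + half_int g.
Proof. intros F G. apply half_int_unique. apply (is_RInt_gen_plus f g); apply half_int_correct; trivial. Qed.

Lemma half_int_minus (f g : R -> R) : integrable f -> integrable g ->
  half_int (fun t => f t - g t) = half_int f - half_int g.
Proof. intros F G. apply half_int_unique. apply (is_RInt_gen_minus f g); apply half_int_correct; trivial. Qed.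

Lemma half_int_scal (f : R -> R) (k : R) : integrable f -> half_int (fun t => k * f t) = k * half_int f.
Proof. intros F. apply half_int_unique. apply (is_RInt_gen_scal f k). apply half_int_correct; trivial. Qed.

Lemma half_int_le (f g : R -> R) : integrable f -> integrable g -> (forall t, 0 < t -> f t <= g t) ->
  half_int f <= half_int g.
Proof.
  intros Hf Hg H.
  pose proof (is_RInt_gen_half_inv _ _ (half_int_correct f Hf)) as Lf.
  pose proof (is_RInt_gen_half_inv _ _ (half_int_correct g Hg)) as Lg.
  apply (filterlim_le (F := filter_prod (at_right 0) at_infty)
     (fun ab => RInt f (fst ab) (snd ab)) (fun ab => RInt g (fst ab) (snd ab)) (half_int f) (half_int g)).
  - generalize filter_prod_pos. apply filter_imp. intros [a b] Hab. simpl in *.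
    destruct Hf as [? [Hf _]]. destruct Hg as [? [Hg _]].
    apply RInt_le; try lra; try (apply ex_RInt_pos; trivial; lra). intros; apply H; lra.
  - exact Lf.
  - exact Lg.
Qed.

Lemma half_int_abs_le (f g : R -> R) : integrable f -> integrable g ->
  (forall t, 0 < t -> Rabs (f t) <= g t) -> Rabs (half_int f) <= half_int g.
Proof.
  intros Hf Hg H. apply Rabs_le. split.
  - replace (- half_int g) with ((-1) * half_int g) by ring. rewrite <- half_int_scal by trivial.
    apply half_int_le; trivial. apply integrable_scal; trivial.
    intros t Ht. specialize (H t Ht). apply Rabs_le_between in H. lra.
  - apply half_int_le; trivial. intros t Ht. specialize (H t Ht). apply Rabs_le_between in H. lra.
Qed.

Lemma half_int_FTC (F f : R -> R) (l0 l1 : R) : cont_pos f ->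
  (forall t, 0 < t -> is_derive F t (f t)) ->
  filterlim F (at_right 0) (locally l0) -> filterlim F at_infty (locally l1) ->
  half_int f = l1 - l0.
Proof.
  intros Hf HF H0 H1. apply half_int_unique. apply is_RInt_gen_half; trivial.
  apply (filterlim_ext_loc (fun ab : R * R => F (snd ab) + - F (fst ab))).
  - generalize filter_prod_pos. apply filter_imp. intros [a b] Hab. simpl in *.
    symmetry. apply is_RInt_unique. apply (is_RInt_derive F f).
    intros x Hx. rewrite Rmin_left in Hx by lra. apply HF. lra.
    intros x Hx. rewrite Rmin_left in Hx by lra. apply Hf. lra.
  - apply (filterlim_comp_2 (G := locally l1) (H := locally (- l0)) (fun ab : R * R => F (snd ab)) (fun ab : R * R => - F (fst ab)) Rplus).
    + apply (filterlim_comp _ _ _ snd F _ at_infty). apply filterlim_snd. exact H1.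
    + apply (filterlim_comp _ _ _ (fun ab : R * R => F (fst ab)) Ropp _ (locally l0)).
      apply (filterlim_comp _ _ _ fst F _ (at_right 0)). apply filterlim_fst. exact H0.
      apply (filterlim_opp (V := R_NormedModule)).
    + apply (filterlim_plus (V := R_NormedModule)).
Qed.

(** * Differentiation under the improper integral sign *)

Lemma taylor2_bound (f f1 f2 : R -> R) (x h r K : R) : Rabs h < r ->
  (forall y, Rabs (y - x) < r -> is_derive f y (f1 y)) ->
  (forall y, Rabs (y - x) < r -> is_derive f1 y (f2 y)) ->
  (forall y, Rabs (y - x) < r -> Rabs (f2 y) <= K) ->
  Rabs (f (x + h) - f x - h * f1 x) <= K * h ^ 2.
Proof.
  intros Hh H1 H2 HK.
  assert (HK0 : 0 <= K). { eapply Rle_trans. apply (Rabs_pos (f2 x)). apply HK. rewrite Rminus_diag, Rabs_R0. apply Rle_lt_trans with (Rabs h); trivial. apply Rabs_pos. }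
  assert (Hb : forall y, Rabs (y - x) <= Rabs h -> Rabs (f1 y - f1 x) <= K * Rabs (y - x)).
  { intros y Hy. destruct (MVT_gen f1 x y f2) as [c [Hc Ec]].
    - intros z Hz. apply H2. apply Rle_lt_trans with (Rabs (y - x)); [|lra].
      unfold Rmin, Rmax in Hz. destruct (Rle_dec x y); unfold Rabs; repeat destruct Rcase_abs; lra.
    - intros z Hz. apply continuity_pt_filterlim. apply (is_derive_continuous f1 z (f2 z)). apply H2.
      apply Rle_lt_trans with (Rabs (y - x)); [|lra].
      unfold Rmin, Rmax in Hz. destruct (Rle_dec x y); unfold Rabs; repeat destruct Rcase_abs; lra.
    - rewrite Ec, Rabs_mult. apply Rmult_le_compat_r. apply Rabs_pos. apply HK.
      apply Rle_lt_trans with (Rabs (y - x)); [|lra].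
      unfold Rmin, Rmax in Hc. destruct (Rle_dec x y); unfold Rabs; repeat destruct Rcase_abs; lra. }
  destruct (MVT_gen (fun y => f y - y * f1 x) x (x + h) (fun y => f1 y - f1 x)) as [c [Hc Ec]].
  - intros z Hz. assert (Hzx : Rabs (z - x) < r).
    { apply Rle_lt_trans with (Rabs h); [|lra].
      unfold Rmin, Rmax in Hz. destruct (Rle_dec x (x+h)); unfold Rabs; repeat destruct Rcase_abs; lra. }
    apply (is_derive_minus f (fun y => y * f1 x)). auto. auto_derive; trivial; ring.
  - intros z Hz. assert (Hzx : Rabs (z - x) < r).
    { apply Rle_lt_trans with (Rabs h); [|lra].
      unfold Rmin, Rmax in Hz. destruct (Rle_dec x (x+h)); unfold Rabs; repeat destruct Rcase_abs; lra. }
    apply continuity_pt_filterlim. apply (is_derive_continuous (fun y => f y - y * f1 x) z (f1 z - f1 x)).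
    apply (is_derive_minus f (fun y => y * f1 x)). auto. auto_derive; trivial; ring.
  - replace (f (x + h) - f x - h * f1 x) with ((f (x + h) - (x + h) * f1 x) - (f x - x * f1 x)) by ring.
    rewrite Ec. replace (x + h - x) with h by ring. rewrite Rabs_mult.
    assert (Hcx : Rabs (c - x) <= Rabs h).
    { unfold Rmin, Rmax in Hc. destruct (Rle_dec x (x+h)); unfold Rabs; repeat destruct Rcase_abs; lra. }
    replace (K * h ^ 2) with (K * Rabs h * Rabs h) by (rewrite Rmult_assoc, <- Rabs_mult, (Rabs_pos_eq (h * h)) by nra; ring).
    apply Rmult_le_compat_r. apply Rabs_pos. eapply Rle_trans. apply Hb; trivial.
    apply Rmult_le_compat_l; trivial.
Qed.

(** A remainder of second order is what integrating a pointwise Taylor remainder delivers. *)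
Lemma is_derive_of_quadratic_bound (F : R -> R) (x l r K : R) : 0 < r ->
  (forall h, Rabs h < r -> Rabs (F (x + h) - F x - h * l) <= K * h ^ 2) -> is_derive F x l.
Proof.
  intros Hr H. split. apply is_linear_scal_l. intros y Hy.
  apply (is_filter_lim_locally_unique (V := R_NormedModule)) in Hy. subst y.
  intros eps.
  assert (HK : 0 <= Rabs K + 1) by (pose proof (Rabs_pos K); lra).
  assert (Hd : 0 < Rmin r (eps / (Rabs K + 1))).
  { apply Rmin_glb_lt; trivial. apply Rdiv_lt_0_compat. apply cond_pos. pose proof (Rabs_pos K); lra. }
  exists (mkposreal _ Hd). change (forall y : R, ball x (mkposreal _ Hd) y ->
    norm (minus (minus (F y) (F x)) (scal (minus y x) l)) <= eps * norm (minus y x)).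
  intros y Hy.
  unfold ball in Hy; simpl in Hy; unfold AbsRing_ball, minus, plus, opp, abs in Hy; simpl in Hy.
  unfold norm, minus, plus, opp, scal; simpl; unfold abs, mult; simpl.
  set (h := y + - x) in *.
  assert (H1 : Rabs h < r) by (eapply Rlt_le_trans; [apply Hy|apply Rmin_l]).
  assert (H2 : Rabs h < eps / (Rabs K + 1)) by (eapply Rlt_le_trans; [apply Hy|apply Rmin_r]).
  specialize (H h H1). replace (x + h) with y in H by (unfold h; ring).
  replace (F y + - F x + - (h * l)) with (F y - F x - h * l) by ring.
  eapply Rle_trans. apply H.
  replace (h ^ 2) with (Rabs h * Rabs h) by (rewrite <- Rabs_mult, Rabs_pos_eq by nra; ring).
  rewrite <- Rmult_assoc. apply Rmult_le_compat_r. apply Rabs_pos.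
  apply Rle_trans with ((Rabs K + 1) * Rabs h). apply Rmult_le_compat_r. apply Rabs_pos. pose proof (Rle_abs K); lra.
  apply (Rmult_lt_compat_l (Rabs K + 1)) in H2. 2: pose proof (Rabs_pos K); lra.
  replace ((Rabs K + 1) * (eps / (Rabs K + 1))) with (pos eps) in H2. lra. field. pose proof (Rabs_pos K); lra.
Qed.

(** Only the second derivative needs a majorant uniform in the parameter: the remainder of
    [taylor2_bound] is then dominated by [K * h ^ 2 * delta t], whose integral is of order
    [h ^ 2]. *)
Lemma is_derive_half_int (f f1 f2 : R -> R -> R) (x r K : R) : 0 < r ->
  (forall y t, Rabs (y - x) < r -> 0 < t -> is_derive (fun y => f y t) y (f1 y t)) ->
  (forall y t, Rabs (y - x) < r -> 0 < t -> is_derive (fun y => f1 y t) y (f2 y t)) ->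
  (forall y t, Rabs (y - x) < r -> 0 < t -> Rabs (f2 y t) <= K * delta t) ->
  (forall y, Rabs (y - x) < r -> integrable (f y)) -> integrable (f1 x) ->
  is_derive (fun y => half_int (f y)) x (half_int (f1 x)).
Proof.
  intros Hr H1 H2 HK If If1.
  assert (Hx : Rabs (x - x) < r) by (rewrite Rminus_diag, Rabs_R0; trivial).
  apply (is_derive_of_quadratic_bound _ _ _ r (K * PI) Hr).
  intros h Hh.
  assert (Hxh : Rabs (x + h - x) < r) by (replace (x + h - x) with h by ring; trivial).
  rewrite <- half_int_scal by trivial.
  assert (I1 : integrable (fun t => h * f1 x t)) by (apply integrable_scal; trivial).
  assert (I2 : integrable (fun t => f (x + h) t - f x t)) by (apply integrable_minus; auto).
  rewrite <- half_int_minus by auto. rewrite <- half_int_minus by trivial.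
  assert (D : dominated (K * h ^ 2) (fun t => f (x + h) t - f x t - h * f1 x t)).
  { split. destruct (integrable_minus _ _ I2 I1) as [? [? _]]; trivial.
    intros t Ht. replace (K * h ^ 2 * delta t) with (K * delta t * h ^ 2) by ring.
    apply (taylor2_bound (fun y => f y t) (fun y => f1 y t) (fun y => f2 y t) x h r); auto. }
  apply half_int_dominated in D. destruct D as [_ D]. lra.
Qed.

(** * The power series of Bessel functions and the modified Bessel functions of orders 0 and 1 *)

(** The factorial makes [c n * x ^ n] tend to 0 for every [x], whereas outside a finite disc of
    convergence the terms of a power series do not tend to 0. *)
Lemma CV_radius_fact (c : nat -> R) (M : R) :
  (forall k, Rabs (c k) <= M / INR (fact k)) -> CV_radius c = p_infty.
Proof.
  intros H.
  assert (HM : 0 <= M).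
  { specialize (H 0%nat). simpl in H. eapply Rle_trans. apply Rabs_pos. eapply Rle_trans. apply H. lra. }
  assert (L : forall x, is_lim_seq (fun n => c n * x ^ n) 0).
  { intros x. apply is_lim_seq_abs_0.
    apply (is_lim_seq_le_le (fun _ => 0) _ (fun n => M * (/ INR (fact n) * (Rabs x) ^ n))).
    - intros n. split. apply Rabs_pos. rewrite Rabs_mult, <- RPow_abs.
      replace (M * (/ INR (fact n) * Rabs x ^ n)) with (M / INR (fact n) * Rabs x ^ n) by (unfold Rdiv; ring).
      apply Rmult_le_compat_r; auto. apply pow_le, Rabs_pos.
    - apply is_lim_seq_const.
    - replace (Finite 0) with (Rbar_mult M 0) by (simpl; f_equal; ring).
      apply is_lim_seq_scal_l.
      apply ex_series_lim_0. exists (exp (Rabs x)).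
      generalize (is_exp_Reals (Rabs x)). unfold is_pseries. apply is_series_ext.
      intros n. unfold scal; simpl; unfold mult; simpl. rewrite Rmult_comm. reflexivity. }
  destruct (CV_radius c) as [r | |] eqn:E; trivial.
  - exfalso. pose proof (CV_radius_ge_0 c) as H0. rewrite E in H0. simpl in H0.
    apply (CV_disk_outside c (r + 1)). rewrite E. simpl. rewrite Rabs_pos_eq; lra. apply L.
  - exfalso. pose proof (CV_radius_ge_0 c) as H0. rewrite E in H0. simpl in H0. trivial.
Qed.

(* With rho_0 = a + i b, the sequence determined by (k + 1 + i mu) rho_(k+1) = rho_k. *)
Fixpoint rho_seq (mu a b : R) (k : nat) : R * R :=
  match k with
  | O => (a, b)
  | S k => let (u, v) := rho_seq mu a b k in let m := INR (S k) in
           ((m * u + mu * v) / (m ^ 2 + mu ^ 2), (m * v - mu * u) / (m ^ 2 + mu ^ 2))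
  end.

(** Taylor coefficients in [y = (x / 2) ^ 2] of the entire factor of J_(i mu): when [a + i b] is 1 /
    Gamma (1 + i mu), [rho_seq] runs through 1 / Gamma (k + 1 + i mu). *)
Definition re_coef (mu a b : R) (k : nat) : R := (-1) ^ k / INR (fact k) * fst (rho_seq mu a b k).
Definition im_coef (mu a b : R) (k : nat) : R := (-1) ^ k / INR (fact k) * snd (rho_seq mu a b k).

Section BesselSeries.
Variables mu a b : R.
Let pc := re_coef mu a b.
Let qc := im_coef mu a b.

Lemma rho_seq_rec (k : nat) : let m := INR (S k) in
  m * fst (rho_seq mu a b (S k)) - mu * snd (rho_seq mu a b (S k)) = fst (rho_seq mu a b k) /\
  m * snd (rho_seq mu a b (S k)) + mu * fst (rho_seq mu a b (S k)) = snd (rho_seq mu a b k).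
Proof.
  intros m. assert (Hm : 0 < m) by (apply lt_0_INR; lia).
  cbn [rho_seq]. destruct (rho_seq mu a b k) as [u v]. cbn [fst snd]. fold m.
  split; field; nra.
Qed.

(** Each step divides by k + 1 + i mu, whose modulus is at least 1. *)
Lemma rho_seq_bound (k : nat) : fst (rho_seq mu a b k) ^ 2 + snd (rho_seq mu a b k) ^ 2 <= a ^ 2 + b ^ 2.
Proof.
  induction k as [|k IH]. simpl; lra.
  destruct (rho_seq_rec k) as [H1 H2]. set (m := INR (S k)) in *.
  assert (Hm : 1 <= m) by (apply (le_INR 1); lia).
  set (u := fst (rho_seq mu a b (S k))) in *. set (v := snd (rho_seq mu a b (S k))) in *.
  rewrite <- H1, <- H2 in IH. eapply Rle_trans; [|exact IH].
  replace ((m * u - mu * v) ^ 2 + (m * v + mu * u) ^ 2) with ((m ^ 2 + mu ^ 2) * (u ^ 2 + v ^ 2)) by ring.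
  assert (1 <= m ^ 2 + mu ^ 2) by nra. assert (0 <= u ^ 2 + v ^ 2) by nra. nra.
Qed.

Lemma coef_bound (k : nat) : Rabs (pc k) <= (1 + a ^ 2 + b ^ 2) / INR (fact k) /\
  Rabs (qc k) <= (1 + a ^ 2 + b ^ 2) / INR (fact k).
Proof.
  pose proof (rho_seq_bound k) as H. pose proof (INR_fact_lt_0 k) as Hf.
  unfold pc, qc, re_coef, im_coef.
  set (u := fst _) in *. set (v := snd _) in *.
  assert (Hi : 0 < / INR (fact k)) by (apply Rinv_0_lt_compat; trivial).
  assert (G : forall w, w ^ 2 <= a ^ 2 + b ^ 2 -> Rabs ((-1) ^ k / INR (fact k) * w) <= (1 + a ^ 2 + b ^ 2) / INR (fact k)).
  { intros w Hw. unfold Rdiv. rewrite !Rabs_mult, pow_1_abs, Rmult_1_l, (Rabs_pos_eq (/ _)) by lra.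
    rewrite Rmult_comm. apply Rmult_le_compat_r. lra.
    unfold Rabs; destruct Rcase_abs; nra. }
  split; apply G; nra.
Qed.

Lemma CV_re : CV_radius pc = p_infty.
Proof. apply (CV_radius_fact _ (1 + a ^ 2 + b ^ 2)). intros k. apply (coef_bound k). Qed.
Lemma CV_im : CV_radius qc = p_infty.
Proof. apply (CV_radius_fact _ (1 + a ^ 2 + b ^ 2)). intros k. apply (coef_bound k). Qed.

(** Bessel's equation of order i mu at the level of coefficients, split into real and imaginary
    parts. *)
Lemma coef_rec (k : nat) :
  INR (S k) * (INR (S k) * pc (S k) - mu * qc (S k)) = - pc k /\
  INR (S k) * (INR (S k) * qc (S k) + mu * pc (S k)) = - qc k.
Proof.
  destruct (rho_seq_rec k) as [H1 H2]. unfold pc, qc, re_coef, im_coef.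
  rewrite <- H1, <- H2. pose proof (INR_fact_lt_0 k).
  assert (0 < INR (S k)) by (apply lt_0_INR; lia).
  rewrite fact_simpl, mult_INR. cbn [pow].
  split; field; lra.
Qed.
End BesselSeries.

Lemma entire_derive (c : nat -> R) (y : R) : CV_radius c = p_infty ->
  is_derive (PSeries c) y (PSeries (PS_derive c) y).
Proof. intros H. apply is_derive_PSeries. rewrite H. exact I. Qed.

Lemma entire_ex (c : nat -> R) (y : R) : CV_radius c = p_infty -> ex_pseries c y.
Proof. intros H. apply CV_radius_inside. rewrite H. exact I. Qed.

Definition bs_p mu a b := PSeries (re_coef mu a b).
Definition bs_q mu a b := PSeries (im_coef mu a b).
Definition bs_p1 mu a b := PSeries (PS_derive (re_coef mu a b)).
Definition bs_q1 mu a b := PSeries (PS_derive (im_coef mu a b)).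

Lemma is_derive_bs_p mu a b y : is_derive (bs_p mu a b) y (bs_p1 mu a b y).
Proof. apply entire_derive, CV_re. Qed.
Lemma is_derive_bs_q mu a b y : is_derive (bs_q mu a b) y (bs_q1 mu a b y).
Proof. apply entire_derive, CV_im. Qed.

(** Turns the coefficient recurrence into a first-order system, so that Bessel's equation becomes
    available without second derivatives of any series. *)
Lemma entire_first_order (c d e : nat -> R) (m y : R) :
  CV_radius c = p_infty -> CV_radius d = p_infty ->
  (forall k, INR (S k) * (INR (S k) * c (S k) + m * d (S k)) = - e k) ->
  is_derive (fun y => y * PSeries (PS_derive c) y + m * PSeries d y) y (- PSeries e y).
Proof.
  intros Hc Hd H.
  assert (Hc' : CV_radius (PS_incr_1 (PS_derive c)) = p_infty)
    by (rewrite CV_radius_incr_1, CV_radius_derive; trivial).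
  assert (Hd' : CV_radius (PS_scal m d) = p_infty).
  (* Scaling preserves the radius only for a nonzero factor, and the factor 0 does occur: order 0 is
     used for I_0 and J_0. *)
  { destruct (Req_dec m 0) as [->|Hm].
    - rewrite (CV_radius_ext _ (fun _ => 0)). apply CV_radius_const_0.
      intros n. unfold PS_scal, scal; simpl; unfold mult; simpl. ring.
    - rewrite CV_radius_scal; trivial. }
  set (s := PS_plus (PS_incr_1 (PS_derive c)) (PS_scal m d)).
  assert (Hs : CV_radius s = p_infty).
  { pose proof (CV_radius_plus (PS_incr_1 (PS_derive c)) (PS_scal m d)) as E.
    rewrite Hc', Hd' in E. fold s in E. destruct (CV_radius s); simpl in E; trivial; destruct E. }
  apply (is_derive_ext (PSeries s)).
  - intros t. unfold s. rewrite PSeries_plus by (apply entire_ex; trivial).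
    rewrite PSeries_incr_1, PSeries_scal. reflexivity.
  - replace (- PSeries e y) with (PSeries (PS_derive s) y). apply entire_derive; trivial.
    rewrite <- PSeries_opp. apply PSeries_ext. intros n.
    unfold PS_derive at 1, PS_opp, opp. cbn [AbelianGroup.opp]. simpl opp.
    change (INR (S n) * s (S n) = - e n). rewrite <- H. f_equal.
Qed.

Lemma is_derive_bs_r mu a b y :
  is_derive (fun y => y * bs_p1 mu a b y + (- mu) * bs_q mu a b y) y (- bs_p mu a b y).
Proof.
  apply entire_first_order. apply CV_re. apply CV_im.
  intros k. destruct (coef_rec mu a b k) as [H _]. rewrite <- H. ring.
Qed.

Lemma is_derive_bs_s mu a b y :
  is_derive (fun y => y * bs_q1 mu a b y + mu * bs_p mu a b y) y (- bs_q mu a b y).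
Proof.
  apply entire_first_order. apply CV_im. apply CV_re.
  intros k. destruct (coef_rec mu a b k) as [_ H]. rewrite <- H. ring.
Qed.

(* I_0(2 sqrt w) and sqrt w I_1(2 sqrt w) *)
Definition i0 (w : R) : R := bs_p 0 1 0 (- w).
Definition iota (w : R) : R := - w * bs_p1 0 1 0 (- w).

Lemma is_derive_i0 (w : R) : 0 < w -> is_derive i0 w (iota w / w).
Proof.
  intros Hw. replace (iota w / w) with ((-1) * bs_p1 0 1 0 (- w)) by (unfold iota; field; lra).
  apply (is_derive_comp (bs_p 0 1 0) Ropp). apply is_derive_bs_p. auto_derive; trivial; ring.
Qed.

Lemma continuous_i0 (w : R) : continuous i0 w.
Proof.
  apply (continuous_comp Ropp (bs_p 0 1 0)).
  apply (is_derive_continuous _ w (-1)). auto_derive; trivial; ring.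
  eapply is_derive_continuous, is_derive_bs_p.
Qed.

Lemma is_derive_iota (w : R) : is_derive iota w (i0 w).
Proof.
  replace (i0 w) with ((-1) * (- bs_p 0 1 0 (- w))) by (unfold i0; ring).
  apply (is_derive_ext (fun w => (fun y => y * bs_p1 0 1 0 y + (- 0) * bs_q 0 1 0 y) (- w))).
  intros t; unfold iota; simpl; ring.
  apply (is_derive_comp (fun y => y * bs_p1 0 1 0 y + (- 0) * bs_q 0 1 0 y) Ropp).
  apply is_derive_bs_r. auto_derive; trivial; ring.
Qed.

Lemma rho_seq_0 (k : nat) : rho_seq 0 1 0 k = (/ INR (fact k), 0).
Proof.
  induction k as [|k IH]. simpl. f_equal; field.
  cbn [rho_seq]. rewrite IH. rewrite fact_simpl, mult_INR.
  pose proof (INR_fact_lt_0 k). assert (0 < INR (S k)) by (apply lt_0_INR; lia).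
  f_equal; field; lra.
Qed.

(** For [w >= 0] all terms of the series are nonnegative, so the sum exceeds each one. The rapid
    decay of the K functions comes entirely from this lower bound. *)
Lemma i0_ge_term (w : R) (k : nat) : 0 <= w -> w ^ k / INR (fact k) ^ 2 <= i0 w.
Proof.
  intros Hw. unfold i0, bs_p, PSeries.
  assert (E : forall n, re_coef 0 1 0 n * (- w) ^ n = w ^ n / INR (fact n) ^ 2).
  { intros n. unfold re_coef. rewrite rho_seq_0. cbn [fst].
    replace (- w) with ((-1) * w) by ring. rewrite Rpow_mult_distr.
    replace ((-1) ^ n / INR (fact n) * / INR (fact n) * ((-1) ^ n * w ^ n))
     with (((-1) ^ n * (-1) ^ n) * (w ^ n / INR (fact n) ^ 2)).
    rewrite <- Rpow_mult_distr. replace (-1 * -1) with 1 by ring. rewrite pow1. ring.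
    pose proof (INR_fact_lt_0 n). field. lra. }
  rewrite (Series_ext _ _ E).
  assert (Ex : ex_series (fun n => w ^ n / INR (fact n) ^ 2)).
  { pose proof (entire_ex _ (- w) (CV_re 0 1 0)) as H.
    apply ex_pseries_R in H. revert H. apply ex_series_ext. exact E. }
  assert (P : forall n, 0 <= w ^ n / INR (fact n) ^ 2).
  { intros n. apply Rmult_le_pos. apply pow_le; trivial. apply Rlt_le, Rinv_0_lt_compat, pow_lt, INR_fact_lt_0. }
  rewrite (Series_incr_n _ (S k)) by (trivial; lia).
  assert (0 <= Series (fun n => w ^ (S k + n) / INR (fact (S k + n)) ^ 2)).
  { rewrite <- (Rmult_0_l (Series (fun _ => 0))). rewrite <- Series_scal_l.
    apply Series_le. intros n; split. lra. rewrite Rmult_0_l. apply P.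
    apply (ex_series_incr_n (fun n => w ^ n / INR (fact n) ^ 2) (S k)); trivial. }
  cbn [pred].
  assert (w ^ k / INR (fact k) ^ 2 <= sum_f_R0 (fun n => w ^ n / INR (fact n) ^ 2) k).
  { clear - P. destruct k. simpl; lra. rewrite tech5.
    pose proof (cond_pos_sum (fun n => w ^ n / INR (fact n) ^ 2) k P). lra. }
  lra.
Qed.

Lemma i0_ge_1 (w : R) : 0 <= w -> 1 <= i0 w.
Proof. intros H. pose proof (i0_ge_term w 0 H). simpl in H0. lra. Qed.

Lemma i0_0 : i0 0 = 1.
Proof. unfold i0, bs_p. rewrite Ropp_0, PSeries_0. unfold re_coef; simpl. field. Qed.

Lemma iota_0 : iota 0 = 0.
Proof. unfold iota. ring. Qed.

Lemma iota_ge (w : R) : 0 <= w -> w <= iota w.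
Proof.
  intros Hw. destruct (Req_dec w 0) as [->|Hn]. rewrite iota_0; lra.
  destruct (MVT_gen iota 0 w i0) as [c [Hc Ec]].
  - intros; apply is_derive_iota.
  - intros; apply continuity_pt_filterlim. eapply is_derive_continuous, is_derive_iota.
  - rewrite Rmin_left, Rmax_right in Hc by lra.
    rewrite iota_0 in Ec. pose proof (i0_ge_1 c ltac:(lra)). nra.
Qed.

Lemma iota_pos (w : R) : 0 < w -> 0 < iota w.
Proof. intros H. pose proof (iota_ge w). lra. Qed.

Lemma i0_incr (v w : R) : 0 < v -> v <= w -> i0 v <= i0 w.
Proof.
  intros Hv Hw. destruct (Req_dec v w) as [->|Hn]. lra.
  destruct (MVT_gen i0 v w (fun w => iota w / w)) as [c [Hc Ec]].
  - intros x Hx. apply is_derive_i0. rewrite Rmin_left in Hx; lra.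
  - intros x Hx. apply continuity_pt_filterlim. apply continuous_i0.
  - rewrite Rmin_left, Rmax_right in Hc by lra.
    assert (0 < iota c / c). { apply Rdiv_lt_0_compat. apply iota_pos; lra. lra. }
    nra.
Qed.

(** * The decaying solution by reduction of order *)

Definition iotainv2 (w : R) : R := / (iota w) ^ 2.

Lemma cont_pos_iotainv2 : cont_pos iotainv2.
Proof.
  intros w Hw. unfold iotainv2. apply continuous_Rinv_comp.
  - apply (is_derive_continuous _ w (2 * iota w * i0 w)).
    pose proof (is_derive_iota w). auto_derive. exists (i0 w). exact H.
    drw H. ring.
  - apply pow_nonzero. pose proof (iota_pos w Hw). lra.
Qed.

(** [i0] is increasing and is the derivative of [iota]: inserting the factor [i0 t / i0 v >= 1]
    makes the integrand the exact derivative of [- / (i0 v * iota t)]. *)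
Lemma RInt_iotainv2_bound (v w : R) : 0 < v -> v <= w ->
  0 <= RInt iotainv2 v w <= / i0 v * (/ iota v - / iota w).
Proof.
  intros Hv Hvw.
  assert (Ex : ex_RInt iotainv2 v w) by (apply ex_RInt_pos; [apply cont_pos_iotainv2|lra|lra]).
  assert (P : forall t, 0 < t -> 0 < iotainv2 t) by (intros; apply Rinv_0_lt_compat, pow_lt, iota_pos; trivial).
  split. apply RInt_ge_0; trivial. intros; apply Rlt_le, P; lra.
  set (g := fun t => / i0 v * (i0 t * iotainv2 t)).
  assert (C : cont_pos g).
  { intros t Ht. unfold g. apply (continuous_scal_r (/ i0 v) (fun t => i0 t * iotainv2 t)).
    apply (continuous_mult i0 iotainv2). apply continuous_i0. apply cont_pos_iotainv2; trivial. }
  assert (D : is_RInt g v w (/ i0 v * (- / iota w) - / i0 v * (- / iota v))).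
  { apply (is_RInt_derive (fun t => / i0 v * (- / iota t)) g).
    - intros x Hx. rewrite Rmin_left in Hx by lra. pose proof (iota_pos x ltac:(lra)).
      pose proof (is_derive_iota x) as Hd. unfold g, iotainv2. auto_derive. split. exists (i0 x); exact Hd. lra.
      drw Hd. field. split; try lra. pose proof (i0_ge_1 v); lra.
    - intros x Hx. rewrite Rmin_left in Hx by lra. apply C; lra. }
  replace (/ i0 v * (/ iota v - / iota w)) with (RInt g v w) by (rewrite (is_RInt_unique _ _ _ _ D); lra).
  apply RInt_le; trivial. eexists; exact D.
  intros t Ht. unfold g. rewrite <- Rmult_assoc. rewrite <- (Rmult_1_l (iotainv2 t)) at 1.
  apply Rmult_le_compat_r. apply Rlt_le, P; lra.
  pose proof (i0_ge_1 v ltac:(lra)). pose proof (i0_incr v t ltac:(lra) ltac:(lra)).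
  apply (Rmult_le_reg_l (i0 v)). lra. rewrite <- Rmult_assoc, Rinv_r by lra. lra.
Qed.

Lemma iota_tail_exists : exists L, filterlim (fun w => RInt iotainv2 1 w) at_infty (locally (L : R)).
Proof.
  apply (filterlim_locally_cauchy (U := R_CompleteSpace)). intros eps.
  exists (fun w => 2 / eps < w /\ 1 < w). split.
  { apply filter_and; apply at_infty_gt. }
  assert (G : forall u v, 2 / eps < u -> 1 < u -> u <= v -> Rabs (RInt iotainv2 1 v - RInt iotainv2 1 u) < eps).
  { intros u v Hu Hu1 Huv.
    rewrite <- (RInt_Chasles iotainv2 1 u v) by (apply ex_RInt_pos; [apply cont_pos_iotainv2|lra|lra]).
    unfold plus; simpl. replace (RInt iotainv2 1 u + RInt iotainv2 u v - RInt iotainv2 1 u) with (RInt iotainv2 u v) by (simpl; lra).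
    pose proof (RInt_iotainv2_bound u v ltac:(lra) Huv) as [B1 B2].
    rewrite Rabs_pos_eq by trivial. eapply Rle_lt_trans. apply B2.
    pose proof (i0_ge_1 u ltac:(lra)) as I1. pose proof (iota_ge u ltac:(lra)) as I2.
    pose proof (iota_pos v ltac:(lra)) as I3. pose proof (cond_pos eps) as He.
    assert (0 < / iota v) by (apply Rinv_0_lt_compat; trivial).
    assert (/ iota u <= / u) by (apply Rinv_le_contravar; lra).
    assert (/ i0 u <= 1) by (rewrite <- Rinv_1; apply Rinv_le_contravar; lra).
    assert (0 < / i0 u) by (apply Rinv_0_lt_compat; lra).
    assert (0 < / iota u) by (apply Rinv_0_lt_compat; lra).
    assert (/ u < eps / 2). { apply (Rmult_lt_reg_r u). lra. rewrite Rinv_l by lra.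
      apply (Rmult_lt_compat_r (eps/2)) in Hu; [|lra]. replace (2 / eps * (eps / 2)) with 1 in Hu by (field; lra). lra. }
    apply Rle_lt_trans with (1 * / u); [|lra].
    apply Rle_trans with (/ i0 u * / iota u). apply Rmult_le_compat_l; lra.
    apply Rmult_le_compat; lra. }
  intros u v [Hu Hu1] [Hv Hv1]. change (Rabs (RInt iotainv2 1 v - RInt iotainv2 1 u) < eps).
  destruct (Rle_dec u v). apply G; trivial.
  rewrite Rabs_minus_sym. apply G; trivial. lra.
Qed.

Definition iota_tail_lim : R := Lim (fun w => RInt iotainv2 1 w) p_infty.

Lemma iota_tail_lim_correct : filterlim (fun w => RInt iotainv2 1 w) at_infty (locally iota_tail_lim).
Proof.
  destruct iota_tail_exists as [L HL].
  assert (E : is_lim (fun w => RInt iotainv2 1 w) p_infty L) by exact HL.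
  unfold iota_tail_lim. rewrite (is_lim_unique _ _ _ E). exact HL.
Qed.

(** The integral of [iotainv2] from [w] to infinity, anchored at 1 so that the fundamental theorem
    gives its derivative. *)
Definition iota_tail (w : R) : R := iota_tail_lim - RInt iotainv2 1 w.

Lemma is_derive_iota_tail (w : R) : 0 < w -> is_derive iota_tail w (- / (iota w) ^ 2).
Proof.
  intros Hw. unfold iota_tail.
  replace (- / iota w ^ 2) with (0 - iotainv2 w) by (unfold iotainv2; ring).
  apply (is_derive_minus (fun _ => iota_tail_lim) (fun w => RInt iotainv2 1 w)).
  apply (is_derive_const (V := R_NormedModule)).
  apply (is_derive_RInt iotainv2 _ 1). 2: apply cont_pos_iotainv2; trivial.
  exists (mkposreal w Hw). intros y Hy.
  unfold ball in Hy; simpl in Hy; unfold AbsRing_ball, minus, plus, opp, abs in Hy; simpl in Hy.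
  apply (RInt_correct (V:=R_CompleteNormedModule)). apply ex_RInt_pos. apply cont_pos_iotainv2. lra.
  apply Rabs_def2 in Hy. lra.
Qed.

(** The source of all signs: the lower bound makes [gam] nonnegative, the upper one makes [kap]
    nonnegative and [gam] at most [/ i0]. *)
Lemma iota_tail_bound (w : R) : 0 < w -> 0 <= iota_tail w <= / (i0 w * iota w).
Proof.
  intros Hw.
  assert (L : filterlim (fun v => RInt iotainv2 1 v - RInt iotainv2 1 w) at_infty (locally (iota_tail w))).
  { apply lim_minus. apply Rbar_locally_filter. apply iota_tail_lim_correct. apply filterlim_const. }
  pose proof (i0_ge_1 w ltac:(lra)). pose proof (iota_pos w Hw).
  assert (E : forall v, w < v -> 0 <= RInt iotainv2 1 v - RInt iotainv2 1 w <= / (i0 w * iota w)).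
  { intros v Hv.
    rewrite <- (RInt_Chasles iotainv2 1 w v) by (apply ex_RInt_pos; [apply cont_pos_iotainv2|lra|lra]).
    unfold plus; simpl. replace (RInt iotainv2 1 w + RInt iotainv2 w v - RInt iotainv2 1 w) with (RInt iotainv2 w v) by (simpl; lra).
    pose proof (RInt_iotainv2_bound w v Hw ltac:(lra)) as [B1 B2]. split; trivial.
    eapply Rle_trans. apply B2. rewrite Rinv_mult.
    apply Rmult_le_compat_l. apply Rlt_le, Rinv_0_lt_compat; lra.
    pose proof (Rinv_0_lt_compat _ (iota_pos v ltac:(lra))). lra. }
  split.
  - apply (filterlim_le (F := at_infty) (fun _ => 0) (fun v => RInt iotainv2 1 v - RInt iotainv2 1 w) 0 (iota_tail w)).
    generalize (at_infty_gt w). apply filter_imp. intros x Hx; apply E; trivial.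
    apply filterlim_const. exact L.
  - apply (filterlim_le (F := at_infty) (fun v => RInt iotainv2 1 v - RInt iotainv2 1 w) (fun _ => / (i0 w * iota w)) (iota_tail w) (/ (i0 w * iota w))).
    generalize (at_infty_gt w). apply filter_imp. intros x Hx; apply E; trivial.
    exact L. apply filterlim_const.
Qed.

(* 2 sqrt w K_1(2 sqrt w) and 2 K_0(2 sqrt w), by reduction of order *)
Definition gam (w : R) : R := iota w * iota_tail w.
Definition kap (w : R) : R := / iota w - i0 w * iota_tail w.

Lemma is_derive_gam (w : R) : 0 < w -> is_derive gam w (- kap w).
Proof.
  intros Hw. pose proof (iota_pos w Hw). pose proof (is_derive_iota w) as H1.
  pose proof (is_derive_iota_tail w Hw) as H2.
  unfold gam. auto_derive. split. eexists; exact H1. split; trivial. eexists; exact H2.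
  drw H1. drw H2. unfold kap. field. lra.
Qed.

Lemma is_derive_kap (w : R) : 0 < w -> is_derive kap w (- gam w / w).
Proof.
  intros Hw. pose proof (iota_pos w Hw). pose proof (is_derive_iota w) as H1.
  pose proof (is_derive_iota_tail w Hw) as H2. pose proof (is_derive_i0 w Hw) as H3.
  unfold kap. auto_derive. repeat split; trivial; try (eexists; eassumption). lra.
  drw H1. drw H2. drw H3. unfold gam. field. lra.
Qed.

Lemma gam_kap_wronskian (w : R) : 0 < w -> iota w * kap w + i0 w * gam w = 1.
Proof. intros Hw. pose proof (iota_pos w Hw). unfold gam, kap. field. lra. Qed.

Lemma gam_bound (w : R) : 0 < w -> 0 <= gam w <= / i0 w.
Proof.
  intros Hw. pose proof (iota_pos w Hw). pose proof (i0_ge_1 w ltac:(lra)). pose proof (iota_tail_bound w Hw) as [B1 B2].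
  unfold gam. split. apply Rmult_le_pos; lra.
  apply Rle_trans with (iota w * / (i0 w * iota w)). apply Rmult_le_compat_l; lra.
  right. field. lra.
Qed.

Lemma gam_le_1 (w : R) : 0 < w -> gam w <= 1.
Proof.
  intros Hw. pose proof (gam_bound w Hw) as [_ B]. pose proof (i0_ge_1 w ltac:(lra)).
  eapply Rle_trans. apply B. rewrite <- Rinv_1. apply Rinv_le_contravar; lra.
Qed.

Lemma kap_nonneg (w : R) : 0 < w -> 0 <= kap w.
Proof.
  intros Hw. pose proof (iota_pos w Hw). pose proof (i0_ge_1 w ltac:(lra)). pose proof (iota_tail_bound w Hw) as [B1 B2].
  unfold kap. assert (i0 w * iota_tail w <= i0 w * / (i0 w * iota w)) by (apply Rmult_le_compat_l; lra).
  replace (i0 w * / (i0 w * iota w)) with (/ iota w) in H1 by (field; lra). lra.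
Qed.

Lemma kap_decr (v w : R) : 0 < v -> v <= w -> kap w <= kap v.
Proof.
  intros Hv Hw. destruct (Req_dec v w) as [->|Hn]. lra.
  destruct (MVT_gen kap v w (fun w => - gam w / w)) as [c [Hc Ec]].
  - intros x Hx. apply is_derive_kap. rewrite Rmin_left in Hx; lra.
  - intros x Hx. apply continuity_pt_filterlim. eapply is_derive_continuous, is_derive_kap. rewrite Rmin_left in Hx; lra.
  - rewrite Rmin_left, Rmax_right in Hc by lra.
    pose proof (gam_bound c ltac:(lra)) as [B _].
    assert (0 <= gam c / c) by (apply Rmult_le_pos; [trivial | apply Rlt_le, Rinv_0_lt_compat; lra]).
    unfold Rdiv in *. nra.
Qed.

(** [kap] is decreasing and is minus the derivative of [gam], so [w / 2 * kap w] is at most the drop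
    of [gam] over [[w / 2, w]]. This passes the decay of [gam] on to [kap]. *)
Lemma kap_le_gam_half (w : R) : 0 < w -> kap w <= 2 / w * gam (w / 2).
Proof.
  intros Hw.
  destruct (MVT_gen gam (w/2) w (fun w => - kap w)) as [c [Hc Ec]].
  - intros x Hx. apply is_derive_gam. rewrite Rmin_left in Hx; lra.
  - intros x Hx. apply continuity_pt_filterlim. eapply is_derive_continuous, is_derive_gam. rewrite Rmin_left in Hx; lra.
  - rewrite Rmin_left, Rmax_right in Hc by lra.
    pose proof (gam_bound w Hw) as [B _]. pose proof (kap_decr c w ltac:(lra) ltac:(lra)).
    pose proof (kap_nonneg w Hw).
    apply (Rmult_le_reg_l (w / 2)). lra.
    replace (w / 2 * (2 / w * gam (w / 2))) with (gam (w/2)) by (field; lra). nra.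
Qed.

(** [kap w + ln w] has derivative [(1 - gam w) / w >= 0]; this is the logarithmic singularity of
    K_0. *)
Lemma kap_le_log (w : R) : 0 < w <= 1 -> kap w <= kap 1 - ln w.
Proof.
  intros Hw. destruct (Req_dec w 1) as [->|Hn]. rewrite ln_1; lra.
  destruct (MVT_gen (fun w => kap w + ln w) w 1 (fun w => - gam w / w + / w)) as [c [Hc Ec]].
  - intros x Hx. rewrite Rmin_left, Rmax_right in Hx by lra.
    apply (is_derive_plus kap ln). apply is_derive_kap; lra. apply is_derive_ln; lra.
  - intros x Hx. rewrite Rmin_left, Rmax_right in Hx by lra.
    apply continuity_pt_filterlim. apply (is_derive_continuous (fun w => kap w + ln w) x (- gam x / x + / x)).
    apply (is_derive_plus kap ln). apply is_derive_kap; lra. apply is_derive_ln; lra.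
  - rewrite Rmin_left, Rmax_right in Hc by lra.
    pose proof (gam_le_1 c ltac:(lra)).
    assert (0 <= - gam c / c + / c).
    { replace (- gam c / c + / c) with ((1 - gam c) * / c) by (field; lra).
      apply Rmult_le_pos. lra. apply Rlt_le, Rinv_0_lt_compat; lra. }
    rewrite ln_1 in Ec. nra.
Qed.

Lemma gam_decay (m : nat) : exists K, 0 < K /\ forall w, 0 < w -> gam w * (1 + w) ^ m <= K.
Proof.
  exists (2 ^ m * (1 + INR (fact m) ^ 2)).
  assert (F : 0 < INR (fact m) ^ 2) by (apply pow_lt, INR_fact_lt_0).
  assert (P2 : 0 < 2 ^ m) by (apply pow_lt; lra).
  split. apply Rmult_lt_0_compat; lra.
  intros w Hw. pose proof (gam_bound w Hw) as [B1 B2]. pose proof (gam_le_1 w Hw).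
  destruct (Rle_dec w 1).
  - apply Rle_trans with (1 * 2 ^ m). apply Rmult_le_compat; trivial. apply pow_le; lra. apply pow_incr; lra. nra.
  - apply Rle_trans with (gam w * (2 * w) ^ m). apply Rmult_le_compat_l; trivial. apply pow_incr; lra.
    rewrite Rpow_mult_distr.
    pose proof (i0_ge_term w m ltac:(lra)). assert (0 < w ^ m) by (apply pow_lt; lra).
    assert (gam w * w ^ m <= INR (fact m) ^ 2).
    { apply Rle_trans with (/ i0 w * w ^ m). apply Rmult_le_compat_r; lra.
      pose proof (i0_ge_1 w ltac:(lra)).
      apply (Rmult_le_reg_l (i0 w)). lra. rewrite <- Rmult_assoc, Rinv_r, Rmult_1_l by lra.
      apply (Rmult_le_reg_r (/ INR (fact m) ^ 2)). apply Rinv_0_lt_compat; lra.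
      rewrite Rmult_assoc, Rinv_r by lra. unfold Rdiv in H0. lra. }
    nra.
Qed.

Lemma ln_le_root (w : R) : 0 < w -> - ln w <= 4 / sqrt (sqrt w).
Proof.
  intros Hw. assert (H1 : 0 < sqrt w) by (apply sqrt_lt_R0; trivial).
  assert (H2 : 0 < sqrt (sqrt w)) by (apply sqrt_lt_R0; trivial).
  set (z := / sqrt (sqrt w)).
  assert (Hz : 0 < z) by (apply Rinv_0_lt_compat; trivial).
  assert (E : ln w = - (4 * ln z)).
  { unfold z. rewrite ln_Rinv by trivial.
    rewrite <- (sqrt_sqrt w) at 1 by lra. rewrite <- (sqrt_sqrt (sqrt w)) at 1 2 by lra.
    rewrite !ln_mult; trivial; try (apply Rmult_lt_0_compat; trivial). ring. }
  rewrite E. unfold Rdiv. fold z.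
  pose proof (exp_ineq1_le (ln z)) as H3. rewrite exp_ln in H3 by trivial. lra.
Qed.

(** A fourth root absorbs the logarithm at 0. The exponent 1/4 is chosen because after
    [w = x ^ 2 * sinh t ^ 2] it becomes the square root that [delta] tolerates. *)
Lemma kap_decay (m : nat) : exists K, 0 < K /\ forall w, 0 < w -> kap w * sqrt (sqrt w) * (1 + w) ^ m <= K.
Proof.
  destruct (gam_decay (S m)) as [G [HG HG2]].
  pose proof (kap_nonneg 1 ltac:(lra)) as K1.
  assert (P2 : 0 < 2 ^ m) by (apply pow_lt; lra).
  exists ((kap 1 + 4) * 2 ^ m + 2 * 2 ^ (S m) * G). split.
  { assert (0 < 2 ^ S m) by (apply pow_lt; lra). nra. }
  intros w Hw. pose proof (kap_nonneg w Hw) as K0.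
  assert (H1 : 0 < sqrt w) by (apply sqrt_lt_R0; trivial).
  assert (H2 : 0 < sqrt (sqrt w)) by (apply sqrt_lt_R0; trivial).
  assert (P3 : 0 < 2 ^ S m) by (apply pow_lt; lra).
  destruct (Rle_dec w 1).
  - assert (S1 : sqrt (sqrt w) <= 1).
    { rewrite <- sqrt_1. apply sqrt_le_1_alt. rewrite <- sqrt_1. apply sqrt_le_1_alt. lra. }
    pose proof (kap_le_log w ltac:(lra)). pose proof (ln_le_root w Hw).
    assert (kap w * sqrt (sqrt w) <= kap 1 + 4).
    { apply Rle_trans with ((kap 1 + 4 / sqrt (sqrt w)) * sqrt (sqrt w)). apply Rmult_le_compat_r; lra.
      replace ((kap 1 + 4 / sqrt (sqrt w)) * sqrt (sqrt w)) with (kap 1 * sqrt (sqrt w) + 4) by (field; lra). nra. }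
    apply Rle_trans with ((kap 1 + 4) * 2 ^ m). apply Rmult_le_compat; trivial. nra. apply pow_le; lra. apply pow_incr; lra.
    nra.
  - assert (S1 : sqrt (sqrt w) <= w).
    { assert (sqrt w <= w). { rewrite <- (sqrt_sqrt w) at 2 by lra. assert (1 <= sqrt w) by (rewrite <- sqrt_1; apply sqrt_le_1_alt; lra). nra. }
      apply Rle_trans with (sqrt w); trivial. apply sqrt_le_1_alt. trivial. }
    pose proof (kap_le_gam_half w Hw) as HK. specialize (HG2 (w/2) ltac:(lra)).
    pose proof (gam_bound (w/2) ltac:(lra)) as [B _].
    assert (kap w * sqrt (sqrt w) <= 2 * gam (w/2)).
    { apply Rle_trans with ((2 / w * gam (w/2)) * w). apply Rmult_le_compat; lra. right; field; lra. }
    apply Rle_trans with (2 * gam (w/2) * (2 ^ (S m) * (1 + w/2) ^ S m)).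
    apply Rmult_le_compat; trivial. nra. apply pow_le; lra.
    rewrite <- Rpow_mult_distr. apply Rle_trans with ((2 * (1 + w/2)) ^ m). apply pow_incr; lra.
    simpl. assert (0 < (2 * (1 + w/2)) ^ m) by (apply pow_lt; lra). nra.
    replace (2 * gam (w / 2) * (2 ^ S m * (1 + w / 2) ^ S m)) with (2 * 2 ^ S m * (gam (w/2) * (1 + w/2) ^ S m)) by ring.
    apply Rle_trans with (2 * 2 ^ S m * G). apply Rmult_le_compat_l; lra. nra.
Qed.

Lemma cont_pos_gam : cont_pos gam.
Proof. intros t Ht. eapply is_derive_continuous, is_derive_gam; trivial. Qed.
Lemma cont_pos_kap : cont_pos kap.
Proof. intros t Ht. eapply is_derive_continuous, is_derive_kap; trivial. Qed.

(** By the Wronskian, [1 - gam w = iota w * kap w + (i0 w - 1) * gam w], and both terms are small at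
    0; for [w > 1] the bound is trivial because the constant exceeds 1. *)
Lemma one_minus_gam : exists K, 0 < K /\ forall w, 0 < w -> 0 <= 1 - gam w <= K * sqrt w.
Proof.
  destruct (kap_decay 0) as [K [HK HK2]].
  assert (CI : forall w, 0 <= w <= 1 -> 0 <= iota w <= i0 1 * w).
  { intros w Hw. destruct (Req_dec w 0) as [->|Hn]. rewrite iota_0; lra.
    split. pose proof (iota_pos w); lra.
    destruct (MVT_gen iota 0 w i0) as [c [Hc Ec]].
    - intros; apply is_derive_iota.
    - intros; apply continuity_pt_filterlim. eapply is_derive_continuous, is_derive_iota.
    - rewrite Rmin_left, Rmax_right in Hc by lra. rewrite iota_0 in Ec.
      assert (i0 c <= i0 1). { destruct (Req_dec c 0) as [->|]. rewrite i0_0. apply i0_ge_1; lra. apply i0_incr; lra. }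
      nra. }
  pose proof (i0_ge_1 1 ltac:(lra)) as I1.
  exists (i0 1 * K + i0 1). split. nra.
  intros w Hw. pose proof (gam_le_1 w Hw). split. lra.
  assert (S0 : 0 < sqrt w) by (apply sqrt_lt_R0; trivial).
  pose proof (gam_bound w Hw) as [G0 _].
  destruct (Rle_dec w 1) as [H1|H1].
  - assert (S1 : sqrt w <= 1) by (rewrite <- sqrt_1; apply sqrt_le_1_alt; lra).
    assert (Sw : w <= sqrt w) by (rewrite <- (sqrt_sqrt w) at 1 by lra; nra).
    assert (S3 : 0 < sqrt (sqrt w)) by (apply sqrt_lt_R0; trivial).
    assert (S4 : sqrt w <= sqrt (sqrt w)).
    { rewrite <- (sqrt_sqrt (sqrt w)) at 1 by lra. assert (sqrt (sqrt w) <= 1) by (rewrite <- sqrt_1; apply sqrt_le_1_alt; lra). nra. }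
    pose proof (gam_kap_wronskian w Hw) as W. pose proof (kap_nonneg w Hw) as K0.
    pose proof (CI w ltac:(lra)) as [C1 C2].
    specialize (HK2 w Hw). rewrite pow_O, Rmult_1_r in HK2.
    assert (A1 : iota w * kap w <= i0 1 * K * sqrt w).
    { apply Rle_trans with (i0 1 * w * kap w). apply Rmult_le_compat_r; lra.
      assert (w * kap w <= K * sqrt w).
      { rewrite <- (sqrt_sqrt w) at 1 by lra.
        assert (sqrt w * kap w <= K). { apply Rle_trans with (sqrt (sqrt w) * kap w). apply Rmult_le_compat_r; lra. lra. }
        nra. }
      nra. }
    assert (A2 : i0 w - 1 <= i0 1 * sqrt w).
    { destruct (MVT_gen i0 0 w (fun w => iota w / w)) as [c [Hc Ec]].
      - intros x Hx. apply is_derive_i0. rewrite Rmin_left in Hx; lra.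
      - intros x Hx. apply continuity_pt_filterlim. apply continuous_i0.
      - rewrite Rmin_left, Rmax_right in Hc by lra. rewrite i0_0 in Ec. rewrite Ec, Rminus_0_r.
        destruct (Req_dec c 0) as [->|Hc0]. rewrite iota_0. unfold Rdiv. rewrite !Rmult_0_l. nra.
        pose proof (CI c ltac:(lra)) as [C3 C4].
        assert (iota c / c <= i0 1). { apply (Rmult_le_reg_r c). lra. unfold Rdiv. rewrite Rmult_assoc, Rinv_l by lra. lra. }
        assert (0 <= iota c / c). { apply Rmult_le_pos; trivial. apply Rlt_le, Rinv_0_lt_compat; lra. }
        nra. }
    pose proof (i0_ge_1 w ltac:(lra)).
    nra.
  - assert (1 <= sqrt w) by (rewrite <- sqrt_1; apply sqrt_le_1_alt; lra).
    assert (1 <= i0 1 * K + i0 1) by nra. nra.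
Qed.

(** * Mellin moments of K_0 *)

Lemma dominated_intro (f : R -> R) (K : R) : cont_pos f ->
  (forall t, 0 < t -> Rabs (f t) * (sqrt t * (1 + t)) <= K) -> dominated K f.
Proof.
  intros Hc H. split; trivial. intros t Ht. specialize (H t Ht).
  pose proof (sqrt_lt_R0 t Ht). assert (0 < sqrt t * (1 + t)) by (apply Rmult_lt_0_compat; lra).
  unfold delta. apply (Rmult_le_reg_r (sqrt t * (1 + t))); trivial.
  rewrite Rmult_assoc, Rinv_l by lra. lra.
Qed.

Lemma sqrt_le_1p (t : R) : 0 <= t -> sqrt t <= 1 + t.
Proof. intros H. pose proof (sqrt_pos t). pose proof (sqrt_sqrt t H). nra. Qed.

Lemma lim_at_infty_inv : filterlim (fun t => / t) at_infty (locally 0).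
Proof.
  apply lim_at_spec. apply Rbar_locally_filter. intros e He. exists (/ e). intros x Hx.
  assert (0 < / e) by (apply Rinv_0_lt_compat; trivial). rewrite Rminus_0_r, Rabs_pos_eq.
  rewrite <- (Rinv_inv e). apply Rinv_lt_contravar; trivial. nra.
  apply Rlt_le, Rinv_0_lt_compat. lra.
Qed.

Section Phase.
Variable mu : R.

(** The real part of exp (i d) times the Mellin transform of [kap] at j + 1 + i mu, classically exp
    (i d) Gamma (j + 1 + i mu)^2. The free phase [d] lets a complex recurrence be written with real
    integrals. *)
Definition kmom (j : nat) (d : R) : R := half_int (fun w => w ^ j * kap w * cos (mu * ln w + d)).
Definition gmom (j : nat) (d : R) : R := half_int (fun w => w ^ j * gam w * cos (mu * ln w + d)).

Lemma cont_pos_phase (d : R) : cont_pos (fun w => cos (mu * ln w + d)).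
Proof.
  intros w Hw. apply (ex_derive_continuous (fun w => cos (mu * ln w + d))). auto_derive. trivial.
Qed.

Lemma cont_pos_mult (f g : R -> R) : cont_pos f -> cont_pos g -> cont_pos (fun t => f t * g t).
Proof. intros F G t Ht. apply (continuous_mult f g); auto. Qed.

Lemma cont_pos_pow (j : nat) : cont_pos (fun w => w ^ j).
Proof. intros w Hw. apply (ex_derive_continuous (fun w => w ^ j)). auto_derive. trivial. Qed.

Lemma kap_pow_bound (j : nat) : exists K, 0 < K /\ forall w, 0 < w -> w ^ j * kap w * (sqrt w * (1 + w)) <= K.
Proof.
  destruct (kap_decay (j + 2)) as [K [H1 H2]]. exists K; split; trivial.
  intros w Hw. specialize (H2 w Hw).
  assert (S1 : 0 < sqrt w) by (apply sqrt_lt_R0; trivial).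
  assert (S2 : 0 < sqrt (sqrt w)) by (apply sqrt_lt_R0; trivial).
  pose proof (kap_nonneg w Hw). eapply Rle_trans; [|exact H2].
  rewrite pow_add. simpl (_ ^ 2).
  assert (w ^ j <= (1 + w) ^ j) by (apply pow_incr; lra).
  assert (0 < w ^ j) by (apply pow_lt; lra).
  assert (sqrt w <= sqrt (sqrt w) * (1 + w)).
  { rewrite <- (sqrt_sqrt (sqrt w)) at 1 by lra. apply Rmult_le_compat_l. lra.
    pose proof (sqrt_le_1p (sqrt w) ltac:(lra)).
    assert (sqrt (sqrt w) <= 1 + w); trivial.
    destruct (Rle_dec w 1). assert (sqrt (sqrt w) <= 1). { rewrite <- sqrt_1. apply sqrt_le_1_alt. rewrite <- sqrt_1. apply sqrt_le_1_alt. lra. } lra.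
    assert (sqrt w <= w). { rewrite <- (sqrt_sqrt w) at 2 by lra. assert (1 <= sqrt w) by (rewrite <- sqrt_1; apply sqrt_le_1_alt; lra). nra. }
    lra. }
  replace (w ^ j * kap w * (sqrt w * (1 + w))) with (kap w * (w ^ j * sqrt w) * (1 + w)) by ring.
  replace (kap w * sqrt (sqrt w) * ((1 + w) ^ j * ((1 + w) * ((1 + w) * 1)))) with (kap w * ((1 + w) ^ j * (sqrt (sqrt w) * (1 + w))) * (1 + w)) by ring.
  apply Rmult_le_compat_r. lra. apply Rmult_le_compat_l; trivial.
  apply Rmult_le_compat; lra.
Qed.

Lemma gam_pow_bound (j : nat) : exists K, 0 < K /\ forall w, 0 < w -> w ^ j * gam w * (sqrt w * (1 + w)) <= K.
Proof.
  destruct (gam_decay (j + 2)) as [K [H1 H2]]. exists K; split; trivial.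
  intros w Hw. specialize (H2 w Hw). destruct (gam_bound w Hw) as [G _].
  eapply Rle_trans; [|exact H2]. rewrite pow_add. simpl (_ ^ 2).
  assert (w ^ j <= (1 + w) ^ j) by (apply pow_incr; lra).
  assert (0 < w ^ j) by (apply pow_lt; lra).
  pose proof (sqrt_le_1p w ltac:(lra)). pose proof (sqrt_pos w).
  replace (w ^ j * gam w * (sqrt w * (1 + w))) with (gam w * (w ^ j * (sqrt w * (1 + w)))) by ring.
  apply Rmult_le_compat_l; trivial. apply Rmult_le_compat; try lra. nra. nra.
Qed.

Lemma integrable_phase (g : R -> R) (d K : R) : cont_pos g ->
  (forall w, 0 < w -> 0 <= g w) -> (forall w, 0 < w -> g w * (sqrt w * (1 + w)) <= K) ->
  integrable (fun w => g w * cos (mu * ln w + d)).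
Proof.
  intros C P B. exists K. apply dominated_intro.
  - apply cont_pos_mult; trivial. apply cont_pos_phase.
  - intros t Ht. rewrite Rabs_mult, (Rabs_pos_eq (g t)) by auto.
    eapply Rle_trans; [|apply (B t Ht)]. pose proof (sqrt_lt_R0 t Ht). specialize (P t Ht).
    assert (0 < sqrt t * (1 + t)) by (apply Rmult_lt_0_compat; lra).
    assert (Rabs (cos (mu * ln t + d)) <= 1) by (apply Rabs_le; apply COS_bound).
    pose proof (Rabs_pos (cos (mu * ln t + d))).
    apply Rmult_le_compat_r. lra. nra.
Qed.

Lemma integrable_kmom (j : nat) (d : R) : integrable (fun w => w ^ j * kap w * cos (mu * ln w + d)).
Proof.
  destruct (kap_pow_bound j) as [K [HK H]]. apply (integrable_phase (fun w => w ^ j * kap w) d K).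
  - apply cont_pos_mult. apply cont_pos_pow. apply cont_pos_kap.
  - intros w Hw. apply Rmult_le_pos. apply pow_le; lra. apply kap_nonneg; trivial.
  - exact H.
Qed.

Lemma integrable_gmom (j : nat) (d : R) : integrable (fun w => w ^ j * gam w * cos (mu * ln w + d)).
Proof.
  destruct (gam_pow_bound j) as [K [HK H]]. apply (integrable_phase (fun w => w ^ j * gam w) d K).
  - apply cont_pos_mult. apply cont_pos_pow. apply cont_pos_gam.
  - intros w Hw. apply Rmult_le_pos. apply pow_le; lra. apply gam_bound; trivial.
  - exact H.
Qed.

(** Multiplication by k + i mu seen on real parts: a modulus and a phase shift. *)
Lemma polar_combination (k x : R) : 0 < k ->
  k * cos x - mu * sin x = sqrt (k ^ 2 + mu ^ 2) * cos (x + atan (mu / k)).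
Proof.
  intros Hk. rewrite cos_plus, cos_atan, sin_atan.
  assert (E : sqrt (k ^ 2 + mu ^ 2) = k * sqrt (1 + (mu / k)²)).
  { rewrite <- (sqrt_Rsqr k) at 2 by lra. rewrite <- sqrt_mult_alt by apply Rle_0_sqr.
    f_equal. unfold Rsqr. field. lra. }
  assert (0 < sqrt (1 + (mu / k)²)). { apply sqrt_lt_R0. pose proof (Rle_0_sqr (mu/k)). lra. }
  rewrite E. field. lra.
Qed.

Lemma phase_boundary (g : R -> R) (d K : R) :
  (forall w, 0 < w -> 0 <= g w) -> (forall w, 0 < w -> g w * (sqrt w * (1 + w)) <= K) ->
  filterlim (fun w => w * g w * cos (mu * ln w + d)) (at_right 0) (locally 0) /\
  ((forall w, 0 < w -> w ^ 2 * g w <= K) -> filterlim (fun w => w * g w * cos (mu * ln w + d)) at_infty (locally 0)).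
Proof.
  intros P B.
  assert (C : forall w, 0 < w -> Rabs (w * g w * cos (mu * ln w + d)) <= w * g w).
  { intros w Hw. rewrite Rabs_mult. specialize (P w Hw).
    assert (0 <= w * g w) by (apply Rmult_le_pos; lra). rewrite Rabs_pos_eq by trivial.
    assert (Rabs (cos (mu * ln w + d)) <= 1) by (apply Rabs_le; apply COS_bound).
    pose proof (Rabs_pos (cos (mu * ln w + d))). nra. }
  split.
  - apply (lim_at_squeeze _ _ (fun w => K * sqrt w)).
    + generalize at_right0_pos. apply filter_imp. intros w Hw. rewrite Rminus_0_r.
      eapply Rle_trans. apply C; trivial. specialize (B w Hw). pose proof (sqrt_lt_R0 w Hw).
      specialize (P w Hw).
      rewrite <- (sqrt_sqrt w) at 1 by lra.
      assert (g w * sqrt w <= K). { eapply Rle_trans; [|exact B]. apply Rmult_le_compat_l; trivial. nra. }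
      nra.
    + apply lim_scal0. apply within_filter, locally_filter. apply lim_sqrt_0.
  - intros B2. apply (lim_at_squeeze _ _ (fun w => K * / w)).
    + generalize (at_infty_gt 0). apply filter_imp. intros w Hw. rewrite Rminus_0_r.
      eapply Rle_trans. apply C; trivial. specialize (B2 w Hw).
      apply (Rmult_le_reg_r w); trivial. replace (K * / w * w) with K by (field; lra). simpl in B2. lra.
    + apply lim_scal0. apply Rbar_locally_filter. apply lim_at_infty_inv.
Qed.

Lemma is_derive_phase_product (f : R -> R) (j : nat) (d w f' : R) : 0 < w -> is_derive f w f' ->
  is_derive (fun w => w * (w ^ j * f w) * cos (mu * ln w + d)) w
    (sqrt (INR (S j) ^ 2 + mu ^ 2) * (w ^ j * f w * cos (mu * ln w + (d + atan (mu / INR (S j)))))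
      + w ^ S j * f' * cos (mu * ln w + d)).
Proof.
  intros Hw Hf. rewrite <- Rplus_assoc.
  replace (sqrt (INR (S j) ^ 2 + mu ^ 2) * (w ^ j * f w * cos (mu * ln w + d + atan (mu / INR (S j)))))
    with (w ^ j * f w * (sqrt (INR (S j) ^ 2 + mu ^ 2) * cos (mu * ln w + d + atan (mu / INR (S j))))) by ring.
  rewrite <- polar_combination by (apply lt_0_INR; lia).
  auto_derive. repeat split; trivial. exists f'; exact Hf.
  drw Hf. rewrite S_INR. destruct j as [|j]. simpl. field. lra.
  cbn [pred pow]. rewrite S_INR. field. lra.
Qed.

(** Integration by parts, [kap] being minus the derivative of [gam]; it produces one factor k + i
    mu. *)
Lemma kmom_step (j : nat) (d : R) : let k := INR (S j) in
  kmom (S j) d = sqrt (k ^ 2 + mu ^ 2) * gmom j (d + atan (mu / k)).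
Proof.
  intros k.
  destruct (gam_pow_bound j) as [K [HK H]]. destruct (gam_pow_bound (S (S j))) as [K2 [HK2 H2]].
  destruct (gam_decay (S (S j))) as [K3 [HK3 H3]].
  destruct (phase_boundary (fun w => w ^ j * gam w) d (K + K3)) as [L0 L1].
  - intros w Hw. apply Rmult_le_pos. apply pow_le; lra. apply gam_bound; trivial.
  - intros w Hw. specialize (H w Hw). lra.
  - pose proof (integrable_gmom j (d + atan (mu / k))) as IG. pose proof (integrable_kmom (S j) d) as IK.
    assert (E := half_int_FTC (fun w => w * (w ^ j * gam w) * cos (mu * ln w + d))
      (fun w => sqrt (k ^ 2 + mu ^ 2) * (w ^ j * gam w * cos (mu * ln w + (d + atan (mu / k)))) - w ^ S j * kap w * cos (mu * ln w + d)) 0 0).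
    unfold kmom, gmom. rewrite half_int_minus in E; trivial. 2: apply integrable_scal; trivial.
    rewrite half_int_scal in E by trivial.
    cut (forall x y : R, y - x = 0 - 0 -> x = y). 2: intros; lra. intros Q; apply Q; clear Q. apply E.
    + destruct (integrable_minus _ _ (integrable_scal _ (sqrt (k ^ 2 + mu ^ 2)) IG) IK) as [? [? _]]; trivial.
    + intros t Ht. pose proof (is_derive_phase_product gam j d t _ Ht (is_derive_gam t Ht)) as Q.
      fold k in Q. match goal with |- is_derive _ _ ?a => match type of Q with is_derive _ _ ?b => replace a with b by ring end end. exact Q.
    + exact L0.
    + apply L1. intros w Hw. specialize (H3 w Hw). destruct (gam_bound w Hw) as [G0 _].
      assert (w ^ S (S j) <= (1 + w) ^ S (S j)) by (apply pow_incr; lra).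
      replace (w ^ 2 * (w ^ j * gam w)) with (gam w * w ^ S (S j)) by (simpl; ring).
      apply Rle_trans with (gam w * (1 + w) ^ S (S j)). apply Rmult_le_compat_l; trivial. lra.
Qed.

(** Integration by parts, [gam w] being [- w] times the derivative of [kap]. With the previous step
    the factor is (k + i mu)^2, the functional equation of the square of Gamma. *)
Lemma gmom_step (j : nat) (d : R) : let k := INR (S j) in
  gmom j d = sqrt (k ^ 2 + mu ^ 2) * kmom j (d + atan (mu / k)).
Proof.
  intros k.
  destruct (kap_pow_bound j) as [K [HK H]].
  destruct (kap_pow_bound (S (S j))) as [K3 [HK3 H3]].
  assert (B3 : forall w, 0 < w -> w ^ 2 * (w ^ j * kap w) <= K + K3).
  { intros w Hw. specialize (H3 w Hw). specialize (H w Hw). pose proof (kap_nonneg w Hw).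
    assert (0 < w ^ j) by (apply pow_lt; lra). assert (0 <= w ^ j * kap w) by nra.
    pose proof (sqrt_lt_R0 w Hw). pose proof (sqrt_sqrt w ltac:(lra)).
    destruct (Rle_dec w 1).
    - assert (w ^ 2 <= sqrt w * (1 + w)). { assert (sqrt w <= 1) by (rewrite <- sqrt_1; apply sqrt_le_1_alt; lra). simpl. nra. }
      apply Rle_trans with (w ^ j * kap w * (sqrt w * (1 + w))). 2: lra. rewrite Rmult_comm. apply Rmult_le_compat_l; trivial.
    - assert (1 <= sqrt w) by (rewrite <- sqrt_1; apply sqrt_le_1_alt; lra).
      assert (1 <= sqrt w * (1 + w)) by nra.
      replace (w ^ S (S j) * kap w * (sqrt w * (1 + w))) with (w ^ 2 * (w ^ j * kap w) * (sqrt w * (1 + w))) in H3 by (simpl; ring).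
      assert (0 <= w ^ 2 * (w ^ j * kap w)). { apply Rmult_le_pos; trivial. simpl; nra. } nra. }
  destruct (phase_boundary (fun w => w ^ j * kap w) d (K + K3)) as [L0 L1].
  - intros w Hw. apply Rmult_le_pos. apply pow_le; lra. apply kap_nonneg; trivial.
  - intros w Hw. specialize (H w Hw). lra.
  - pose proof (integrable_kmom j (d + atan (mu / k))) as IK. pose proof (integrable_gmom j d) as IG.
    assert (E := half_int_FTC (fun w => w * (w ^ j * kap w) * cos (mu * ln w + d))
      (fun w => sqrt (k ^ 2 + mu ^ 2) * (w ^ j * kap w * cos (mu * ln w + (d + atan (mu / k)))) - w ^ j * gam w * cos (mu * ln w + d)) 0 0).
    unfold kmom, gmom. rewrite half_int_minus in E; trivial. 2: apply integrable_scal; trivial.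
    rewrite half_int_scal in E by trivial.
    cut (forall x y : R, y - x = 0 - 0 -> x = y). 2: intros; lra. intros Q; apply Q; clear Q. apply E.
    + destruct (integrable_minus _ _ (integrable_scal _ (sqrt (k ^ 2 + mu ^ 2)) IK) IG) as [? [? _]]; trivial.
    + intros t Ht. pose proof (is_derive_phase_product kap j d t _ Ht (is_derive_kap t Ht)) as Q.
      fold k in Q. match goal with |- is_derive _ _ ?a => match type of Q with is_derive _ _ ?b => replace a with b end end. exact Q.
      simpl (_ ^ S j). field. lra.
    + exact L0.
    + apply L1. exact B3.
Qed.

Lemma kmom_rec (j : nat) (d : R) : let k := INR (S j) in
  kmom (S j) d = (k ^ 2 + mu ^ 2) * kmom j (d + 2 * atan (mu / k)).
Proof.
  intros k. rewrite kmom_step, gmom_step. fold k. rewrite <- Rmult_assoc, sqrt_sqrt by nra.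
  f_equal. f_equal. ring.
Qed.

(** The argument of (1 + i mu) ... (j + i mu) without reduction modulo 2 PI; [mod_prod] is the
    squared modulus of the same product. *)
Fixpoint phase_sum (j : nat) : R :=
  match j with O => 0 | S i => phase_sum i + atan (mu / INR (S i)) end.
Fixpoint mod_prod (j : nat) : R :=
  match j with O => 1 | S i => mod_prod i * (INR (S i) ^ 2 + mu ^ 2) end.

Lemma kmom_closed (j : nat) (d : R) : kmom j d = mod_prod j * kmom 0 (d + 2 * phase_sum j).
Proof.
  revert d. induction j as [|j IH]; intros d. simpl. rewrite Rmult_1_l. f_equal. ring.
  rewrite kmom_rec, IH. cbn [mod_prod phase_sum].
  replace (d + 2 * (phase_sum j + atan (mu / INR (S j))))
    with (d + 2 * atan (mu / INR (S j)) + 2 * phase_sum j) by ring. ring.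
Qed.

Lemma mod_prod_pos (j : nat) : 0 < mod_prod j.
Proof.
  induction j as [|j IH]. simpl; lra. cbn [mod_prod]. apply Rmult_lt_0_compat; trivial.
  pose proof (lt_0_INR (S j) ltac:(lia)). nra.
Qed.
End Phase.

Lemma mod_prod_0 (j : nat) : mod_prod 0 j = INR (fact j) ^ 2.
Proof. induction j as [|j IH]. simpl; ring. cbn [mod_prod]. rewrite IH, fact_simpl, mult_INR. ring. Qed.

Lemma phase_sum_0 (j : nat) : phase_sum 0 j = 0.
Proof.
  induction j as [|j IH]. simpl; ring. cbn [phase_sum]. rewrite IH. unfold Rdiv. rewrite Rmult_0_l, atan_0. ring.
Qed.

(** At [mu = 0] all phases vanish, and the starting value is [gam] at 0 minus [gam] at infinity,
    which is 1. *)
Lemma kmom_weight (j : nat) : integrable (fun w => w ^ j * kap w) /\ half_int (fun w => w ^ j * kap w) = INR (fact j) ^ 2.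
Proof.
  assert (X : forall w : R, 0 < w -> w ^ j * kap w * cos (0 * ln w + 0) = w ^ j * kap w).
  { intros w _. rewrite Rmult_0_l, Rplus_0_l, cos_0. ring. }
  assert (I : integrable (fun w => w ^ j * kap w)).
  { destruct (kap_pow_bound j) as [K [HK H]]. exists K. apply dominated_intro.
    apply cont_pos_mult. apply cont_pos_pow. apply cont_pos_kap.
    intros t Ht. rewrite Rabs_pos_eq. auto. apply Rmult_le_pos. apply pow_le; lra. apply kap_nonneg; trivial. }
  split; trivial.
  rewrite <- (half_int_ext _ _ X) by apply integrable_kmom. change (kmom 0 j 0 = INR (fact j) ^ 2).
  rewrite kmom_closed, mod_prod_0, phase_sum_0.
  replace (kmom 0 0 (0 + 2 * 0)) with 1. ring.
  rewrite Rmult_0_r, Rplus_0_r. unfold kmom.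
  assert (C : cont_pos (fun w => w ^ 0 * kap w * cos (0 * ln w + 0))) by (destruct (integrable_kmom 0 0 0) as [? [? _]]; trivial).
  rewrite (half_int_FTC (fun w => - gam w) _ (-1) 0); trivial. ring.
  - intros t Ht. pose proof (is_derive_gam t Ht) as Hg. rewrite Rmult_0_l, Rplus_0_l, cos_0. auto_derive. eexists; exact Hg.
    drw Hg. simpl. ring.
  - destruct one_minus_gam as [K [HK H]].
    apply (lim_at_squeeze _ _ (fun w => K * sqrt w)).
    + generalize at_right0_pos. apply filter_imp. intros w Hw. specialize (H w Hw).
      replace (- gam w - -1) with (1 - gam w) by ring. rewrite Rabs_pos_eq; lra.
    + apply lim_scal0. apply within_filter, locally_filter. apply lim_sqrt_0.
  - destruct (gam_decay 1) as [K [HK H]].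
    apply (lim_at_squeeze _ _ (fun w => K * / w)).
    + generalize (at_infty_gt 0). apply filter_imp. intros w Hw. specialize (H w Hw). simpl in H.
      destruct (gam_bound w Hw) as [G _].
      rewrite Rminus_0_r, Rabs_Ropp, Rabs_pos_eq by trivial.
      apply (Rmult_le_reg_r w); trivial. rewrite Rmult_assoc, Rinv_l by lra. nra.
    + apply lim_scal0. apply Rbar_locally_filter. apply lim_at_infty_inv.
Qed.

Lemma cos_lipschitz (x y : R) : Rabs (cos x - cos y) <= Rabs (x - y).
Proof.
  destruct (MVT_gen cos y x (fun t => - sin t)) as [c [_ Ec]].
  - intros t _. auto_derive; trivial; ring.
  - intros t _. apply continuity_cos.
  - rewrite Ec, Rabs_mult, Rabs_Ropp. rewrite <- (Rmult_1_l (Rabs (x - y))) at 2.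
    apply Rmult_le_compat_r. apply Rabs_pos. apply Rabs_le. pose proof (SIN_bound c). lra.
Qed.

Lemma ln_le_minus_1 (r : R) : 0 < r -> ln r <= r - 1.
Proof. intros Hr. pose proof (exp_ineq1_le (ln r)) as H. rewrite exp_ln in H by trivial. lra. Qed.

(** For [w / m >= 1/2] the logarithm is Lipschitz in the ratio. Otherwise the ratio is further than
    1/2 from 1, and the trivial bound 2 for a difference of cosines is at most
    [4 * Rabs (w / m - 1)]. *)
Lemma phase_ratio_bound (mu d m w : R) : 0 <= mu -> 0 < m -> 0 < w ->
  Rabs (cos (mu * ln w + d) - cos (mu * ln m + d)) <= (4 + 2 * mu) * Rabs (w / m - 1).
Proof.
  intros Hmu Hm Hw. set (r := w / m). assert (Hr : 0 < r) by (apply Rdiv_lt_0_compat; trivial).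
  pose proof (Rabs_pos (r - 1)) as P.
  destruct (Rle_dec (1/2) r) as [Hr2|Hr2].
  - eapply Rle_trans. apply cos_lipschitz.
    replace (mu * ln w + d - (mu * ln m + d)) with (mu * ln r) by (unfold r, Rdiv; rewrite ln_mult, ln_Rinv; trivial; try ring; apply Rinv_0_lt_compat; trivial).
    rewrite Rabs_mult, (Rabs_pos_eq mu) by trivial.
    assert (Rabs (ln r) <= 2 * Rabs (r - 1)).
    { pose proof (ln_le_minus_1 r Hr). pose proof (ln_le_minus_1 (/ r) ltac:(apply Rinv_0_lt_compat; trivial)) as H2.
      rewrite ln_Rinv in H2 by trivial.
      assert (/ r - 1 <= 2 * Rabs (r - 1)).
      { replace (/ r - 1) with ((1 - r) * / r) by (field; lra).
        assert (/ r <= 2). { replace 2 with (/ (1/2)) by field. apply Rinv_le_contravar; lra. }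
        assert (0 < / r) by (apply Rinv_0_lt_compat; trivial).
        destruct (Rle_dec r 1). rewrite Rabs_left1 by lra. nra. rewrite Rabs_pos_eq by lra. nra. }
      pose proof (Rle_abs (r - 1)). apply Rabs_le. lra. }
    nra.
  - assert (1/2 <= Rabs (r - 1)) by (rewrite Rabs_left; lra).
    apply Rle_trans with 2.
    + pose proof (COS_bound (mu * ln w + d)). pose proof (COS_bound (mu * ln m + d)). apply Rabs_le. lra.
    + nra.
Qed.

(* Under the weight w^j kap w the variable w / (j+1)^2 has mean 1 and small variance. *)
Lemma kmom_concentration (mu : R) (j : nat) (d : R) : 0 <= mu ->
  Rabs (kmom mu j d - INR (fact j) ^ 2 * cos (2 * mu * ln (INR (S j)) + d)) <=
  INR (fact j) ^ 2 * ((4 + 2 * mu) * 4 / sqrt (INR (S j))).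
Proof.
  intros Hmu. set (a := INR (S j)). assert (Ha : 1 <= a) by (apply (le_INR 1); lia).
  set (m := a ^ 2). assert (Hm : 0 < m) by (unfold m; nra).
  destruct (kmom_weight j) as [I0 E0]. destruct (kmom_weight (S j)) as [I1 E1]. destruct (kmom_weight (S (S j))) as [I2 E2].
  set (F := INR (fact j) ^ 2) in *.
  assert (HF : 0 < F) by (apply pow_lt, INR_fact_lt_0).
  assert (E1' : half_int (fun w => w ^ S j * kap w) = m * F).
  { rewrite E1, fact_simpl, mult_INR. fold a. unfold m, F. ring. }
  assert (E2' : half_int (fun w => w ^ S (S j) * kap w) = (a + 1) ^ 2 * m * F).
  { rewrite E2, fact_simpl, mult_INR, fact_simpl, mult_INR. fold a. unfold m, F. rewrite (S_INR (S j)). fold a. ring. }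
  replace (2 * mu * ln a + d) with (mu * ln m + d).
  2:{ unfold m. simpl. rewrite Rmult_1_r, ln_mult by lra. ring. }
  set (C := 4 + 2 * mu). assert (HC : 0 < C) by (unfold C; lra).
  set (eta := / sqrt a). assert (S0 : 0 < sqrt a) by (apply sqrt_lt_R0; lra).
  assert (He : 0 < eta) by (apply Rinv_0_lt_compat; trivial).
  set (cm := cos (mu * ln m + d)).
  (* Coefficients of [C * (eta + (w / m - 1) ^ 2 / eta)] in powers of [w]: the absolute value is
     replaced by a quadratic through [|x| <= eta + x^2 / eta], so that three moments suffice. *)
  set (p := C * eta + C / eta). set (q := - 2 * (C / eta) / m). set (s := C / eta / m ^ 2).
  set (dom := fun w => p * (w ^ j * kap w) + q * (w ^ S j * kap w) + s * (w ^ S (S j) * kap w)).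
  assert (ID : integrable dom).
  { unfold dom. repeat apply integrable_plus; apply integrable_scal; trivial. }
  assert (VD : half_int dom = F * (C * eta + C / eta * ((a + 1) ^ 2 / a ^ 2 - 1))).
  { unfold dom. rewrite !half_int_plus; try (repeat apply integrable_plus; apply integrable_scal; trivial).
    rewrite !half_int_scal by trivial. rewrite E0, E1', E2'. unfold p, q, s, m. field. split; lra. }
  assert (IK : integrable (fun w => w ^ j * kap w * cos (mu * ln w + d) - cm * (w ^ j * kap w))).
  { apply integrable_minus. apply integrable_kmom. apply integrable_scal; trivial. }
  replace (kmom mu j d - F * cm) with (half_int (fun w => w ^ j * kap w * cos (mu * ln w + d) - cm * (w ^ j * kap w))).
  2:{ rewrite half_int_minus, half_int_scal; trivial. rewrite E0. unfold kmom. ring. apply integrable_kmom. apply integrable_scal; trivial. }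
  eapply Rle_trans. apply (half_int_abs_le _ dom); trivial.
  - intros w Hw. pose proof (kap_nonneg w Hw). assert (0 < w ^ j) by (apply pow_lt; lra).
    assert (Hk : 0 <= w ^ j * kap w) by nra.
    replace (w ^ j * kap w * cos (mu * ln w + d) - cm * (w ^ j * kap w)) with (w ^ j * kap w * (cos (mu * ln w + d) - cm)) by ring.
    rewrite Rabs_mult, (Rabs_pos_eq _ Hk).
    replace (dom w) with (w ^ j * kap w * (C * (eta + (w / m - 1) ^ 2 / eta))).
    2:{ unfold dom, p, q, s. simpl. field. split; lra. }
    apply Rmult_le_compat_l; trivial. unfold cm.
    eapply Rle_trans. apply phase_ratio_bound; trivial. fold C.
    apply Rmult_le_compat_l. lra.
    set (x := w / m - 1). replace (x ^ 2) with (Rabs x * Rabs x) by (rewrite <- Rabs_mult, Rabs_pos_eq; nra).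
    set (y := Rabs x). assert (0 <= y) by apply Rabs_pos.
    apply (Rmult_le_reg_r eta); trivial. replace ((eta + y * y / eta) * eta) with (eta * eta + y * y) by (field; lra).
    nra.
  - rewrite VD. apply Rmult_le_compat_l. lra.
    (* The relative variance is of order [/ a]; the choice [eta = / sqrt a] balances it against the
       linear term. *)
    assert ((a + 1) ^ 2 / a ^ 2 - 1 <= 3 * eta * eta).
    { unfold eta. replace (3 * / sqrt a * / sqrt a) with (3 / a).
      2:{ rewrite <- (sqrt_sqrt a) at 1 by lra. field. lra. }
      apply (Rmult_le_reg_r (a ^ 2)). nra. unfold Rdiv. rewrite Rmult_minus_distr_r, Rmult_assoc, Rinv_l by nra.
      replace (3 * / a * a ^ 2) with (3 * a) by (field; lra). nra. }
    assert (0 < C / eta) by (apply Rdiv_lt_0_compat; lra).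
    apply Rle_trans with (C * eta + C / eta * (3 * eta * eta)). nra.
    right. unfold Rdiv. fold eta. field. lra.
Qed.

(** * The modulus and the phase of the Gamma function on the line 1 + i R *)

Lemma is_derive_cosh (t : R) : is_derive cosh t (sinh t).
Proof. apply is_derive_Reals. apply derivable_pt_lim_cosh. Qed.
Lemma is_derive_sinh (t : R) : is_derive sinh t (cosh t).
Proof. apply is_derive_Reals. apply derivable_pt_lim_sinh. Qed.

Lemma cosh_sinh_sqr (t : R) : cosh t ^ 2 = 1 + sinh t ^ 2.
Proof.
  unfold cosh, sinh. pose proof (exp_plus t (- t)) as H. rewrite Rplus_opp_r, exp_0 in H.
  rewrite H. field.
Qed.

Lemma cosh_ge_1 (t : R) : 1 <= cosh t.
Proof.
  unfold cosh. pose proof (exp_plus t (- t)) as H. rewrite Rplus_opp_r, exp_0 in H.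
  pose proof (exp_pos t). pose proof (exp_pos (-t)).
  set (a := exp t) in *. set (b := exp (- t)) in *. pose proof (Rle_0_sqr (a - b)) as Q. unfold Rsqr in Q.
  destruct (Rle_dec 2 (a + b)) as [Hab|Hab]. lra. exfalso. nra.
Qed.

Lemma cosh_ge_exp (t : R) : exp t / 2 <= cosh t.
Proof. unfold cosh. pose proof (exp_pos (-t)). lra. Qed.

Lemma sinh_ge (t : R) : 0 <= t -> t <= sinh t.
Proof.
  intros Ht. destruct (Req_dec t 0) as [->|Hn]. rewrite sinh_0; lra.
  destruct (MVT_gen sinh 0 t cosh) as [c [Hc Ec]].
  - intros; apply is_derive_sinh.
  - intros; apply continuity_pt_filterlim. eapply is_derive_continuous, is_derive_sinh.
  - rewrite sinh_0 in Ec. pose proof (cosh_ge_1 c). nra.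
Qed.

Lemma sinh_pos (t : R) : 0 < t -> 0 < sinh t.
Proof. intros H. pose proof (sinh_ge t). lra. Qed.

Lemma exp_neg_delta (t : R) : 0 < t -> exp (- t) <= 2 * delta t.
Proof.
  intros Ht. unfold delta. rewrite exp_Ropp.
  pose proof (sqrt_lt_R0 t Ht). pose proof (sqrt_sqrt t ltac:(lra)).
  replace (2 * / (sqrt t * (1 + t))) with (/ (sqrt t * (1 + t) / 2)) by (field; lra).
  apply Rinv_le_contravar. nra.
  pose proof (exp_ineq1_le (t / 2)) as H1. replace (exp t) with (exp (t/2) * exp (t/2)) by (rewrite <- exp_plus; f_equal; field).
  pose proof (Rle_0_sqr (sqrt t - 1)) as Q. unfold Rsqr in Q.
  assert (2 * sqrt t <= 1 + t) by lra.
  apply Rle_trans with ((1 + t) * (1 + t) / 4). nra.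
  apply Rle_trans with ((1 + t / 2) * (1 + t / 2)). nra. apply Rmult_le_compat; lra.
Qed.

Definition sech (t : R) : R := / cosh t.

Lemma sech_bound (t : R) : 0 < sech t <= 1 /\ sech t <= 2 * exp (- t).
Proof.
  pose proof (cosh_ge_1 t). pose proof (cosh_ge_exp t). pose proof (exp_pos t). unfold sech. repeat split.
  - apply Rinv_0_lt_compat. lra.
  - rewrite <- Rinv_1. apply Rinv_le_contravar; lra.
  - rewrite exp_Ropp. replace (2 * / exp t) with (/ (exp t / 2)) by (field; lra). apply Rinv_le_contravar; lra.
Qed.

Lemma sech_tanh_sqr (t : R) : tanh t ^ 2 = 1 - sech t ^ 2.
Proof.
  unfold tanh, sech. pose proof (cosh_sinh_sqr t). pose proof (cosh_ge_1 t).
  replace (1 - (/ cosh t) ^ 2) with ((cosh t ^ 2 - 1) / cosh t ^ 2) by (field; lra).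
  replace (cosh t ^ 2 - 1) with (sinh t ^ 2) by lra. field. lra.
Qed.

Lemma tanh_bound (t : R) : -1 <= tanh t <= 1.
Proof. pose proof (sech_tanh_sqr t). pose proof (sech_bound t). nra. Qed.

Lemma is_derive_sech (t : R) : is_derive sech t (- sech t * tanh t).
Proof.
  pose proof (cosh_ge_1 t). unfold sech, tanh. auto_derive. lra. field. lra.
Qed.

Lemma is_derive_tanh (t : R) : is_derive tanh t (sech t ^ 2).
Proof.
  pose proof (cosh_ge_1 t). pose proof (cosh_sinh_sqr t). unfold tanh, sech. auto_derive. lra. replace ((/ cosh t) ^ 2) with ((cosh t ^ 2 - sinh t ^ 2) / cosh t ^ 2). field. lra.
  replace (cosh t ^ 2 - sinh t ^ 2) with 1 by lra. field. lra.
Qed.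

Lemma lim_exp_neg : filterlim (fun t => exp (- t)) at_infty (locally 0).
Proof.
  apply (lim_at_squeeze _ _ (fun t => / t)). 2: apply lim_at_infty_inv.
  generalize (at_infty_gt 0). apply filter_imp. intros t Ht. rewrite Rminus_0_r, Rabs_pos_eq by apply Rlt_le, exp_pos.
  rewrite exp_Ropp. apply Rinv_le_contravar; trivial. pose proof (exp_ineq1_le t). lra.
Qed.

Lemma lim_bounded_exp (F : R -> R) (K : R) : (forall t, 0 < t -> Rabs (F t) <= K * exp (- t)) ->
  filterlim F at_infty (locally 0).
Proof.
  intros H. apply (lim_at_squeeze _ _ (fun t => K * exp (- t))).
  generalize (at_infty_gt 0). apply filter_imp. intros t Ht. rewrite Rminus_0_r. auto.
  apply lim_scal0. apply Rbar_locally_filter. apply lim_exp_neg.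
Qed.

Lemma integrable_exp (f : R -> R) (K : R) : cont_pos f -> (forall t, 0 < t -> Rabs (f t) <= K * exp (- t)) -> integrable f.
Proof.
  intros C H. exists (2 * Rabs K). split; trivial. intros t Ht. specialize (H t Ht).
  pose proof (exp_neg_delta t Ht). pose proof (exp_pos (- t)). pose proof (Rle_abs K). pose proof (Rabs_pos K).
  eapply Rle_trans. apply H. apply Rle_trans with (Rabs K * exp (- t)). nra. nra.
Qed.

(** For [m >= 1] a Beta integral in disguise, with [nu = 2 * mu] proportional to |Gamma (m + i
    mu)|^2. *)
Definition sech_int (nu : R) (m : nat) : R := half_int (fun t => sech t ^ (2 * m) * cos (nu * t)).

Lemma sech_pow_bound (m : nat) (t : R) : (1 <= m)%nat -> 0 <= sech t ^ (2 * m) <= 2 * exp (- t).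
Proof.
  intros Hm. destruct (sech_bound t) as [[H1 H2] H3]. split. apply pow_le; lra.
  apply Rle_trans with (sech t); trivial. rewrite <- (pow_1 (sech t)) at 2.
  replace (2 * m)%nat with (1 + (2 * m - 1))%nat by lia. rewrite pow_add, !pow_1.
  assert (sech t ^ (2 * m - 1) <= 1). { rewrite <- (pow1 (2 * m - 1)). apply pow_incr. lra. }
  assert (0 <= sech t ^ (2 * m - 1)) by (apply pow_le; lra). nra.
Qed.

Lemma continuous_sech_cos (nu : R) (m : nat) (t : R) : continuous (fun t => sech t ^ m * cos (nu * t)) t.
Proof.
  apply (ex_derive_continuous (fun t => sech t ^ m * cos (nu * t))). auto_derive.
  repeat split; trivial. eexists; apply is_derive_sech.
Qed.

Lemma integrable_sech_int (nu : R) (m : nat) : (1 <= m)%nat -> integrable (fun t => sech t ^ (2 * m) * cos (nu * t)).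
Proof.
  intros Hm. apply (integrable_exp _ 2). intros t _; apply continuous_sech_cos.
  intros t Ht. destruct (sech_pow_bound m t Hm) as [H1 H2]. rewrite Rabs_mult, (Rabs_pos_eq _ H1).
  assert (Rabs (cos (nu * t)) <= 1) by (apply Rabs_le, COS_bound). pose proof (Rabs_pos (cos (nu * t))). nra.
Qed.

Lemma is_derive_sech_pow (m : nat) (t : R) :
  is_derive (fun t => sech t ^ (2 * m)) t (- (2 * INR m) * sech t ^ (2 * m) * tanh t).
Proof.
  pose proof (is_derive_sech t) as H. auto_derive. eexists; exact H. drw H.
  replace (m + (m + 0))%nat with (2 * m)%nat by lia. rewrite mult_INR. simpl (INR 2).
  destruct m as [|m]. simpl. ring.
  replace (2 * S m)%nat with (S (pred (2 * S m))) by lia. cbn [pow pred]. ring.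
Qed.

(** The second derivative of [sech^(2m)] is [4 k^2 sech^(2m) - 2k (2k + 1) sech^(2m+2)]. [F]
    collects the boundary terms of integrating by parts twice against the cosine. *)
Lemma sech_int_rec (nu : R) (m : nat) : (1 <= m)%nat -> let k := INR m in
  2 * k * (2 * k + 1) * sech_int nu (S m) = (4 * k ^ 2 + nu ^ 2) * sech_int nu m.
Proof.
  intros Hm k.
  pose proof (integrable_sech_int nu m Hm) as I1. pose proof (integrable_sech_int nu (S m) ltac:(lia)) as I2.
  set (F := fun t => - (2 * k) * (sech t ^ (2 * m) * tanh t) * cos (nu * t) + nu * sin (nu * t) * sech t ^ (2 * m)).
  assert (E := half_int_FTC F (fun t => (4 * k ^ 2 + nu ^ 2) * (sech t ^ (2 * m) * cos (nu * t))
     - 2 * k * (2 * k + 1) * (sech t ^ (2 * S m) * cos (nu * t))) 0 0).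
  assert (D : forall t, is_derive F t ((4 * k ^ 2 + nu ^ 2) * (sech t ^ (2 * m) * cos (nu * t))
     - 2 * k * (2 * k + 1) * (sech t ^ (2 * S m) * cos (nu * t)))).
  { intros t. pose proof (is_derive_sech_pow m t) as H1. pose proof (is_derive_tanh t) as H2. unfold F.
    replace (sech t ^ (2 * S m)) with (sech t ^ (2 * m) * sech t ^ 2) by (rewrite <- pow_add; f_equal; lia).
    cbv beta in *. fold k in H1. set (G := fun t => sech t ^ (2 * m)) in *.
    change (sech t ^ (2 * m)) with (G t). change (is_derive G t (- (2 * k) * G t * tanh t)) in H1.
    change (is_derive (fun t => - (2 * k) * (G t * tanh t) * cos (nu * t) + nu * sin (nu * t) * G t) t
      ((4 * k ^ 2 + nu ^ 2) * (G t * cos (nu * t)) - 2 * k * (2 * k + 1) * (G t * sech t ^ 2 * cos (nu * t)))).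
    clearbody G.
    auto_derive. repeat split; trivial; first [exact (ex_intro _ _ H1)|exact (ex_intro _ _ H2)].
    drw H1. drw H2. pose proof (sech_tanh_sqr t) as Q.
    replace (sech t ^ 2) with (1 - tanh t ^ 2) by lra. ring. }
  rewrite half_int_minus in E; try (apply integrable_scal; trivial).
  rewrite !half_int_scal in E by trivial. fold (sech_int nu m) in E. fold (sech_int nu (S m)) in E.
  apply Rminus_diag_uniq_sym. replace 0 with (0 - 0) at 1 by ring. apply E.
  - intros t Ht. apply (continuous_minus (fun t => (4 * k ^ 2 + nu ^ 2) * (sech t ^ (2 * m) * cos (nu * t)))).
    apply (continuous_scal_r (4 * k ^ 2 + nu ^ 2) (fun t => sech t ^ (2 * m) * cos (nu * t))). apply continuous_sech_cos.
    apply (continuous_scal_r (2 * k * (2 * k + 1)) (fun t => sech t ^ (2 * S m) * cos (nu * t))). apply continuous_sech_cos.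
  - intros t _; apply D.
  - replace 0 with (F 0) at 2. apply continuous_at_right. eapply is_derive_continuous, D.
    unfold F. unfold tanh. rewrite sinh_0, Rmult_0_r, sin_0. unfold Rdiv. ring.
  - apply (lim_bounded_exp _ ((2 * k + Rabs nu) * 2)). intros t Ht. unfold F.
    destruct (sech_pow_bound m t Hm) as [S1 S2].
    assert (Hk : 0 <= k) by apply pos_INR.
    eapply Rle_trans. apply Rabs_triang. rewrite !Rabs_mult, Rabs_Ropp, (Rabs_pos_eq _ S1), (Rabs_pos_eq (2 * k)) by lra.
    assert (C1 : Rabs (cos (nu * t)) <= 1) by (apply Rabs_le, COS_bound).
    assert (C2 : Rabs (sin (nu * t)) <= 1) by (apply Rabs_le, SIN_bound).
    assert (C3 : Rabs (tanh t) <= 1) by (apply Rabs_le, tanh_bound).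
    pose proof (Rabs_pos (cos (nu * t))). pose proof (Rabs_pos (sin (nu * t))). pose proof (Rabs_pos (tanh t)). pose proof (Rabs_pos nu).
    set (s := sech t ^ (2 * m)) in *.
    assert (s * Rabs (tanh t) <= s) by nra. assert (0 <= s * Rabs (tanh t)) by nra.
    assert (s * Rabs (tanh t) * Rabs (cos (nu * t)) <= s) by nra.
    assert (Rabs (sin (nu * t)) * s <= s) by nra.
    replace (2 * k * (s * Rabs (tanh t)) * Rabs (cos (nu * t))) with (2 * k * (s * Rabs (tanh t) * Rabs (cos (nu * t)))) by ring.
    replace (Rabs nu * Rabs (sin (nu * t)) * s) with (Rabs nu * (Rabs (sin (nu * t)) * s)) by ring.
    assert (Rabs nu * (Rabs (sin (nu * t)) * s) <= Rabs nu * s) by (apply Rmult_le_compat_l; trivial).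
    assert (2 * k * (s * Rabs (tanh t) * Rabs (cos (nu * t))) <= 2 * k * s) by (apply Rmult_le_compat_l; lra).
    nra.
Qed.

Lemma lim_tanh : filterlim tanh at_infty (locally 1).
Proof.
  apply (lim_at_squeeze _ _ (fun t => 2 * exp (- t))).
  - generalize (at_infty_gt 0). apply filter_imp. intros t Ht.
    pose proof (sech_tanh_sqr t). pose proof (sech_bound t) as [[S1 S2] S3].
    assert (0 < tanh t). { unfold tanh. apply Rdiv_lt_0_compat. apply sinh_pos; trivial. pose proof (cosh_ge_1 t); lra. }
    pose proof (tanh_bound t). rewrite Rabs_left1 by lra. nra.
  - apply lim_scal0. apply Rbar_locally_filter. apply lim_exp_neg.
Qed.

Lemma sech_int_0_1 : sech_int 0 1 = 1.
Proof.
  unfold sech_int. rewrite (half_int_FTC tanh _ 0 1). ring.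
  - intros t _; apply continuous_sech_cos.
  - intros t _. rewrite Rmult_0_l, cos_0, Rmult_1_r. apply is_derive_tanh.
  - replace 0 with (tanh 0) at 2 by (unfold tanh; rewrite sinh_0; unfold Rdiv; ring).
    apply continuous_at_right. eapply is_derive_continuous, is_derive_tanh.
  - apply lim_tanh.
Qed.

Lemma sech_int_0_pos (m : nat) : 0 < sech_int 0 (S m).
Proof.
  induction m as [|m IH]. rewrite sech_int_0_1; lra.
  pose proof (sech_int_rec 0 (S m) ltac:(lia)) as H. cbv zeta in H.
  assert (0 < INR (S m)) by (apply lt_0_INR; lia). set (k := INR (S m)) in *.
  assert (0 < (4 * k ^ 2 + 0 ^ 2) * sech_int 0 (S m)) by (apply Rmult_lt_0_compat; nra).
  rewrite <- H in H1. assert (0 < 2 * k * (2 * k + 1)) by nra.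
  apply (Rmult_lt_reg_l (2 * k * (2 * k + 1))); lra.
Qed.

(** Dividing the recurrence by the one at frequency 0 leaves the factors [1 + mu^2 / k^2], which are
    those of [mod_prod] over the squared factorial. *)
Lemma sech_int_ratio (mu : R) (m : nat) :
  sech_int (2 * mu) (S m) = sech_int 0 (S m) * (mod_prod mu m / INR (fact m) ^ 2) * sech_int (2 * mu) 1.
Proof.
  induction m as [|m IH]. rewrite sech_int_0_1. simpl. field.
  pose proof (sech_int_rec 0 (S m) ltac:(lia)) as H0. pose proof (sech_int_rec (2 * mu) (S m) ltac:(lia)) as H1.
  cbv zeta in *. assert (0 < INR (S m)) by (apply lt_0_INR; lia).
  cbn [mod_prod]. rewrite fact_simpl, mult_INR. pose proof (INR_fact_lt_0 m).
  set (k := INR (S m)) in *.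
  apply (Rmult_eq_reg_l (2 * k * (2 * k + 1))); [|nra]. rewrite H1, IH.
  rewrite <- !Rmult_assoc, H0. field. split; lra.
Qed.

Lemma cos_ge_quadratic (x : R) : 0 <= 1 - cos x <= x ^ 2 / 2.
Proof.
  pose proof (COS_bound x). split. lra.
  replace x with (2 * (x / 2)) at 1 by field. rewrite cos_2a_sin.
  assert (sin (x/2) ^ 2 <= (x / 2) ^ 2).
  { assert (A : Rabs (sin (x/2)) <= Rabs (x/2)).
    { destruct (MVT_gen sin 0 (x/2) cos) as [c [_ Ec]].
      - intros t _. auto_derive; trivial; ring.
      - intros t _. apply continuity_sin.
      - rewrite sin_0, !Rminus_0_r in Ec. rewrite Ec, Rabs_mult.
        assert (Rabs (cos c) <= 1) by (apply Rabs_le, COS_bound). pose proof (Rabs_pos (x/2)). nra. }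
    rewrite <- (pow2_abs (sin (x/2))), <- (pow2_abs (x/2)). apply pow_incr. split; trivial. apply Rabs_pos. }
  nra.
Qed.

(** The weight [sech^(2m)] concentrates at 0, where the cosine is 1. From
    [1 - cos (2 mu t) <= 2 mu^2 t^2] and [t^2 sech^2 t <= tanh^2 t = 1 - sech^2 t] the majorant
    becomes a difference of two consecutive integrals at frequency 0. *)
Lemma sech_int_concentration (mu : R) (m : nat) : (1 <= m)%nat ->
  Rabs (mod_prod mu m / INR (fact m) ^ 2 * sech_int (2 * mu) 1 - 1) <= mu ^ 2 / INR m.
Proof.
  intros Hm. assert (Hk : 0 < INR m) by (apply lt_0_INR; lia).
  pose proof (sech_int_0_pos m) as P. pose proof (sech_int_ratio mu m) as E.
  pose proof (sech_int_rec 0 m Hm) as H0. cbv zeta in H0.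
  apply (Rmult_le_reg_l (sech_int 0 (S m))); trivial.
  rewrite <- (Rabs_pos_eq (sech_int 0 (S m))) at 1 by lra. rewrite <- Rabs_mult.
  replace (sech_int 0 (S m) * (mod_prod mu m / INR (fact m) ^ 2 * sech_int (2 * mu) 1 - 1)) with
    (sech_int (2 * mu) (S m) - sech_int 0 (S m)) by (rewrite E; ring).
  pose proof (integrable_sech_int (2 * mu) (S m) ltac:(lia)) as I1.
  pose proof (integrable_sech_int 0 (S m) ltac:(lia)) as I2. pose proof (integrable_sech_int 0 m Hm) as I3.
  unfold sech_int at 1 2. rewrite <- half_int_minus by trivial.
  eapply Rle_trans. apply (half_int_abs_le _ (fun t => 2 * mu ^ 2 * (sech t ^ (2 * m) * cos (0 * t) - sech t ^ (2 * S m) * cos (0 * t)))).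
  - apply integrable_minus; trivial.
  - apply integrable_scal, integrable_minus; trivial.
  - intros t Ht. rewrite Rmult_0_l, cos_0, !Rmult_1_r.
    destruct (sech_pow_bound m t Hm) as [S1 _]. pose proof (sech_bound t) as [[S2 S3] _].
    replace (2 * S m)%nat with (2 * m + 2)%nat by lia. rewrite pow_add.
    set (s := sech t ^ (2 * m)) in *.
    replace (s * sech t ^ 2 * cos (2 * mu * t) - s * sech t ^ 2) with (- (s * sech t ^ 2 * (1 - cos (2 * mu * t)))) by ring.
    pose proof (cos_ge_quadratic (2 * mu * t)) as [C1 C2].
    assert (0 <= s * sech t ^ 2) by (apply Rmult_le_pos; nra).
    rewrite Rabs_Ropp, Rabs_pos_eq by (apply Rmult_le_pos; trivial).
    assert (T : sech t ^ 2 * t ^ 2 <= 1 - sech t ^ 2).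
    { rewrite <- sech_tanh_sqr. unfold tanh, sech. pose proof (sinh_ge t ltac:(lra)). pose proof (cosh_ge_1 t).
      replace ((/ cosh t) ^ 2 * t ^ 2) with ((/ cosh t) ^ 2 * (t * t)) by ring.
      replace ((sinh t / cosh t) ^ 2) with ((/ cosh t) ^ 2 * (sinh t * sinh t)) by (field; lra).
      apply Rmult_le_compat_l. nra. nra. }
    apply Rle_trans with (s * sech t ^ 2 * ((2 * mu * t) ^ 2 / 2)). apply Rmult_le_compat_l; trivial.
    replace (s * sech t ^ 2 * ((2 * mu * t) ^ 2 / 2)) with (2 * mu ^ 2 * (s * (sech t ^ 2 * t ^ 2))) by field.
    apply Rmult_le_compat_l. nra. replace (s - s * sech t ^ 2) with (s * (1 - sech t ^ 2)) by ring.
    apply Rmult_le_compat_l; trivial.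
  - rewrite half_int_scal by (apply integrable_minus; trivial). rewrite half_int_minus by trivial.
    fold (sech_int 0 m). fold (sech_int 0 (S m)).
    (* At frequency 0 the recurrence gives [sech_int 0 m - sech_int 0 (S m) = sech_int 0 (S m) / (2
       * INR m)]. *)
    right. replace (sech_int 0 m) with (2 * INR m * (2 * INR m + 1) * sech_int 0 (S m) / (4 * INR m ^ 2)).
    field. lra. rewrite H0. field. lra.
Qed.

Lemma lim_seq_inv_INR (C : R) : is_lim_seq (fun m => C / INR m) 0.
Proof.
  replace (Finite 0) with (Rbar_mult C 0) by (simpl; f_equal; ring).
  apply (is_lim_seq_scal_l (fun m => / INR m)).
  replace (Finite 0) with (Rbar_inv p_infty) by reflexivity. apply is_lim_seq_inv. apply is_lim_seq_INR. discriminate.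
Qed.

Lemma is_lim_seq_squeeze (u v : nat -> R) (l : R) :
  (exists N, forall n, (N <= n)%nat -> Rabs (u n - l) <= v n) -> is_lim_seq v 0 -> is_lim_seq u l.
Proof.
  intros [N H] Hv. apply (is_lim_seq_ext (fun n => (u n - l) + l)). intros; ring.
  replace (Finite l) with (Rbar_plus 0 l) by (simpl; f_equal; ring).
  apply is_lim_seq_plus'. 2: apply is_lim_seq_const.
  apply is_lim_seq_abs_0. apply (is_lim_seq_le_le_loc (fun _ => 0) _ v).
  exists N. intros n Hn. split. apply Rabs_pos. auto. apply is_lim_seq_const. trivial.
Qed.

(** The product formula for 1 / |Gamma (1 + i mu)|^2. Positivity of the integral is not visible from
    its oscillating integrand; it is forced because positive numbers times it tend to 1. *)
Lemma mod_prod_lim (mu : R) :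
  0 < sech_int (2 * mu) 1 /\ is_lim_seq (fun m => mod_prod mu m / INR (fact m) ^ 2) (/ sech_int (2 * mu) 1).
Proof.
  set (s := sech_int (2 * mu) 1).
  assert (L : is_lim_seq (fun m => mod_prod mu m / INR (fact m) ^ 2 * s) 1).
  { apply (is_lim_seq_squeeze _ (fun m => mu ^ 2 / INR m)). exists 1%nat. intros n Hn.
    apply sech_int_concentration; trivial. apply lim_seq_inv_INR. }
  assert (P : forall m, 0 < mod_prod mu m / INR (fact m) ^ 2).
  { intros m. apply Rdiv_lt_0_compat. apply mod_prod_pos. apply pow_lt, INR_fact_lt_0. }
  assert (Hs : 0 < s).
  { destruct (Rlt_dec 0 s) as [|Hn]; trivial. exfalso.
    assert (Q : Rbar_le 1 0). 2: simpl in Q; lra.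
    apply (is_lim_seq_le (fun m => mod_prod mu m / INR (fact m) ^ 2 * s) (fun _ => 0)); trivial.
    intros n. specialize (P n). nra. apply is_lim_seq_const. }
  split; trivial.
  apply (is_lim_seq_ext (fun m => (mod_prod mu m / INR (fact m) ^ 2 * s) * / s)). intros n. field.
  split. pose proof (INR_fact_lt_0 n); lra. lra.
  replace (Finite (/ s)) with (Rbar_mult 1 (/ s)) by (simpl; f_equal; ring). apply (is_lim_seq_scal_r _ (/ s) 1). exact L.
Qed.

Lemma atan_bounds (x : R) : 0 <= x -> x - x ^ 2 <= atan x <= x.
Proof.
  intros Hx. destruct (Req_dec x 0) as [->|Hn]. rewrite atan_0; lra. split.
  - destruct (MVT_gen (fun x => atan x - x + x ^ 2) 0 x (fun x => / (1 + x ^ 2) - 1 + 2 * x)) as [c [Hc Ec]].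
    + intros t _. auto_derive; trivial. unfold Rsqr. field. nra.
    + intros t _. apply continuity_pt_filterlim. apply (ex_derive_continuous (fun x => atan x - x + x ^ 2)). auto_derive. trivial.
    + rewrite Rmin_left, Rmax_right in Hc by lra. rewrite atan_0 in Ec.
      assert (0 <= / (1 + c ^ 2) - 1 + 2 * c).
      { replace (/ (1 + c ^ 2) - 1 + 2 * c) with (c * (2 + 2 * c ^ 2 - c) / (1 + c ^ 2)) by (field; nra).
        apply Rmult_le_pos. nra. apply Rlt_le, Rinv_0_lt_compat. nra. }
      nra.
  - destruct (MVT_gen atan 0 x (fun x => / (1 + x ^ 2))) as [c [Hc Ec]].
    + intros t _. auto_derive; trivial. unfold Rsqr. field. nra.
    + intros t _. apply continuity_pt_filterlim. apply continuous_atan.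
    + rewrite Rmin_left, Rmax_right in Hc by lra. rewrite atan_0 in Ec.
      assert (/ (1 + c ^ 2) <= 1) by (rewrite <- Rinv_1; apply Rinv_le_contravar; nra). nra.
Qed.

(** The increments are bounded by a multiple of the telescoping [/ k - / (k + 1)], so adding
    [C / (j + 1)] makes the sequence decreasing while it stays bounded below. *)
Lemma phase_converges (mu : R) : 0 <= mu ->
  exists ph, is_lim_seq (fun j => phase_sum mu j - mu * ln (INR (S j))) (Finite ph).
Proof.
  intros Hmu. set (u := fun j => phase_sum mu j - mu * ln (INR (S j))).
  set (C := mu + 2 * mu ^ 2).
  assert (D : forall j, let k := INR (S j) in Rabs (u (S j) - u j) <= C * (/ k - / (k + 1))).
  { intros j k. assert (Hk : 1 <= k) by (apply (le_INR 1); lia).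
    unfold u. cbn [phase_sum]. rewrite (S_INR (S j)). fold k.
    replace (phase_sum mu j + atan (mu / k) - mu * ln (k + 1) - (phase_sum mu j - mu * ln k))
      with (atan (mu / k) - mu * (ln (k + 1) - ln k)) by ring.
    assert (Hq : 0 <= mu / k) by (apply Rmult_le_pos; [trivial | apply Rlt_le, Rinv_0_lt_compat; lra]).
    pose proof (atan_bounds (mu / k) Hq) as [A1 A2].
    assert (L1 : ln (k + 1) - ln k <= / k).
    { rewrite <- ln_div by lra. pose proof (ln_le_minus_1 ((k + 1) / k) ltac:(apply Rdiv_lt_0_compat; lra)).
      replace ((k + 1) / k - 1) with (/ k) in H by (field; lra). trivial. }
    assert (L2 : / (k + 1) <= ln (k + 1) - ln k).
    { pose proof (ln_le_minus_1 (k / (k + 1)) ltac:(apply Rdiv_lt_0_compat; lra)).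
      rewrite ln_div in H by lra. replace (k / (k + 1) - 1) with (- / (k + 1)) in H by (field; lra). lra. }
    assert (L3 : mu ^ 2 * / k ^ 2 <= 2 * mu ^ 2 * (/ k - / (k + 1))).
    { replace (/ k - / (k + 1)) with (/ (k * (k + 1))) by (field; lra).
      replace (2 * mu ^ 2 * / (k * (k + 1))) with (mu ^ 2 * / (k * (k + 1) / 2)) by (field; lra).
      apply Rmult_le_compat_l. nra. apply Rinv_le_contravar; nra. }
    replace ((mu / k) ^ 2) with (mu ^ 2 * / k ^ 2) in A1 by (field; lra). unfold Rdiv in A1, A2.
    assert (0 < / k - / (k + 1)). { replace (/ k - / (k + 1)) with (/ (k * (k + 1))) by (field; lra). apply Rinv_0_lt_compat; nra. }
    unfold C. apply Rabs_le. nra. }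
  assert (B : forall j, u 0%nat - C * (1 - / INR (S j)) <= u j).
  { induction j as [|j IH]. change (INR 1) with 1. rewrite Rinv_1. lra.
    specialize (D j). cbv zeta in D. apply Rabs_le_between in D. rewrite (S_INR (S j)). lra. }
  assert (HC : 0 <= C) by (unfold C; nra).
  destruct (ex_finite_lim_seq_decr (fun j => u j + C * / INR (S j)) (u 0%nat - C)) as [l Hl].
  - intros j. specialize (D j). cbv zeta in D. apply Rabs_le_between in D. rewrite (S_INR (S j)). lra.
  - intros j. specialize (B j). assert (0 < / INR (S j)) by (apply Rinv_0_lt_compat, lt_0_INR; lia). nra.
  - exists l. apply (is_lim_seq_ext (fun j => (u j + C * / INR (S j)) - C / INR (S j))). intros n; unfold Rdiv; ring.
    replace (Finite l) with (Finite (l - 0)) by (f_equal; ring).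
    apply is_lim_seq_minus'; trivial. apply (is_lim_seq_incr_1 (fun m => C / INR m)). apply lim_seq_inv_INR.
Qed.

(** The argument of 1 / Gamma (1 + i mu), on the branch determined by the sum of arctangents. *)
Definition gamma_phase (mu : R) : R := Lim_seq (fun j => phase_sum mu j - mu * ln (INR (S j))).

Lemma gamma_phase_lim (mu : R) : 0 <= mu -> is_lim_seq (fun j => phase_sum mu j - mu * ln (INR (S j))) (gamma_phase mu).
Proof.
  intros H. destruct (phase_converges mu H) as [l Hl]. unfold gamma_phase. rewrite (is_lim_seq_unique _ _ Hl). exact Hl.
Qed.

(** The limit of [mod_prod mu j / INR (fact j) ^ 2 * kmom mu 0 d] is computed twice: by the product
    formula, and by [kmom_closed] with the concentration of the j-th moment. Comparing the two
    yields modulus and phase of Gamma (1 + i mu)^2. *)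
Lemma kmom_0_value (mu d : R) : 0 <= mu -> kmom mu 0 d = sech_int (2 * mu) 1 * cos (d - 2 * gamma_phase mu).
Proof.
  intros Hmu. destruct (mod_prod_lim mu) as [Hs HL]. set (s := sech_int (2 * mu) 1) in *.
  set (K := kmom mu 0 d).
  assert (L1 : is_lim_seq (fun j => mod_prod mu j / INR (fact j) ^ 2 * K) (/ s * K)).
  { apply (is_lim_seq_scal_r _ K (/ s)). exact HL. }
  assert (L2 : is_lim_seq (fun j => cos (d - 2 * (phase_sum mu j - mu * ln (INR (S j))))) (cos (d - 2 * gamma_phase mu))).
  { apply is_lim_seq_continuous. apply continuity_cos. apply is_lim_seq_minus'. apply is_lim_seq_const.
    apply (is_lim_seq_scal_l _ 2 (gamma_phase mu)). apply gamma_phase_lim; trivial. }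
  assert (L3 : is_lim_seq (fun j => (4 + 2 * mu) * 4 / sqrt (INR (S j))) 0).
  { replace (Finite 0) with (Rbar_mult ((4 + 2 * mu) * 4) 0) by (simpl; f_equal; ring).
    apply (is_lim_seq_scal_l (fun j => / sqrt (INR (S j)))).
    replace (Finite 0) with (Rbar_inv p_infty) by reflexivity. apply is_lim_seq_inv; [|discriminate].
    apply (is_lim_seq_incr_1 (fun j => sqrt (INR j))).
    apply (filterlim_comp _ _ _ INR sqrt eventually at_infty). apply is_lim_seq_INR. apply filterlim_sqrt_p. }
  assert (L4 : is_lim_seq (fun j => mod_prod mu j / INR (fact j) ^ 2 * K) (cos (d - 2 * gamma_phase mu))).
  { apply (is_lim_seq_ext (fun j => (mod_prod mu j / INR (fact j) ^ 2 * K - cos (d - 2 * (phase_sum mu j - mu * ln (INR (S j))))) + cos (d - 2 * (phase_sum mu j - mu * ln (INR (S j)))))).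
    intros; ring. replace (cos (d - 2 * gamma_phase mu)) with (0 + cos (d - 2 * gamma_phase mu)) by ring.
    apply is_lim_seq_plus'; trivial.
    apply (is_lim_seq_squeeze _ (fun j => (4 + 2 * mu) * 4 / sqrt (INR (S j)))); trivial.
    exists 0%nat. intros j _. rewrite Rminus_0_r.
    (* The phase is chosen so that unwinding the [j] steps of [kmom_closed] lands on [d] for every
       [j]. *)
    pose proof (kmom_concentration mu j (d - 2 * phase_sum mu j) Hmu) as H.
    rewrite kmom_closed in H. replace (d - 2 * phase_sum mu j + 2 * phase_sum mu j) with d in H by ring. fold K in H.
    assert (F : 0 < INR (fact j) ^ 2) by (apply pow_lt, INR_fact_lt_0).
    apply (Rmult_le_reg_l (INR (fact j) ^ 2)); trivial.
    rewrite <- (Rabs_pos_eq (INR (fact j) ^ 2)) at 1 by lra. rewrite <- Rabs_mult.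
    eapply Rle_trans; [|exact H]. right. f_equal.
    replace (2 * mu * ln (INR (S j)) + (d - 2 * phase_sum mu j)) with (d - 2 * (phase_sum mu j - mu * ln (INR (S j)))) by ring.
    cbn [INR]. field. apply INR_fact_neq_0. }
  pose proof (is_lim_seq_unique _ _ L1) as U1. pose proof (is_lim_seq_unique _ _ L4) as U4. rewrite U1 in U4.
  injection U4. intros E. rewrite <- E. field. lra.
Qed.

(** * The Bessel functions J of orders 0 and i mu *)

Definition Clim (u : nat -> C) (l : C) : Prop :=
  is_lim_seq (fun n => Re (u n)) (Re l) /\ is_lim_seq (fun n => Im (u n)) (Im l).

Lemma Clim_unique (u : nat -> C) (l : C) : Clim u l -> CLim_seq u = l.
Proof.
  intros [H1 H2]. unfold CLim_seq. rewrite (is_lim_seq_unique _ _ H1), (is_lim_seq_unique _ _ H2).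
  destruct l; reflexivity.
Qed.

Lemma Clim_mult (u v : nat -> C) (l m : C) : Clim u l -> Clim v m -> Clim (fun n => Cmult (u n) (v n)) (Cmult l m).
Proof.
  intros [H1 H2] [H3 H4]. split; simpl.
  - apply is_lim_seq_minus'; apply is_lim_seq_mult'; assumption.
  - apply is_lim_seq_plus'; apply is_lim_seq_mult'; assumption.
Qed.

(** Index 0 is set aside because m^z is built from [ln (INR m)]. *)
Lemma Clim_ext_loc (u v : nat -> C) (l : C) : (forall n, (1 <= n)%nat -> u n = v n) -> Clim u l -> Clim v l.
Proof.
  intros H [H1 H2]. split.
  - apply (is_lim_seq_ext_loc (fun n => Re (u n))); trivial. exists 1%nat. intros n Hn. rewrite H; trivial.
  - apply (is_lim_seq_ext_loc (fun n => Im (u n))); trivial. exists 1%nat. intros n Hn. rewrite H; trivial.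
Qed.

Definition rgamma_term (z : C) (m : nat) : C :=
  Cmult (Cpoch z m) (Cinv (Cmult (RtoC (INR (fact m))) (cpow_pos (INR m) z))).

Lemma polar_form (k mu : R) : 0 < k ->
  k = sqrt (k ^ 2 + mu ^ 2) * cos (atan (mu / k)) /\ mu = sqrt (k ^ 2 + mu ^ 2) * sin (atan (mu / k)).
Proof.
  intros Hk. pose proof (polar_combination mu k 0 Hk) as H1. pose proof (polar_combination mu k (- (PI / 2)) Hk) as H2.
  rewrite cos_0, sin_0, Rplus_0_l in H1.
  rewrite cos_neg, sin_neg, cos_PI2, sin_PI2 in H2.
  replace (- (PI / 2) + atan (mu / k)) with (- (PI / 2 - atan (mu / k))) in H2 by ring. rewrite cos_neg, cos_shift in H2.
  split; lra.
Qed.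

(** [Cpoch z m] has [m + 1] factors, hence the index [S m]. *)
Lemma Cpoch_polar (mu : R) (m : nat) :
  Cpoch (1, mu) m = (sqrt (mod_prod mu (S m)) * cos (phase_sum mu (S m)), sqrt (mod_prod mu (S m)) * sin (phase_sum mu (S m))).
Proof.
  induction m as [|m IH].
  - simpl Cpoch. cbn [mod_prod phase_sum]. simpl (INR 1). destruct (polar_form 1 mu ltac:(lra)) as [H1 H2].
    rewrite Rmult_1_l, Rplus_0_l. f_equal; assumption.
  - cbn [Cpoch]. rewrite IH. clear IH. generalize (S m). intros j. cbn [mod_prod phase_sum].
    destruct (polar_form (INR (S j)) mu ltac:(apply lt_0_INR; lia)) as [H1 H2].
    rewrite sqrt_mult_alt by (apply Rlt_le, mod_prod_pos). rewrite cos_plus, sin_plus.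
    set (r := sqrt (INR (S j) ^ 2 + mu ^ 2)) in *. set (al := atan (mu / INR (S j))) in *.
    set (q := sqrt (mod_prod mu j)). set (s := phase_sum mu j).
    replace (Cplus (1, mu) (RtoC (INR j))) with ((r * cos al, r * sin al) : C).
    2:{ rewrite <- H1, <- H2. unfold Cplus, RtoC. simpl fst. simpl snd. rewrite S_INR. f_equal; ring. }
    unfold Cmult; simpl. f_equal; ring.
Qed.

Lemma rgamma_term_polar (mu : R) (m : nat) : (1 <= m)%nat ->
  let r := sqrt (mod_prod mu (S m)) / (INR (fact m) * INR m) in let th := phase_sum mu (S m) - mu * ln (INR m) in
  rgamma_term (1, mu) m = (r * cos th, r * sin th).
Proof.
  intros Hm r th. unfold rgamma_term. rewrite Cpoch_polar.
  unfold cpow_pos, Cexp. assert (Hk : 0 < INR m) by (apply lt_0_INR; lia).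
  replace (Re (Cmult (1, mu) (RtoC (ln (INR m))))) with (ln (INR m)) by (simpl; ring).
  replace (Im (Cmult (1, mu) (RtoC (ln (INR m))))) with (mu * ln (INR m)) by (simpl; ring).
  rewrite exp_ln by trivial. unfold th, r. rewrite cos_minus, sin_minus.
  set (t := mu * ln (INR m)). set (s := phase_sum mu (S m)). set (q := sqrt _).
  pose proof (INR_fact_lt_0 m) as Hf. set (F := INR (fact m)) in *. set (k := INR m) in *.
  assert (T : cos t ^ 2 + sin t ^ 2 = 1). { pose proof (sin2_cos2 t) as Q. unfold Rsqr in Q. simpl. lra. }
  replace (Cinv (Cmult (RtoC F) (k * cos t, k * sin t))) with ((cos t / (F * k), - sin t / (F * k)) : C).
  2:{ unfold Cinv, Cmult, RtoC. simpl fst. simpl snd.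
      replace ((F * (k * cos t) - 0 * (k * sin t)) ^ 2 + (F * (k * sin t) + 0 * (k * cos t)) ^ 2)
        with ((F * k) ^ 2 * (cos t ^ 2 + sin t ^ 2)) by ring. rewrite T. f_equal; field; lra. }
  unfold Cmult; simpl fst; simpl snd. f_equal; field; lra.
Qed.

(** Real part of 1 / Gamma (1 + i mu); its modulus is the square root of the limit in
    [mod_prod_lim]. *)
Definition rg_re (mu : R) : R := sqrt (/ sech_int (2 * mu) 1) * cos (gamma_phase mu).
Definition rg_im (mu : R) : R := sqrt (/ sech_int (2 * mu) 1) * sin (gamma_phase mu).

Lemma rgamma_lim_base (mu : R) : 0 <= mu -> Clim (rgamma_term (1, mu)) (rg_re mu, rg_im mu).
Proof.
  intros Hmu.
  set (r := fun m => sqrt (mod_prod mu (S m)) / (INR (fact m) * INR m)).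
  set (th := fun m => phase_sum mu (S m) - mu * ln (INR m)).
  destruct (mod_prod_lim mu) as [Hs Hl].
  assert (Inv : is_lim_seq (fun m => 1 / INR m) 0) by apply lim_seq_inv_INR.
  assert (L1 : is_lim_seq r (sqrt (/ sech_int (2 * mu) 1))).
  (* The product formula is normalised by [(m + 1)!] and Gauss's quotient by [m! * m]; their ratio
     is [1 + 1 / m]. *)
  { apply (is_lim_seq_ext_loc (fun m => sqrt (mod_prod mu (S m) / INR (fact (S m)) ^ 2) * (1 + 1 / INR m))).
    - exists 1%nat. intros m Hm. unfold r. assert (Hk : 0 < INR m) by (apply lt_0_INR; lia).
      pose proof (INR_fact_lt_0 m) as Hf. pose proof (INR_fact_lt_0 (S m)) as Hf2.
      rewrite sqrt_div_alt by (apply pow_lt; trivial). rewrite (sqrt_pow2 (INR (fact (S m)))) by lra.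
      rewrite fact_simpl, mult_INR, S_INR. field. lra.
    - replace (sqrt (/ sech_int (2 * mu) 1)) with (sqrt (/ sech_int (2 * mu) 1) * (1 + 0)) by ring.
      apply is_lim_seq_mult'.
      + apply (is_lim_seq_continuous sqrt (fun m => mod_prod mu (S m) / INR (fact (S m)) ^ 2)).
        apply continuity_pt_sqrt. apply Rlt_le, Rinv_0_lt_compat; trivial.
        apply (is_lim_seq_incr_1 (fun m => mod_prod mu m / INR (fact m) ^ 2)). exact Hl.
      + apply is_lim_seq_plus'; trivial. apply is_lim_seq_const. }
  assert (L2 : is_lim_seq th (gamma_phase mu)).
  (* [gamma_phase] is normalised at index [m + 1] by [ln (m + 2)] and Gauss's quotient by [ln m];
     the discrepancy [ln (1 + 2 / m)] vanishes in the limit. *)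
  { apply (is_lim_seq_ext_loc (fun m => (phase_sum mu (S m) - mu * ln (INR (S (S m)))) + mu * ln (1 + 2 * (1 / INR m)))).
    - exists 1%nat. intros m Hm. unfold th. assert (Hk : 0 < INR m) by (apply lt_0_INR; lia).
      replace (1 + 2 * (1 / INR m)) with (INR (S (S m)) / INR m) by (rewrite !S_INR; field; lra).
      rewrite ln_div; trivial. ring. apply lt_0_INR; lia.
    - replace (gamma_phase mu) with (gamma_phase mu + mu * ln (1 + 2 * 0)).
      2:{ rewrite Rmult_0_r, Rplus_0_r, ln_1. ring. }
      apply is_lim_seq_plus'. apply (is_lim_seq_incr_1 (fun m => phase_sum mu m - mu * ln (INR (S m)))). apply gamma_phase_lim; trivial.
      apply is_lim_seq_mult'. apply is_lim_seq_const.
      apply (is_lim_seq_continuous ln (fun m => 1 + 2 * (1 / INR m))).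
      apply continuity_pt_filterlim. rewrite Rmult_0_r, Rplus_0_r. apply (is_derive_continuous ln 1 (/1)). apply is_derive_ln. lra.
      apply is_lim_seq_plus'. apply is_lim_seq_const. apply is_lim_seq_mult'; trivial. apply is_lim_seq_const. }
  assert (L3 : Clim (fun m => (r m * cos (th m), r m * sin (th m))) (rg_re mu, rg_im mu)).
  { split; simpl.
    - apply is_lim_seq_mult'; trivial. apply is_lim_seq_continuous; trivial. apply continuity_cos.
    - apply is_lim_seq_mult'; trivial. apply is_lim_seq_continuous; trivial. apply continuity_sin. }
  revert L3. apply Clim_ext_loc. intros m Hm. symmetry. apply rgamma_term_polar; trivial.
Qed.

(** * Functional equation and conjugation symmetry of 1 / Gamma *)

Lemma Cpoch_shift (z : C) (m : nat) :
  Cmult z (Cpoch (Cplus z (RtoC 1)) m) = Cmult (Cpoch z m) (Cplus z (RtoC (INR (S m)))).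
Proof.
  induction m as [|m IH].
  - simpl. reflexivity.
  - cbn [Cpoch]. rewrite Cmult_assoc, IH. f_equal. rewrite (S_INR (S m)), RtoC_plus.
    rewrite <- Cplus_assoc, (Cplus_comm (RtoC 1)). reflexivity.
Qed.

Lemma cpow_shift (x : R) (z : C) : 0 < x -> cpow_pos x (Cplus z (RtoC 1)) = Cmult (RtoC x) (cpow_pos x z).
Proof.
  intros Hx. unfold cpow_pos, Cexp.
  replace (Re (Cmult (Cplus z (RtoC 1)) (RtoC (ln x)))) with (Re (Cmult z (RtoC (ln x))) + ln x) by (simpl; ring).
  replace (Im (Cmult (Cplus z (RtoC 1)) (RtoC (ln x)))) with (Im (Cmult z (RtoC (ln x)))) by (simpl; ring).
  rewrite exp_plus, exp_ln by trivial.
  set (a := Re (Cmult z (RtoC (ln x)))). set (b := Im (Cmult z (RtoC (ln x)))).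
  apply injective_projections; simpl; ring.
Qed.

Lemma cpow_neq_0 (x : R) (z : C) : cpow_pos x z <> RtoC 0.
Proof.
  unfold cpow_pos, Cexp. generalize (Cmult z (RtoC (ln x))). intros w H.
  assert (H1 : exp (Re w) * cos (Im w) = 0) by exact (f_equal fst H).
  assert (H2 : exp (Re w) * sin (Im w) = 0) by exact (f_equal snd H).
  pose proof (exp_pos (Re w)). pose proof (sin2_cos2 (Im w)) as Q. unfold Rsqr in Q.
  apply Rmult_integral in H1. apply Rmult_integral in H2.
  destruct H1 as [H1|H1]; [lra|]. destruct H2 as [H2|H2]; [lra|].
  rewrite H1, H2 in Q. lra.
Qed.

(** The m-th quotients at z and z + 1 differ by the factor (1 + (z + 1) / m) / z. *)
Lemma rgamma_lim_shift (z l : C) : z <> RtoC 0 -> Clim (rgamma_term z) l ->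
  Clim (rgamma_term (Cplus z (RtoC 1))) (Cmult l (Cinv z)).
Proof.
  intros Hz H.
  assert (E : forall m, (1 <= m)%nat ->
     Cmult (rgamma_term z m) (Cmult (Cplus (RtoC 1) (Cmult (Cplus z (RtoC 1)) (RtoC (1 / INR m)))) (Cinv z)) = rgamma_term (Cplus z (RtoC 1)) m).
  { intros m Hm. assert (Hk : 0 < INR m) by (apply lt_0_INR; lia).
    unfold rgamma_term. rewrite cpow_shift by trivial.
    assert (P : Cpoch (Cplus z (RtoC 1)) m = Cmult (Cmult (Cpoch z m) (Cplus z (RtoC (INR (S m))))) (Cinv z)).
    { rewrite <- Cpoch_shift. field. exact Hz. }
    rewrite P, S_INR, RtoC_plus. replace (RtoC (1 / INR m)) with (Cinv (RtoC (INR m))).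
    2:{ rewrite <- RtoC_inv by lra. f_equal. field. lra. }
    assert (RtoC (INR m) <> 0). { intros Q. apply RtoC_inj in Q. lra. }
    assert (RtoC (INR (fact m)) <> 0). { intros Q. apply RtoC_inj in Q. pose proof (INR_fact_lt_0 m). lra. }
    pose proof (cpow_neq_0 (INR m) z). field. repeat split; assumption. }
  apply (Clim_ext_loc _ _ _ E). apply Clim_mult; trivial.
  assert (Inv : is_lim_seq (fun m => 1 / INR m) 0) by apply lim_seq_inv_INR.
  assert (Q : Clim (fun m => RtoC (1 / INR m)) (RtoC 0)).
  { split; simpl; trivial. apply is_lim_seq_const. }
  assert (X : Cmult (Cplus (RtoC 1) (Cmult (Cplus z (RtoC 1)) (RtoC 0))) (Cinv z) = Cinv z) by ring.
  refine (eq_ind _ (fun w => Clim _ w) _ _ X).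
  apply Clim_mult. 2: split; apply is_lim_seq_const.
  assert (Q2 : Clim (fun m => Cmult (Cplus z (RtoC 1)) (RtoC (1 / INR m))) (Cmult (Cplus z (RtoC 1)) (RtoC 0))).
  { apply Clim_mult; trivial. split; apply is_lim_seq_const. }
  destruct Q2 as [Q2 Q3]. split.
  - apply (is_lim_seq_plus' (fun _ => Re (RtoC 1)) _ _ _ (is_lim_seq_const _) Q2).
  - apply (is_lim_seq_plus' (fun _ => Im (RtoC 1)) _ _ _ (is_lim_seq_const _) Q3).
Qed.

Lemma rgamma_lim (mu : R) (k : nat) : 0 <= mu ->
  Clim (rgamma_term (INR k + 1, mu)) (rho_seq mu (rg_re mu) (rg_im mu) k).
Proof.
  intros Hmu. induction k as [|k IH].
  - simpl. rewrite Rplus_0_l. apply rgamma_lim_base; trivial.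
  - assert (Hk : 0 < INR k + 1) by (rewrite <- S_INR; apply lt_0_INR; lia).
    replace ((INR (S k) + 1, mu) : C) with (Cplus (INR k + 1, mu) (RtoC 1)).
    2:{ rewrite S_INR. unfold Cplus, RtoC. simpl. f_equal; ring. }
    replace (rho_seq mu (rg_re mu) (rg_im mu) (S k) : C) with (Cmult (rho_seq mu (rg_re mu) (rg_im mu) k) (Cinv (INR k + 1, mu))).
    apply rgamma_lim_shift; trivial. intros Q. injection Q. lra.
    cbn [rho_seq]. destruct (rho_seq mu (rg_re mu) (rg_im mu) k) as [u v]. rewrite S_INR.
    unfold Cmult, Cinv; simpl fst; simpl snd. f_equal; field; nra.
Qed.

Lemma rgamma_value (mu : R) (k : nat) : 0 <= mu ->
  rgamma (Cplus (0, mu) (RtoC (INR k + 1))) = rho_seq mu (rg_re mu) (rg_im mu) k.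
Proof.
  intros Hmu. replace (Cplus (0, mu) (RtoC (INR k + 1))) with ((INR k + 1, mu) : C).
  apply Clim_unique, rgamma_lim; trivial. unfold Cplus, RtoC; simpl. f_equal; ring.
Qed.

Definition bJ_p (mu : R) := bs_p mu (rg_re mu) (rg_im mu).
Definition bJ_q (mu : R) := bs_q mu (rg_re mu) (rg_im mu).

(** The power (x / 2)^(i mu) has modulus 1 and argument [mu * ln (x / 2)], and the reciprocal Gamma
    values are supplied by [rho_seq]. *)
Lemma besselJ_value (mu x : R) : 0 <= mu ->
  besselJ (0, mu) x = Cmult (cos (mu * ln (x / 2)), sin (mu * ln (x / 2))) (bJ_p mu ((x / 2) ^ 2), bJ_q mu ((x / 2) ^ 2)).
Proof.
  intros Hmu. unfold besselJ. f_equal.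
  - unfold cpow_pos, Cexp. replace (Re (Cmult (0, mu) (RtoC (ln (x / 2))))) with 0 by (simpl; ring).
    replace (Im (Cmult (0, mu) (RtoC (ln (x / 2))))) with (mu * ln (x / 2)) by (simpl; ring). rewrite exp_0, !Rmult_1_l. reflexivity.
  - unfold CSeries, bJ_p, bJ_q, bs_p, bs_q, PSeries. f_equal; apply Series_ext; intros k; rewrite rgamma_value by trivial.
    + unfold re_coef. rewrite pow_mult. destruct (rho_seq _ _ _ k) as [u v]. simpl. unfold Rdiv. ring.
    + unfold im_coef. rewrite pow_mult. destruct (rho_seq _ _ _ k) as [u v]. simpl. unfold Rdiv. ring.
Qed.

Lemma Cpoch_conj (z : C) (m : nat) : Cpoch (Cconj z) m = Cconj (Cpoch z m).
Proof.
  induction m as [|m IH]. reflexivity. cbn [Cpoch]. rewrite IH, Cmult_conj, Cplus_conj. do 2 f_equal.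
  unfold Cconj, RtoC; simpl. f_equal; ring.
Qed.

Lemma cpow_conj (x : R) (z : C) : cpow_pos x (Cconj z) = Cconj (cpow_pos x z).
Proof.
  unfold cpow_pos, Cexp. replace (Re (Cmult (Cconj z) (RtoC (ln x)))) with (Re (Cmult z (RtoC (ln x)))) by (simpl; ring).
  replace (Im (Cmult (Cconj z) (RtoC (ln x)))) with (- Im (Cmult z (RtoC (ln x)))) by (simpl; ring).
  rewrite cos_neg, sin_neg. unfold Cconj; simpl. f_equal; ring.
Qed.

Lemma rgamma_term_conj (z : C) (m : nat) : (1 <= m)%nat -> rgamma_term (Cconj z) m = Cconj (rgamma_term z m).
Proof.
  intros _. unfold rgamma_term. rewrite Cpoch_conj, cpow_conj, Cmult_conj. f_equal.
  set (w := cpow_pos (INR m) z).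
  replace (Cmult (RtoC (INR (fact m))) (Cconj w)) with (Cconj (Cmult (RtoC (INR (fact m))) w)).
  - generalize (Cmult (RtoC (INR (fact m))) w). intros [u v]. unfold Cinv, Cconj; simpl fst; simpl snd.
    apply injective_projections; simpl;
    replace (u * (u * 1) + - v * (- v * 1)) with (u * (u * 1) + v * (v * 1)) by ring; unfold Rdiv; ring.
  - rewrite Cmult_conj. f_equal. apply injective_projections; simpl; ring.
Qed.

(** The limits above concern [mu >= 0], so the order - i mu is reached by conjugation. [Lim_seq_opp]
    is unconditional, so the identity covers the totalised limits as well. *)
Lemma rgamma_conj (z : C) : rgamma (Cconj z) = Cconj (rgamma z).
Proof.
  unfold rgamma. change (CLim_seq (rgamma_term (Cconj z)) = Cconj (CLim_seq (rgamma_term z))).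
  apply injective_projections; unfold CLim_seq; cbn [fst snd Cconj].
  - f_equal. apply Lim_seq_ext_loc. exists 1%nat. intros n Hn. rewrite rgamma_term_conj by trivial. reflexivity.
  - rewrite (Lim_seq_ext_loc _ (fun n => - Im (rgamma_term z n))). rewrite Lim_seq_opp. destruct (Lim_seq _); simpl; ring.
    exists 1%nat. intros n Hn. rewrite rgamma_term_conj by trivial. reflexivity.
Qed.

Lemma besselJ_conj (nu : C) (x : R) : besselJ (Cconj nu) x = Cconj (besselJ nu x).
Proof.
  unfold besselJ. rewrite cpow_conj, Cmult_conj. f_equal.
  assert (E : forall k, rgamma (Cplus (Cconj nu) (RtoC (INR k + 1))) = Cconj (rgamma (Cplus nu (RtoC (INR k + 1))))).
  { intros k. rewrite <- rgamma_conj. f_equal. unfold Cplus, Cconj, RtoC; simpl. f_equal; ring. }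
  apply injective_projections; unfold CSeries; cbn [fst snd Cconj].
  - apply Series_ext. intros k. rewrite E. simpl. ring.
  - rewrite <- Series_opp. apply Series_ext. intros k. rewrite E. simpl. ring.
Qed.

Lemma rg_0 : rg_re 0 = 1 /\ rg_im 0 = 0.
Proof.
  unfold rg_re, rg_im. replace (2 * 0) with 0 by ring. rewrite sech_int_0_1, Rinv_1, sqrt_1.
  assert (E : gamma_phase 0 = 0).
  { unfold gamma_phase. rewrite (Lim_seq_ext _ (fun _ => 0)). rewrite Lim_seq_const. reflexivity.
    intros n. rewrite phase_sum_0. ring. }
  rewrite E, cos_0, sin_0. split; ring.
Qed.

Lemma im_coef_0 (k : nat) : im_coef 0 1 0 k = 0.
Proof. unfold im_coef. rewrite rho_seq_0. simpl. ring. Qed.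

(** The initial values 1 and 0 are the two components of 1 / Gamma (1), as [rg_0] confirms. *)
Definition J0 (x : R) : R := bs_p 0 1 0 ((x / 2) ^ 2).

Lemma besselJ_0 (x : R) : besselJ (RtoC 0) x = RtoC (J0 x).
Proof.
  change (besselJ (0, 0) x = RtoC (J0 x)). rewrite besselJ_value by lra.
  unfold bJ_p, bJ_q. destruct rg_0 as [-> ->].
  replace (bs_q 0 1 0 ((x / 2) ^ 2)) with 0.
  rewrite Rmult_0_l, cos_0, sin_0. unfold J0, Cmult, RtoC; simpl. f_equal; ring.
  unfold bs_q. rewrite (PSeries_ext _ (fun _ => 0)). rewrite PSeries_const_0. reflexivity. apply im_coef_0.
Qed.

(** * A third-order equation with a unique solution of given behaviour at 0 *)

(** The functions compared oscillate in [ln x] and have no limit at 0, so only the difference from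
    an explicit model is required to vanish. Products then need bounded models, whence
    [bounded_pos]. *)
Definition asymp (f F : R -> R) : Prop := filterlim (fun x => f x - F x) (at_right 0) (locally 0).
Definition bounded_pos (F : R -> R) : Prop := exists K, forall x, 0 < x -> Rabs (F x) <= K.

Lemma asymp_plus (f F g G : R -> R) : asymp f F -> asymp g G -> asymp (fun x => f x + g x) (fun x => F x + G x).
Proof.
  intros H1 H2. unfold asymp in *. apply (filterlim_ext (fun x => (f x - F x) + (g x - G x))). intros; ring.
  rewrite <- (Rplus_0_r 0) at 2. apply lim_plus; trivial. apply within_filter, locally_filter.
Qed.

Lemma asymp_scal (c : R) (f F : R -> R) : asymp f F -> asymp (fun x => c * f x) (fun x => c * F x).
Proof.
  intros H1. unfold asymp in *. apply (filterlim_ext (fun x => c * (f x - F x))). intros; ring.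
  apply lim_scal0; trivial. apply within_filter, locally_filter.
Qed.

Lemma asymp_minus (f F g G : R -> R) : asymp f F -> asymp g G -> asymp (fun x => f x - g x) (fun x => F x - G x).
Proof.
  intros H1 H2. unfold asymp in *. apply (filterlim_ext (fun x => (f x - F x) - (g x - G x))). intros; ring.
  rewrite <- (Rminus_0_r 0) at 2. apply lim_minus; trivial. apply within_filter, locally_filter.
Qed.

Lemma asymp_mult (f F g G : R -> R) : bounded_pos F -> bounded_pos G -> asymp f F -> asymp g G ->
  asymp (fun x => f x * g x) (fun x => F x * G x).
Proof.
  intros [K HK] [L HL] H1 H2. unfold asymp in *.
  apply (lim_at_squeeze _ _ (fun x => Rabs (f x - F x) * Rabs (g x - G x) + (K * Rabs (g x - G x) + L * Rabs (f x - F x)))).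
  - generalize at_right0_pos. apply filter_imp. intros x Hx. rewrite Rminus_0_r. specialize (HK x Hx). specialize (HL x Hx).
    replace (f x * g x - F x * G x) with ((f x - F x) * (g x - G x) + (F x * (g x - G x) + G x * (f x - F x))) by ring.
    eapply Rle_trans. apply Rabs_triang. rewrite Rabs_mult. apply Rplus_le_compat_l.
    eapply Rle_trans. apply Rabs_triang. rewrite !Rabs_mult.
    apply Rplus_le_compat; apply Rmult_le_compat_r; trivial; apply Rabs_pos.
  - assert (F0 : Filter (at_right 0)) by (apply within_filter, locally_filter).
    assert (A : filterlim (fun x => Rabs (f x - F x)) (at_right 0) (locally 0)).
    { apply lim_abs0; trivial. }
    assert (B : filterlim (fun x => Rabs (g x - G x)) (at_right 0) (locally 0)).
    { apply lim_abs0; trivial. }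
    pose proof (lim_plus _ _ _ _ _ (lim_mult _ _ _ _ _ A B) (lim_plus _ _ _ _ _ (lim_scal0 _ K _ B) (lim_scal0 _ L _ A))) as Q.
    replace (0 * 0 + (0 + 0)) with 0 in Q by ring. exact Q.
Qed.

Lemma asymp_refl (F : R -> R) : asymp F F.
Proof. unfold asymp. apply (filterlim_ext (fun _ => 0)). intros; ring. apply filterlim_const. Qed.

Lemma asymp_lim (f : R -> R) (l : R) : filterlim f (at_right 0) (locally l) -> asymp f (fun _ => l).
Proof.
  intros H. unfold asymp. rewrite <- (Rminus_diag l) at 2. apply lim_minus; trivial. apply within_filter, locally_filter. apply filterlim_const.
Qed.

Lemma asymp_ext (f F g G : R -> R) : (forall x, 0 < x -> f x = g x) -> (forall x, 0 < x -> F x = G x) -> asymp f F -> asymp g G.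
Proof.
  intros H1 H2. unfold asymp. apply filterlim_ext_loc. generalize at_right0_pos. apply filter_imp.
  intros x Hx. rewrite H1, H2; trivial.
Qed.

Lemma bounded_pos_plus F G : bounded_pos F -> bounded_pos G -> bounded_pos (fun x => F x + G x).
Proof.
  intros [K HK] [L HL]. exists (K + L). intros x Hx. eapply Rle_trans. apply Rabs_triang.
  specialize (HK x Hx). specialize (HL x Hx). lra.
Qed.
Lemma bounded_pos_mult F G : bounded_pos F -> bounded_pos G -> bounded_pos (fun x => F x * G x).
Proof.
  intros [K HK] [L HL]. exists (K * L). intros x Hx. rewrite Rabs_mult.
  apply Rmult_le_compat; try apply Rabs_pos; auto.
Qed.
Lemma bounded_pos_const c : bounded_pos (fun _ => c).
Proof. exists (Rabs c). intros; lra. Qed.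
Lemma bounded_pos_cos h : bounded_pos (fun x => cos (h x)).
Proof. exists 1. intros; apply Rabs_le, COS_bound. Qed.
Lemma bounded_pos_sin h : bounded_pos (fun x => sin (h x)).
Proof. exists 1. intros; apply Rabs_le, SIN_bound. Qed.

(* An Appell-type third order system; the energy below is asymptotically conserved at 0. *)
Lemma appell_unique (n : R) (D D1 D2 : R -> R) : 0 < n ->
  (forall x, 0 < x -> is_derive D x (D1 x / x)) ->
  (forall x, 0 < x -> is_derive D1 x (D2 x / x)) ->
  (forall x, 0 < x -> is_derive D2 x ((- n ^ 2 * D1 x - 4 * x ^ 2 * (D1 x + D x)) / x)) ->
  asymp (fun x => n ^ 2 * D x + D2 x) (fun _ => 0) -> asymp D1 (fun _ => 0) -> asymp D2 (fun _ => 0) ->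
  forall x, 0 < x -> D x = 0.
Proof.
  intros Hn H0 H1 H2 L0 L1 L2.
  set (A := fun x => n ^ 2 * D x + D2 x).
  (* With theta = x d/dx one has theta A = -4 x^2 (D1 + D), and the cross terms [n ^ 2 * D1 * D2]
     cancel; theta E is therefore of order [x ^ 2], which survives division by [x]. *)
  set (E := fun x => D2 x ^ 2 + n ^ 2 * D1 x ^ 2 + A x ^ 2).
  set (K := 1 + 3 / n ^ 2). assert (Hn2 : 0 < n ^ 2) by nra.
  assert (HK : 0 < / n ^ 2) by (apply Rinv_0_lt_compat; trivial).
  (* Gronwall's factor: [K] is such that [-(D2 + A)(D1 + D) <= K * E], so [g] is nonincreasing. Its
     limit at 0 is 0 and [E] is a sum of squares, so [E] vanishes. *)
  set (g := fun x => E x * exp (- (4 * K * x ^ 2))).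
  assert (dE : forall x, 0 < x -> is_derive E x (- 8 * x * ((D2 x + A x) * (D1 x + D x)))).
  { intros x Hx. specialize (H0 x Hx). specialize (H1 x Hx). specialize (H2 x Hx). unfold E, A.
    auto_derive. repeat split; first [exact (ex_intro _ _ H0)|exact (ex_intro _ _ H1)|exact (ex_intro _ _ H2)].
    drw H0. drw H1. drw H2. field. lra. }
  assert (bE : forall x, - ((D2 x + A x) * (D1 x + D x)) <= K * E x).
  { intros x. assert (HD : D x = (A x - D2 x) * / n ^ 2) by (unfold A; field; lra). rewrite HD.
    unfold E, K, Rdiv. set (y := D2 x). set (v := D1 x). set (a := A x). set (i := / n ^ 2) in *.
    assert (Hi : n ^ 2 * i = 1) by (unfold i; field; lra).
    clearbody y v a i.
    assert (T1 : - (y + a) * v <= (y ^ 2 + a ^ 2) + v ^ 2).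
    { pose proof (pow2_ge_0 (y + a + v)). pose proof (pow2_ge_0 (y - a)). pose proof (pow2_ge_0 v). simpl in *. lra. }
    assert (T2 : - (y + a) * ((a - y) * i) <= i * (y ^ 2 + a ^ 2)).
    { assert (0 <= i * a ^ 2) by (apply Rmult_le_pos; [lra|apply pow2_ge_0]). simpl in *. lra. }
    assert (T3 : v ^ 2 <= i * (n ^ 2 * v ^ 2)). { rewrite <- Rmult_assoc, (Rmult_comm i), Hi. lra. }
    assert (0 <= i * (y ^ 2 + a ^ 2)) by nra. assert (0 <= n ^ 2 * v ^ 2) by nra.
    assert (0 <= i * (n ^ 2 * v ^ 2)) by nra. assert (0 <= y ^ 2 + a ^ 2) by nra.
    replace (- ((y + a) * (v + (a - y) * i))) with (- (y + a) * v + - (y + a) * ((a - y) * i)) by ring.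
    replace ((1 + 3 * i) * (y ^ 2 + n ^ 2 * v ^ 2 + a ^ 2)) with
      ((y ^ 2 + a ^ 2) + 3 * (i * (y ^ 2 + a ^ 2)) + n ^ 2 * v ^ 2 + 3 * (i * (n ^ 2 * v ^ 2))) by ring.
    lra. }
  assert (dg : forall x, 0 < x -> is_derive g x ((- 8 * x * ((D2 x + A x) * (D1 x + D x)) - 8 * K * x * E x) * exp (- (4 * K * x ^ 2)))).
  { intros x Hx. specialize (dE x Hx). unfold g. auto_derive. exact (ex_intro _ _ dE). drw dE. simpl. ring. }
  assert (mono : forall x y, 0 < x -> x < y -> g y <= g x).
  { intros x y Hx Hy. destruct (MVT_gen g x y (fun x => (- 8 * x * ((D2 x + A x) * (D1 x + D x)) - 8 * K * x * E x) * exp (- (4 * K * x ^ 2)))) as [c [Hc Ec]].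
    - intros z Hz. rewrite Rmin_left in Hz by lra. apply dg. lra.
    - intros z Hz. rewrite Rmin_left in Hz by lra. apply continuity_pt_filterlim. eapply is_derive_continuous, dg. lra.
    - rewrite Rmin_left, Rmax_right in Hc by lra.
      assert ((- 8 * c * ((D2 c + A c) * (D1 c + D c)) - 8 * K * c * E c) * exp (- (4 * K * c ^ 2)) <= 0).
      { specialize (bE c). pose proof (exp_pos (- (4 * K * c ^ 2))).
        assert (- 8 * c * ((D2 c + A c) * (D1 c + D c)) - 8 * K * c * E c <= 0) by nra. nra. }
      nra. }
  assert (LE : filterlim E (at_right 0) (locally 0)).
  { assert (F0 : Filter (at_right 0)) by (apply within_filter, locally_filter).
    assert (C0 : bounded_pos (fun _ => 0)) by apply bounded_pos_const.
    assert (S2 : asymp (fun x => D2 x * D2 x) (fun x => 0 * 0)) by (apply (asymp_mult D2 (fun _ => 0) D2 (fun _ => 0)); trivial).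
    assert (S1 : asymp (fun x => D1 x * D1 x) (fun x => 0 * 0)) by (apply (asymp_mult D1 (fun _ => 0) D1 (fun _ => 0)); trivial).
    assert (S0 : asymp (fun x => A x * A x) (fun x => 0 * 0)) by (apply (asymp_mult A (fun _ => 0) A (fun _ => 0)); trivial).
    pose proof (asymp_plus _ _ _ _ (asymp_plus _ _ _ _ S2 (asymp_scal (n ^ 2) _ _ S1)) S0) as Q. unfold asymp in Q.
    revert Q. apply filterlim_ext. intros x. unfold E. ring. }
  assert (Lg : filterlim g (at_right 0) (locally 0)).
  { assert (F0 : Filter (at_right 0)) by (apply within_filter, locally_filter).
    unfold g. replace 0 with (0 * exp (- (4 * K * 0 ^ 2))) at 2 by ring. apply lim_mult; trivial.
    apply (continuous_at_right (fun x => exp (- (4 * K * x ^ 2)))).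
    apply (ex_derive_continuous (fun x => exp (- (4 * K * x ^ 2)))). auto_derive. trivial. }
  intros x Hx.
  assert (Hg : g x <= 0).
  { apply (filterlim_le (F := at_right 0) (fun _ => g x) g (g x) 0).
    - generalize (at_right0_lt x Hx). apply filter_imp. intros y Hy. apply mono; lra.
    - apply filterlim_const.
    - exact Lg. }
  assert (HE : E x <= 0).
  { unfold g in Hg. pose proof (exp_pos (- (4 * K * x ^ 2))). nra. }
  unfold E in HE. assert (HA : A x ^ 2 <= 0) by nra. assert (HD2 : D2 x ^ 2 <= 0) by nra.
  assert (A x = 0) by nra. assert (D2 x = 0) by nra. unfold A in *. nra.
Qed.

Section SquareModulus.
Variable mu : R.
Hypothesis Hmu : 0 < mu.
Let p := bJ_p mu.
Let q := bJ_q mu.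
Let p1 := bs_p1 mu (rg_re mu) (rg_im mu).
Let q1 := bs_q1 mu (rg_re mu) (rg_im mu).
Let y (x : R) := (x / 2) ^ 2.
Let tau (x : R) := mu * ln (x / 2).

(** Real part of J_(i mu)(x); [Ja2] is the imaginary part, and [Jb1], [Jb2] are x d/dx of the
    two. *)
Definition Ja1 (x : R) := cos (tau x) * p (y x) - sin (tau x) * q (y x).
Definition Ja2 (x : R) := cos (tau x) * q (y x) + sin (tau x) * p (y x).
Definition Jb1 (x : R) := - mu * Ja2 x + (cos (tau x) * (2 * (y x * p1 (y x))) - sin (tau x) * (2 * (y x * q1 (y x)))).
Definition Jb2 (x : R) := mu * Ja1 x + (cos (tau x) * (2 * (y x * q1 (y x))) + sin (tau x) * (2 * (y x * p1 (y x)))).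

Let r (z : R) := z * p1 z + (- mu) * q z.
Let s (z : R) := z * q1 z + mu * p z.

Lemma is_derive_y (x : R) : is_derive y x (x / 2).
Proof. unfold y. auto_derive; trivial. simpl. field. Qed.

Lemma is_derive_tau (x : R) : 0 < x -> is_derive tau x (mu / x).
Proof. intros Hx. unfold tau. auto_derive. lra. field. lra. Qed.

Lemma is_derive_Ja1 (x : R) : 0 < x -> is_derive Ja1 x (Jb1 x / x).
Proof.
  intros Hx. pose proof (is_derive_y x) as Hy. pose proof (is_derive_tau x Hx) as Ht.
  pose proof (is_derive_bs_p mu (rg_re mu) (rg_im mu) (y x)) as Hp. pose proof (is_derive_bs_q mu (rg_re mu) (rg_im mu) (y x)) as Hq.
  change (is_derive p (y x) (p1 (y x))) in Hp. change (is_derive q (y x) (q1 (y x))) in Hq.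
  assert (Ey : y x = x * x / 4) by (unfold y; simpl; field).
  unfold Jb1, Ja2. rewrite Ey. unfold Ja1. rewrite <- Ey. clearbody y tau p q p1 q1.
  auto_derive. repeat split; first [exact (ex_intro _ _ Hy)|exact (ex_intro _ _ Ht)|exact (ex_intro _ _ Hp)|exact (ex_intro _ _ Hq)].
  drw Hy. drw Ht. drw Hp. drw Hq. rewrite !Ey. field. lra.
Qed.

Lemma is_derive_Ja2 (x : R) : 0 < x -> is_derive Ja2 x (Jb2 x / x).
Proof.
  intros Hx. pose proof (is_derive_y x) as Hy. pose proof (is_derive_tau x Hx) as Ht.
  pose proof (is_derive_bs_p mu (rg_re mu) (rg_im mu) (y x)) as Hp. pose proof (is_derive_bs_q mu (rg_re mu) (rg_im mu) (y x)) as Hq.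
  change (is_derive p (y x) (p1 (y x))) in Hp. change (is_derive q (y x) (q1 (y x))) in Hq.
  assert (Ey : y x = x * x / 4) by (unfold y; simpl; field).
  unfold Jb2, Ja1. rewrite Ey. unfold Ja2. rewrite <- Ey. clearbody y tau p q p1 q1.
  auto_derive. repeat split; first [exact (ex_intro _ _ Hy)|exact (ex_intro _ _ Ht)|exact (ex_intro _ _ Hp)|exact (ex_intro _ _ Hq)].
  drw Hy. drw Ht. drw Hp. drw Hq. rewrite !Ey. field. lra.
Qed.

(** Rewriting through [r] and [s] lets the next differentiation use the first-order system instead
    of second derivatives of the series. *)
Lemma Jb_rs (x : R) :
  Jb1 x = cos (tau x) * (2 * r (y x) + mu * q (y x)) - sin (tau x) * (2 * s (y x) - mu * p (y x)) /\
  Jb2 x = cos (tau x) * (2 * s (y x) - mu * p (y x)) + sin (tau x) * (2 * r (y x) + mu * q (y x)).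
Proof. unfold Jb1, Jb2, Ja1, Ja2, r, s. split; ring. Qed.

(** Bessel's equation in the form theta^2 J = -(x^2 + mu^2) J, the square of the order being
    -mu^2. *)
Lemma is_derive_Jb (x : R) : 0 < x ->
  is_derive Jb1 x (- (x ^ 2 + mu ^ 2) * Ja1 x / x) /\ is_derive Jb2 x (- (x ^ 2 + mu ^ 2) * Ja2 x / x).
Proof.
  intros Hx. pose proof (is_derive_y x) as Hy. pose proof (is_derive_tau x Hx) as Ht.
  pose proof (is_derive_bs_p mu (rg_re mu) (rg_im mu) (y x)) as Hp. pose proof (is_derive_bs_q mu (rg_re mu) (rg_im mu) (y x)) as Hq.
  change (is_derive p (y x) (p1 (y x))) in Hp. change (is_derive q (y x) (q1 (y x))) in Hq.
  pose proof (is_derive_bs_r mu (rg_re mu) (rg_im mu) (y x)) as Hr. pose proof (is_derive_bs_s mu (rg_re mu) (rg_im mu) (y x)) as Hs.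
  change (is_derive r (y x) (- p (y x))) in Hr. change (is_derive s (y x) (- q (y x))) in Hs.
  assert (Er : y x * p1 (y x) = r (y x) + mu * q (y x)) by (unfold r; ring).
  assert (Es : y x * q1 (y x) = s (y x) - mu * p (y x)) by (unfold s; ring).
  assert (Ey : y x = x * x / 4) by (unfold y; simpl; field).
  split.
  - apply (is_derive_ext (fun x => cos (tau x) * (2 * r (y x) + mu * q (y x)) - sin (tau x) * (2 * s (y x) - mu * p (y x)))).
    intros t; symmetry; apply Jb_rs.
    unfold Ja1. clearbody y tau p q p1 q1 r s.
    auto_derive. repeat split; first [exact (ex_intro _ _ Hy)|exact (ex_intro _ _ Ht)|exact (ex_intro _ _ Hp)|exact (ex_intro _ _ Hq)|exact (ex_intro _ _ Hr)|exact (ex_intro _ _ Hs)].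
    drw Hy. drw Ht. drw Hp. drw Hq. drw Hr. drw Hs.
    set (Y := y x) in *. assert (HY : 0 < Y) by nra.
    assert (Er' : p1 Y = 4 * (r Y + mu * q Y) / (x * x)) by (replace (x * x) with (4 * Y) by lra; rewrite <- Er; field; lra).
    assert (Es' : q1 Y = 4 * (s Y - mu * p Y) / (x * x)) by (replace (x * x) with (4 * Y) by lra; rewrite <- Es; field; lra).
    rewrite Er', Es'. field. lra.
  - apply (is_derive_ext (fun x => cos (tau x) * (2 * s (y x) - mu * p (y x)) + sin (tau x) * (2 * r (y x) + mu * q (y x)))).
    intros t; symmetry; apply Jb_rs.
    unfold Ja2. clearbody y tau p q p1 q1 r s.
    auto_derive. repeat split; first [exact (ex_intro _ _ Hy)|exact (ex_intro _ _ Ht)|exact (ex_intro _ _ Hp)|exact (ex_intro _ _ Hq)|exact (ex_intro _ _ Hr)|exact (ex_intro _ _ Hs)].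
    drw Hy. drw Ht. drw Hp. drw Hq. drw Hr. drw Hs.
    set (Y := y x) in *. assert (HY : 0 < Y) by nra.
    assert (Er' : p1 Y = 4 * (r Y + mu * q Y) / (x * x)) by (replace (x * x) with (4 * Y) by lra; rewrite <- Er; field; lra).
    assert (Es' : q1 Y = 4 * (s Y - mu * p Y) / (x * x)) by (replace (x * x) with (4 * Y) by lra; rewrite <- Es; field; lra).
    rewrite Er', Es'. field. lra.
Qed.
End SquareModulus.

(** * The function J^2 + Y^2 *)

(** With c = cosh (PI mu) and s = sinh (PI mu), (Re J)^2 enters J^2 + Y^2 with the coefficient
    [1 - (c - 1)^2 / s^2] and (Im J)^2 with [(c + 1)^2 / s^2 - 1]; both simplify by
    [s^2 = c^2 - 1]. *)
Definition sq_c1 (mu : R) : R := 2 * (cosh (PI * mu) - 1) / sinh (PI * mu) ^ 2.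
Definition sq_c2 (mu : R) : R := 2 * (cosh (PI * mu) + 1) / sinh (PI * mu) ^ 2.
Definition Hsq (mu x : R) : R := sq_c1 mu * Ja1 mu x ^ 2 + sq_c2 mu * Ja2 mu x ^ 2.
(** [Hsq1] and [Hsq2] are x d/dx applied once and twice to [Hsq], with Bessel's equation already
    inserted in the second. *)
Definition Hsq1 (mu x : R) : R := 2 * (sq_c1 mu * (Ja1 mu x * Jb1 mu x) + sq_c2 mu * (Ja2 mu x * Jb2 mu x)).
Definition Hsq2 (mu x : R) : R :=
  2 * (sq_c1 mu * Jb1 mu x ^ 2 + sq_c2 mu * Jb2 mu x ^ 2) - 2 * (x ^ 2 + mu ^ 2) * Hsq mu x.

(** J_(-i mu) is the conjugate of J_(i mu) = a1 + i a2, and sin (i mu PI) = i s; hence Y = ((c + 1)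
    a2 - i (c - 1) a1) / s, and the imaginary parts of J^2 and Y^2 cancel by [c^2 - s^2 = 1]. *)
Lemma besselJY_square (mu x : R) : 0 < mu ->
  Cplus (Cmult (besselJ (0, mu) x) (besselJ (0, mu) x)) (Cmult (besselY (0, mu) x) (besselY (0, mu) x)) = RtoC (Hsq mu x).
Proof.
  intros Hmu.
  assert (EJ : besselJ (0, mu) x = (Ja1 mu x, Ja2 mu x)).
  { rewrite besselJ_value by lra. unfold Ja1, Ja2, Cmult; simpl fst; simpl snd. apply injective_projections; simpl; ring. }
  assert (EJ' : besselJ (Copp (0, mu)) x = (Ja1 mu x, - Ja2 mu x)).
  { replace (Copp (0, mu)) with (Cconj (0, mu)) by (apply injective_projections; simpl; ring).
    rewrite besselJ_conj, EJ. reflexivity. }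
  unfold besselY. rewrite EJ, EJ'.
  set (a1 := Ja1 mu x). set (a2 := Ja2 mu x).
  pose proof (sinh_pos (PI * mu) ltac:(apply Rmult_lt_0_compat; [apply PI_RGT_0|trivial])) as Hs.
  replace (Ccos (Cmult (0, mu) (RtoC PI))) with (RtoC (cosh (PI * mu))).
  2:{ unfold Ccos. replace (Re (Cmult (0, mu) (RtoC PI))) with 0 by (simpl; ring).
      replace (Im (Cmult (0, mu) (RtoC PI))) with (PI * mu) by (simpl; ring). rewrite cos_0, sin_0. apply injective_projections; simpl; ring. }
  replace (Csin (Cmult (0, mu) (RtoC PI))) with ((0, sinh (PI * mu)) : C).
  2:{ unfold Csin. replace (Re (Cmult (0, mu) (RtoC PI))) with 0 by (simpl; ring).
      replace (Im (Cmult (0, mu) (RtoC PI))) with (PI * mu) by (simpl; ring). rewrite cos_0, sin_0. apply injective_projections; simpl; ring. }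
  unfold Hsq, sq_c1, sq_c2. fold a1 a2.
  pose proof (cosh_sinh_sqr (PI * mu)) as Q. set (c := cosh (PI * mu)) in *. set (s := sinh (PI * mu)) in *. clearbody a1 a2 c s.
  assert (EY : Cdiv (Cminus (Cmult (a1, a2) (RtoC c)) (a1, - a2)) (0, s) = (a2 * (c + 1) / s, - (a1 * (c - 1)) / s)).
  { unfold Cdiv, Cinv. simpl fst. simpl snd. apply injective_projections; simpl; field; lra. }
  rewrite EY. apply injective_projections; simpl.
  - apply (Rmult_eq_reg_r (s * s)); [|nra]. field_simplify; try lra.
    replace (s ^ 2) with (c ^ 2 - 1) by lra. ring.
  - apply (Rmult_eq_reg_r (s * s)); [|nra]. field_simplify; try lra.
    replace (s ^ 2) with (c ^ 2 - 1) by lra. ring.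
Qed.

Section SquareODE.
Variable mu : R.
Hypothesis Hmu : 0 < mu.

Lemma is_derive_Hsq (x : R) : 0 < x -> is_derive (Hsq mu) x (Hsq1 mu x / x).
Proof.
  intros Hx. pose proof (is_derive_Ja1 mu x Hx) as H1. pose proof (is_derive_Ja2 mu x Hx) as H2.
  unfold Hsq, Hsq1. auto_derive. repeat split; first [exact (ex_intro _ _ H1)|exact (ex_intro _ _ H2)].
  drw H1. drw H2. field. lra.
Qed.

Lemma is_derive_Hsq1 (x : R) : 0 < x -> is_derive (Hsq1 mu) x (Hsq2 mu x / x).
Proof.
  intros Hx. pose proof (is_derive_Ja1 mu x Hx) as H1. pose proof (is_derive_Ja2 mu x Hx) as H2.
  destruct (is_derive_Jb mu x Hx) as [H3 H4].
  unfold Hsq2, Hsq1, Hsq. auto_derive. repeat split; first [exact (ex_intro _ _ H1)|exact (ex_intro _ _ H2)|exact (ex_intro _ _ H3)|exact (ex_intro _ _ H4)].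
  drw H1. drw H2. drw H3. drw H4. field. lra.
Qed.

Lemma is_derive_Hsq2 (x : R) : 0 < x ->
  is_derive (Hsq2 mu) x ((- (2 * mu) ^ 2 * Hsq1 mu x - 4 * x ^ 2 * (Hsq1 mu x + Hsq mu x)) / x).
Proof.
  intros Hx. pose proof (is_derive_Hsq x Hx) as H1.
  destruct (is_derive_Jb mu x Hx) as [H3 H4].
  unfold Hsq2. auto_derive. repeat split; first [exact (ex_intro _ _ H1)|exact (ex_intro _ _ H3)|exact (ex_intro _ _ H4)].
  drw H1. drw H3. drw H4. unfold Hsq1, Hsq. field. lra.
Qed.

Let S2 := sech_int (2 * mu) 1.
Let Rt := sqrt (/ S2).
(** The argument of (x / 2)^(i mu) / Gamma (1 + i mu), the leading term of J_(i mu) at 0. *)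
Definition phs (x : R) : R := mu * ln (x / 2) + gamma_phase mu.

Lemma lim_half_sq (f : R -> R) (l : R) : continuous f 0 -> f 0 = l -> filterlim (fun x => f ((x / 2) ^ 2)) (at_right 0) (locally l).
Proof.
  intros Hf <-. apply (lim_continuous _ (fun x => (x / 2) ^ 2) f 0); trivial.
  replace 0 with ((0 / 2) ^ 2) at 2 by field.
  apply (continuous_at_right (fun x => (x / 2) ^ 2)). apply (ex_derive_continuous (fun x => (x / 2) ^ 2)). auto_derive. trivial.
Qed.

Lemma asymp_Ja : asymp (Ja1 mu) (fun x => Rt * cos (phs x)) /\ asymp (Ja2 mu) (fun x => Rt * sin (phs x)) /\
  asymp (Jb1 mu) (fun x => - mu * (Rt * sin (phs x))) /\ asymp (Jb2 mu) (fun x => mu * (Rt * cos (phs x))).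
Proof.
  assert (P0 : asymp (fun x => bJ_p mu ((x / 2) ^ 2)) (fun _ => rg_re mu)).
  { apply asymp_lim. apply (lim_half_sq (bJ_p mu)). eapply is_derive_continuous, is_derive_bs_p.
    unfold bJ_p, bs_p. rewrite PSeries_0. unfold re_coef; simpl. field. }
  assert (Q0 : asymp (fun x => bJ_q mu ((x / 2) ^ 2)) (fun _ => rg_im mu)).
  { apply asymp_lim. apply (lim_half_sq (bJ_q mu)). eapply is_derive_continuous, is_derive_bs_q.
    unfold bJ_q, bs_q. rewrite PSeries_0. unfold im_coef; simpl. field. }
  assert (CP : forall (c : nat -> R), CV_radius c = p_infty -> continuous (fun z => z * PSeries (PS_derive c) z) 0).
  { intros c Hc. apply (continuous_mult (fun z : R => z) (PSeries (PS_derive c)) 0). apply continuous_id.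
    eapply is_derive_continuous. apply entire_derive. rewrite CV_radius_derive. trivial. }
  assert (P1 : asymp (fun x => 2 * ((x / 2) ^ 2 * bs_p1 mu (rg_re mu) (rg_im mu) ((x / 2) ^ 2))) (fun _ => 0)).
  { replace (fun _ : R => 0) with (fun _ : R => 2 * 0). 2: apply FunctionalExtensionality.functional_extensionality; intros; ring.
    apply asymp_scal. apply asymp_lim. apply (lim_half_sq (fun z => z * bs_p1 mu (rg_re mu) (rg_im mu) z)). apply CP, CV_re. ring. }
  assert (Q1 : asymp (fun x => 2 * ((x / 2) ^ 2 * bs_q1 mu (rg_re mu) (rg_im mu) ((x / 2) ^ 2))) (fun _ => 0)).
  { replace (fun _ : R => 0) with (fun _ : R => 2 * 0). 2: apply FunctionalExtensionality.functional_extensionality; intros; ring.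
    apply asymp_scal. apply asymp_lim. apply (lim_half_sq (fun z => z * bs_q1 mu (rg_re mu) (rg_im mu) z)). apply CP, CV_im. ring. }
  set (tau := fun x => mu * ln (x / 2)).
  assert (BC : bounded_pos (fun x => cos (tau x))) by apply bounded_pos_cos.
  assert (BS : bounded_pos (fun x => sin (tau x))) by apply bounded_pos_sin.
  pose proof (asymp_refl (fun x => cos (tau x))) as RC. pose proof (asymp_refl (fun x => sin (tau x))) as RS.
  assert (CC : forall f c, asymp f (fun _ => c) -> asymp (fun x => cos (tau x) * f x) (fun x => cos (tau x) * c)).
  { intros f c Hf. apply asymp_mult; trivial. apply bounded_pos_const. }
  assert (CS : forall f c, asymp f (fun _ => c) -> asymp (fun x => sin (tau x) * f x) (fun x => sin (tau x) * c)).
  { intros f c Hf. apply asymp_mult; trivial. apply bounded_pos_const. }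
  assert (A1 : asymp (Ja1 mu) (fun x => Rt * cos (phs x))).
  { generalize (asymp_minus _ _ _ _ (CC _ _ P0) (CS _ _ Q0)). apply asymp_ext; intros x Hx.
    reflexivity. unfold phs, rg_re, rg_im. fold S2 Rt. rewrite cos_plus. unfold tau. ring. }
  assert (A2 : asymp (Ja2 mu) (fun x => Rt * sin (phs x))).
  { generalize (asymp_plus _ _ _ _ (CC _ _ Q0) (CS _ _ P0)). apply asymp_ext; intros x Hx.
    reflexivity. unfold phs, rg_re, rg_im. fold S2 Rt. rewrite sin_plus. unfold tau. ring. }
  repeat split; trivial.
  - generalize (asymp_plus _ _ _ _ (asymp_scal (- mu) _ _ A2) (asymp_minus _ _ _ _ (CC _ _ P1) (CS _ _ Q1))).
    apply asymp_ext; intros x Hx. reflexivity. ring.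
  - generalize (asymp_plus _ _ _ _ (asymp_scal mu _ _ A1) (asymp_plus _ _ _ _ (CC _ _ Q1) (CS _ _ P1))).
    apply asymp_ext; intros x Hx. reflexivity. ring.
Qed.

Let s := sinh (PI * mu).

(** [Hsq] behaves like [2 / (S2 s^2) * (cosh (PI mu) - cos (2 phs))]. In the first combination the
    oscillation cancels and a constant remains; these are the three quantities that [appell_unique]
    asks for. *)
Lemma asymp_Hsq :
  asymp (fun x => (2 * mu) ^ 2 * Hsq mu x + Hsq2 mu x) (fun _ => 8 * mu ^ 2 * cosh (PI * mu) / (S2 * s ^ 2)) /\
  asymp (Hsq1 mu) (fun x => 4 * mu / (S2 * s ^ 2) * sin (2 * phs x)) /\
  asymp (Hsq2 mu) (fun x => 8 * mu ^ 2 / (S2 * s ^ 2) * cos (2 * phs x)).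
Proof.
  destruct asymp_Ja as [A1 [A2 [B1 B2]]].
  assert (HS : 0 < S2) by apply mod_prod_lim.
  assert (Hs : 0 < s) by (apply sinh_pos, Rmult_lt_0_compat; [apply PI_RGT_0|trivial]).
  assert (HR : Rt * Rt = / S2) by (apply sqrt_sqrt, Rlt_le, Rinv_0_lt_compat; trivial).
  assert (b1 : bounded_pos (fun x => Rt * cos (phs x))) by (apply (bounded_pos_mult (fun _ => Rt)); [apply bounded_pos_const|apply bounded_pos_cos]).
  assert (b2 : bounded_pos (fun x => Rt * sin (phs x))) by (apply (bounded_pos_mult (fun _ => Rt)); [apply bounded_pos_const|apply bounded_pos_sin]).
  assert (b3 : bounded_pos (fun x => - mu * (Rt * sin (phs x)))) by (apply (bounded_pos_mult (fun _ => - mu)); [apply bounded_pos_const|trivial]).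
  assert (b4 : bounded_pos (fun x => mu * (Rt * cos (phs x)))) by (apply (bounded_pos_mult (fun _ => mu)); [apply bounded_pos_const|trivial]).
  pose proof (asymp_mult _ _ _ _ b1 b1 A1 A1) as M11. pose proof (asymp_mult _ _ _ _ b2 b2 A2 A2) as M22.
  pose proof (asymp_mult _ _ _ _ b3 b3 B1 B1) as N11. pose proof (asymp_mult _ _ _ _ b4 b4 B2 B2) as N22.
  pose proof (asymp_mult _ _ _ _ b1 b3 A1 B1) as M13. pose proof (asymp_mult _ _ _ _ b2 b4 A2 B2) as M24.
  assert (X : asymp (fun x => x ^ 2) (fun _ => 0)).
  { apply asymp_lim. replace 0 with (0 ^ 2) at 2 by ring. apply (continuous_at_right (fun x => x ^ 2)).
    apply (ex_derive_continuous (fun x => x ^ 2)). auto_derive; trivial. }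
  pose proof (asymp_plus _ _ _ _ (asymp_scal (sq_c1 mu) _ _ M11) (asymp_scal (sq_c2 mu) _ _ M22)) as AH.
  assert (BH : bounded_pos (fun x => sq_c1 mu * (Rt * cos (phs x) * (Rt * cos (phs x))) + sq_c2 mu * (Rt * sin (phs x) * (Rt * sin (phs x))))).
  { apply bounded_pos_plus; (apply (bounded_pos_mult (fun _ => _)); [apply bounded_pos_const|apply bounded_pos_mult; trivial]). }
  pose proof (asymp_mult _ _ _ _ (bounded_pos_const 0) BH X AH) as XH.
  pose proof (asymp_plus _ _ _ _ (asymp_scal (sq_c1 mu) _ _ N11) (asymp_scal (sq_c2 mu) _ _ N22)) as NN.
  pose proof (asymp_plus _ _ _ _ (asymp_scal (sq_c1 mu) _ _ M13) (asymp_scal (sq_c2 mu) _ _ M24)) as MM.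
  assert (HRi : Rt * Rt * S2 = 1) by (rewrite HR; field; lra).
  assert (V2 : asymp (Hsq2 mu) (fun x => 8 * mu ^ 2 / (S2 * s ^ 2) * cos (2 * phs x))).
  { generalize (asymp_minus _ _ _ _ (asymp_scal 2 _ _ NN) (asymp_plus _ _ _ _ (asymp_scal 2 _ _ XH) (asymp_scal (2 * mu ^ 2) _ _ AH))).
    apply asymp_ext; intros x Hx. unfold Hsq2, Hsq. ring.
    rewrite cos_2a. unfold sq_c1, sq_c2. fold s. unfold Rdiv at 7. rewrite Rinv_mult, <- HR. field. lra. }
  split; [|split]; trivial.
  - generalize (asymp_plus _ _ _ _ (asymp_scal ((2 * mu) ^ 2) _ _ AH) V2).
    apply asymp_ext; intros x Hx. unfold Hsq. ring.
    rewrite cos_2a. replace (cos (phs x) * cos (phs x)) with (1 - sin (phs x) * sin (phs x)).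
    2:{ pose proof (sin2_cos2 (phs x)) as Q. unfold Rsqr in Q. lra. }
    replace (Rt * cos (phs x) * (Rt * cos (phs x))) with (Rt * Rt * (1 - sin (phs x) * sin (phs x))).
    2:{ pose proof (sin2_cos2 (phs x)) as Q. unfold Rsqr in Q. rewrite <- Q. ring. }
    replace (Rt * sin (phs x) * (Rt * sin (phs x))) with (Rt * Rt * (sin (phs x) * sin (phs x))) by ring.
    rewrite HR. unfold sq_c1, sq_c2. fold s. field. split; lra.
  - generalize (asymp_scal 2 _ _ MM). apply asymp_ext; intros x Hx. unfold Hsq1. ring.
    rewrite sin_2a.
    replace (Rt * cos (phs x) * (- mu * (Rt * sin (phs x)))) with (- mu * (Rt * Rt) * (sin (phs x) * cos (phs x))) by ring.
    replace (Rt * sin (phs x) * (mu * (Rt * cos (phs x)))) with (mu * (Rt * Rt) * (sin (phs x) * cos (phs x))) by ring.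
    rewrite HR. unfold sq_c1, sq_c2. fold s. field. split; lra.
Qed.
End SquareODE.

(** * Nicholson integrals *)

Lemma is_derive_eq (f : R -> R) (x l m : R) : is_derive f x l -> l = m -> is_derive f x m.
Proof. intros H <-; exact H. Qed.

(** At most of order [w^(-1/4)] at 0 and below every power at infinity. [kap] and [gam] qualify, and
    the class is stable under sums, multiples and multiplication by [w], which is all that
    differentiation in [x] produces. *)
Definition rapid (g : R -> R) : Prop :=
  cont_pos g /\ forall m : nat, exists K, 0 < K /\ forall w, 0 < w -> Rabs (g w) * sqrt (sqrt w) * (1 + w) ^ m <= K.

Lemma rapid_kap : rapid kap.
Proof.
  split. apply cont_pos_kap. intros m. destruct (kap_decay m) as [K [H1 H2]]. exists K; split; trivial.
  intros w Hw. rewrite Rabs_pos_eq by (apply kap_nonneg; trivial). auto.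
Qed.

Lemma root4_le (w : R) : 0 < w -> 0 < sqrt (sqrt w) <= 1 + w.
Proof.
  intros Hw. assert (0 < sqrt w) by (apply sqrt_lt_R0; trivial). split. apply sqrt_lt_R0; trivial.
  pose proof (sqrt_le_1p w ltac:(lra)). rewrite <- (sqrt_square (1 + w)) by lra. apply sqrt_le_1_alt. nra.
Qed.

Lemma rapid_gam : rapid gam.
Proof.
  split. apply cont_pos_gam. intros m. destruct (gam_decay (S m)) as [K [H1 H2]]. exists K; split; trivial.
  intros w Hw. destruct (gam_bound w Hw) as [G _]. rewrite Rabs_pos_eq by trivial.
  eapply Rle_trans; [|apply (H2 w Hw)]. simpl. rewrite Rmult_assoc. apply Rmult_le_compat_l; trivial.
  apply Rmult_le_compat_r. apply pow_le; lra. apply root4_le; trivial.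
Qed.

Lemma rapid_scal (c : R) (g : R -> R) : rapid g -> rapid (fun w => c * g w).
Proof.
  intros [C H]. split. intros t Ht. apply (continuous_scal_r c g); auto.
  intros m. destruct (H m) as [K [HK H']]. exists (Rabs c * K + 1). pose proof (Rabs_pos c). split. nra.
  intros w Hw. rewrite Rabs_mult, !Rmult_assoc. specialize (H' w Hw). rewrite Rmult_assoc in H'.
  apply Rle_trans with (Rabs c * K). apply Rmult_le_compat_l; trivial. lra.
Qed.

Lemma rapid_plus (f g : R -> R) : rapid f -> rapid g -> rapid (fun w => f w + g w).
Proof.
  intros [C H] [C' H']. split. intros t Ht. apply (continuous_plus f g); auto.
  intros m. destruct (H m) as [K [HK B]]. destruct (H' m) as [K' [HK' B']]. exists (K + K'). split. lra.
  intros w Hw. specialize (B w Hw). specialize (B' w Hw). pose proof (Rabs_triang (f w) (g w)).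
  destruct (root4_le w Hw) as [R0 _]. assert (0 <= (1 + w) ^ m) by (apply pow_le; lra).
  apply Rle_trans with ((Rabs (f w) + Rabs (g w)) * sqrt (sqrt w) * (1 + w) ^ m).
  apply Rmult_le_compat_r; trivial. apply Rmult_le_compat_r; lra. lra.
Qed.

Lemma rapid_mult_id (g : R -> R) : rapid g -> rapid (fun w => w * g w).
Proof.
  intros [C H]. split. intros t Ht. apply (continuous_mult (fun w : R => w) g). apply continuous_id. auto.
  intros m. destruct (H (S m)) as [K [HK H']]. exists K; split; trivial.
  intros w Hw. eapply Rle_trans; [|apply (H' w Hw)]. rewrite Rabs_mult, (Rabs_pos_eq w) by lra.
  destruct (root4_le w Hw) as [R0 _]. assert (0 <= (1 + w) ^ m) by (apply pow_le; lra). pose proof (Rabs_pos (g w)).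
  simpl. replace (w * Rabs (g w) * sqrt (sqrt w) * (1 + w) ^ m) with (Rabs (g w) * sqrt (sqrt w) * (1 + w) ^ m * w) by ring.
  replace (Rabs (g w) * sqrt (sqrt w) * ((1 + w) * (1 + w) ^ m)) with (Rabs (g w) * sqrt (sqrt w) * (1 + w) ^ m * (1 + w)) by ring.
  apply Rmult_le_compat_l; [|lra]. repeat apply Rmult_le_pos; lra.
Qed.

Lemma sinh_sq_pos (x t : R) : 0 < x -> 0 < t -> 0 < x ^ 2 * sinh t ^ 2.
Proof. intros Hx Ht. pose proof (sinh_pos t Ht). apply Rmult_lt_0_compat; apply pow_lt; trivial. Qed.

Lemma root4_sinh (x t : R) : 0 < x -> 0 < t -> sqrt (sqrt (x ^ 2 * sinh t ^ 2)) = sqrt (x * sinh t).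
Proof.
  intros Hx Ht. pose proof (sinh_pos t Ht). f_equal.
  replace (x ^ 2 * sinh t ^ 2) with ((x * sinh t) * (x * sinh t)) by ring. apply sqrt_square. nra.
Qed.

(** Since [sinh t >= t], the fourth root of [x ^ 2 * sinh t ^ 2] is at least [sqrt (x1 * t)], and
    one factor [1 + w] dominates a multiple of [1 + t]: exactly the shape of [delta]. *)
Lemma rapid_delta (g : R -> R) (x1 : R) : rapid g -> 0 < x1 ->
  exists K, 0 < K /\ forall x t, x1 <= x -> 0 < t -> Rabs (g (x ^ 2 * sinh t ^ 2)) <= K * delta t.
Proof.
  intros [C H] Hx1. destruct (H 1%nat) as [K [HK B]].
  set (c := Rmin 1 (x1 ^ 2)). assert (Hc : 0 < c) by (apply Rmin_glb_lt; nra).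
  assert (S1 : 0 < sqrt x1) by (apply sqrt_lt_R0; trivial).
  exists (K * 2 / (sqrt x1 * c)). split. { apply Rdiv_lt_0_compat. lra. apply Rmult_lt_0_compat; lra. }
  intros x t Hx Ht. pose proof (sinh_ge t ltac:(lra)) as Hs.
  specialize (B _ (sinh_sq_pos x t ltac:(lra) Ht)). rewrite root4_sinh in B by lra. rewrite pow_1 in B.
  set (G := Rabs (g (x ^ 2 * sinh t ^ 2))) in *. assert (HG : 0 <= G) by apply Rabs_pos.
  assert (St : 0 < sqrt t) by (apply sqrt_lt_R0; trivial).
  assert (R1 : sqrt x1 * sqrt t <= sqrt (x * sinh t)).
  { rewrite <- sqrt_mult_alt by lra. apply sqrt_le_1_alt. apply Rmult_le_compat; lra. }
  assert (R2 : c * (1 + t) / 2 <= 1 + x ^ 2 * sinh t ^ 2).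
  { assert (c <= 1) by apply Rmin_l. assert (c <= x1 ^ 2) by apply Rmin_r.
    assert (x1 ^ 2 * t ^ 2 <= x ^ 2 * sinh t ^ 2) by (apply Rmult_le_compat; try nra; apply pow_incr; lra).
    assert (c * t ^ 2 <= x1 ^ 2 * t ^ 2) by (apply Rmult_le_compat_r; nra).
    assert (1 + t <= 2 * (1 + t ^ 2)) by nra. nra. }
  unfold delta. apply (Rmult_le_reg_r (sqrt x1 * sqrt t * (c * (1 + t) / 2))).
  { apply Rmult_lt_0_compat. nra. nra. }
  replace (K * 2 / (sqrt x1 * c) * / (sqrt t * (1 + t)) * (sqrt x1 * sqrt t * (c * (1 + t) / 2))) with K by (field; lra).
  eapply Rle_trans; [|exact B]. rewrite (Rmult_assoc G). apply Rmult_le_compat_l; trivial.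
  apply Rmult_le_compat; try nra.
Qed.

Lemma rapid_cosh (g : R -> R) (x : R) (m : nat) : rapid g -> 0 < x ->
  exists K, 0 < K /\ forall t, 0 < t -> Rabs (g (x ^ 2 * sinh t ^ 2)) * sqrt (sinh t) * (cosh t ^ 2) ^ m <= K.
Proof.
  intros [C H] Hx. destruct (H m) as [K [HK B]].
  set (c := Rmin 1 (x ^ 2)). assert (Hc : 0 < c) by (apply Rmin_glb_lt; nra).
  assert (S1 : 0 < sqrt x) by (apply sqrt_lt_R0; trivial). assert (0 < c ^ m) by (apply pow_lt; trivial).
  exists (K / (sqrt x * c ^ m)). split. { apply Rdiv_lt_0_compat. lra. apply Rmult_lt_0_compat; lra. }
  intros t Ht. pose proof (sinh_pos t ltac:(lra)) as Hs.
  specialize (B _ (sinh_sq_pos x t ltac:(lra) Ht)). rewrite root4_sinh in B by lra. rewrite sqrt_mult_alt in B by lra.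
  set (G := Rabs (g (x ^ 2 * sinh t ^ 2))) in *. assert (HG : 0 <= G) by apply Rabs_pos.
  assert (R2 : c * cosh t ^ 2 <= 1 + x ^ 2 * sinh t ^ 2).
  { assert (c <= 1) by apply Rmin_l. assert (c <= x ^ 2) by apply Rmin_r. rewrite cosh_sinh_sqr.
    assert (c * sinh t ^ 2 <= x ^ 2 * sinh t ^ 2) by (apply Rmult_le_compat_r; nra). lra. }
  pose proof (cosh_ge_1 t).
  assert (R3 : c ^ m * (cosh t ^ 2) ^ m <= (1 + x ^ 2 * sinh t ^ 2) ^ m).
  { rewrite <- Rpow_mult_distr. apply pow_incr. split; trivial. apply Rmult_le_pos; nra. }
  assert (Ss : 0 < sqrt (sinh t)) by (apply sqrt_lt_R0; trivial).
  apply (Rmult_le_reg_r (sqrt x * c ^ m)). apply Rmult_lt_0_compat; lra.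
  replace (K / (sqrt x * c ^ m) * (sqrt x * c ^ m)) with K by (field; lra).
  eapply Rle_trans; [|exact B].
  replace (G * sqrt (sinh t) * (cosh t ^ 2) ^ m * (sqrt x * c ^ m)) with (G * (sqrt x * sqrt (sinh t)) * (c ^ m * (cosh t ^ 2) ^ m)) by ring.
  apply Rmult_le_compat_l; trivial. apply Rmult_le_pos; trivial. apply Rmult_le_pos; lra.
Qed.

Lemma continuous_sinh_comp (g : R -> R) (x t : R) : cont_pos g -> 0 < x -> 0 < t -> continuous (fun t => g (x ^ 2 * sinh t ^ 2)) t.
Proof.
  intros C Hx Ht. apply (continuous_comp (fun t => x ^ 2 * sinh t ^ 2) g).
  apply (ex_derive_continuous (fun t => x ^ 2 * sinh t ^ 2)). auto_derive; trivial.
  apply C. apply sinh_sq_pos; trivial.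
Qed.

Definition unit_bounded (ph : R -> R) : Prop := cont_pos ph /\ forall t, 0 < t -> Rabs (ph t) <= 1.

Lemma integrable_rapid (g ph : R -> R) (x : R) : rapid g -> unit_bounded ph -> 0 < x ->
  integrable (fun t => g (x ^ 2 * sinh t ^ 2) * ph t).
Proof.
  intros G [P1 P2] Hx. destruct (rapid_delta g x G Hx) as [K [HK B]]. exists K. split.
  - intros t Ht. apply (continuous_mult (fun t => g (x ^ 2 * sinh t ^ 2)) ph); auto.
    apply continuous_sinh_comp; trivial. apply G.
  - intros t Ht. specialize (B x t ltac:(lra) Ht). specialize (P2 t Ht). rewrite Rabs_mult.
    pose proof (Rabs_pos (g (x ^ 2 * sinh t ^ 2))). pose proof (Rabs_pos (ph t)). nra.
Qed.

Lemma is_derive_comp_R (g h : R -> R) (x g' h' : R) : is_derive g (h x) g' -> is_derive h x h' ->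
  is_derive (fun x => g (h x)) x (g' * h').
Proof. intros D1 D2. rewrite Rmult_comm. apply (is_derive_comp g h x g' h' D1 D2). Qed.

Lemma is_derive_sq_comp (g : R -> R) (y s g' : R) : is_derive g (y ^ 2 * s) g' ->
  is_derive (fun y => g (y ^ 2 * s)) y (g' * (2 * y * s)).
Proof. intros D. apply (is_derive_comp_R g (fun y => y ^ 2 * s)); trivial. auto_derive; trivial. ring. Qed.

(** On functions of [w = x ^ 2 * sinh t ^ 2], the operator x d/dx acts as 2 w d/dw. [g1] and [g2]
    are the first two images of [g] under it; [g2] serves to dominate the second derivative. *)
Lemma is_derive_rapid_int (g g1 g2 ph : R -> R) (x : R) : rapid g -> rapid g1 -> rapid g2 -> unit_bounded ph -> 0 < x ->
  (forall w, 0 < w -> is_derive g w (g1 w / (2 * w))) ->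
  (forall w, 0 < w -> is_derive g1 w (g2 w / (2 * w))) ->
  is_derive (fun x => half_int (fun t => g (x ^ 2 * sinh t ^ 2) * ph t)) x
    (half_int (fun t => g1 (x ^ 2 * sinh t ^ 2) * ph t) / x).
Proof.
  intros R0 R1 R2 P Hx D0 D1. destruct P as [P1 P2].
  destruct (rapid_delta g1 (x / 2) R1 ltac:(lra)) as [K1 [HK1 B1]].
  destruct (rapid_delta g2 (x / 2) R2 ltac:(lra)) as [K2 [HK2 B2]].
  assert (Y : forall y, Rabs (y - x) < x / 2 -> x / 2 < y).
  { intros y Hy. apply Rabs_def2 in Hy. lra. }
  replace (half_int (fun t => g1 (x ^ 2 * sinh t ^ 2) * ph t) / x) with (half_int (fun t => / x * (g1 (x ^ 2 * sinh t ^ 2) * ph t))).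
  2:{ rewrite half_int_scal. unfold Rdiv; ring. apply integrable_rapid; trivial. split; trivial. }
  apply (is_derive_half_int (fun y t => g (y ^ 2 * sinh t ^ 2) * ph t) (fun y t => / y * (g1 (y ^ 2 * sinh t ^ 2) * ph t))
    (fun y t => / y ^ 2 * ((g2 (y ^ 2 * sinh t ^ 2) - g1 (y ^ 2 * sinh t ^ 2)) * ph t)) x (x / 2) (4 / x ^ 2 * (K1 + K2))).
  - lra.
  - intros y t Hy Ht. specialize (Y y Hy). pose proof (sinh_pos t Ht).
    pose proof (D0 (y ^ 2 * sinh t ^ 2) (sinh_sq_pos y t ltac:(lra) Ht)) as D.
    apply is_derive_sq_comp in D. apply (is_derive_scal_l _ _ _ (ph t)) in D.
    eapply is_derive_eq. exact D. unfold scal; simpl; unfold mult; simpl. field. lra.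
  - intros y t Hy Ht. specialize (Y y Hy). pose proof (sinh_pos t Ht).
    pose proof (D1 (y ^ 2 * sinh t ^ 2) (sinh_sq_pos y t ltac:(lra) Ht)) as D.
    apply is_derive_sq_comp in D. set (h := fun y => g1 (y ^ 2 * sinh t ^ 2)).
    change (is_derive h y (g2 (y ^ 2 * sinh t ^ 2) / (2 * (y ^ 2 * sinh t ^ 2)) * (2 * y * sinh t ^ 2))) in D.
    change (is_derive (fun y => / y * (h y * ph t)) y (/ y ^ 2 * ((g2 (y ^ 2 * sinh t ^ 2) - h y) * ph t))).
    clearbody h. auto_derive. split. lra. split; trivial. exact (ex_intro _ _ D).
    drw D. field. lra.
  - intros y t Hy Ht. specialize (Y y Hy). specialize (B1 y t ltac:(lra) Ht). specialize (B2 y t ltac:(lra) Ht).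
    specialize (P2 t Ht). rewrite !Rabs_mult.
    assert (I1 : 0 < / y ^ 2) by (apply Rinv_0_lt_compat; nra). rewrite (Rabs_pos_eq (/ y ^ 2)) by lra.
    assert (I2 : / y ^ 2 <= 4 / x ^ 2). { replace (4 / x ^ 2) with (/ ((x / 2) ^ 2)) by (field; lra). apply Rinv_le_contravar; nra. }
    set (a := g2 _) in *. set (b := g1 _) in *.
    assert (T : Rabs (a - b) <= (K1 + K2) * delta t).
    { eapply Rle_trans. apply Rabs_triang. rewrite Rabs_Ropp. lra. }
    rewrite Rmult_assoc. apply Rmult_le_compat; trivial. lra. apply Rmult_le_pos; apply Rabs_pos.
    pose proof (Rabs_pos (a - b)). pose proof (Rabs_pos (ph t)). nra.
  - intros y Hy. specialize (Y y Hy). apply integrable_rapid; trivial. split; trivial. lra.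
  - apply integrable_scal. apply integrable_rapid; trivial. split; trivial.
Qed.

(** [gN1] to [gN4] are the successive images of [kap] under 2 w d/dw; the last one provides the
    majorant for differentiating the integral of [gN2]. *)
Definition gN1 (w : R) := -2 * gam w.
Definition gN2 (w : R) := 4 * (w * kap w).
Definition gN3 (w : R) := 8 * (w * kap w + -1 * (w * gam w)).
Definition gN4 (w : R) := 16 * (w * kap w + (-2 * (w * gam w) + w * (w * kap w))).

Lemma rapid_gN : rapid gN1 /\ rapid gN2 /\ rapid gN3 /\ rapid gN4.
Proof.
  pose proof rapid_kap as RK. pose proof rapid_gam as RG.
  unfold gN1, gN2, gN3, gN4.
  split; [|split; [|split]]; (apply rapid_scal; repeat first [exact RK|exact RG|apply rapid_mult_id|apply (rapid_scal (-1))|apply (rapid_scal (-2))|apply rapid_plus]).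
Qed.

Lemma is_derive_gN (w : R) : 0 < w -> is_derive kap w (gN1 w / (2 * w)) /\ is_derive gN1 w (gN2 w / (2 * w)) /\
  is_derive gN2 w (gN3 w / (2 * w)) /\ is_derive gN3 w (gN4 w / (2 * w)).
Proof.
  intros Hw. pose proof (is_derive_kap w Hw) as HK. pose proof (is_derive_gam w Hw) as HG.
  unfold gN1, gN2, gN3, gN4. split; [|split; [|split]].
  - replace (-2 * gam w / (2 * w)) with (- gam w / w) by (field; lra). exact HK.
  - auto_derive. exact (ex_intro _ _ HG). drw HG. field. lra.
  - auto_derive. exact (ex_intro _ _ HK). drw HK. field. lra.
  - auto_derive. split; [exact (ex_intro _ _ HK)|split; trivial; exact (ex_intro _ _ HG)]. drw HK. drw HG. field. lra.
Qed.

Lemma unit_bounded_cos (n d : R) : unit_bounded (fun t => cos (n * t + d)).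
Proof.
  split. intros t _. apply (ex_derive_continuous (fun t => cos (n * t + d))). auto_derive; trivial.
  intros; apply Rabs_le, COS_bound.
Qed.

Section Nicholson.
Variable n : R.
Hypothesis Hn : 0 < n.

(** For [g = kap] this is Nicholson's integral up to the factor [4 / PI ^ 2]. The phase [+ 0] keeps
    the integrand in the form [cos (n * t + d)] shared with the shifted integrals. *)
Definition nint (g : R -> R) (x : R) : R := half_int (fun t => g (x ^ 2 * sinh t ^ 2) * cos (n * t + 0)).

Lemma is_derive_nint0 (x : R) : 0 < x -> is_derive (nint kap) x (nint gN1 x / x).
Proof.
  intros Hx. destruct rapid_gN as [R1 [R2 [R3 R4]]].
  apply (is_derive_rapid_int kap gN1 gN2); trivial. apply rapid_kap. apply unit_bounded_cos.
  intros w Hw; apply is_derive_gN; trivial. intros w Hw; apply is_derive_gN; trivial.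
Qed.
Lemma is_derive_nint1 (x : R) : 0 < x -> is_derive (nint gN1) x (nint gN2 x / x).
Proof.
  intros Hx. destruct rapid_gN as [R1 [R2 [R3 R4]]].
  apply (is_derive_rapid_int gN1 gN2 gN3); trivial. apply unit_bounded_cos.
  intros w Hw; apply is_derive_gN; trivial. intros w Hw; apply is_derive_gN; trivial.
Qed.
Lemma is_derive_nint2 (x : R) : 0 < x -> is_derive (nint gN2) x (nint gN3 x / x).
Proof.
  intros Hx. destruct rapid_gN as [R1 [R2 [R3 R4]]].
  apply (is_derive_rapid_int gN2 gN3 gN4); trivial. apply unit_bounded_cos.
  intros w Hw; apply is_derive_gN; trivial. intros w Hw; apply is_derive_gN; trivial.
Qed.

Lemma is_derive_sinh_comp (g : R -> R) (x t g' : R) : is_derive g (x ^ 2 * sinh t ^ 2) g' ->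
  is_derive (fun t => g (x ^ 2 * sinh t ^ 2)) t (g' * (2 * x ^ 2 * sinh t * cosh t)).
Proof.
  intros D. apply (is_derive_comp_R g (fun t => x ^ 2 * sinh t ^ 2)); trivial. auto_derive; trivial. ring.
Qed.

(** A factor of the size of [sinh t * cosh t] overcomes the singularity of [g] at 0 and is overcome
    by its decay at infinity; boundary terms of this kind vanish at both ends. *)
Lemma rapid_boundary (g ph : R -> R) (x K : R) : rapid g -> 0 < x ->
  (forall t, 0 < t -> Rabs (ph t) <= K * (sinh t * cosh t)) ->
  filterlim (fun t => ph t * g (x ^ 2 * sinh t ^ 2)) (at_right 0) (locally 0) /\
  filterlim (fun t => ph t * g (x ^ 2 * sinh t ^ 2)) at_infty (locally 0).
Proof.
  intros G Hx B. destruct (rapid_cosh g x 2 G Hx) as [L [HL H]].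
  assert (E : forall t, 0 < t -> Rabs (ph t * g (x ^ 2 * sinh t ^ 2)) <= K * L * (sqrt (sinh t) * sech t) * sech t ^ 2).
  { intros t Ht. specialize (B t Ht). specialize (H t Ht). rewrite Rabs_mult. pose proof (sinh_pos t Ht). pose proof (cosh_ge_1 t).
    assert (Ss : 0 < sqrt (sinh t)) by (apply sqrt_lt_R0; trivial).
    pose proof (Rabs_pos (g (x ^ 2 * sinh t ^ 2))). set (a := Rabs (g (x ^ 2 * sinh t ^ 2))) in *.
    pose proof (Rabs_pos (ph t)).
    assert (0 <= K). { assert (0 < sinh t * cosh t) by nra. nra. }
    apply Rle_trans with (K * (sinh t * cosh t) * a). apply Rmult_le_compat_r; trivial.
    unfold sech. apply (Rmult_le_reg_r (cosh t ^ 3)). apply pow_lt; lra.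
    replace (K * L * (sqrt (sinh t) * / cosh t) * (/ cosh t) ^ 2 * cosh t ^ 3) with (K * (L * sqrt (sinh t))) by (field; lra).
    replace (K * (sinh t * cosh t) * a * cosh t ^ 3) with (K * (a * sqrt (sinh t) * (cosh t ^ 2) ^ 2 * sqrt (sinh t))).
    2:{ rewrite <- (sqrt_sqrt (sinh t)) at 3 by lra. ring. }
    apply Rmult_le_compat_l; trivial. apply Rmult_le_compat_r; lra. }
  assert (S2 : forall t, 0 < t -> 0 <= sqrt (sinh t) * sech t <= 1).
  { intros t Ht. pose proof (sinh_pos t Ht). pose proof (cosh_ge_1 t). pose proof (sech_bound t).
    split. apply Rmult_le_pos. apply sqrt_pos. lra.
    unfold sech. apply (Rmult_le_reg_r (cosh t)). lra. rewrite Rmult_assoc, Rinv_l, Rmult_1_l, Rmult_1_r by lra.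
    rewrite <- (sqrt_square (cosh t)) by lra. apply sqrt_le_1_alt.
    assert (sinh t <= cosh t). { unfold sinh, cosh. pose proof (exp_pos (- t)). lra. } nra. }
  assert (KL : forall t, 0 < t -> 0 <= K * L).
  { intros t Ht. specialize (B t Ht). pose proof (Rabs_pos (ph t)). pose proof (sinh_pos t Ht). pose proof (cosh_ge_1 t).
    assert (0 < sinh t * cosh t) by nra. assert (0 <= K) by nra. nra. }
  split.
  - apply (lim_at_squeeze _ _ (fun t => K * L * sqrt (sinh t))).
    + generalize at_right0_pos. apply filter_imp. intros t Ht. rewrite Rminus_0_r. eapply Rle_trans. apply E; trivial.
      specialize (KL t Ht). pose proof (sech_bound t) as [[S3 S4] _]. pose proof (sqrt_pos (sinh t)).
      replace (K * L * (sqrt (sinh t) * sech t) * sech t ^ 2) with (K * L * sqrt (sinh t) * sech t ^ 3) by ring.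
      rewrite <- (Rmult_1_r (K * L * sqrt (sinh t))) at 2. apply Rmult_le_compat_l. nra.
      rewrite <- (pow1 3). apply pow_incr. lra.
    + apply lim_scal0. apply within_filter, locally_filter.
      replace 0 with (sqrt (sinh 0)) at 2 by (rewrite sinh_0, sqrt_0; trivial).
      apply (continuous_at_right (fun t => sqrt (sinh t))). apply (continuous_comp sinh sqrt).
      eapply is_derive_continuous, is_derive_sinh. apply continuous_sqrt.
  - apply (lim_bounded_exp _ (K * L * 2)). intros t Ht. eapply Rle_trans. apply E; trivial.
    specialize (KL t Ht). pose proof (sech_bound t) as [[S3 S4] S5]. specialize (S2 t Ht).
    rewrite (Rmult_assoc (K * L) 2). rewrite (Rmult_assoc (K * L)). apply Rmult_le_compat_l; trivial.
    apply Rle_trans with (1 * sech t). apply Rmult_le_compat; try lra. nra. nra. lra.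
Qed.

Lemma sin_abs_le (a : R) : 0 <= a -> Rabs (sin a) <= a.
Proof.
  intros Ha. destruct (MVT_gen sin 0 a cos) as [c [_ Ec]].
  - intros t _. auto_derive; trivial; ring.
  - intros t _. apply continuity_sin.
  - rewrite sin_0, !Rminus_0_r in Ec. rewrite Ec, Rabs_mult, (Rabs_pos_eq a) by trivial.
    assert (Rabs (cos c) <= 1) by (apply Rabs_le, COS_bound). nra.
Qed.

Lemma sin_le_sinh_cosh (t : R) : 0 < t -> Rabs (sin (n * t + 0)) <= n * (sinh t * cosh t).
Proof.
  intros Ht. rewrite Rplus_0_r. eapply Rle_trans. apply sin_abs_le. nra.
  pose proof (sinh_ge t ltac:(lra)). pose proof (cosh_ge_1 t). apply Rmult_le_compat_l; nra.
Qed.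

Lemma half_int_FTC0 (F f : R -> R) : integrable f -> (forall t, 0 < t -> is_derive F t (f t)) ->
  filterlim F (at_right 0) (locally 0) -> filterlim F at_infty (locally 0) -> half_int f = 0.
Proof.
  intros [K [C _]] D L0 L1. rewrite (half_int_FTC F f 0 0); trivial. ring.
Qed.

Lemma lim0_plus (F G : R -> R) : (filterlim F (at_right 0) (locally 0) /\ filterlim F at_infty (locally 0)) ->
  (filterlim G (at_right 0) (locally 0) /\ filterlim G at_infty (locally 0)) ->
  filterlim (fun t => F t + G t) (at_right 0) (locally 0) /\ filterlim (fun t => F t + G t) at_infty (locally 0).
Proof.
  intros [F0 F1] [G0 G1]. rewrite <- (Rplus_0_r 0) at 2 3. split; (apply lim_plus; [|trivial|trivial]).
  apply within_filter, locally_filter. apply Rbar_locally_filter.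
Qed.

Lemma nint_ode (x : R) : 0 < x -> nint gN3 x = - n ^ 2 * nint gN1 x - 4 * x ^ 2 * (nint gN1 x + nint kap x).
Proof.
  intros Hx. destruct rapid_gN as [R1 [R2 [R3 R4]]]. pose proof rapid_kap as R0.
  pose proof (unit_bounded_cos n 0) as U.
  pose proof (integrable_rapid _ _ _ R0 U Hx) as I0. pose proof (integrable_rapid _ _ _ R1 U Hx) as I1.
  pose proof (integrable_rapid _ _ _ R3 U Hx) as I3.
  set (f := fun t => gN3 (x ^ 2 * sinh t ^ 2) * cos (n * t + 0) + (n ^ 2 + 4 * x ^ 2) * (gN1 (x ^ 2 * sinh t ^ 2) * cos (n * t + 0))
     + (4 * x ^ 2) * (kap (x ^ 2 * sinh t ^ 2) * cos (n * t + 0))).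
  assert (If : integrable f) by (repeat apply integrable_plus; trivial; apply integrable_scal; trivial).
  assert (E : half_int f = nint gN3 x + (n ^ 2 + 4 * x ^ 2) * nint gN1 x + 4 * x ^ 2 * nint kap x).
  { unfold f. rewrite !half_int_plus, !half_int_scal; trivial; repeat apply integrable_plus; trivial; apply integrable_scal; trivial. }
  assert (Z : half_int f = 0). 2: lra.
  (* The integrand [f] is the [t]-derivative of this [F], so the third-order equation holds up to
     boundary values, which are 0. *)
  set (F := fun t => (4 * x ^ 2 * (sinh t * cosh t) * cos (n * t + 0)) * kap (x ^ 2 * sinh t ^ 2) + (-2 * n * sin (n * t + 0)) * gam (x ^ 2 * sinh t ^ 2)).
  assert (L : filterlim F (at_right 0) (locally 0) /\ filterlim F at_infty (locally 0)).
  { apply lim0_plus.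
    - apply (rapid_boundary kap (fun t => 4 * x ^ 2 * (sinh t * cosh t) * cos (n * t + 0)) x (4 * x ^ 2)); trivial.
      intros t Ht. pose proof (sinh_pos t Ht). pose proof (cosh_ge_1 t). assert (0 <= 4 * x ^ 2 * (sinh t * cosh t)).
      { apply Rmult_le_pos. pose proof (pow2_ge_0 x); lra. apply Rmult_le_pos; lra. }
      rewrite Rabs_mult, (Rabs_pos_eq (4 * x ^ 2 * (sinh t * cosh t))) by trivial.
      assert (Rabs (cos (n * t + 0)) <= 1) by (apply Rabs_le, COS_bound).
      pose proof (Rabs_pos (cos (n * t + 0))). nra.
    - apply (rapid_boundary gam (fun t => -2 * n * sin (n * t + 0)) x (2 * n * n)); trivial. apply rapid_gam.
      intros t Ht. rewrite Rabs_mult, Rabs_left by nra. pose proof (sin_le_sinh_cosh t Ht).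
      replace (2 * n * n * (sinh t * cosh t)) with (- (-2 * n) * (n * (sinh t * cosh t))) by ring.
      apply Rmult_le_compat_l; nra. }
  apply (half_int_FTC0 F f If); try apply L.
  intros t Ht. pose proof (sinh_sq_pos x t Hx Ht) as W. pose proof (sinh_pos t Ht).
  pose proof (is_derive_sinh_comp kap x t _ (is_derive_kap _ W)) as DK.
  pose proof (is_derive_sinh_comp gam x t _ (is_derive_gam _ W)) as DG.
  unfold f, gN3, gN1.
  pose proof (cosh_sinh_sqr t) as Q.
  set (k := fun t => kap (x ^ 2 * sinh t ^ 2)) in *. set (g := fun t => gam (x ^ 2 * sinh t ^ 2)) in *.
  change (kap (x ^ 2 * sinh t ^ 2)) with (k t) in *. change (gam (x ^ 2 * sinh t ^ 2)) with (g t) in *.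
  change (is_derive (fun t => 4 * x ^ 2 * (sinh t * cosh t) * cos (n * t + 0) * k t + -2 * n * sin (n * t + 0) * g t) t
    (8 * (x ^ 2 * sinh t ^ 2 * k t + -1 * (x ^ 2 * sinh t ^ 2 * g t)) * cos (n * t + 0) +
    (n ^ 2 + 4 * x ^ 2) * (-2 * g t * cos (n * t + 0)) + 4 * x ^ 2 * (k t * cos (n * t + 0)))).
  change (is_derive k t (- g t / (x ^ 2 * sinh t ^ 2) * (2 * x ^ 2 * sinh t * cosh t))) in DK.
  change (is_derive g t (- k t * (2 * x ^ 2 * sinh t * cosh t))) in DG.
  clearbody k g. auto_derive. split; [exact (ex_intro _ _ DK)|split; trivial; exact (ex_intro _ _ DG)].
  drw DK. drw DG.
  set (co := cos (n * t + 0)). set (si := sin (n * t + 0)).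
  field_simplify; try lra. replace (cosh t ^ 2) with (1 + sinh t ^ 2) by lra. ring.
Qed.
End Nicholson.

(** * Nicholson integrals near 0 *)

(** Separates the double limit into two one-sided limits of a primitive based at 1, as is needed to
    cut the integral at a point that moves with [x]. *)
Lemma half_int_antiderivative (f : R -> R) : integrable f -> exists l0 l1,
  filterlim (fun a => RInt f 1 a) (at_right 0) (locally (l0 : R)) /\ filterlim (fun b => RInt f 1 b) at_infty (locally (l1 : R)) /\
  half_int f = l1 - l0.
Proof.
  intros If. pose proof (is_RInt_gen_half_inv _ _ (half_int_correct f If)) as H. destruct If as [K [C _]].
  assert (Ch : forall a b c, 0 < a -> 0 < b -> 0 < c -> RInt f a b = RInt f a c - RInt f b c).
  { intros a b c Ha Hb Hc. pose proof (RInt_Chasles f a b c (ex_RInt_pos f a b C Ha Hb) (ex_RInt_pos f b c C Hb Hc)) as Q.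
    unfold plus in Q; simpl in Q. lra. }
  assert (Sw : forall a b, 0 < a -> 0 < b -> RInt f a b = - RInt f b a).
  { intros a b Ha Hb. pose proof (Ch a b b Ha Hb Hb) as Q. rewrite (Ch a b a Ha Hb Ha). rewrite RInt_point. unfold zero; simpl. lra. }
  assert (Cau : forall eps : posreal, exists P Q, at_right 0 P /\ at_infty Q /\
     forall a b a' b', P a -> Q b -> P a' -> Q b' -> Rabs (RInt f a b - RInt f a' b') < eps).
  { intros eps. assert (He : 0 < eps / 2) by (pose proof (cond_pos eps); lra).
    pose proof (proj1 (lim_at_spec _ _ _) H _ He) as [P Q HP HQ HPQ]. exists P, Q. repeat split; trivial.
    intros a b a' b' H1 H2 H3 H4. pose proof (HPQ a b H1 H2) as X. pose proof (HPQ a' b' H3 H4) as Y. simpl in X, Y.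
    apply Rabs_def2 in X. apply Rabs_def2 in Y. apply Rabs_def1; lra. }
  assert (L0 : exists l0, filterlim (fun a => RInt f 1 a) (at_right 0) (locally (l0 : R))).
  { apply (filterlim_locally_cauchy (U := R_CompleteSpace)). intros eps. destruct (Cau eps) as [P [Q [HP [HQ X]]]].
    exists (fun a => P a /\ 0 < a). split. apply filter_and; trivial. apply at_right0_pos.
    intros u v [Pu u0] [Pv v0]. destruct (filter_ex _ (filter_and _ _ HQ (at_infty_gt 0))) as [b [Qb b0]].
    specialize (X u b v b Pu Qb Pv Qb).
    change (Rabs (RInt f 1 v - RInt f 1 u) < eps).
    replace (RInt f 1 v - RInt f 1 u) with (RInt f u b - RInt f v b); trivial.
    rewrite (Ch 1 v b) by lra. rewrite (Ch 1 u b) by lra. lra. }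
  assert (L1 : exists l1, filterlim (fun a => RInt f 1 a) at_infty (locally (l1 : R))).
  { apply (filterlim_locally_cauchy (U := R_CompleteSpace)). intros eps. destruct (Cau eps) as [P [Q [HP [HQ X]]]].
    exists (fun a => Q a /\ 0 < a). split. apply filter_and; trivial. apply at_infty_gt.
    intros u v [Pu u0] [Pv v0]. destruct (filter_ex _ (filter_and _ _ HP at_right0_pos)) as [b [Qb b0]].
    specialize (X b v b u Qb Pv Qb Pu).
    change (Rabs (RInt f 1 v - RInt f 1 u) < eps).
    replace (RInt f 1 v - RInt f 1 u) with (RInt f b v - RInt f b u); trivial.
    rewrite (Ch b v 1) by lra. rewrite (Ch b u 1) by lra. rewrite (Sw v 1), (Sw u 1) by lra. lra. }
  destruct L0 as [l0 L0]. destruct L1 as [l1 L1]. exists l0, l1. split; [|split]; trivial.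
  apply (half_int_FTC (fun a => RInt f 1 a)); trivial.
  intros t Ht. apply (is_derive_RInt f _ 1). 2: apply C; trivial.
  exists (mkposreal t Ht). intros y Hy.
  unfold ball in Hy; simpl in Hy; unfold AbsRing_ball, minus, plus, opp, abs in Hy; simpl in Hy.
  apply (RInt_correct (V:=R_CompleteNormedModule)). apply ex_RInt_pos; trivial. lra. apply Rabs_def2 in Hy. lra.
Qed.

Lemma is_derive_RInt_pos (f : R -> R) (t : R) : cont_pos f -> 0 < t -> is_derive (fun a => RInt f 1 a) t (f t).
Proof.
  intros C Ht. apply (is_derive_RInt f _ 1). 2: apply C; trivial.
  exists (mkposreal t Ht). intros y Hy.
  unfold ball in Hy; simpl in Hy; unfold AbsRing_ball, minus, plus, opp, abs in Hy; simpl in Hy.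
  apply (RInt_correct (V:=R_CompleteNormedModule)). apply ex_RInt_pos; trivial. lra. apply Rabs_def2 in Hy. lra.
Qed.

(** [4 * eta] is [gN2]. Unlike [gam] it tends to 0 at 0, so its integrals remain under control as
    [x] shrinks. *)
Definition eta (w : R) : R := w * kap w.

Lemma rapid_eta : rapid eta.
Proof. apply rapid_mult_id, rapid_kap. Qed.

Lemma root_kap_bound : exists K, 0 < K /\ forall z, 0 < z -> z * kap (z ^ 2) <= K /\ z * gam (z ^ 2) <= K.
Proof.
  destruct (kap_decay 1) as [K1 [H1 B1]]. destruct (gam_decay 1) as [K2 [H2 B2]].
  exists (K1 + K2). split. lra. intros z Hz. assert (Hz2 : 0 < z ^ 2) by nra.
  specialize (B1 _ Hz2). specialize (B2 _ Hz2). rewrite pow_1 in B1, B2.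
  pose proof (kap_nonneg _ Hz2). destruct (gam_bound _ Hz2) as [G _].
  assert (E : sqrt (z ^ 2) = z) by (apply sqrt_pow2; lra). rewrite E in B1.
  pose proof (root4_le (z ^ 2) Hz2) as [R1 R2]. rewrite E in R1, R2.
  assert (z <= sqrt z * (1 + z ^ 2)). { rewrite <- (sqrt_sqrt z) at 1 by lra. apply Rmult_le_compat_l; lra. }
  assert (z <= 1 + z ^ 2) by nra.
  split.
  - apply Rle_trans with (kap (z ^ 2) * sqrt z * (1 + z ^ 2)). 2: lra. rewrite Rmult_assoc, Rmult_comm. apply Rmult_le_compat_l; trivial.
  - apply Rle_trans with (gam (z ^ 2) * (1 + z ^ 2)). 2: lra. rewrite Rmult_comm. apply Rmult_le_compat_l; trivial.
Qed.

(** The derivative of [eta (z ^ 2)] is [2 * (z * kap (z ^ 2) - z * gam (z ^ 2))], bounded on the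
    half line. It is applied to [x * sinh t] and [x * (exp t / 2)], which differ by
    [x * exp (- t) / 2]. *)
Lemma eta_lipschitz : exists L, 0 < L /\ forall u v, 0 < u -> u <= v -> Rabs (eta (u ^ 2) - eta (v ^ 2)) <= L * (v - u).
Proof.
  destruct root_kap_bound as [K [HK B]]. exists (4 * K). split. lra. intros u v Hu Hv.
  destruct (MVT_gen (fun z => eta (z ^ 2)) u v (fun z => 2 * (z * kap (z ^ 2)) - 2 * (z * gam (z ^ 2)))) as [c [Hc Ec]].
  - intros z Hz. rewrite Rmin_left in Hz by lra. assert (Hz2 : 0 < z ^ 2) by nra.
    assert (D : is_derive eta (z ^ 2) (kap (z ^ 2) - gam (z ^ 2))).
    { pose proof (is_derive_kap _ Hz2) as DK. unfold eta. generalize dependent (z ^ 2). intros w H2 DK. auto_derive.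
      exact (ex_intro _ _ DK). drw DK. field. lra. }
    apply (is_derive_eq _ _ ((kap (z ^ 2) - gam (z ^ 2)) * (2 * z))). 2: ring.
    apply (is_derive_comp_R eta (fun z => z ^ 2)); trivial. auto_derive; trivial. ring.
  - intros z Hz. rewrite Rmin_left in Hz by lra. assert (Hz2 : 0 < z ^ 2) by nra.
    apply continuity_pt_filterlim. apply (continuous_comp (fun z => z ^ 2) eta).
    apply (ex_derive_continuous (fun z => z ^ 2)). auto_derive; trivial.
    apply rapid_eta; trivial.
  - rewrite Rmin_left, Rmax_right in Hc by lra. rewrite Rabs_minus_sym, Ec, Rabs_mult, (Rabs_pos_eq (v - u)) by lra.
    apply Rmult_le_compat_r. lra. specialize (B c ltac:(lra)). destruct B as [B1 B2].
    assert (Hc2 : 0 < c ^ 2) by nra. pose proof (kap_nonneg _ Hc2). destruct (gam_bound _ Hc2) as [G _].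
    apply Rabs_le. nra.
Qed.

Lemma lim_gam_0 : filterlim (fun w => 1 - gam w) (at_right 0) (locally 0).
Proof.
  destruct one_minus_gam as [K [HK B]]. apply (lim_at_squeeze _ _ (fun w => K * sqrt w)).
  - generalize at_right0_pos. apply filter_imp. intros w Hw. specialize (B w Hw). rewrite Rminus_0_r, Rabs_pos_eq; lra.
  - apply lim_scal0. apply within_filter, locally_filter. apply lim_sqrt_0.
Qed.

Section Asymptotics.
Variable mu : R.
Hypothesis Hmu : 0 < mu.
Let n := 2 * mu.

(* Substitute [w = x^2 exp (2 t) / 4]. *)
Lemma shifted_phase_integral (x d : R) : 0 < x ->
  integrable (fun t => 4 * eta (x ^ 2 * (exp t / 2) ^ 2) * cos (n * t + d)) /\
  Rabs (half_int (fun t => 4 * eta (x ^ 2 * (exp t / 2) ^ 2) * cos (n * t + d)) - 2 * kmom mu 0 (d - n * ln (x / 2))) <= 2 * (1 - gam (x ^ 2 / 4)).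
Proof.
  intros Hx. set (d' := d - n * ln (x / 2)).
  set (f := fun w => w ^ 0 * kap w * cos (mu * ln w + d')).
  assert (If : integrable f) by apply integrable_kmom.
  destruct (half_int_antiderivative f If) as [l0 [l1 [L0 [L1 E]]]].
  assert (Cf : cont_pos f) by (destruct If as [? [? _]]; trivial).
  assert (Hx4 : 0 < x ^ 2 / 4) by nra.
  assert (W : forall t, x ^ 2 * (exp t / 2) ^ 2 = x ^ 2 / 4 * exp (2 * t)).
  { intros t. replace (2 * t) with (t + t) by ring. rewrite exp_plus. field. }
  assert (WP : forall t, 0 < x ^ 2 * (exp t / 2) ^ 2). { intros t. rewrite W. apply Rmult_lt_0_compat; trivial. apply exp_pos. }
  assert (I : integrable (fun t => 4 * eta (x ^ 2 * (exp t / 2) ^ 2) * cos (n * t + d))).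
  { destruct (proj2 rapid_eta 1%nat) as [K [HK B]].
    set (c := Rmin 1 (x ^ 2 / 4)). assert (Hc : 0 < c) by (apply Rmin_glb_lt; lra).
    assert (Sx : 0 < sqrt (x / 2)) by (apply sqrt_lt_R0; lra).
    apply (integrable_exp _ (4 * K / (sqrt (x / 2) * (x ^ 2 / 4)))).
    - intros t Ht. apply (continuous_mult (fun t => 4 * eta (x ^ 2 * (exp t / 2) ^ 2))).
      apply (continuous_scal_r 4 (fun t => eta (x ^ 2 * (exp t / 2) ^ 2))).
      apply (continuous_comp (fun t => x ^ 2 * (exp t / 2) ^ 2) eta).
      apply (ex_derive_continuous (fun t => x ^ 2 * (exp t / 2) ^ 2)). auto_derive; trivial.
      apply rapid_eta. apply WP. apply (ex_derive_continuous (fun t => cos (n * t + d))). auto_derive; trivial.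
    - intros t Ht. specialize (B _ (WP t)). rewrite pow_1 in B.
      rewrite !Rabs_mult, (Rabs_pos_eq 4) by lra.
      assert (Rabs (cos (n * t + d)) <= 1) by (apply Rabs_le, COS_bound). pose proof (Rabs_pos (cos (n * t + d))).
      set (e := Rabs (eta (x ^ 2 * (exp t / 2) ^ 2))) in *. assert (He : 0 <= e) by apply Rabs_pos.
      apply Rle_trans with (4 * e). nra.
      assert (ET : 1 <= exp t) by (pose proof (exp_ineq1_le t); lra).
      assert (Q1 : sqrt (x / 2) <= sqrt (sqrt (x ^ 2 * (exp t / 2) ^ 2))).
      { apply sqrt_le_1_alt. replace (x ^ 2 * (exp t / 2) ^ 2) with ((x / 2 * exp t) * (x / 2 * exp t)) by field. rewrite sqrt_square by nra. nra. }
      assert (Q2 : x ^ 2 / 4 * exp t <= 1 + x ^ 2 * (exp t / 2) ^ 2).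
      { rewrite W. replace (2 * t) with (t + t) by ring. rewrite exp_plus. nra. }
      rewrite exp_Ropp. apply (Rmult_le_reg_r (sqrt (x / 2) * (x ^ 2 / 4 * exp t))).
      { apply Rmult_lt_0_compat; trivial. apply Rmult_lt_0_compat; lra. }
      replace (4 * K / (sqrt (x / 2) * (x ^ 2 / 4)) * / exp t * (sqrt (x / 2) * (x ^ 2 / 4 * exp t))) with (4 * K) by (field; lra).
      rewrite Rmult_assoc. apply Rmult_le_compat_l. lra. eapply Rle_trans; [|exact B]. rewrite Rmult_assoc. apply Rmult_le_compat_l; trivial.
      apply Rmult_le_compat; nra. }
  split; trivial.
  (* The range [t > 0] becomes [w > x ^ 2 / 4]. The missing part of the moment is at most the
     integral of [kap] from 0 to [x ^ 2 / 4], which is [1 - gam (x ^ 2 / 4)]. *)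
  assert (V : half_int (fun t => 4 * eta (x ^ 2 * (exp t / 2) ^ 2) * cos (n * t + d)) = 2 * l1 - 2 * RInt f 1 (x ^ 2 / 4)).
  { apply (half_int_FTC (fun t => 2 * RInt f 1 (x ^ 2 / 4 * exp (2 * t)))).
    - destruct I as [? [? _]]; trivial.
    - intros t Ht.
      assert (D : is_derive (fun t => RInt f 1 (x ^ 2 / 4 * exp (2 * t))) t (f (x ^ 2 / 4 * exp (2 * t)) * (x ^ 2 / 4 * exp (2 * t) * 2))).
      { apply (is_derive_comp_R (fun a => RInt f 1 a) (fun t => x ^ 2 / 4 * exp (2 * t))).
        apply is_derive_RInt_pos; trivial. rewrite <- W. apply WP. auto_derive; trivial. field. }
      apply (is_derive_scal _ _ 2) in D. eapply is_derive_eq. exact D.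
      rewrite W. unfold f, eta. rewrite pow_O, ln_mult, ln_exp by (trivial; apply exp_pos).
      replace (ln (x ^ 2 / 4)) with (2 * ln (x / 2)). 2:{ replace (x ^ 2 / 4) with (x / 2 * (x / 2)) by field. rewrite ln_mult by lra. ring. }
      replace (mu * (2 * ln (x / 2) + 2 * t) + d') with (n * t + d) by (unfold d', n; ring). ring.
    - apply lim_scal. apply within_filter, locally_filter.
      assert (Q : continuous (fun t => RInt f 1 (x ^ 2 / 4 * exp (2 * t))) 0).
      { apply (continuous_comp (fun t => x ^ 2 / 4 * exp (2 * t)) (fun a => RInt f 1 a)).
        apply (ex_derive_continuous (fun t => x ^ 2 / 4 * exp (2 * t))). auto_derive; trivial.
        eapply is_derive_continuous, is_derive_RInt_pos; trivial. rewrite <- W. apply WP. }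
      apply continuous_at_right in Q. rewrite Rmult_0_r, exp_0, Rmult_1_r in Q. exact Q.
    - apply lim_scal. apply Rbar_locally_filter.
      apply (filterlim_comp _ _ _ (fun t => x ^ 2 / 4 * exp (2 * t)) (fun a => RInt f 1 a) at_infty at_infty); trivial.
      intros P [M HM]. exists (Rmax 0 (M / (x ^ 2 / 4))). intros t Ht. apply HM.
      assert (0 < t) by (eapply Rle_lt_trans; [apply Rmax_l|exact Ht]).
      assert (M / (x ^ 2 / 4) < t) by (eapply Rle_lt_trans; [apply Rmax_r|exact Ht]).
      assert (t < exp (2 * t)) by (pose proof (exp_ineq1_le (2 * t)); lra).
      apply (Rmult_lt_compat_l (x ^ 2 / 4)) in H0; trivial. replace (x ^ 2 / 4 * (M / (x ^ 2 / 4))) with M in H0 by (field; lra).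
      apply (Rmult_lt_compat_l (x ^ 2 / 4)) in H1; trivial. lra. }
  assert (Ek : kmom mu 0 d' = l1 - l0) by exact E.
  rewrite V, Ek. replace (2 * l1 - 2 * RInt f 1 (x ^ 2 / 4) - 2 * (l1 - l0)) with (2 * (l0 - RInt f 1 (x ^ 2 / 4))) by ring.
  rewrite Rabs_mult, (Rabs_pos_eq 2) by lra. apply Rmult_le_compat_l. lra.
  apply (filterlim_le (F := at_right 0) (fun a => Rabs (RInt f 1 a - RInt f 1 (x ^ 2 / 4))) (fun _ => 1 - gam (x ^ 2 / 4)) (Rabs (l0 - RInt f 1 (x ^ 2 / 4))) (1 - gam (x ^ 2 / 4))).
  - generalize (at_right0_lt _ Hx4). apply filter_imp. intros a Ha.
    assert (CK : cont_pos kap) by apply cont_pos_kap.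
    replace (RInt f 1 a - RInt f 1 (x ^ 2 / 4)) with (- RInt f a (x ^ 2 / 4)).
    2:{ pose proof (RInt_Chasles f 1 a (x ^ 2 / 4) (ex_RInt_pos f 1 a Cf Rlt_0_1 (proj1 Ha)) (ex_RInt_pos f a _ Cf (proj1 Ha) Hx4)) as Q.
        unfold plus in Q; simpl in Q. simpl. lra. }
    rewrite Rabs_Ropp. apply Rle_trans with (RInt kap a (x ^ 2 / 4)).
    + apply RInt_abs_le; try (apply ex_RInt_pos; trivial; lra). lra. intros t Ht. unfold f.
      pose proof (kap_nonneg t ltac:(lra)). rewrite Rabs_mult, pow_O, Rmult_1_l, (Rabs_pos_eq (kap t)) by trivial.
      assert (Rabs (cos (mu * ln t + d')) <= 1) by (apply Rabs_le, COS_bound). pose proof (Rabs_pos (cos (mu * ln t + d'))). nra.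
    + assert (R : is_RInt kap a (x ^ 2 / 4) (- gam (x ^ 2 / 4) - - gam a)).
      { apply (is_RInt_derive (fun w => - gam w) kap).
        - intros w Hw. rewrite Rmin_left in Hw by lra. pose proof (is_derive_gam w ltac:(lra)) as D.
          apply (is_derive_opp gam) in D. eapply is_derive_eq. exact D. unfold opp; simpl; ring.
        - intros w Hw. rewrite Rmin_left in Hw by lra. apply CK; lra. }
      rewrite (is_RInt_unique _ _ _ _ R). pose proof (gam_le_1 a ltac:(lra)). lra.
  - apply (lim_continuous _ (fun a => RInt f 1 a - RInt f 1 (x ^ 2 / 4)) Rabs).
    apply lim_minus; trivial. apply within_filter, locally_filter. apply filterlim_const. apply continuous_Rabs.
  - apply filterlim_const.
Qed.

(** Replacing [sinh t] by [exp t / 2] costs O(x); the new integral is a truncated Mellin moment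
    whose phase carries [ln (x / 2)]. *)
Lemma asymp_eta_integral (d : R) :
  asymp (fun x => half_int (fun t => 4 * eta (x ^ 2 * sinh t ^ 2) * cos (n * t + d))) (fun x => 2 * kmom mu 0 (d - n * ln (x / 2))).
Proof.
  destruct eta_lipschitz as [L [HL B]]. unfold asymp.
  apply (lim_at_squeeze _ _ (fun x => 4 * L * PI * x + 2 * (1 - gam (x ^ 2 / 4)))).
  - generalize at_right0_pos. apply filter_imp. intros x Hx. rewrite Rminus_0_r.
    destruct (shifted_phase_integral x d Hx) as [I2 E2].
    assert (I1 : integrable (fun t => 4 * eta (x ^ 2 * sinh t ^ 2) * cos (n * t + d))).
    { apply (integrable_rapid (fun w => 4 * eta w)); trivial. apply rapid_scal, rapid_eta. apply unit_bounded_cos. }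
    set (u := half_int (fun t => 4 * eta (x ^ 2 * sinh t ^ 2) * cos (n * t + d))).
    set (v := half_int (fun t => 4 * eta (x ^ 2 * (exp t / 2) ^ 2) * cos (n * t + d))) in *.
    replace (u - 2 * kmom mu 0 (d - n * ln (x / 2))) with ((u - v) + (v - 2 * kmom mu 0 (d - n * ln (x / 2)))) by ring.
    eapply Rle_trans. apply Rabs_triang. apply Rplus_le_compat; trivial.
    unfold u, v. rewrite <- half_int_minus by trivial.
    replace (4 * L * PI * x) with (4 * L * x * PI) by ring. apply half_int_dominated. split.
    destruct (integrable_minus _ _ I1 I2) as [? [? _]]; trivial.
    intros t Ht. rewrite <- Rmult_minus_distr_r. rewrite <- Rmult_minus_distr_l. rewrite !Rabs_mult, (Rabs_pos_eq 4) by lra.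
    pose proof (sinh_pos t Ht). pose proof (exp_pos (- t)).
    assert (ES : exp t / 2 - sinh t = exp (- t) / 2) by (unfold sinh; field).
    specialize (B (x * sinh t) (x * (exp t / 2)) ltac:(nra) ltac:(nra)). rewrite !Rpow_mult_distr in B.
    replace (x * (exp t / 2) - x * sinh t) with (x * (exp (- t) / 2)) in B by (rewrite <- ES; ring).
    set (a := Rabs (eta _ - eta _)) in *. assert (0 <= a) by apply Rabs_pos.
    assert (Rabs (cos (n * t + d)) <= 1) by (apply Rabs_le, COS_bound). pose proof (Rabs_pos (cos (n * t + d))).
    pose proof (exp_neg_delta t Ht).
    apply Rle_trans with (4 * a). nra.
    apply Rle_trans with (2 * L * x * exp (- t)). lra.
    replace (4 * L * x * delta t) with (2 * L * x * (2 * delta t)) by ring. apply Rmult_le_compat_l; trivial.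
    apply Rlt_le. apply Rmult_lt_0_compat; lra.
  - rewrite <- (Rplus_0_r 0) at 2. assert (F0 : Filter (at_right 0)) by (apply within_filter, locally_filter).
    apply lim_plus; trivial.
    + apply lim_scal0; trivial. apply (continuous_at_right (fun x => x)). apply continuous_id.
    + apply lim_scal0; trivial.
      apply (filterlim_comp _ _ _ (fun x => x ^ 2 / 4) (fun w => 1 - gam w) (at_right 0) (at_right 0)). 2: apply lim_gam_0.
      intros P [e He]. assert (0 < Rmin 1 e) by (apply Rmin_glb_lt; [lra|apply cond_pos]).
      generalize (at_right0_lt _ H). unfold filtermap. apply filter_imp. intros x Hx. apply He. 2: nra.
      assert (x < 1) by (eapply Rlt_le_trans; [apply Hx|apply Rmin_l]). assert (x < e) by (eapply Rlt_le_trans; [apply Hx|apply Rmin_r]).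
      unfold ball; simpl; unfold AbsRing_ball, minus, plus, opp, abs; simpl. rewrite Ropp_0, Rplus_0_r, Rabs_pos_eq; nra.
Qed.

Let S2 := sech_int n 1.

Lemma asymp_nint2 : asymp (nint n gN2) (fun x => 2 * S2 * cos (2 * phs mu x)).
Proof.
  generalize (asymp_eta_integral 0). apply asymp_ext; intros x Hx.
  - reflexivity.
  - rewrite kmom_0_value by lra. fold n S2. unfold phs.
    rewrite <- cos_neg. replace (- (0 - n * ln (x / 2) - 2 * gamma_phase mu)) with (2 * (mu * ln (x / 2) + gamma_phase mu)) by (unfold n; ring). ring.
Qed.

Lemma Hn : 0 < n.
Proof. unfold n; lra. Qed.

(** [coth t = 1 + exp (- t) / sinh t], and the second part contributes O(x) because
    [x * sinh t * kap (x ^ 2 * sinh t ^ 2)] is bounded. The first part is a cosine integral with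
    phase [- (PI / 2)], the case of [asymp_eta_integral]. *)
Lemma integrable_coth_eta (x : R) : 0 < x -> integrable (fun t => 4 * (cosh t / sinh t) * eta (x ^ 2 * sinh t ^ 2) * sin (n * t + 0)) /\
  exists K, 0 < K /\ forall x, 0 < x -> integrable (fun t => 4 * (cosh t / sinh t) * eta (x ^ 2 * sinh t ^ 2) * sin (n * t + 0)) /\
  Rabs (half_int (fun t => 4 * (cosh t / sinh t) * eta (x ^ 2 * sinh t ^ 2) * sin (n * t + 0)) -
        half_int (fun t => 4 * eta (x ^ 2 * sinh t ^ 2) * cos (n * t + - (PI / 2)))) <= K * x.
Proof.
  destruct root_kap_bound as [K [HK B]].
  assert (G : forall x, 0 < x -> integrable (fun t => 4 * (cosh t / sinh t) * eta (x ^ 2 * sinh t ^ 2) * sin (n * t + 0)) /\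
  Rabs (half_int (fun t => 4 * (cosh t / sinh t) * eta (x ^ 2 * sinh t ^ 2) * sin (n * t + 0)) -
        half_int (fun t => 4 * eta (x ^ 2 * sinh t ^ 2) * cos (n * t + - (PI / 2)))) <= 8 * K * PI * x).
  { clear x. intros x Hx. pose proof Hn as Hn.
    assert (SC : forall t, cos (n * t + - (PI / 2)) = sin (n * t + 0)).
    { intros t. rewrite Rplus_0_r. replace (n * t + - (PI / 2)) with (- (PI / 2 - n * t)) by ring. rewrite cos_neg. apply cos_shift. }
    assert (I1 : integrable (fun t => 4 * eta (x ^ 2 * sinh t ^ 2) * cos (n * t + - (PI / 2)))).
    { apply (integrable_rapid (fun w => 4 * eta w)); trivial. apply rapid_scal, rapid_eta. apply unit_bounded_cos. }
    assert (D : dominated (8 * K * x) (fun t => 4 * (exp (- t) / sinh t * eta (x ^ 2 * sinh t ^ 2) * sin (n * t + 0)))).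
    { split.
      - intros t Ht. pose proof (sinh_pos t Ht). apply (continuous_scal_r 4 (fun t => exp (- t) / sinh t * eta (x ^ 2 * sinh t ^ 2) * sin (n * t + 0))).
        apply (continuous_mult (fun t => exp (- t) / sinh t * eta (x ^ 2 * sinh t ^ 2))).
        apply (continuous_mult (fun t => exp (- t) / sinh t)).
        apply (ex_derive_continuous (fun t => exp (- t) / sinh t)). auto_derive. lra.
        apply continuous_sinh_comp; trivial. apply rapid_eta.
        apply (ex_derive_continuous (fun t => sin (n * t + 0))). auto_derive; trivial.
      - intros t Ht. pose proof (sinh_pos t Ht). pose proof (exp_pos (- t)).
        specialize (B (x * sinh t) ltac:(nra)). rewrite Rpow_mult_distr in B. destruct B as [B _].
        pose proof (kap_nonneg _ (sinh_sq_pos x t Hx Ht)). unfold eta.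
        set (k := kap (x ^ 2 * sinh t ^ 2)) in *.
        replace (4 * (exp (- t) / sinh t * (x ^ 2 * sinh t ^ 2 * k) * sin (n * t + 0))) with (4 * x * exp (- t) * (x * sinh t * k) * sin (n * t + 0)) by (field; lra).
        rewrite Rabs_mult. assert (0 <= x * sinh t * k) by (apply Rmult_le_pos; nra).
        rewrite Rabs_pos_eq by (apply Rmult_le_pos; [apply Rmult_le_pos; lra|trivial]).
        assert (Rabs (sin (n * t + 0)) <= 1) by (apply Rabs_le, SIN_bound). pose proof (Rabs_pos (sin (n * t + 0))).
        pose proof (exp_neg_delta t Ht).
        assert (P : 0 <= 4 * x * exp (- t)) by (apply Rmult_le_pos; lra).
        apply Rle_trans with (4 * x * exp (- t) * K * 1).
        apply Rmult_le_compat; trivial. apply Rmult_le_pos; trivial. apply Rmult_le_compat_l; trivial.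
        replace (8 * K * x * delta t) with (4 * x * K * (2 * delta t)) by ring.
        replace (4 * x * exp (- t) * K * 1) with (4 * x * K * exp (- t)) by ring.
        apply Rmult_le_compat_l; trivial. apply Rmult_le_pos; lra. }
    assert (E : forall t, 0 < t -> 4 * eta (x ^ 2 * sinh t ^ 2) * cos (n * t + - (PI / 2)) + 4 * (exp (- t) / sinh t * eta (x ^ 2 * sinh t ^ 2) * sin (n * t + 0))
       = 4 * (cosh t / sinh t) * eta (x ^ 2 * sinh t ^ 2) * sin (n * t + 0)).
    { intros t Ht. pose proof (sinh_pos t Ht). rewrite SC. replace (cosh t) with (sinh t + exp (- t)) by (unfold cosh, sinh; field). field. lra. }
    assert (I2 : integrable (fun t => 4 * (exp (- t) / sinh t * eta (x ^ 2 * sinh t ^ 2) * sin (n * t + 0)))) by (exists (8 * K * x); exact D).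
    pose proof (integrable_plus _ _ I1 I2) as I3.
    assert (I4 : integrable (fun t => 4 * (cosh t / sinh t) * eta (x ^ 2 * sinh t ^ 2) * sin (n * t + 0))).
    { destruct I3 as [L [C3 D3]]. exists L. split.
      - intros t Ht. pose proof (sinh_pos t Ht).
        apply (continuous_mult (fun t => 4 * (cosh t / sinh t) * eta (x ^ 2 * sinh t ^ 2))).
        apply (continuous_mult (fun t => 4 * (cosh t / sinh t))).
        apply (ex_derive_continuous (fun t => 4 * (cosh t / sinh t))). auto_derive. lra.
        apply continuous_sinh_comp; trivial. apply rapid_eta.
        apply (ex_derive_continuous (fun t => sin (n * t + 0))). auto_derive; trivial.
      - intros t Ht. rewrite <- E by trivial. auto. }
    split; trivial.
    rewrite <- (half_int_ext _ _ E I3). rewrite half_int_plus by trivial.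
    match goal with |- Rabs (?a + ?b - ?a) <= _ => replace (a + b - a) with b by ring end.
    apply half_int_dominated in D. replace (8 * K * PI * x) with (8 * K * x * PI) by ring. apply D. }
  intros Hx. split. apply G; trivial. exists (8 * K * PI). split. pose proof PI_RGT_0. nra. exact G.
Qed.

(** As [x] tends to 0, [gam (x ^ 2 * sinh t ^ 2)] tends to 1 and loses its decay in [t]; integrating
    the cosine replaces [gam] by [eta], whose asymptotics are known. *)
Lemma nint1_by_parts (x : R) : 0 < x ->
  n * nint n gN1 x = - half_int (fun t => 4 * (cosh t / sinh t) * eta (x ^ 2 * sinh t ^ 2) * sin (n * t + 0)).
Proof.
  intros Hx. pose proof Hn as Hn. destruct (integrable_coth_eta x Hx) as [I1 _].
  assert (I2 : integrable (fun t => gN1 (x ^ 2 * sinh t ^ 2) * cos (n * t + 0))).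
  { apply (integrable_rapid gN1); trivial. apply rapid_gN. apply unit_bounded_cos. }
  pose proof (integrable_plus _ _ (integrable_scal _ n I2) I1) as I3.
  assert (Z := half_int_FTC0 (fun t => -2 * sin (n * t + 0) * gam (x ^ 2 * sinh t ^ 2)) _ I3).
  rewrite half_int_plus, half_int_scal in Z; trivial. 2: apply integrable_scal; trivial.
  unfold nint.
  match type of Z with _ -> _ -> _ -> ?a + ?b = 0 => assert (Q : a + b = 0) end.
  { apply Z; clear Z.
    - intros t Ht. pose proof (sinh_sq_pos x t Hx Ht) as W. pose proof (sinh_pos t Ht).
      pose proof (is_derive_sinh_comp gam x t _ (is_derive_gam _ W)) as DG.
      unfold gN1, eta.
      set (g := fun t => gam (x ^ 2 * sinh t ^ 2)) in *.
      change (gam (x ^ 2 * sinh t ^ 2)) with (g t) in *.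
      change (is_derive g t (- kap (x ^ 2 * sinh t ^ 2) * (2 * x ^ 2 * sinh t * cosh t))) in DG.
      set (k := kap (x ^ 2 * sinh t ^ 2)) in *.
      change (is_derive (fun t => -2 * sin (n * t + 0) * g t) t (n * (-2 * g t * cos (n * t + 0)) + 4 * (cosh t / sinh t) * (x ^ 2 * sinh t ^ 2 * k) * sin (n * t + 0))).
      clearbody g k. auto_derive. exact (ex_intro _ _ DG). drw DG. field. lra.
    - apply (rapid_boundary gam (fun t => -2 * sin (n * t + 0)) x (2 * n)); trivial. apply rapid_gam.
      intros t Ht. rewrite Rabs_mult, Rabs_left by lra. pose proof (sin_le_sinh_cosh n Hn t Ht).
      replace (2 * n * (sinh t * cosh t)) with (- (-2) * (n * (sinh t * cosh t))) by ring. apply Rmult_le_compat_l; lra.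
    - apply (rapid_boundary gam (fun t => -2 * sin (n * t + 0)) x (2 * n)); trivial. apply rapid_gam.
      intros t Ht. rewrite Rabs_mult, Rabs_left by lra. pose proof (sin_le_sinh_cosh n Hn t Ht).
      replace (2 * n * (sinh t * cosh t)) with (- (-2) * (n * (sinh t * cosh t))) by ring. apply Rmult_le_compat_l; lra. }
  lra.
Qed.

Lemma asymp_nint1 : asymp (nint n gN1) (fun x => S2 / mu * sin (2 * phs mu x)).
Proof.
  pose proof Hn as Hn. destruct (integrable_coth_eta 1 Rlt_0_1) as [_ [K [HK B]]].
  assert (A : asymp (fun x => half_int (fun t => 4 * (cosh t / sinh t) * eta (x ^ 2 * sinh t ^ 2) * sin (n * t + 0)))
     (fun x => 2 * kmom mu 0 (- (PI / 2) - n * ln (x / 2)))).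
  { pose proof (asymp_eta_integral (- (PI / 2))) as A1. unfold asymp in *.
    apply (lim_at_squeeze _ _ (fun x => K * x + Rabs (half_int (fun t => 4 * eta (x ^ 2 * sinh t ^ 2) * cos (n * t + - (PI / 2))) - 2 * kmom mu 0 (- (PI / 2) - n * ln (x / 2))))).
    - generalize at_right0_pos. apply filter_imp. intros x Hx. rewrite Rminus_0_r. destruct (B x Hx) as [_ B'].
      match goal with |- Rabs (?a - ?b) <= _ + Rabs (?c - ?b) => replace (a - b) with ((a - c) + (c - b)) by ring end.
      eapply Rle_trans. apply Rabs_triang. lra.
    - rewrite <- (Rplus_0_r 0) at 2. assert (F0 : Filter (at_right 0)) by (apply within_filter, locally_filter).
      apply lim_plus; trivial. apply lim_scal0; trivial. apply (continuous_at_right (fun x => x)). apply continuous_id.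
      apply lim_abs0; trivial. }
  generalize (asymp_scal (- / n) _ _ A). apply asymp_ext; intros x Hx.
  - pose proof (nint1_by_parts x Hx) as E.
    match goal with |- - / n * ?a = _ => replace a with (- (n * nint n gN1 x)) by lra end. field. lra.
  - rewrite kmom_0_value by lra. fold n S2. unfold phs.
    replace (- (PI / 2) - n * ln (x / 2) - 2 * gamma_phase mu) with (- (PI / 2 + 2 * (mu * ln (x / 2) + gamma_phase mu))) by (unfold n; ring).
    rewrite cos_neg, cos_plus, cos_PI2, sin_PI2. unfold n. field. lra.
Qed.

(** Half of the cofactor of [gam] once [n ^ 2 * kap + gN2] has been integrated by parts. It does not
    depend on [x], so letting [gam] tend to 1 gives the limit. *)
Definition e0 (t : R) : R := n * sin (n * t + 0) / (sinh t * cosh t) + sech t ^ 2 * cos (n * t + 0).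
Definition c0 : R := half_int e0.

Lemma tanh_ge (t : R) : 0 < t -> t / (1 + t) <= tanh t.
Proof.
  intros Ht. pose proof (sinh_pos t Ht). pose proof (cosh_ge_1 t). pose proof (sinh_ge t ltac:(lra)).
  unfold tanh. apply (Rmult_le_reg_r ((1 + t) * cosh t)). apply Rmult_lt_0_compat; lra.
  replace (t / (1 + t) * ((1 + t) * cosh t)) with (t * cosh t) by (field; lra).
  replace (sinh t / cosh t * ((1 + t) * cosh t)) with (sinh t + t * sinh t) by (field; lra).
  replace (cosh t) with (sinh t + exp (- t)) by (unfold cosh, sinh; field).
  assert (exp (- t) <= 1). { rewrite <- exp_0. apply Rlt_le, exp_increasing. lra. } nra.
Qed.

Lemma sin_le_tanh (t : R) : 0 < t -> Rabs (sin (n * t + 0)) <= (1 + n) * tanh t.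
Proof.
  intros Ht. pose proof Hn as Hn. pose proof (tanh_ge t Ht) as T. rewrite Rplus_0_r.
  apply Rle_trans with ((1 + n) * (t / (1 + t))). 2: apply Rmult_le_compat_l; lra.
  assert (Rabs (sin (n * t)) <= 1) by (apply Rabs_le, SIN_bound). pose proof (sin_abs_le (n * t) ltac:(nra)).
  apply (Rmult_le_reg_r (1 + t)). lra. replace ((1 + n) * (t / (1 + t)) * (1 + t)) with ((1 + n) * t) by (field; lra).
  pose proof (Rabs_pos (sin (n * t))). nra.
Qed.

Lemma e0_bound (t : R) : 0 < t -> Rabs (e0 t) <= (n ^ 2 + n + 1) * sech t ^ 2.
Proof.
  intros Ht. pose proof Hn as Hn. pose proof (sinh_pos t Ht). pose proof (cosh_ge_1 t). pose proof (sin_le_tanh t Ht) as B. unfold e0.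
  eapply Rle_trans. apply Rabs_triang. pose proof (sech_bound t) as [[S1 _] _].
  rewrite !Rabs_mult. unfold Rdiv. rewrite !Rabs_mult, (Rabs_pos_eq n), (Rabs_pos_eq (/ (sinh t * cosh t))), (Rabs_pos_eq (sech t ^ 2)).
  2: nra. 2: apply Rlt_le, Rinv_0_lt_compat; nra. 2: lra.
  assert (Rabs (cos (n * t + 0)) <= 1) by (apply Rabs_le, COS_bound).
  assert (I : 0 < / (sinh t * cosh t)) by (apply Rinv_0_lt_compat; nra).
  assert (n * Rabs (sin (n * t + 0)) * / (sinh t * cosh t) <= (n ^ 2 + n) * sech t ^ 2).
  { replace ((n ^ 2 + n) * sech t ^ 2) with (n * ((1 + n) * tanh t) * / (sinh t * cosh t)) by (unfold tanh, sech; field; lra).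
    apply Rmult_le_compat_r. lra. apply Rmult_le_compat_l; lra. }
  assert (0 <= sech t ^ 2) by nra. nra.
Qed.

Lemma cont_pos_e0 : cont_pos e0.
Proof.
  intros t Ht. pose proof (sinh_pos t Ht). pose proof (cosh_ge_1 t).
  apply (ex_derive_continuous e0). unfold e0, sech. auto_derive. repeat split; trivial; nra.
Qed.

Lemma integrable_e0 : integrable e0.
Proof.
  pose proof Hn as Hn. apply (integrable_exp _ ((n ^ 2 + n + 1) * 2)). apply cont_pos_e0.
  intros t Ht. eapply Rle_trans. apply e0_bound; trivial. pose proof (sech_bound t) as [[S1 S2'] S3].
  rewrite Rmult_assoc. apply Rmult_le_compat_l. nra. nra.
Qed.

Lemma nint0_by_parts (x : R) : 0 < x -> integrable (fun t => gam (x ^ 2 * sinh t ^ 2) * e0 t) /\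
  n ^ 2 * nint n kap x + nint n gN2 x = 2 * half_int (fun t => gam (x ^ 2 * sinh t ^ 2) * e0 t).
Proof.
  intros Hx. pose proof Hn as Hn. pose proof (unit_bounded_cos n 0) as U.
  assert (I1 : integrable (fun t => gam (x ^ 2 * sinh t ^ 2) * e0 t)).
  { destruct integrable_e0 as [K [C D]]. exists K. split.
    - intros t Ht. apply (continuous_mult (fun t => gam (x ^ 2 * sinh t ^ 2)) e0); auto. apply continuous_sinh_comp; trivial. apply cont_pos_gam.
    - intros t Ht. rewrite Rabs_mult. pose proof (sinh_sq_pos x t Hx Ht) as W. pose proof (gam_le_1 _ W). destruct (gam_bound _ W) as [G _].
      rewrite (Rabs_pos_eq (gam _)) by trivial. specialize (D t Ht). pose proof (Rabs_pos (e0 t)). nra. }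
  split; trivial.
  assert (I2 : integrable (fun t => kap (x ^ 2 * sinh t ^ 2) * cos (n * t + 0))) by (apply (integrable_rapid kap); trivial; apply rapid_kap).
  assert (I3 : integrable (fun t => gN2 (x ^ 2 * sinh t ^ 2) * cos (n * t + 0))) by (apply (integrable_rapid gN2); trivial; apply rapid_gN).
  pose proof (integrable_minus _ _ (integrable_plus _ _ (integrable_scal _ (n ^ 2) I2) I3) (integrable_scal _ 2 I1)) as I4.
  (* The term with [tanh t] reproduces [gN2], and its other contribution turns the [coth t] coming
     from the derivative of [kap] into [coth t - tanh t = / (sinh t * cosh t)], which decays. *)
  assert (Z := half_int_FTC0 (fun t => n * sin (n * t + 0) * kap (x ^ 2 * sinh t ^ 2) + -2 * tanh t * cos (n * t + 0) * gam (x ^ 2 * sinh t ^ 2)) _ I4).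
  rewrite half_int_minus, half_int_plus, !half_int_scal in Z; trivial; try (apply integrable_scal; trivial); try (apply integrable_plus; trivial; apply integrable_scal; trivial).
  unfold nint. apply Rminus_diag_uniq.
  assert (BB : (filterlim (fun t => n * sin (n * t + 0) * kap (x ^ 2 * sinh t ^ 2) + -2 * tanh t * cos (n * t + 0) * gam (x ^ 2 * sinh t ^ 2)) (at_right 0) (locally 0) /\
     filterlim (fun t => n * sin (n * t + 0) * kap (x ^ 2 * sinh t ^ 2) + -2 * tanh t * cos (n * t + 0) * gam (x ^ 2 * sinh t ^ 2)) at_infty (locally 0))).
  { apply lim0_plus.
    - apply (rapid_boundary kap (fun t => n * sin (n * t + 0)) x (n * n)); trivial. apply rapid_kap.
      intros t Ht. rewrite Rabs_mult, Rabs_pos_eq by lra. pose proof (sin_le_sinh_cosh n Hn t Ht).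
      replace (n * n * (sinh t * cosh t)) with (n * (n * (sinh t * cosh t))) by ring. apply Rmult_le_compat_l; lra.
    - apply (rapid_boundary gam (fun t => -2 * tanh t * cos (n * t + 0)) x 2); trivial. apply rapid_gam.
      intros t Ht. rewrite !Rabs_mult, (Rabs_left (-2)) by lra. pose proof (sinh_pos t Ht). pose proof (cosh_ge_1 t).
      assert (Rabs (cos (n * t + 0)) <= 1) by (apply Rabs_le, COS_bound). pose proof (Rabs_pos (cos (n * t + 0))).
      assert (0 < tanh t) by (apply Rdiv_lt_0_compat; lra). rewrite (Rabs_pos_eq (tanh t)) by lra.
      assert (tanh t <= sinh t * cosh t).
      { unfold tanh, Rdiv. apply Rmult_le_compat_l. lra. apply Rle_trans with 1; trivial. rewrite <- Rinv_1. apply Rinv_le_contravar; lra. }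
      nra. }
  apply Z; try apply BB.
  intros t Ht. pose proof (sinh_sq_pos x t Hx Ht) as W. pose proof (sinh_pos t Ht). pose proof (cosh_ge_1 t).
  pose proof (is_derive_sinh_comp kap x t _ (is_derive_kap _ W)) as DK.
  pose proof (is_derive_sinh_comp gam x t _ (is_derive_gam _ W)) as DG.
  pose proof (is_derive_tanh t) as DT.
  unfold gN2, e0, sech. unfold sech in DT.
  pose proof (cosh_sinh_sqr t) as Q.
  set (k := fun t => kap (x ^ 2 * sinh t ^ 2)) in *. set (g := fun t => gam (x ^ 2 * sinh t ^ 2)) in *.
  change (kap (x ^ 2 * sinh t ^ 2)) with (k t) in *. change (gam (x ^ 2 * sinh t ^ 2)) with (g t) in *.
  change (is_derive (fun t => n * sin (n * t + 0) * k t + -2 * tanh t * cos (n * t + 0) * g t) t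
    (n ^ 2 * (k t * cos (n * t + 0)) + 4 * (x ^ 2 * sinh t ^ 2 * k t) * cos (n * t + 0) -
     2 * (g t * (n * sin (n * t + 0) / (sinh t * cosh t) + (/ cosh t) ^ 2 * cos (n * t + 0))))).
  change (is_derive k t (- g t / (x ^ 2 * sinh t ^ 2) * (2 * x ^ 2 * sinh t * cosh t))) in DK.
  change (is_derive g t (- k t * (2 * x ^ 2 * sinh t * cosh t))) in DG.
  clearbody k g. auto_derive. split; [exact (ex_intro _ _ DK)|split;[exact (ex_intro _ _ DT)|split; trivial; exact (ex_intro _ _ DG)]].
  drw DK. drw DG. drw DT.
  set (co := cos (n * t + 0)). set (si := sin (n * t + 0)). unfold tanh.
  apply (Rmult_eq_reg_r (cosh t ^ 2 * sinh t)); [|apply Rmult_integral_contrapositive; split; [apply pow_nonzero|]; lra].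
  field_simplify; try lra. replace (cosh t ^ 4) with ((1 + sinh t ^ 2) * (1 + sinh t ^ 2)) by (rewrite <- Q; ring).
  try replace (cosh t ^ 3) with (cosh t * (1 + sinh t ^ 2)) by (rewrite <- Q; ring).
  replace (cosh t ^ 2) with (1 + sinh t ^ 2) by lra. ring.
Qed.

(** [1 - gam] is at most of order [x * sinh t] by [one_minus_gam], and [e0] is bounded by a multiple
    of [sech t ^ 2], so the error is O(x). *)
Lemma asymp_nint0 : asymp (fun x => n ^ 2 * nint n kap x + nint n gN2 x) (fun _ => 2 * c0).
Proof.
  pose proof Hn as Hn. destruct one_minus_gam as [K [HK B]]. unfold asymp.
  set (L := K * (n ^ 2 + n + 1)). assert (HL : 0 < L) by (unfold L; nra).
  apply (lim_at_squeeze _ _ (fun x => 8 * L * PI * x)).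
  - generalize at_right0_pos. apply filter_imp. intros x Hx. rewrite Rminus_0_r.
    destruct (nint0_by_parts x Hx) as [I E]. rewrite E. unfold c0. rewrite <- Rmult_minus_distr_l, <- half_int_minus by (trivial; apply integrable_e0).
    rewrite Rabs_mult, (Rabs_pos_eq 2) by lra. replace (8 * L * PI * x) with (2 * (4 * L * x * PI)) by ring. apply Rmult_le_compat_l. lra.
    apply half_int_dominated. split. destruct (integrable_minus _ _ I integrable_e0) as [? [? _]]; trivial.
    intros t Ht. pose proof (sinh_pos t Ht). specialize (B _ (sinh_sq_pos x t Hx Ht)).
    assert (SQ : sqrt (x ^ 2 * sinh t ^ 2) = x * sinh t).
    { replace (x ^ 2 * sinh t ^ 2) with ((x * sinh t) * (x * sinh t)) by ring. apply sqrt_square. nra. }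
    rewrite SQ in B. replace (gam (x ^ 2 * sinh t ^ 2) * e0 t - e0 t) with (- ((1 - gam (x ^ 2 * sinh t ^ 2)) * e0 t)) by ring.
    rewrite Rabs_Ropp, Rabs_mult, (Rabs_pos_eq (1 - _)) by lra. pose proof (e0_bound t Ht). pose proof (Rabs_pos (e0 t)).
    pose proof (sech_bound t) as [[S1 S2'] S3]. pose proof (exp_neg_delta t Ht).
    apply Rle_trans with (K * (x * sinh t) * ((n ^ 2 + n + 1) * sech t ^ 2)). apply Rmult_le_compat; lra.
    replace (K * (x * sinh t) * ((n ^ 2 + n + 1) * sech t ^ 2)) with (L * x * (sinh t * sech t ^ 2)) by (unfold L; ring).
    replace (4 * L * x * delta t) with (L * x * (2 * (2 * delta t))) by ring. apply Rmult_le_compat_l. nra.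
    apply Rle_trans with (sech t). 2: lra.
    replace (sinh t * sech t ^ 2) with (tanh t * sech t). 2:{ unfold tanh, sech. pose proof (cosh_ge_1 t). field. lra. }
    pose proof (tanh_bound t). nra.
  - apply lim_scal0. apply within_filter, locally_filter. apply (continuous_at_right (fun x => x)). apply continuous_id.
Qed.
End Asymptotics.

(** * The integral of cos (n t) / (sinh^2 t + e) *)

Lemma zero_derivative_const (f : R -> R) (a b : R) :
  (forall x, Rmin a b <= x <= Rmax a b -> is_derive f x 0) -> f b = f a.
Proof.
  intros H. destruct (MVT_gen f a b (fun _ => 0)) as [c [_ Ec]].
  - intros x Hx. apply H. lra.
  - intros x Hx. apply continuity_pt_filterlim. eapply is_derive_continuous, H. exact Hx.
  - lra.
Qed.

Section Kernel.
Variable mu : R.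
Hypothesis Hmu : 0 < mu.
Let n := 2 * mu.
Let S2 := sech_int n 1.

Definition kerB (e t : R) : R := cos (n * t + 0) / (sinh t ^ 2 + e).
(** Used twice: at [e = cosh u ^ 2] it yields the coefficients, and at [e = cos th ^ 2] with [th]
    near [PI / 2] it yields the constants [S2] and [c0]. *)
Definition Bint (e : R) : R := half_int (kerB e).
Definition kerS (e t : R) : R := sin (n * t + 0) * tanh t * ((1 - e) / (sinh t ^ 2 + e)).
(** The companion of [Bint] in a first-order system in [e]; the factor [1 - e] of [kerS] makes the
    value at [e = 1] explicit. *)
Definition Sint (e : R) : R := n * half_int (kerS e) + S2.

Lemma denominator_bound (e0 e t : R) : 0 < e0 -> e0 <= e ->
  0 < sinh t ^ 2 + e /\ / (sinh t ^ 2 + e) <= / Rmin 1 e0 * sech t ^ 2.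
Proof.
  intros He0 He. set (m := Rmin 1 e0). assert (Hm : 0 < m) by (apply Rmin_glb_lt; lra).
  assert (m <= 1) by apply Rmin_l. assert (m <= e0) by apply Rmin_r.
  pose proof (pow2_ge_0 (sinh t)). pose proof (cosh_ge_1 t). pose proof (cosh_sinh_sqr t) as Q.
  split. lra. unfold sech. rewrite pow_inv.
  rewrite <- Rinv_mult. apply Rinv_le_contravar. apply Rmult_lt_0_compat; trivial. apply pow_lt; lra.
  rewrite Q. nra.
Qed.

Lemma sech_sq_exp (t : R) : 0 < t -> 0 <= sech t ^ 2 <= 2 * exp (- t).
Proof. intros Ht. pose proof (sech_bound t) as [[S1 S3] S4]. split; nra. Qed.

Lemma Rabs_cos_le (x : R) : Rabs (cos x) <= 1.
Proof. apply Rabs_le, COS_bound. Qed.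
Lemma Rabs_sin_le (x : R) : Rabs (sin x) <= 1.
Proof. apply Rabs_le, SIN_bound. Qed.

Lemma unit_times_denominator (ph : R -> R) (e K : R) : 0 < e -> cont_pos ph -> (forall t, 0 < t -> Rabs (ph t) <= K) ->
  integrable (fun t => ph t / (sinh t ^ 2 + e)).
Proof.
  intros He C B. apply (integrable_exp _ (K * (/ Rmin 1 e * 2))).
  - intros t Ht. apply (continuous_mult ph (fun t => / (sinh t ^ 2 + e))); auto.
    apply (ex_derive_continuous (fun t => / (sinh t ^ 2 + e))). auto_derive. destruct (denominator_bound e e t He (Rle_refl e)). simpl in *; lra.
  - intros t Ht. destruct (denominator_bound e e t He (Rle_refl e)) as [D1 D2]. pose proof (sech_sq_exp t Ht).
    specialize (B t Ht). pose proof (Rabs_pos (ph t)). unfold Rdiv. rewrite Rabs_mult, (Rabs_pos_eq (/ _)).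
    2: apply Rlt_le, Rinv_0_lt_compat; trivial.
    assert (0 < / Rmin 1 e) by (apply Rinv_0_lt_compat, Rmin_glb_lt; lra).
    assert (0 < / (sinh t ^ 2 + e)) by (apply Rinv_0_lt_compat; trivial).
    rewrite Rmult_assoc. apply Rmult_le_compat; trivial. lra. rewrite Rmult_assoc. eapply Rle_trans. apply D2. apply Rmult_le_compat_l; lra.
Qed.

Lemma integrable_kerB (e : R) : 0 < e -> integrable (kerB e).
Proof.
  intros He. apply (unit_times_denominator (fun t => cos (n * t + 0)) e 1 He).
  intros t _. apply (ex_derive_continuous (fun t => cos (n * t + 0))). auto_derive; trivial.
  intros; apply Rabs_cos_le.
Qed.

Lemma integrable_kerS (e : R) : 0 < e -> integrable (kerS e).
Proof.
  intros He.
  assert (I : integrable (fun t => (1 - e) * (sin (n * t + 0) * tanh t / (sinh t ^ 2 + e)))).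
  { apply integrable_scal. apply (unit_times_denominator (fun t => sin (n * t + 0) * tanh t) e 1 He).
    intros t _. apply (ex_derive_continuous (fun t => sin (n * t + 0) * tanh t)). auto_derive; trivial. repeat split; trivial. eexists; apply is_derive_tanh.
    intros t _. rewrite Rabs_mult. pose proof (Rabs_sin_le (n * t + 0)). assert (Rabs (tanh t) <= 1) by (apply Rabs_le, tanh_bound).
    pose proof (Rabs_pos (tanh t)). pose proof (Rabs_pos (sin (n * t + 0))). nra. }
  destruct I as [K [C D]]. exists K.
  assert (E : forall t, (1 - e) * (sin (n * t + 0) * tanh t / (sinh t ^ 2 + e)) = kerS e t) by (intros; unfold kerS, Rdiv; ring).
  split. intros t Ht. apply (continuous_ext _ _ t E). auto. intros t Ht. rewrite <- E. auto.
Qed.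

Lemma near_half (e y : R) : 0 < e -> Rabs (y - e) < e / 2 -> e / 2 <= y.
Proof. intros He Hy. apply Rabs_def2 in Hy. lra. Qed.

Definition Bint1 (e : R) : R := half_int (fun t => - cos (n * t + 0) / (sinh t ^ 2 + e) ^ 2).

Lemma integrable_kerB1 (e : R) : 0 < e -> integrable (fun t => - cos (n * t + 0) / (sinh t ^ 2 + e) ^ 2).
Proof.
  intros He.
  destruct (unit_times_denominator (fun t => - cos (n * t + 0) / (sinh t ^ 2 + e)) e (/ e) He) as [K [C D]].
  - intros t _. apply (ex_derive_continuous (fun t => - cos (n * t + 0) / (sinh t ^ 2 + e))). auto_derive.
    destruct (denominator_bound e e t He (Rle_refl e)). simpl in *; lra.
  - intros t Ht. unfold Rdiv. rewrite Rabs_mult, Rabs_Ropp. pose proof (Rabs_cos_le (n * t + 0)).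
    pose proof (pow2_ge_0 (sinh t)). assert (0 < / (sinh t ^ 2 + e)) by (apply Rinv_0_lt_compat; lra).
    rewrite (Rabs_pos_eq (/ _)) by lra. assert (/ (sinh t ^ 2 + e) <= / e) by (apply Rinv_le_contravar; lra).
    pose proof (Rabs_pos (cos (n * t + 0))). nra.
  - assert (E : forall t, - cos (n * t + 0) / (sinh t ^ 2 + e) / (sinh t ^ 2 + e) = - cos (n * t + 0) / (sinh t ^ 2 + e) ^ 2).
    { intros t. pose proof (pow2_ge_0 (sinh t)). field. lra. }
    exists K. split. intros t Ht. apply (continuous_ext _ _ t E). auto. intros t Ht. rewrite <- E. auto.
Qed.

Lemma is_derive_Bint (e : R) : 0 < e -> is_derive Bint e (Bint1 e).
Proof.
  intros He. set (m := / Rmin 1 (e / 2)). assert (Hm : 0 < m) by (apply Rinv_0_lt_compat, Rmin_glb_lt; lra).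
  apply (is_derive_half_int kerB (fun e t => - cos (n * t + 0) / (sinh t ^ 2 + e) ^ 2) (fun e t => 2 * cos (n * t + 0) / (sinh t ^ 2 + e) ^ 3)
    e (e / 2) (2 * (m ^ 3 * 4))). lra.
  - intros y t Hy Ht. pose proof (near_half e y He Hy). destruct (denominator_bound (e/2) y t ltac:(lra) ltac:(lra)) as [D1 D2].
    unfold kerB. auto_derive. simpl in *; lra. simpl in *. field. lra.
  - intros y t Hy Ht. pose proof (near_half e y He Hy). destruct (denominator_bound (e/2) y t ltac:(lra) ltac:(lra)) as [D1 D2].
    auto_derive. simpl in *. nra. simpl in *. field. lra.
  - intros y t Hy Ht. pose proof (near_half e y He Hy). destruct (denominator_bound (e/2) y t ltac:(lra) ltac:(lra)) as [D1 D2]. fold m in D2.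
    pose proof (sech_sq_exp t Ht). pose proof (exp_neg_delta t Ht). pose proof (Rabs_cos_le (n * t + 0)). pose proof (sech_bound t) as [[S1 S3] _].
    set (i := / (sinh t ^ 2 + y)) in *. assert (Hi : 0 < i) by (apply Rinv_0_lt_compat; trivial).
    replace (2 * cos (n * t + 0) / (sinh t ^ 2 + y) ^ 3) with (2 * i ^ 3 * cos (n * t + 0)) by (unfold i; field; lra).
    rewrite Rabs_mult, Rabs_pos_eq. 2: { pose proof (pow_lt i 3 Hi). lra. }
    assert (i ^ 3 <= m ^ 3 * sech t ^ 2).
    { apply Rle_trans with ((m * sech t ^ 2) ^ 3). apply pow_incr; lra. rewrite Rpow_mult_distr. apply Rmult_le_compat_l. apply pow_le; lra.
      assert (sech t ^ 2 <= 1) by nra. assert (0 <= sech t ^ 2) by nra. set (q := sech t ^ 2) in *. simpl. nra. }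
    assert (0 < m ^ 3) by (apply pow_lt; trivial). pose proof (Rabs_pos (cos (n * t + 0))). pose proof (pow_lt i 3 Hi).
    apply Rle_trans with (2 * i ^ 3). nra.
    apply Rle_trans with (2 * (m ^ 3 * (4 * delta t))). apply Rmult_le_compat_l. lra. eapply Rle_trans. apply H3. apply Rmult_le_compat_l; lra. lra.
  - intros y Hy. apply integrable_kerB. pose proof (near_half e y He Hy). lra.
  - apply integrable_kerB1; trivial.
Qed.

Lemma FTC0_continuous (F f : R -> R) (K : R) : integrable f -> (forall t, is_derive F t (f t)) -> F 0 = 0 ->
  (forall t, 0 < t -> Rabs (F t) <= K * exp (- t)) -> half_int f = 0.
Proof.
  intros I D F0 B. apply (half_int_FTC0 F f I). auto.
  rewrite <- F0 at 2. apply continuous_at_right. eapply is_derive_continuous, D.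
  apply (lim_bounded_exp F K B).
Qed.

Lemma integrable_kerS1 (e : R) : 0 < e -> integrable (fun t => - (sin (n * t + 0) * tanh t * cosh t ^ 2) / (sinh t ^ 2 + e) ^ 2).
Proof.
  intros He. set (m := / Rmin 1 e). assert (Hm : 0 < m) by (apply Rinv_0_lt_compat, Rmin_glb_lt; lra).
  destruct (unit_times_denominator (fun t => - (sin (n * t + 0) * tanh t * cosh t ^ 2) / (sinh t ^ 2 + e)) e m He) as [K [C D]].
  - intros t _. apply (ex_derive_continuous (fun t => - (sin (n * t + 0) * tanh t * cosh t ^ 2) / (sinh t ^ 2 + e))). auto_derive.
    destruct (denominator_bound e e t He (Rle_refl e)). repeat split; trivial. eexists; apply is_derive_tanh. simpl in *; lra.
  - intros t Ht. destruct (denominator_bound e e t He (Rle_refl e)) as [D1 D2]. fold m in D2. pose proof (cosh_ge_1 t).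
    unfold Rdiv. rewrite Rabs_mult, Rabs_Ropp, !Rabs_mult. pose proof (Rabs_sin_le (n * t + 0)). assert (Rabs (tanh t) <= 1) by (apply Rabs_le, tanh_bound).
    assert (0 < / (sinh t ^ 2 + e)) by (apply Rinv_0_lt_compat; lra).
    rewrite (Rabs_pos_eq (/ _)) by lra. rewrite (Rabs_pos_eq (cosh t ^ 2)) by nra.
    pose proof (Rabs_pos (tanh t)). pose proof (Rabs_pos (sin (n * t + 0))).
    assert (cosh t ^ 2 * / (sinh t ^ 2 + e) <= m).
    { apply Rle_trans with (cosh t ^ 2 * (m * sech t ^ 2)). apply Rmult_le_compat_l; nra. right. unfold sech. field. lra. }
    assert (0 <= cosh t ^ 2 * / (sinh t ^ 2 + e)) by (apply Rmult_le_pos; nra).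
    assert (Rabs (sin (n * t + 0)) * Rabs (tanh t) <= 1) by nra. assert (0 <= Rabs (sin (n * t + 0)) * Rabs (tanh t)) by nra.
    rewrite Rmult_assoc. nra.
  - assert (E : forall t, - (sin (n * t + 0) * tanh t * cosh t ^ 2) / (sinh t ^ 2 + e) / (sinh t ^ 2 + e) = - (sin (n * t + 0) * tanh t * cosh t ^ 2) / (sinh t ^ 2 + e) ^ 2).
    { intros t. pose proof (pow2_ge_0 (sinh t)). field. lra. }
    exists K. split. intros t Ht. apply (continuous_ext _ _ t E). auto. intros t Ht. rewrite <- E. auto.
Qed.

(** The [e]-derivative of [(1 - e) / (sinh t ^ 2 + e)] is [- cosh t ^ 2 / (sinh t ^ 2 + e) ^ 2].
    Times [tanh t] this is half the [t]-derivative of [/ (sinh t ^ 2 + e)], and one integration by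
    parts returns [Bint]. *)
Lemma is_derive_Sint (e : R) : 0 < e -> is_derive Sint e (- n ^ 2 / 2 * Bint e).
Proof.
  intros He. set (m := / Rmin 1 (e / 2)). assert (Hm : 0 < m) by (apply Rinv_0_lt_compat, Rmin_glb_lt; lra).
  pose proof (integrable_kerS1 e He) as I1. pose proof (integrable_kerB e He) as IB.
  assert (D : is_derive (fun e => half_int (kerS e)) e (half_int (fun t => - (sin (n * t + 0) * tanh t * cosh t ^ 2) / (sinh t ^ 2 + e) ^ 2))).
  { apply (is_derive_half_int kerS (fun e t => - (sin (n * t + 0) * tanh t * cosh t ^ 2) / (sinh t ^ 2 + e) ^ 2)
      (fun e t => 2 * (sin (n * t + 0) * tanh t * cosh t ^ 2) / (sinh t ^ 2 + e) ^ 3) e (e / 2) (2 * (m ^ 3 * 4))). lra.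
    - intros y t Hy Ht. pose proof (near_half e y He Hy). destruct (denominator_bound (e/2) y t ltac:(lra) ltac:(lra)) as [D1 D2].
      unfold kerS. rewrite cosh_sinh_sqr. auto_derive. simpl in *; lra. simpl in *. field. lra.
    - intros y t Hy Ht. pose proof (near_half e y He Hy). destruct (denominator_bound (e/2) y t ltac:(lra) ltac:(lra)) as [D1 D2].
      auto_derive. simpl in *. nra. simpl in *. field. lra.
    - intros y t Hy Ht. pose proof (near_half e y He Hy). destruct (denominator_bound (e/2) y t ltac:(lra) ltac:(lra)) as [D1 D2]. fold m in D2.
      pose proof (sech_sq_exp t Ht). pose proof (exp_neg_delta t Ht). pose proof (Rabs_sin_le (n * t + 0)). pose proof (sech_bound t) as [[S1 S3] _].
      assert (T : Rabs (tanh t) <= 1) by (apply Rabs_le, tanh_bound). pose proof (cosh_ge_1 t).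
      set (i := / (sinh t ^ 2 + y)) in *. assert (Hi : 0 < i) by (apply Rinv_0_lt_compat; trivial).
      replace (2 * (sin (n * t + 0) * tanh t * cosh t ^ 2) / (sinh t ^ 2 + y) ^ 3) with (2 * (i ^ 3 * cosh t ^ 2) * (sin (n * t + 0) * tanh t)) by (unfold i; field; lra).
      pose proof (pow_lt i 3 Hi). assert (P : 0 <= i ^ 3 * cosh t ^ 2) by (apply Rmult_le_pos; [lra|nra]).
      rewrite Rabs_mult, Rabs_pos_eq by lra.
      assert (i ^ 3 * cosh t ^ 2 <= m ^ 3 * sech t ^ 2).
      { apply Rle_trans with ((m * sech t ^ 2) ^ 3 * cosh t ^ 2). apply Rmult_le_compat_r. nra. apply pow_incr; lra.
        replace ((m * sech t ^ 2) ^ 3 * cosh t ^ 2) with (m ^ 3 * (sech t ^ 2 * sech t ^ 2)) by (unfold sech; field; lra).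
        apply Rmult_le_compat_l. apply pow_le; lra. assert (sech t ^ 2 <= 1) by nra. set (q := sech t ^ 2) in *. nra. }
      assert (0 < m ^ 3) by (apply pow_lt; trivial). rewrite Rabs_mult. pose proof (Rabs_pos (sin (n * t + 0))). pose proof (Rabs_pos (tanh t)).
      assert (Rabs (sin (n * t + 0)) * Rabs (tanh t) <= 1) by nra. assert (0 <= Rabs (sin (n * t + 0)) * Rabs (tanh t)) by nra.
      apply Rle_trans with (2 * (i ^ 3 * cosh t ^ 2)). nra.
      apply Rle_trans with (2 * (m ^ 3 * (4 * delta t))). apply Rmult_le_compat_l. lra. eapply Rle_trans. eassumption. apply Rmult_le_compat_l; lra. lra.
    - intros y Hy. apply integrable_kerS. pose proof (near_half e y He Hy). lra.
    - exact I1. }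
  assert (I3 : integrable (fun t => - (sin (n * t + 0) * tanh t * cosh t ^ 2) / (sinh t ^ 2 + e) ^ 2 + (n / 2) * kerB e t)).
  { apply integrable_plus; trivial. apply integrable_scal; trivial. }
  assert (Z : half_int (fun t => - (sin (n * t + 0) * tanh t * cosh t ^ 2) / (sinh t ^ 2 + e) ^ 2 + (n / 2) * kerB e t) = 0).
  { apply (FTC0_continuous (fun t => / 2 * sin (n * t + 0) / (sinh t ^ 2 + e)) _ (/ Rmin 1 e * 2)); trivial.
    - intros t. destruct (denominator_bound e e t He (Rle_refl e)) as [D1 D2]. pose proof (cosh_ge_1 t). unfold kerB, tanh.
      auto_derive. simpl in *; lra. simpl in *. field. lra.
    - rewrite Rmult_0_r, Rplus_0_r, sin_0. unfold Rdiv. ring.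
    - intros t Ht. destruct (denominator_bound e e t He (Rle_refl e)) as [D1 D2]. pose proof (sech_sq_exp t Ht).
      assert (0 < / (sinh t ^ 2 + e)) by (apply Rinv_0_lt_compat; lra). pose proof (Rabs_sin_le (n * t + 0)). pose proof (Rabs_pos (sin (n * t + 0))).
      assert (0 < / Rmin 1 e) by (apply Rinv_0_lt_compat, Rmin_glb_lt; lra).
      unfold Rdiv. rewrite !Rabs_mult, (Rabs_pos_eq (/ _)), (Rabs_pos_eq (/ (_ + _))) by lra.
      apply Rle_trans with (1 * / (sinh t ^ 2 + e)). apply Rmult_le_compat_r; lra. rewrite Rmult_1_l, Rmult_assoc. eapply Rle_trans. apply D2. apply Rmult_le_compat_l; lra. }
  rewrite half_int_plus, half_int_scal in Z; trivial. 2: apply integrable_scal; trivial. fold (Bint e) in Z.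
  unfold Sint. apply (is_derive_scal _ _ n) in D.
  apply (is_derive_plus (fun e => n * half_int (kerS e)) (fun _ => S2) e _ 0) in D. 2: apply (is_derive_const (V := R_NormedModule)).
  eapply is_derive_eq. exact D.
  match goal with |- plus (n * ?a) 0 = _ => change (n * a + 0 = - n ^ 2 / 2 * Bint e); replace a with (- (n / 2 * Bint e)) by lra end.
  field.
Qed.

Lemma integrable_S2 : integrable (fun t => sech t ^ 2 * cos (n * t + 0)) /\ half_int (fun t => sech t ^ 2 * cos (n * t + 0)) = S2.
Proof.
  pose proof (integrable_sech_int n 1 (le_n 1)) as I.
  assert (E : forall t, 0 < t -> sech t ^ (2 * 1) * cos (n * t) = sech t ^ 2 * cos (n * t + 0)).
  { intros t _. rewrite Rplus_0_r. reflexivity. }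
  split. destruct I as [K [C D]]. exists K. split. intros t Ht. apply (ex_derive_continuous (fun t => sech t ^ 2 * cos (n * t + 0))). auto_derive. repeat split; trivial. eexists; apply is_derive_sech.
  intros t Ht. rewrite <- E by trivial. auto.
  rewrite <- (half_int_ext _ _ E I). reflexivity.
Qed.

(** The difference of the sides is the integral of the [t]-derivative of [cos (n t) tanh t (1 - e) /
    (sinh^2 t + e)], which vanishes at both ends. *)
Lemma Bint_Sint (e : R) : 0 < e -> (2 * e - 1) * Bint e + 2 * e * (e - 1) * Bint1 e = Sint e.
Proof.
  intros He. pose proof (integrable_kerB e He) as IB. pose proof (integrable_kerB1 e He) as IB1. pose proof (integrable_kerS e He) as IS.
  destruct integrable_S2 as [I2 E2].
  set (f := fun t => (2 * e - 1) * kerB e t + 2 * e * (e - 1) * (- cos (n * t + 0) / (sinh t ^ 2 + e) ^ 2) - (n * kerS e t + sech t ^ 2 * cos (n * t + 0))).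
  assert (If : integrable f).
  { unfold f. apply integrable_minus; apply integrable_plus; trivial; apply integrable_scal; trivial. }
  assert (Z : half_int f = 0).
  { apply (FTC0_continuous (fun t => cos (n * t + 0) * tanh t * ((1 - e) / (sinh t ^ 2 + e))) f (Rabs (1 - e) * (/ Rmin 1 e * 2))); trivial.
    - intros t. destruct (denominator_bound e e t He (Rle_refl e)) as [D1 D2]. pose proof (cosh_ge_1 t). unfold f, kerB, kerS.
      pose proof (is_derive_tanh t) as DT. pose proof (cosh_sinh_sqr t) as Q. unfold sech in *.
      auto_derive. repeat split; trivial. exact (ex_intro _ _ DT). simpl in *; lra. drw DT. unfold tanh.
      set (co := cos (n * t + 0)). set (si := sin (n * t + 0)).
      replace (sinh t * (sinh t * 1) + e) with (sinh t ^ 2 + e) by (simpl; ring).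
      set (s := sinh t) in *. set (c := cosh t) in *. clearbody s c co si.
      apply (Rmult_eq_reg_r (c ^ 2 * (s ^ 2 + e) ^ 2)). 2: { apply Rmult_integral_contrapositive; split; apply pow_nonzero; lra. }
      field_simplify; try (repeat split; lra). replace (c ^ 2) with (1 + s ^ 2) by lra. ring.
    - unfold tanh. rewrite sinh_0. unfold Rdiv. ring.
    - intros t Ht. destruct (denominator_bound e e t He (Rle_refl e)) as [D1 D2]. pose proof (sech_sq_exp t Ht).
      assert (0 < / (sinh t ^ 2 + e)) by (apply Rinv_0_lt_compat; lra). pose proof (Rabs_cos_le (n * t + 0)). pose proof (Rabs_pos (cos (n * t + 0))).
      assert (T : Rabs (tanh t) <= 1) by (apply Rabs_le, tanh_bound). pose proof (Rabs_pos (tanh t)). pose proof (Rabs_pos (1 - e)).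
      assert (0 < / Rmin 1 e) by (apply Rinv_0_lt_compat, Rmin_glb_lt; lra).
      unfold Rdiv. rewrite !Rabs_mult, (Rabs_pos_eq (/ _)) by lra.
      apply Rle_trans with (1 * (Rabs (1 - e) * / (sinh t ^ 2 + e))). apply Rmult_le_compat_r. apply Rmult_le_pos; lra. nra.
      rewrite Rmult_1_l, Rmult_assoc. apply Rmult_le_compat_l; trivial. rewrite Rmult_assoc. eapply Rle_trans. apply D2. apply Rmult_le_compat_l; lra. }
  unfold f in Z. rewrite half_int_minus, !half_int_plus, !half_int_scal, E2 in Z; trivial;
    try (apply integrable_plus; trivial; apply integrable_scal; trivial); try (apply integrable_scal; trivial).
  fold (Bint e) in Z. fold (Bint1 e) in Z. unfold Sint. lra.
Qed.

Lemma Sint_1 : Sint 1 = S2.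
Proof.
  unfold Sint. assert (E : forall t, 0 < t -> kerS 1 t = 0 * kerS 1 t) by (intros; unfold kerS, Rdiv; ring).
  rewrite (half_int_ext _ _ E) by (apply integrable_kerS; lra). rewrite half_int_scal by (apply integrable_kerS; lra). ring.
Qed.

(** At [e = cosh u ^ 2] the system becomes [V' = Sg], [Sg' = - n ^ 2 * V] for
    [V = sinh u * cosh u * Bint e]: a harmonic oscillator started at [V = 0], [Sg = S2]. *)
Lemma hyperbolic_kernel (u : R) : n * (sinh u * cosh u * Bint (cosh u ^ 2)) = S2 * sin (n * u).
Proof.
  set (e := fun u => cosh u ^ 2). assert (He : forall u, 1 <= e u) by (intros v; unfold e; pose proof (cosh_ge_1 v); nra).
  set (V := fun u => sinh u * cosh u * Bint (e u)). set (Sg := fun u => Sint (e u)).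
  assert (De : forall u, is_derive e u (2 * cosh u * sinh u)) by (intros v; unfold e; auto_derive; trivial; ring).
  assert (DV : forall u, is_derive V u (Sg u)).
  { intros v. specialize (He v). pose proof (is_derive_comp_R Bint e v _ _ (is_derive_Bint (e v) ltac:(lra)) (De v)) as DB.
    unfold V, Sg. rewrite <- Bint_Sint by lra. set (b := fun u => Bint (e u)) in *.
    change (is_derive (fun u => sinh u * cosh u * b u) v ((2 * e v - 1) * b v + 2 * e v * (e v - 1) * Bint1 (e v))).
    change (is_derive b v (Bint1 (e v) * (2 * cosh v * sinh v))) in DB.
    assert (Q : e v = 1 + sinh v ^ 2) by apply cosh_sinh_sqr. assert (Q2 : e v = cosh v ^ 2) by reflexivity.
    clearbody b e. auto_derive. exact (ex_intro _ _ DB). drw DB.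
    replace ((2 * e v - 1) * b v) with ((cosh v ^ 2 + sinh v ^ 2) * b v) by (rewrite <- Q2; replace (sinh v ^ 2) with (e v - 1) by lra; ring).
    replace (2 * e v * (e v - 1)) with (2 * cosh v ^ 2 * sinh v ^ 2) by (rewrite <- Q2; replace (sinh v ^ 2) with (e v - 1) by lra; ring).
    ring. }
  assert (DS : forall u, is_derive Sg u (- n ^ 2 * V u)).
  { intros v. specialize (He v). unfold Sg, V. eapply is_derive_eq. apply (is_derive_comp_R Sint e). apply is_derive_Sint; lra. apply De. field. }
  assert (E0 : e 0 = 1) by (unfold e; rewrite cosh_0; ring).
  assert (V0 : V 0 = 0) by (unfold V; rewrite sinh_0; ring).
  assert (S0 : Sg 0 = S2) by (unfold Sg; rewrite E0; apply Sint_1).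
  (* Two rotated combinations have zero derivative; solving them for [V] replaces a uniqueness
     theorem for the oscillator. *)
  assert (X : Sg u * cos (n * u) + n * V u * sin (n * u) = S2).
  { rewrite (zero_derivative_const (fun u => Sg u * cos (n * u) + n * V u * sin (n * u)) 0 u).
    rewrite Rmult_0_r, cos_0, sin_0, S0. ring.
    intros v _. specialize (DV v). specialize (DS v). clearbody V Sg. auto_derive. repeat split; first [exact (ex_intro _ _ DV)|exact (ex_intro _ _ DS)].
    drw DV. drw DS. ring. }
  assert (Y : Sg u * sin (n * u) - n * V u * cos (n * u) = 0).
  { rewrite (zero_derivative_const (fun u => Sg u * sin (n * u) - n * V u * cos (n * u)) 0 u).
    rewrite Rmult_0_r, cos_0, sin_0, V0. ring.
    intros v _. specialize (DV v). specialize (DS v). clearbody V Sg. auto_derive. repeat split; first [exact (ex_intro _ _ DV)|exact (ex_intro _ _ DS)].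
    drw DV. drw DS. ring. }
  change (n * V u = S2 * sin (n * u)). pose proof (sin2_cos2 (n * u)) as Q. unfold Rsqr in Q.
  rewrite <- (Rmult_1_r (n * V u)), <- Q. rewrite <- X.
  replace ((Sg u * cos (n * u) + n * V u * sin (n * u)) * sin (n * u)) with (cos (n * u) * (Sg u * sin (n * u) - n * V u * cos (n * u)) + n * V u * (sin (n * u) * sin (n * u) + cos (n * u) * cos (n * u))) by ring.
  rewrite Y. ring.
Qed.

(** The same system at u = i th: the sign of the oscillator flips and hyperbolic functions appear.
    The range stops short of [PI / 2], where [e] would reach 0 and the denominator would vanish at
    [t = 0]. *)
Lemma circular_kernel (th : R) : 0 <= th < PI / 2 ->
  n * (sin th * cos th * Bint (cos th ^ 2)) = S2 * sinh (n * th) /\ Sint (cos th ^ 2) = S2 * cosh (n * th).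
Proof.
  intros Hth.
  set (e := fun u => cos u ^ 2). assert (He : forall u, 0 <= u < PI / 2 -> 0 < e u) by (intros v Hv; unfold e; pose proof (cos_gt_0 v ltac:(lra) ltac:(lra)); nra).
  set (V := fun u => sin u * cos u * Bint (e u)). set (Sg := fun u => Sint (e u)).
  assert (De : forall u, is_derive e u (- 2 * cos u * sin u)) by (intros v; unfold e; auto_derive; trivial; ring).
  assert (DV : forall u, 0 <= u < PI / 2 -> is_derive V u (Sg u)).
  { intros v Hv. specialize (He v Hv). pose proof (is_derive_comp_R Bint e v _ _ (is_derive_Bint (e v) ltac:(lra)) (De v)) as DB.
    unfold V, Sg. rewrite <- Bint_Sint by lra. set (b := fun u => Bint (e u)) in *.
    change (is_derive (fun u => sin u * cos u * b u) v ((2 * e v - 1) * b v + 2 * e v * (e v - 1) * Bint1 (e v))).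
    change (is_derive b v (Bint1 (e v) * (- 2 * cos v * sin v))) in DB.
    assert (Q : e v = 1 - sin v ^ 2). { unfold e. pose proof (sin2_cos2 v) as Q. unfold Rsqr in Q. simpl. lra. }
    assert (Q2 : e v = cos v ^ 2) by reflexivity.
    clearbody b e. auto_derive. exact (ex_intro _ _ DB). drw DB.
    replace ((2 * e v - 1) * b v) with ((cos v ^ 2 - sin v ^ 2) * b v) by (rewrite <- Q2; replace (sin v ^ 2) with (1 - e v) by lra; ring).
    replace (2 * e v * (e v - 1)) with (- 2 * cos v ^ 2 * sin v ^ 2) by (rewrite <- Q2; replace (sin v ^ 2) with (1 - e v) by lra; ring).
    ring. }
  assert (DS : forall u, 0 <= u < PI / 2 -> is_derive Sg u (n ^ 2 * V u)).
  { intros v Hv. specialize (He v Hv). unfold Sg, V. eapply is_derive_eq. apply (is_derive_comp_R Sint e). apply is_derive_Sint; lra. apply De. field. }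
  assert (E0 : e 0 = 1) by (unfold e; rewrite cos_0; ring).
  assert (V0 : V 0 = 0) by (unfold V; rewrite sin_0; ring).
  assert (S0 : Sg 0 = S2) by (unfold Sg; rewrite E0; apply Sint_1).
  assert (X : Sg th * cosh (n * th) - n * V th * sinh (n * th) = S2).
  { rewrite (zero_derivative_const (fun u => Sg u * cosh (n * u) - n * V u * sinh (n * u)) 0 th).
    rewrite Rmult_0_r, cosh_0, sinh_0, S0. ring.
    intros v Hv. rewrite Rmin_left, Rmax_right in Hv by lra. specialize (DV v ltac:(lra)). specialize (DS v ltac:(lra)). clearbody V Sg. auto_derive. repeat split; first [exact (ex_intro _ _ DV)|exact (ex_intro _ _ DS)].
    drw DV. drw DS. ring. }
  assert (Y : Sg th * sinh (n * th) - n * V th * cosh (n * th) = 0).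
  { rewrite (zero_derivative_const (fun u => Sg u * sinh (n * u) - n * V u * cosh (n * u)) 0 th).
    rewrite Rmult_0_r, cosh_0, sinh_0, V0. ring.
    intros v Hv. rewrite Rmin_left, Rmax_right in Hv by lra. specialize (DV v ltac:(lra)). specialize (DS v ltac:(lra)). clearbody V Sg. auto_derive. repeat split; first [exact (ex_intro _ _ DV)|exact (ex_intro _ _ DS)].
    drw DV. drw DS. ring. }
  change (n * V th = S2 * sinh (n * th) /\ Sg th = S2 * cosh (n * th)). pose proof (cosh_sinh_sqr (n * th)) as Q.
  set (c := cosh (n * th)) in *. set (s := sinh (n * th)) in *.
  split; rewrite <- X.
  - replace ((Sg th * c - n * V th * s) * s) with (c * (Sg th * s - n * V th * c) + n * V th * (c ^ 2 - s ^ 2)) by ring.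
    rewrite Y. replace (c ^ 2 - s ^ 2) with 1 by lra. ring.
  - replace ((Sg th * c - n * V th * s) * c) with (s * (Sg th * s - n * V th * c) + Sg th * (c ^ 2 - s ^ 2)) by ring.
    rewrite Y. replace (c ^ 2 - s ^ 2) with 1 by lra. ring.
Qed.

Lemma denominator_integral (th : R) : 0 < th < PI / 2 ->
  integrable (fun t => 1 / (sinh t ^ 2 + cos th ^ 2)) /\ sin th * cos th * half_int (fun t => 1 / (sinh t ^ 2 + cos th ^ 2)) = th.
Proof.
  intros Hth. pose proof (cos_gt_0 th ltac:(lra) ltac:(lra)) as Hc. pose proof (sin_gt_0 th ltac:(lra) ltac:(pose proof PI2_1; lra)) as Hs.
  assert (I : integrable (fun t => 1 / (sinh t ^ 2 + cos th ^ 2))).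
  { apply (unit_times_denominator (fun _ => 1) _ 1). nra. intros t _; apply continuous_const. intros; rewrite Rabs_R1; lra. }
  split; trivial. rewrite <- half_int_scal by trivial.
  rewrite (half_int_FTC (fun t => atan (tan th * tanh t)) _ 0 th). ring.
  - destruct (integrable_scal _ (sin th * cos th) I) as [? [? _]]; trivial.
  - intros t Ht. pose proof (is_derive_tanh t) as DT. pose proof (cosh_ge_1 t). pose proof (cosh_sinh_sqr t) as Q.
    auto_derive. exact (ex_intro _ _ DT). drw DT. unfold tan, tanh, sech.
    pose proof (sin2_cos2 th) as Q2. unfold Rsqr in Q2.
    set (s := sin th) in *. set (c := cos th) in *. set (S := sinh t) in *. set (C := cosh t) in *. clearbody s c S C.
    assert (0 < S ^ 2 + c ^ 2) by nra.
    assert (HD : 0 < c ^ 2 * C ^ 2 + s ^ 2 * S ^ 2).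
    { assert (0 < c ^ 2 * C ^ 2) by (apply Rmult_lt_0_compat; apply pow_lt; lra).
      assert (0 <= s ^ 2 * S ^ 2) by (apply Rmult_le_pos; apply pow2_ge_0). lra. }
    assert (E : S ^ 2 + c ^ 2 = c ^ 2 * C ^ 2 + s ^ 2 * S ^ 2).
    { replace (C ^ 2) with (1 + S ^ 2) by lra. replace (s ^ 2) with (1 - c ^ 2) by (simpl; lra). ring. }
    rewrite E. field. simpl in *. repeat split; lra.
  - replace 0 with (atan (tan th * tanh 0)) at 2. 2:{ unfold tanh. rewrite sinh_0. replace (tan th * (0 / cosh 0)) with 0 by (unfold Rdiv; ring). apply atan_0. }
    apply (continuous_at_right (fun t => atan (tan th * tanh t))).
    apply (ex_derive_continuous (fun t => atan (tan th * tanh t))). auto_derive. eexists; apply is_derive_tanh.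
  - assert (Q : filterlim (fun t => atan (tan th * tanh t)) at_infty (locally (atan (tan th * 1)))).
    { apply (lim_continuous _ (fun t => tan th * tanh t) atan). apply lim_scal. apply Rbar_locally_filter. apply lim_tanh. apply continuous_atan. }
    rewrite Rmult_1_r, atan_tan in Q by lra. exact Q.
Qed.

Lemma at_left_bound (g : R -> R) (b K : R) : 0 < b -> continuous g b ->
  (exists h : R -> R, continuous h b /\ h b = 0 /\ forall x, 0 < x < b -> Rabs (g x) <= K * h x) -> g b = 0.
Proof.
  intros Hb Hg [h [Ch [h0 B]]].
  assert (Lf : forall f : R -> R, continuous f b -> filterlim f (at_left b) (locally (f b : R))).
  { intros f Hf P HP. specialize (Hf P HP). unfold filtermap, at_left, within in *. revert Hf. apply filter_imp. auto. }
  assert (LB : at_left b (fun x => 0 < x < b)).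
  { exists (mkposreal b Hb). intros y Hy Hyb. split; trivial. unfold ball in Hy; simpl in Hy; unfold AbsRing_ball, minus, plus, opp, abs in Hy; simpl in Hy. apply Rabs_def2 in Hy. lra. }
  assert (L0 : filterlim g (at_left b) (locally 0)).
  { apply (lim_at_squeeze _ _ (fun x => K * h x)).
    - revert LB. apply filter_imp. intros x Hx. rewrite Rminus_0_r. auto.
    - apply lim_scal0. apply within_filter, locally_filter. rewrite <- h0 at 1. apply Lf; trivial. }
  apply (filterlim_locally_unique (F := at_left b) g (g b) 0); trivial. apply Lf; trivial.
Qed.

Lemma S2_value : S2 * sinh (PI * mu) = PI * mu.
Proof.
  pose proof (Hn mu Hmu) as Hn. fold n in Hn. pose proof PI2_1 as HP.
  set (g := fun th => S2 / n * sinh (n * th) - th).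
  assert (G : g (PI / 2) = 0).
  (* [1 - cos (n t) = 2 sin (mu t)^2] is at most a multiple of [tanh t ^ 2], which compensates the
     denominator [sinh t ^ 2] that remains at [e = 0]. *)
  { set (K := half_int (fun t => 2 * (1 + mu) ^ 2 * sech t ^ 2)).
    apply (at_left_bound g (PI / 2) K). lra.
    - apply (ex_derive_continuous g). unfold g. auto_derive. trivial.
    - exists (fun th => sin th * cos th). split; [|split].
      + apply (ex_derive_continuous (fun th => sin th * cos th)). auto_derive; trivial.
      + rewrite cos_PI2. ring.
      + intros th Hth. pose proof (cos_gt_0 th ltac:(lra) ltac:(lra)) as Hc. pose proof (sin_gt_0 th ltac:(lra) ltac:(lra)) as Hs.
        destruct (denominator_integral th Hth) as [I1 E1]. destruct (circular_kernel th ltac:(lra)) as [E2 _].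
        assert (He : 0 < cos th ^ 2) by nra. pose proof (integrable_kerB _ He) as IB.
        replace (g th) with (sin th * cos th * (Bint (cos th ^ 2) - half_int (fun t => 1 / (sinh t ^ 2 + cos th ^ 2)))).
        2:{ unfold g. rewrite Rmult_minus_distr_l, E1. f_equal. apply (Rmult_eq_reg_l n); [|lra]. rewrite E2. field. lra. }
        rewrite Rabs_mult, (Rabs_pos_eq (sin th * cos th)) by nra. rewrite (Rmult_comm K). apply Rmult_le_compat_l. nra.
        unfold Bint. rewrite <- half_int_minus by trivial. unfold K. apply half_int_abs_le.
        * apply integrable_minus; trivial.
        * apply (integrable_exp _ (2 * (1 + mu) ^ 2 * 2)). intros t _. apply (ex_derive_continuous (fun t => 2 * (1 + mu) ^ 2 * sech t ^ 2)). auto_derive. eexists; apply is_derive_sech.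
          intros t Ht. pose proof (sech_sq_exp t Ht). assert (0 <= 2 * (1 + mu) ^ 2) by (pose proof (pow2_ge_0 (1 + mu)); lra). rewrite Rabs_pos_eq by (apply Rmult_le_pos; lra).
          replace (2 * (1 + mu) ^ 2 * 2 * exp (- t)) with (2 * (1 + mu) ^ 2 * (2 * exp (- t))) by ring. apply Rmult_le_compat_l; lra.
        * intros t Ht. unfold kerB. pose proof (sinh_pos t Ht). pose proof (cosh_ge_1 t).
          replace (cos (n * t + 0) / (sinh t ^ 2 + cos th ^ 2) - 1 / (sinh t ^ 2 + cos th ^ 2)) with (- ((1 - cos (n * t + 0)) / (sinh t ^ 2 + cos th ^ 2))) by (field; nra).
          replace (1 - cos (n * t + 0)) with (2 * sin (mu * t) ^ 2).
          2:{ rewrite Rplus_0_r. unfold n. replace (2 * mu * t) with (2 * (mu * t)) by ring. rewrite cos_2a_sin. ring. }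
          pose proof (sin_le_tanh (mu / 2) ltac:(lra) t Ht) as T. replace (2 * (mu / 2)) with mu in T by field. rewrite Rplus_0_r in T.
          assert (D : 0 < / (sinh t ^ 2 + cos th ^ 2)) by (apply Rinv_0_lt_compat; nra).
          rewrite Rabs_Ropp. unfold Rdiv. rewrite Rabs_pos_eq by (apply Rmult_le_pos; nra).
          assert (T2 : sin (mu * t) ^ 2 <= ((1 + mu) * tanh t) ^ 2).
          { rewrite <- pow2_abs. apply pow_incr. split; trivial. apply Rabs_pos. }
          assert (D2 : / (sinh t ^ 2 + cos th ^ 2) <= / sinh t ^ 2) by (apply Rinv_le_contravar; nra).
          apply Rle_trans with (2 * ((1 + mu) * tanh t) ^ 2 * / sinh t ^ 2). apply Rmult_le_compat; nra.
          right. unfold tanh, sech. field. lra. }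
  unfold g in G. replace (n * (PI / 2)) with (PI * mu) in G by (unfold n; field).
  assert (E : S2 / n * sinh (PI * mu) = PI / 2) by lra.
  replace (S2 * sinh (PI * mu)) with (n * (S2 / n * sinh (PI * mu))) by (field; lra). rewrite E. unfold n. field.
Qed.

(** [Sint e] tends to [c0] as [e] tends to 0: the error is at most [n (1 + n) e] times the
    elementary integral, that is [n (1 + n) th cos th / sin th]. *)
Lemma c0_value : c0 mu = S2 * cosh (PI * mu).
Proof.
  pose proof (Hn mu Hmu) as Hn. fold n in Hn. pose proof PI2_1 as HP.
  set (g := fun th => S2 * cosh (n * th) - c0 mu).
  assert (G : g (PI / 2) = 0).
  { apply (at_left_bound g (PI / 2) (n * (1 + n))). lra.
    - apply (ex_derive_continuous g). unfold g. auto_derive. trivial.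
    - exists (fun th => cos th / sin th * th). split; [|split].
      + apply (ex_derive_continuous (fun th => cos th / sin th * th)). auto_derive. rewrite sin_PI2. lra.
      + rewrite cos_PI2. unfold Rdiv. ring.
      + intros th Hth. pose proof (cos_gt_0 th ltac:(lra) ltac:(lra)) as Hc. pose proof (sin_gt_0 th ltac:(lra) ltac:(lra)) as Hs.
        destruct (denominator_integral th Hth) as [I1 E1]. destruct (circular_kernel th ltac:(lra)) as [_ E2].
        assert (He : 0 < cos th ^ 2) by nra. pose proof (integrable_kerS _ He) as IS. destruct integrable_S2 as [I2 ES].
        pose proof (integrable_e0 mu Hmu) as I0.
        unfold g. rewrite <- E2. unfold Sint. rewrite <- ES. rewrite <- half_int_scal by trivial.
        rewrite <- half_int_plus by (trivial; apply integrable_scal; trivial). unfold c0.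
        rewrite <- half_int_minus by (trivial; apply integrable_plus; trivial; apply integrable_scal; trivial).
        replace (n * (1 + n) * (cos th / sin th * th)) with (half_int (fun t => n * (1 + n) * cos th ^ 2 * (1 / (sinh t ^ 2 + cos th ^ 2)))).
        2:{ rewrite half_int_scal by trivial. replace (cos th / sin th * th) with (cos th / sin th * (sin th * cos th * half_int (fun t => 1 / (sinh t ^ 2 + cos th ^ 2)))) by (rewrite E1; reflexivity). field. lra. }
        apply half_int_abs_le.
        * apply integrable_minus; trivial. apply integrable_plus; trivial; apply integrable_scal; trivial.
        * apply integrable_scal; trivial.
        * intros t Ht. pose proof (sinh_pos t Ht). pose proof (cosh_ge_1 t). pose proof (cosh_sinh_sqr t) as Q. unfold kerS, e0. fold n.
          set (e := cos th ^ 2) in *. assert (HD : 0 < sinh t ^ 2 + e) by nra.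
          pose proof (sin_le_tanh mu Hmu t Ht) as T. fold n in T. set (si := sin (n * t + 0)) in *.
          match goal with |- Rabs ?a <= _ => replace a with (- (n * si * (/ tanh t * (e * (1 / (sinh t ^ 2 + e)))))) end.
          2:{ unfold tanh, sech. set (s := sinh t) in *. set (c := cosh t) in *. clearbody s c si.
              apply (Rmult_eq_reg_r (c ^ 2 * s * (s ^ 2 + e))). 2: { apply Rmult_integral_contrapositive; split; [apply Rmult_integral_contrapositive; split; [apply pow_nonzero|]|]; lra. }
              field_simplify; try (repeat split; lra). replace (c ^ 2) with (1 + s ^ 2) by lra. try replace (c ^ 3) with (c * (1 + s ^ 2)) by (rewrite <- Q; ring). ring. }
          assert (HT : 0 < tanh t) by (apply Rdiv_lt_0_compat; lra). assert (0 < / tanh t) by (apply Rinv_0_lt_compat; trivial).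
          assert (0 < 1 / (sinh t ^ 2 + e)) by (apply Rdiv_lt_0_compat; lra).
          assert (0 < / tanh t * (e * (1 / (sinh t ^ 2 + e)))) by (apply Rmult_lt_0_compat; trivial; apply Rmult_lt_0_compat; lra).
          rewrite Rabs_Ropp, !Rabs_mult, (Rabs_pos_eq n), (Rabs_pos_eq (/ tanh t)), (Rabs_pos_eq e), (Rabs_pos_eq (1 / _)) by lra.
          apply Rle_trans with (n * ((1 + n) * tanh t) * (/ tanh t * (e * (1 / (sinh t ^ 2 + e))))).
          apply Rmult_le_compat_r. lra. apply Rmult_le_compat_l; lra.
          right. field. lra. }
  unfold g in G. replace (n * (PI / 2)) with (PI * mu) in G by (unfold n; field). lra.
Qed.
End Kernel.

(** * Nicholson's formula and the Lommel integral *)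

Lemma nicholson (mu x : R) : 0 < mu -> 0 < x -> Hsq mu x = 4 / PI ^ 2 * nint (2 * mu) kap x.
Proof.
  intros Hmu Hx. pose proof PI_RGT_0 as HPI. set (n := 2 * mu). assert (Hn : 0 < n) by (unfold n; lra).
  set (k := 4 / PI ^ 2).
  cut (Hsq mu x - k * nint n kap x = 0). lra.
  pose proof (S2_value mu Hmu) as ES. fold n in ES. set (S2 := sech_int n 1) in *. set (s := sinh (PI * mu)) in *.
  assert (Hs : 0 < s) by (apply sinh_pos, Rmult_lt_0_compat; lra).
  assert (HS : 0 < S2) by apply mod_prod_lim.
  destruct (asymp_Hsq mu Hmu) as [AH0 [AH1 AH2]]. fold n S2 s in AH0, AH1, AH2.
  pose proof (asymp_nint0 mu Hmu) as AN0. pose proof (asymp_nint1 mu Hmu) as AN1. pose proof (asymp_nint2 mu Hmu) as AN2.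
  fold n in AN0, AN1, AN2. fold S2 in AN1, AN2. rewrite c0_value in AN0 by trivial. fold n S2 in AN0.
  (* The reflection formula is what makes the three pairs of asymptotic constants agree for the
     single factor [4 / PI ^ 2]. *)
  assert (EP : PI = S2 * s / mu) by (rewrite ES; field; lra).
  apply (appell_unique n (fun x => Hsq mu x - k * nint n kap x) (fun x => Hsq1 mu x - k * nint n gN1 x) (fun x => Hsq2 mu x - k * nint n gN2 x)); trivial.
  - intros y Hy. replace ((Hsq1 mu y - k * nint n gN1 y) / y) with (Hsq1 mu y / y - k * (nint n gN1 y / y)) by (field; lra).
    apply (is_derive_minus (Hsq mu) (fun x => k * nint n kap x)). apply is_derive_Hsq; trivial.
    apply (is_derive_scal (nint n kap)). apply is_derive_nint0; trivial.
  - intros y Hy. replace ((Hsq2 mu y - k * nint n gN2 y) / y) with (Hsq2 mu y / y - k * (nint n gN2 y / y)) by (field; lra).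
    apply (is_derive_minus (Hsq1 mu) (fun x => k * nint n gN1 x)). apply is_derive_Hsq1; trivial.
    apply (is_derive_scal (nint n gN1)). apply is_derive_nint1; trivial.
  - intros y Hy. eapply is_derive_eq. apply (is_derive_minus (Hsq2 mu) (fun x => k * nint n gN2 x)). apply is_derive_Hsq2; trivial.
    apply (is_derive_scal (nint n gN2)). apply is_derive_nint2; trivial.
    rewrite (nint_ode n Hn y Hy). fold n. unfold minus, plus, opp; cbn -[pow nint]. unfold Rdiv. ring.
  - generalize (asymp_minus _ _ _ _ AH0 (asymp_scal k _ _ AN0)). apply asymp_ext; intros y Hy. unfold n. ring.
    unfold k. rewrite EP. field. lra.
  - generalize (asymp_minus _ _ _ _ AH1 (asymp_scal k _ _ AN1)). apply asymp_ext; intros y Hy. ring.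
    unfold k. rewrite EP. field. lra.
  - generalize (asymp_minus _ _ _ _ AH2 (asymp_scal k _ _ AN2)). apply asymp_ext; intros y Hy. ring.
    unfold k. rewrite EP. field. lra.
Qed.

(** * J_0 and J_1 on the positive axis *)

Definition J1 (x : R) : R := - (x / 2 * bs_p1 0 1 0 ((x / 2) ^ 2)).

Lemma is_derive_J0 (x : R) : is_derive J0 x (- J1 x).
Proof.
  unfold J0. eapply is_derive_eq. apply (is_derive_comp_R (bs_p 0 1 0) (fun x => (x / 2) ^ 2)).
  apply is_derive_bs_p. auto_derive; trivial. unfold J1. field.
Qed.

Lemma is_derive_xJ1 (x : R) : is_derive (fun x => x * J1 x) x (x * J0 x).
Proof.
  apply (is_derive_ext (fun x => -2 * (fun y => y * bs_p1 0 1 0 y + - 0 * bs_q 0 1 0 y) ((x / 2) ^ 2))).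
  intros t. unfold J1. simpl. field.
  eapply is_derive_eq. apply (is_derive_scal (fun x => (fun y => y * bs_p1 0 1 0 y + - 0 * bs_q 0 1 0 y) ((x / 2) ^ 2))).
  apply (is_derive_comp_R (fun y => y * bs_p1 0 1 0 y + - 0 * bs_q 0 1 0 y) (fun x => (x / 2) ^ 2)).
  apply is_derive_bs_r. auto_derive; trivial. unfold J0. simpl. field.
Qed.

Lemma is_derive_J1 (x : R) : 0 < x -> is_derive J1 x (J0 x - J1 x / x).
Proof.
  intros Hx. apply (is_derive_ext_loc (fun x => (x * J1 x) / x)).
  - exists (mkposreal x Hx). intros y Hy. unfold ball in Hy; simpl in Hy; unfold AbsRing_ball, minus, plus, opp, abs in Hy; simpl in Hy.
    apply Rabs_def2 in Hy. cbv beta. change (y * J1 y / y = J1 y). field. lra.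
  - pose proof (is_derive_xJ1 x) as D. set (h := fun x => x * J1 x) in *. assert (E : h x = x * J1 x) by reflexivity.
    change (is_derive h x (x * J0 x)) in D. change (is_derive (fun x => h x / x) x (J0 x - J1 x / x)). clearbody h. auto_derive. split. exact (ex_intro _ _ D). split; trivial. lra.
    drw D. rewrite E. field. lra.
Qed.

Lemma continuous_J0 (x : R) : continuous J0 x.
Proof. eapply is_derive_continuous, is_derive_J0. Qed.

Lemma continuous_J1 (x : R) : continuous J1 x.
Proof.
  apply (continuous_ext (fun x => (-1) * (x / 2 * bs_p1 0 1 0 ((x / 2) ^ 2)))). intros; unfold J1; simpl; ring.
  apply (continuous_scal_r (-1) (fun x => x / 2 * bs_p1 0 1 0 ((x / 2) ^ 2))).
  apply (continuous_mult (fun x => x / 2) (fun x => bs_p1 0 1 0 ((x / 2) ^ 2))).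
  apply (ex_derive_continuous (fun x => x / 2)). auto_derive; trivial.
  apply (continuous_comp (fun x => (x / 2) ^ 2) (bs_p1 0 1 0)).
  apply (ex_derive_continuous (fun x => (x / 2) ^ 2)). auto_derive; trivial.
  eapply is_derive_continuous. apply entire_derive. rewrite CV_radius_derive. apply CV_re.
Qed.

Lemma J0_0 : J0 0 = 1.
Proof. unfold J0, bs_p. replace ((0 / 2) ^ 2) with 0 by field. rewrite PSeries_0. unfold re_coef; simpl. field. Qed.
Lemma J1_0 : J1 0 = 0.
Proof. unfold J1. field. Qed.

(* The Liouville transform w = sqrt x J0 satisfies w'' + (1 + 1/(4 x^2)) w = 0; this is the energy w^2 + w'^2. *)
Lemma J_decay : exists M, 0 < M /\ forall x, 1 <= x -> x * J0 x ^ 2 <= M /\ x * J1 x ^ 2 <= M.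
Proof.
  set (E := fun x => x * J0 x ^ 2 + x * J1 x ^ 2 - J0 x * J1 x + J0 x ^ 2 / (4 * x)).
  (* For the energy, E' = - w w' / (2 x^2) is at most E / (4 x^2), so the factor [exp (/ (4 * x))]
     makes [g] nonincreasing. *)
  set (g := fun x => E x * exp (/ (4 * x))).
  assert (SQ : forall x, 0 < x -> E x = x * J0 x ^ 2 + x * (J1 x - J0 x / (2 * x)) ^ 2) by (intros x Hx; unfold E; field; lra).
  assert (dE : forall x, 0 < x -> is_derive E x (J0 x * J1 x / (2 * x) - J0 x ^ 2 / (4 * x ^ 2))).
  { intros x Hx. pose proof (is_derive_J0 x) as D0. pose proof (is_derive_J1 x Hx) as D1. unfold E.
    auto_derive. repeat split; try (first [exact (ex_intro _ _ D0)|exact (ex_intro _ _ D1)]); try lra. drw D0. drw D1. field. lra. }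
  assert (dg : forall x, 0 < x -> is_derive g x ((J0 x * J1 x / (2 * x) - J0 x ^ 2 / (4 * x ^ 2) - E x / (4 * x ^ 2)) * exp (/ (4 * x)))).
  { intros x Hx. pose proof (dE x Hx) as D. unfold g. clearbody E. auto_derive. split. exact (ex_intro _ _ D). split; trivial. lra. drw D. simpl. field. lra. }
  assert (mono : forall x, 1 <= x -> g x <= g 1).
  { intros x Hx. destruct (Req_dec x 1) as [->|Hx1]. lra.
    destruct (MVT_gen g 1 x (fun x => (J0 x * J1 x / (2 * x) - J0 x ^ 2 / (4 * x ^ 2) - E x / (4 * x ^ 2)) * exp (/ (4 * x)))) as [c [Hc Ec]].
    - intros z Hz. rewrite Rmin_left in Hz by lra. apply dg. lra.
    - intros z Hz. rewrite Rmin_left in Hz by lra. apply continuity_pt_filterlim. eapply is_derive_continuous, dg. lra.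
    - rewrite Rmin_left, Rmax_right in Hc by lra.
      assert (J0 c * J1 c / (2 * c) - J0 c ^ 2 / (4 * c ^ 2) - E c / (4 * c ^ 2) <= 0).
      { rewrite SQ by lra. replace (J0 c * J1 c / (2 * c) - J0 c ^ 2 / (4 * c ^ 2) - (c * J0 c ^ 2 + c * (J1 c - J0 c / (2 * c)) ^ 2) / (4 * c ^ 2))
          with (- ((J0 c - J1 c + J0 c / (2 * c)) ^ 2 * / (4 * c))) by (field; lra).
        assert (0 <= (J0 c - J1 c + J0 c / (2 * c)) ^ 2 * / (4 * c)). { apply Rmult_le_pos. apply pow2_ge_0. apply Rlt_le, Rinv_0_lt_compat. lra. } lra. }
      pose proof (exp_pos (/ (4 * c))).
      assert ((J0 c * J1 c / (2 * c) - J0 c ^ 2 / (4 * c ^ 2) - E c / (4 * c ^ 2)) * exp (/ (4 * c)) <= 0) by nra. nra. }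
  set (M := Rabs (g 1) + 1). assert (HM : 0 < M) by (unfold M; pose proof (Rabs_pos (g 1)); lra).
  assert (EB : forall x, 1 <= x -> E x <= M).
  { intros x Hx. specialize (mono x Hx). unfold g in mono at 1.
    assert (0 <= E x). { rewrite SQ by lra. assert (0 <= x * J0 x ^ 2) by (apply Rmult_le_pos; [lra|apply pow2_ge_0]).
      assert (0 <= x * (J1 x - J0 x / (2 * x)) ^ 2) by (apply Rmult_le_pos; [lra|apply pow2_ge_0]). lra. }
    assert (1 <= exp (/ (4 * x))). { pose proof (exp_ineq1_le (/ (4 * x))). assert (0 < / (4 * x)) by (apply Rinv_0_lt_compat; lra). lra. }
    pose proof (Rle_abs (g 1)). unfold M. nra. }
  (* [J1] is recovered from w' and [J0] by [(a + b)^2 <= 2 a^2 + 2 b^2], which gives at most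
     [2 * M + M / 2]. *)
  exists (3 * M). split. lra. intros x Hx. specialize (EB x Hx). rewrite SQ in EB by lra.
  assert (A : 0 <= x * J0 x ^ 2) by (apply Rmult_le_pos; [lra|apply pow2_ge_0]).
  assert (B : 0 <= x * (J1 x - J0 x / (2 * x)) ^ 2) by (apply Rmult_le_pos; [lra|apply pow2_ge_0]).
  split. lra.
  assert (x * J1 x ^ 2 <= 2 * (x * (J1 x - J0 x / (2 * x)) ^ 2) + 2 * (x * (J0 x / (2 * x)) ^ 2)).
  { set (a := J1 x - J0 x / (2 * x)). set (b := J0 x / (2 * x)). replace (J1 x) with (a + b) by (unfold a, b; ring).
    replace (2 * (x * a ^ 2) + 2 * (x * b ^ 2)) with (x * (a + b) ^ 2 + x * (a - b) ^ 2) by ring.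
    assert (0 <= x * (a - b) ^ 2) by (apply Rmult_le_pos; [lra|apply pow2_ge_0]). lra. }
  assert (x * (J0 x / (2 * x)) ^ 2 <= x * J0 x ^ 2 / 4).
  { replace (x * (J0 x / (2 * x)) ^ 2) with (x * J0 x ^ 2 / 4 * / x ^ 2) by (field; lra).
    rewrite <- (Rmult_1_r (x * J0 x ^ 2 / 4)) at 2. apply Rmult_le_compat_l. lra. rewrite <- Rinv_1. apply Rinv_le_contravar; nra. }
  lra.
Qed.

Lemma J_small (e : R) : 0 < e -> exists d, 0 < d /\ forall z, 0 < z < d -> Rabs (1 - J0 z) < e /\ Rabs (J1 z) < e.
Proof.
  intros He. pose proof (continuous_at_right _ _ (continuous_J0 0)) as L0. pose proof (continuous_at_right _ _ (continuous_J1 0)) as L1.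
  rewrite J0_0 in L0. rewrite J1_0 in L1.
  pose proof (filter_and _ _ (proj1 (lim_at_spec _ _ _) L0 e He) (proj1 (lim_at_spec _ _ _) L1 e He)) as [d Hd].
  exists d. split. apply cond_pos. intros z Hz. specialize (Hd z).
  assert (B : ball 0 d z). { unfold ball; simpl; unfold AbsRing_ball, minus, plus, opp, abs; simpl. rewrite Ropp_0, Rplus_0_r, Rabs_pos_eq; lra. }
  destruct (Hd B (proj1 Hz)) as [H1 H2]. rewrite Rabs_minus_sym in H1. rewrite Rminus_0_r in H2. split; trivial.
Qed.

Lemma J_large (e : R) : 0 < e -> exists Z, 0 < Z /\ forall z, Z < z -> Rabs (J0 z) < e /\ Rabs (J1 z) < e.
Proof.
  intros He. destruct J_decay as [M [HM B]]. exists (1 + M / e ^ 2).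
  assert (0 < M / e ^ 2) by (apply Rdiv_lt_0_compat; nra). split. lra. intros z Hz.
  destruct (B z ltac:(lra)) as [B0 B1].
  assert (K : forall a, z * a ^ 2 <= M -> Rabs a < e).
  { intros a Ha. apply Rnot_le_lt. intros Hn. assert (e ^ 2 <= a ^ 2). { rewrite <- (pow2_abs a). apply pow_incr. lra. }
    assert (M < z * e ^ 2). { apply (Rmult_lt_reg_r (/ e ^ 2)). apply Rinv_0_lt_compat; nra. replace (z * e ^ 2 * / e ^ 2) with z by (field; lra). unfold Rdiv in Hz. lra. }
    nra. }
  split; apply K; trivial.
Qed.

(** The scale-invariant counterpart of [rapid_delta]: the majorant moves with [X], so small [X] is
    allowed. *)
Lemma kap_scaled : exists K, 0 < K /\ forall X t, 0 < X -> 0 < t -> 0 <= kap (X ^ 2 * sinh t ^ 2) <= K * delta (X * t).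
Proof.
  destruct (kap_decay 1) as [K [HK B]]. exists (2 * K). split. lra. intros X t HX Ht.
  pose proof (sinh_sq_pos X t HX Ht) as W. specialize (B _ W). pose proof (kap_nonneg _ W) as P. split; trivial.
  rewrite root4_sinh, pow_1 in B by trivial. pose proof (sinh_ge t ltac:(lra)).
  assert (XT : 0 < X * t) by (apply Rmult_lt_0_compat; trivial).
  assert (S1 : 0 < sqrt (X * t)) by (apply sqrt_lt_R0; trivial).
  assert (S2 : sqrt (X * t) <= sqrt (X * sinh t)) by (apply sqrt_le_1_alt; apply Rmult_le_compat_l; lra).
  assert (R2 : (1 + X * t) / 2 <= 1 + X ^ 2 * sinh t ^ 2).
  { assert ((X * t) ^ 2 <= X ^ 2 * sinh t ^ 2). { rewrite <- Rpow_mult_distr. apply pow_incr. split. lra. apply Rmult_le_compat_l; lra. } nra. }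
  unfold delta. apply (Rmult_le_reg_r (sqrt (X * t) * ((1 + X * t) / 2))). apply Rmult_lt_0_compat; lra.
  replace (2 * K * / (sqrt (X * t) * (1 + X * t)) * (sqrt (X * t) * ((1 + X * t) / 2))) with K by (field; lra).
  eapply Rle_trans; [|exact B]. rewrite (Rmult_assoc (kap _)). apply Rmult_le_compat_l; trivial. apply Rmult_le_compat; lra.
Qed.

(** * Lommel's antiderivative integrated over t, and its limits in X *)

Section LommelTransform.
Variable n : R.
Hypothesis Hn : 0 < n.

(* Lommel's antiderivative in [X] of [X / 2 * kap (X^2 sinh^2 t) * J0 (2 X cosh u) * cos (n t)], normalised to vanish at [X = 0]. *)
Definition lom (u X t : R) : R :=
  (1 + cosh u * X * kap (X ^ 2 * sinh t ^ 2) * J1 (2 * cosh u * X) - gam (X ^ 2 * sinh t ^ 2) * J0 (2 * cosh u * X))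
  / (4 * (sinh t ^ 2 + cosh u ^ 2)) * cos (n * t + 0).
(** The integral of [x / 2 * nint n kap x * J0 (2 * cosh u * x)] over [(0, X)], written as a
    [t]-integral so that its behaviour at both ends in [X] becomes visible. *)
Definition Psi (X u : R) : R := half_int (lom u X).

(** [lom1] and [lom2] are the first two [X]-derivatives of [lom]; the denominator cancels already in
    the first. *)
Definition lom1 (u X t : R) : R := X / 2 * kap (X ^ 2 * sinh t ^ 2) * J0 (2 * cosh u * X) * cos (n * t + 0).
Definition lom2 (u X t : R) : R :=
  (/ 2 * kap (X ^ 2 * sinh t ^ 2) * J0 (2 * cosh u * X) - gam (X ^ 2 * sinh t ^ 2) * J0 (2 * cosh u * X)
   - X / 2 * kap (X ^ 2 * sinh t ^ 2) * (2 * cosh u * J1 (2 * cosh u * X))) * cos (n * t + 0).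

Lemma is_derive_kg (X t : R) : 0 < X -> 0 < t ->
  is_derive (fun X => kap (X ^ 2 * sinh t ^ 2)) X (- 2 * gam (X ^ 2 * sinh t ^ 2) / X) /\
  is_derive (fun X => gam (X ^ 2 * sinh t ^ 2)) X (- 2 * X * sinh t ^ 2 * kap (X ^ 2 * sinh t ^ 2)).
Proof.
  intros HX Ht. pose proof (sinh_sq_pos X t HX Ht) as W. pose proof (sinh_pos t Ht). split.
  - eapply is_derive_eq. apply is_derive_sq_comp. apply is_derive_kap; trivial. field. lra.
  - eapply is_derive_eq. apply is_derive_sq_comp. apply is_derive_gam; trivial. ring.
Qed.

Lemma is_derive_lom (u X t : R) : 0 < X -> 0 < t -> is_derive (fun X => lom u X t) X (lom1 u X t).
Proof.
  intros HX Ht. destruct (is_derive_kg X t HX Ht) as [DK DG]. pose proof (cosh_ge_1 u) as Hc. pose proof (pow2_ge_0 (sinh t)).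
  assert (D0 : is_derive (fun X => J0 (2 * cosh u * X)) X (- J1 (2 * cosh u * X) * (2 * cosh u))).
  { apply (is_derive_comp_R J0 (fun X => 2 * cosh u * X)). apply is_derive_J0. auto_derive; trivial. ring. }
  assert (D1 : is_derive (fun X => J1 (2 * cosh u * X)) X ((J0 (2 * cosh u * X) - J1 (2 * cosh u * X) / (2 * cosh u * X)) * (2 * cosh u))).
  { apply (is_derive_comp_R J1 (fun X => 2 * cosh u * X)). apply is_derive_J1. nra. auto_derive; trivial. ring. }
  unfold lom, lom1.
  set (k := fun X => kap (X ^ 2 * sinh t ^ 2)) in *. set (g := fun X => gam (X ^ 2 * sinh t ^ 2)) in *.
  set (j0 := fun X => J0 (2 * cosh u * X)) in *. set (j1 := fun X => J1 (2 * cosh u * X)) in *.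
  change (is_derive k X (- 2 * g X / X)) in DK. change (is_derive g X (- 2 * X * sinh t ^ 2 * k X)) in DG.
  change (is_derive j0 X (- j1 X * (2 * cosh u))) in D0. change (is_derive j1 X ((j0 X - j1 X / (2 * cosh u * X)) * (2 * cosh u))) in D1.
  change (is_derive (fun X => (1 + cosh u * X * k X * j1 X - g X * j0 X) / (4 * (sinh t ^ 2 + cosh u ^ 2)) * cos (n * t + 0)) X
    (X / 2 * k X * j0 X * cos (n * t + 0))).
  clearbody k g j0 j1. auto_derive. repeat split; first [exact (ex_intro _ _ DK)|exact (ex_intro _ _ DG)|exact (ex_intro _ _ D0)|exact (ex_intro _ _ D1)].
  drw DK. drw DG. drw D0. drw D1. simpl in *. field. repeat split; nra.
Qed.

Lemma is_derive_lom1 (u X t : R) : 0 < X -> 0 < t -> is_derive (fun X => lom1 u X t) X (lom2 u X t).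
Proof.
  intros HX Ht. destruct (is_derive_kg X t HX Ht) as [DK DG].
  assert (D0 : is_derive (fun X => J0 (2 * cosh u * X)) X (- J1 (2 * cosh u * X) * (2 * cosh u))).
  { apply (is_derive_comp_R J0 (fun X => 2 * cosh u * X)). apply is_derive_J0. auto_derive; trivial. ring. }
  unfold lom1, lom2.
  set (k := fun X => kap (X ^ 2 * sinh t ^ 2)) in *. set (g := fun X => gam (X ^ 2 * sinh t ^ 2)) in *.
  set (j0 := fun X => J0 (2 * cosh u * X)) in *. set (j1 := fun X => J1 (2 * cosh u * X)) in *.
  change (is_derive k X (- 2 * g X / X)) in DK.
  change (is_derive j0 X (- j1 X * (2 * cosh u))) in D0.
  change (is_derive (fun X => X / 2 * k X * j0 X * cos (n * t + 0)) X ((/ 2 * k X * j0 X - g X * j0 X - X / 2 * k X * (2 * cosh u * j1 X)) * cos (n * t + 0))).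
  clearbody k g j0 j1. auto_derive. repeat split; first [exact (ex_intro _ _ DK)|exact (ex_intro _ _ D0)].
  drw DK. drw D0. field. lra.
Qed.

Lemma J_bounded_on (Z : R) : exists M, 0 < M /\ forall z, 0 <= z <= Z -> Rabs (J0 z) <= M /\ Rabs (J1 z) <= M.
Proof.
  destruct (Rle_dec 0 Z) as [HZ|HZ]. 2: exists 1; split; [lra|intros; lra].
  destruct (continuity_ab_maj (fun z => Rabs (J0 z) + Rabs (J1 z)) 0 Z HZ) as [m [Hm _]].
  - intros c _. apply continuity_pt_filterlim. apply (continuous_plus (fun z => Rabs (J0 z)) (fun z => Rabs (J1 z))).
    apply (continuous_comp J0 Rabs). apply continuous_J0. apply continuous_Rabs.
    apply (continuous_comp J1 Rabs). apply continuous_J1. apply continuous_Rabs.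
  - exists (Rabs (J0 m) + Rabs (J1 m) + 1). pose proof (Rabs_pos (J0 m)). pose proof (Rabs_pos (J1 m)). split. lra.
    intros z Hz. specialize (Hm z Hz). simpl in Hm. pose proof (Rabs_pos (J0 z)). pose proof (Rabs_pos (J1 z)). lra.
Qed.

Lemma cont_pos_lom (u X : R) : 0 < X -> cont_pos (lom u X).
Proof.
  intros HX t Ht. pose proof (cosh_ge_1 u) as Hc. pose proof (pow2_ge_0 (sinh t)). unfold lom.
  pose proof (is_derive_sinh_comp kap X t _ (is_derive_kap _ (sinh_sq_pos X t HX Ht))) as DK.
  pose proof (is_derive_sinh_comp gam X t _ (is_derive_gam _ (sinh_sq_pos X t HX Ht))) as DG.
  set (k := fun t => kap (X ^ 2 * sinh t ^ 2)) in *. set (g := fun t => gam (X ^ 2 * sinh t ^ 2)) in *.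
  apply ex_intro in DK. apply ex_intro in DG. change (ex_derive k t) in DK. change (ex_derive g t) in DG.
  apply (ex_derive_continuous (fun t => (1 + cosh u * X * k t * J1 (2 * cosh u * X) - g t * J0 (2 * cosh u * X)) / (4 * (sinh t ^ 2 + cosh u ^ 2)) * cos (n * t + 0))).
  clearbody k g. auto_derive. repeat split; trivial. simpl in *. nra.
Qed.

Lemma inv_D_bound (u t : R) : 0 < / (4 * (sinh t ^ 2 + cosh u ^ 2)) <= sech t ^ 2 / 4.
Proof.
  pose proof (cosh_ge_1 u) as Hc. pose proof (pow2_ge_0 (sinh t)). pose proof (cosh_sinh_sqr t). pose proof (cosh_ge_1 t).
  split. apply Rinv_0_lt_compat. nra.
  unfold sech. replace ((/ cosh t) ^ 2 / 4) with (/ (4 * cosh t ^ 2)) by (field; lra). apply Rinv_le_contravar; nra.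
Qed.

(** [c = 1] serves small [X] and [c = 0] serves large [X], where the limit has been subtracted. The
    [J1] term keeps the factor [X * kap], whose integral is bounded uniformly in [X]. *)
Lemma lom_split_bound (c u X t : R) : 0 < X -> 0 < t ->
  Rabs ((c + cosh u * X * kap (X ^ 2 * sinh t ^ 2) * J1 (2 * cosh u * X) - gam (X ^ 2 * sinh t ^ 2) * J0 (2 * cosh u * X))
  / (4 * (sinh t ^ 2 + cosh u ^ 2)) * cos (n * t + 0)) <=
  Rabs (c - gam (X ^ 2 * sinh t ^ 2) * J0 (2 * cosh u * X)) * (sech t ^ 2 / 4) + cosh u * Rabs (J1 (2 * cosh u * X)) * (X * kap (X ^ 2 * sinh t ^ 2)).
Proof.
  intros HX Ht. pose proof (cosh_ge_1 u) as Hc. pose proof (inv_D_bound u t) as [I1 I2]. pose proof (sech_bound t) as [[S1 S2] _].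
  pose proof (kap_nonneg _ (sinh_sq_pos X t HX Ht)) as KP. set (k := kap (X ^ 2 * sinh t ^ 2)) in *. set (g := gam (X ^ 2 * sinh t ^ 2)).
  set (j0 := J0 (2 * cosh u * X)). set (j1 := J1 (2 * cosh u * X)). set (i := / (4 * (sinh t ^ 2 + cosh u ^ 2))) in *.
  unfold Rdiv at 1. fold i. rewrite !Rabs_mult, (Rabs_pos_eq i) by lra. pose proof (Rabs_cos_le (n * t + 0)) as C1. pose proof (Rabs_pos (cos (n * t + 0))).
  replace (c + cosh u * X * k * j1 - g * j0) with ((c - g * j0) + cosh u * j1 * (X * k)) by ring.
  assert (XK : 0 <= X * k) by (apply Rmult_le_pos; lra).
  assert (T : Rabs ((c - g * j0) + cosh u * j1 * (X * k)) <= Rabs (c - g * j0) + cosh u * Rabs j1 * (X * k)).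
  { eapply Rle_trans. apply Rabs_triang. rewrite (Rabs_mult (cosh u * j1)), (Rabs_mult (cosh u)), (Rabs_pos_eq (cosh u)), (Rabs_pos_eq (X * k)) by lra. lra. }
  set (A := Rabs (c - g * j0)) in *. assert (0 <= A) by apply Rabs_pos. assert (0 <= cosh u * Rabs j1 * (X * k)).
  { apply Rmult_le_pos; trivial. apply Rmult_le_pos. lra. apply Rabs_pos. }
  set (B := cosh u * Rabs j1 * (X * k)) in *.
  assert (i <= 1) by nra.
  apply Rle_trans with ((A + B) * i * 1). apply Rmult_le_compat; trivial. apply Rmult_le_pos; [apply Rabs_pos|lra]. apply Rmult_le_compat_r; lra.
  rewrite Rmult_1_r, Rmult_plus_distr_r. apply Rplus_le_compat. apply Rmult_le_compat_l; trivial. nra.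
Qed.

Lemma integrable_Xkap (X : R) : 0 < X -> integrable (fun t => X * kap (X ^ 2 * sinh t ^ 2)).
Proof.
  intros HX. apply integrable_scal. pose proof (integrable_rapid kap (fun _ => 1) X rapid_kap) as I.
  assert (U : unit_bounded (fun _ => 1)). { split. intros t _; apply continuous_const. intros; rewrite Rabs_R1; lra. }
  specialize (I U HX). destruct I as [K [C D]]. exists K. split.
  intros t Ht. apply continuous_sinh_comp; trivial. apply cont_pos_kap. intros t Ht. specialize (D t Ht). rewrite Rmult_1_r in D. exact D.
Qed.

Lemma Xkap_bound : exists K, 0 < K /\ forall X, 0 < X -> half_int (fun t => X * kap (X ^ 2 * sinh t ^ 2)) <= K.
Proof.
  destruct kap_scaled as [K [HK B]]. exists (K * PI). pose proof PI_RGT_0. split. nra. intros X HX.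
  destruct (half_int_scaled (fun t => X * kap (X ^ 2 * sinh t ^ 2)) K X HX) as [_ Q].
  - intros t Ht. apply (continuous_scal_r X (fun t => kap (X ^ 2 * sinh t ^ 2))). apply continuous_sinh_comp; trivial. apply cont_pos_kap.
  - intros t Ht. specialize (B X t HX Ht). rewrite Rabs_pos_eq by (apply Rmult_le_pos; lra).
    replace (K * (X * delta (X * t))) with (X * (K * delta (X * t))) by ring. apply Rmult_le_compat_l; lra.
  - eapply Rle_trans. apply Rle_abs. exact Q.
Qed.

Lemma integrable_sech_sq (c : R) : integrable (fun t => c * sech t ^ 2).
Proof.
  apply integrable_scal. apply (integrable_exp _ 2). intros t _. apply (ex_derive_continuous (fun t => sech t ^ 2)). auto_derive. eexists; apply is_derive_sech.
  intros t Ht. pose proof (sech_sq_exp t Ht). rewrite Rabs_pos_eq; lra.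
Qed.

Lemma integrable_lom (u X : R) : 0 < X -> integrable (lom u X).
Proof.
  intros HX.
  assert (I : integrable (fun t => (1 + Rabs (J0 (2 * cosh u * X))) / 4 * sech t ^ 2 + cosh u * Rabs (J1 (2 * cosh u * X)) * (X * kap (X ^ 2 * sinh t ^ 2)))).
  { apply integrable_plus. apply integrable_sech_sq. apply integrable_scal, integrable_Xkap; trivial. }
  destruct I as [K [C D]]. exists K. split. apply cont_pos_lom; trivial. intros t Ht. specialize (D t Ht).
  pose proof (lom_split_bound 1 u X t HX Ht) as L. unfold lom. eapply Rle_trans. apply L. eapply Rle_trans; [|apply D].
  eapply Rle_trans; [|apply Rle_abs]. apply Rplus_le_compat_r.
  replace ((1 + Rabs (J0 (2 * cosh u * X))) / 4 * sech t ^ 2) with ((1 + Rabs (J0 (2 * cosh u * X))) * (sech t ^ 2 / 4)) by field.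
  apply Rmult_le_compat_r. pose proof (pow2_ge_0 (sech t)); lra.
  pose proof (sinh_sq_pos X t HX Ht) as W. pose proof (gam_le_1 _ W). destruct (gam_bound _ W) as [G _].
  eapply Rle_trans. apply Rabs_triang. rewrite Rabs_R1, Rabs_Ropp, Rabs_mult, (Rabs_pos_eq (gam _)) by trivial. pose proof (Rabs_pos (J0 (2 * cosh u * X))). nra.
Qed.

Lemma is_derive_Psi (u X : R) : 0 < X -> is_derive (fun X => Psi X u) X (X / 2 * nint n kap X * J0 (2 * cosh u * X)).
Proof.
  intros HX. pose proof (unit_bounded_cos n 0) as U. pose proof (cosh_ge_1 u) as Hc.
  pose proof (integrable_rapid kap _ X rapid_kap U HX) as IK.
  assert (E : half_int (lom1 u X) = X / 2 * nint n kap X * J0 (2 * cosh u * X)).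
  { unfold nint. replace (X / 2 * half_int (fun t => kap (X ^ 2 * sinh t ^ 2) * cos (n * t + 0)) * J0 (2 * cosh u * X))
      with (X / 2 * J0 (2 * cosh u * X) * half_int (fun t => kap (X ^ 2 * sinh t ^ 2) * cos (n * t + 0))) by ring.
    rewrite <- half_int_scal by trivial. symmetry. apply half_int_ext. intros t Ht. unfold lom1. ring. apply integrable_scal; trivial. }
  assert (I1 : integrable (lom1 u X)).
  { destruct (integrable_scal _ (X / 2 * J0 (2 * cosh u * X)) IK) as [K [C D]].
    assert (Q : forall t, X / 2 * J0 (2 * cosh u * X) * (kap (X ^ 2 * sinh t ^ 2) * cos (n * t + 0)) = lom1 u X t) by (intros; unfold lom1; ring).
    exists K. split. intros t Ht. apply (continuous_ext _ _ t Q). auto. intros t Ht. rewrite <- Q. auto. }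
  rewrite <- E. unfold Psi.
  destruct (J_bounded_on (2 * cosh u * (2 * X))) as [M [HM BM]].
  destruct (rapid_delta kap (X / 2) rapid_kap ltac:(lra)) as [K1 [HK1 B1]]. destruct (rapid_delta gam (X / 2) rapid_gam ltac:(lra)) as [K2 [HK2 B2]].
  apply (is_derive_half_int (fun X t => lom u X t) (lom1 u) (lom2 u) X (X / 2) (M * (K1 + K2 + 2 * X * K1 * (2 * cosh u)))). lra.
  - intros y t Hy Ht. apply Rabs_def2 in Hy. apply is_derive_lom; trivial. lra.
  - intros y t Hy Ht. apply Rabs_def2 in Hy. apply is_derive_lom1; trivial. lra.
  - intros y t Hy Ht. apply Rabs_def2 in Hy. specialize (B1 y t ltac:(lra) Ht). specialize (B2 y t ltac:(lra) Ht).
    destruct (BM (2 * cosh u * y)) as [M0 M1]. split. apply Rmult_le_pos; lra. apply Rmult_le_compat_l; lra.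
    unfold lom2. set (k := kap (y ^ 2 * sinh t ^ 2)) in *. set (g := gam (y ^ 2 * sinh t ^ 2)) in *. set (j0 := J0 (2 * cosh u * y)) in *. set (j1 := J1 (2 * cosh u * y)) in *.
    set (d := delta t) in *. assert (0 < d) by (apply delta_pos; trivial).
    pose proof (Rabs_cos_le (n * t + 0)). rewrite Rabs_mult. rewrite <- (Rmult_1_r (M * _ * d)). apply Rmult_le_compat; trivial; try apply Rabs_pos.
    assert (P : forall a b A B, Rabs a <= A -> Rabs b <= B -> Rabs (a * b) <= A * B).
    { intros a b A B HA HB. rewrite Rabs_mult. apply Rmult_le_compat; trivial; apply Rabs_pos. }
    assert (Q1 : Rabs (/ 2 * k * j0) <= K1 * d * M).
    { apply P. 2: exact M0. rewrite Rabs_mult, (Rabs_pos_eq (/ 2)) by lra. pose proof (Rabs_pos k). lra. }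
    assert (Q2 : Rabs (g * j0) <= K2 * d * M) by (apply P; trivial).
    assert (Q3 : Rabs (y / 2 * k * (2 * cosh u * j1)) <= 2 * X * (K1 * d) * (2 * cosh u * M)).
    { apply P. apply P; trivial. rewrite Rabs_pos_eq; lra. apply P; trivial. rewrite Rabs_pos_eq; lra. }
    eapply Rle_trans. apply Rabs_triang. rewrite Rabs_Ropp. eapply Rle_trans. apply Rplus_le_compat_r. apply Rabs_triang. rewrite Rabs_Ropp.
    lra.
  - intros y Hy. apply Rabs_def2 in Hy. apply integrable_lom. lra.
  - exact I1.
Qed.

Lemma lom_integral_bound (c u X L : R) (f : R -> R) : 0 < X -> integrable f ->
  (forall t, 0 < t -> Rabs (f t) <= L * sech t + cosh u * Rabs (J1 (2 * cosh u * X)) * (X * kap (X ^ 2 * sinh t ^ 2))) ->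
  0 <= L -> forall K, (forall X, 0 < X -> half_int (fun t => X * kap (X ^ 2 * sinh t ^ 2)) <= K) ->
  Rabs (half_int f) <= 4 * PI * L + cosh u * Rabs (J1 (2 * cosh u * X)) * K.
Proof.
  intros HX If B HL K HK. pose proof (cosh_ge_1 u).
  assert (IS : integrable sech).
  { apply (integrable_exp _ 2). intros t _. eapply is_derive_continuous, is_derive_sech. intros t Ht. pose proof (sech_bound t) as [[S1 _] S3]. rewrite Rabs_pos_eq; lra. }
  assert (BS : half_int sech <= 4 * PI).
  { assert (D : dominated 4 sech). { split. intros t _. eapply is_derive_continuous, is_derive_sech.
      intros t Ht. pose proof (sech_bound t) as [[S1 _] S3]. pose proof (exp_neg_delta t Ht). rewrite Rabs_pos_eq; lra. }
    apply half_int_dominated in D. destruct D as [_ D]. pose proof (Rle_abs (half_int sech)). lra. }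
  pose proof (integrable_Xkap X HX) as IX.
  eapply Rle_trans. apply (half_int_abs_le f (fun t => L * sech t + cosh u * Rabs (J1 (2 * cosh u * X)) * (X * kap (X ^ 2 * sinh t ^ 2)))); trivial.
  apply integrable_plus; apply integrable_scal; trivial.
  rewrite (half_int_plus (fun t => L * sech t) (fun t => cosh u * Rabs (J1 (2 * cosh u * X)) * (X * kap (X ^ 2 * sinh t ^ 2))))
    by (apply integrable_scal; trivial).
  rewrite (half_int_scal sech), (half_int_scal (fun t => X * kap (X ^ 2 * sinh t ^ 2))) by trivial.
  specialize (HK X HX). assert (0 <= cosh u * Rabs (J1 (2 * cosh u * X))). { apply Rmult_le_pos. lra. apply Rabs_pos. }
  apply Rplus_le_compat. rewrite (Rmult_comm (4 * PI)). apply Rmult_le_compat_l; trivial. apply Rmult_le_compat_l; trivial.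
Qed.

Lemma cosh_le_PI (u : R) : - PI <= u <= PI -> cosh u <= cosh PI.
Proof.
  intros Hu. assert (G : forall v, 0 <= v <= PI -> cosh v <= cosh PI).
  { intros v Hv. destruct (Req_dec v PI) as [->|Hn']. lra.
    destruct (MVT_gen cosh v PI sinh) as [c [Hc Ec]].
    - intros; apply is_derive_cosh.
    - intros; apply continuity_pt_filterlim. eapply is_derive_continuous, is_derive_cosh.
    - rewrite Rmin_left, Rmax_right in Hc by lra. pose proof (sinh_ge c ltac:(lra)). nra. }
  destruct (Rle_dec 0 u). apply G; lra. rewrite <- (Ropp_involutive u).
  replace (cosh (- - u)) with (cosh (- u)). apply G; lra. unfold cosh. rewrite Ropp_involutive. lra.
Qed.

(** [1 - gam * J0] is small because [J0] is near 1 and [1 - gam] is at most [G * (X * sinh t)],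
    whose growth the factor [sech t ^ 2] compensates. Uniformity in [u] comes from
    [cosh u <= cosh PI]. *)
Lemma Psi_small (e : R) : 0 < e -> exists d, 0 < d /\ forall X u, 0 < X < d -> - PI <= u <= PI -> Rabs (Psi X u) <= e.
Proof.
  intros He. destruct Xkap_bound as [K [HK BK]]. destruct one_minus_gam as [G [HG BG]]. pose proof PI_RGT_0 as HP.
  set (c := cosh PI). assert (Hc1 : 1 <= c) by apply cosh_ge_1.
  set (T := 4 * PI * (1 + 2 * G) + c * K). assert (HT : 0 < T) by (unfold T; nra).
  set (e' := Rmin 1 (e / T)). assert (He' : 0 < e') by (apply Rmin_glb_lt; [lra|apply Rdiv_lt_0_compat; lra]).
  assert (He1 : e' <= 1) by apply Rmin_l. assert (He2 : e' <= e / T) by apply Rmin_r.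
  destruct (J_small e' He') as [d [Hd BJ]]. exists (Rmin e' (d / (2 * c))). split. apply Rmin_glb_lt; trivial. apply Rdiv_lt_0_compat; lra.
  intros X u [HX HXd] Hu. pose proof (cosh_ge_1 u) as Hc. pose proof (cosh_le_PI u Hu) as Hcu. fold c in Hcu.
  assert (X < e') by (eapply Rlt_le_trans; [apply HXd|apply Rmin_l]). assert (HX2 : X < d / (2 * c)) by (eapply Rlt_le_trans; [apply HXd|apply Rmin_r]).
  assert (Hz : 0 < 2 * cosh u * X < d).
  { split. apply Rmult_lt_0_compat; lra. apply (Rmult_lt_compat_l (2 * c)) in HX2; [|lra]. replace (2 * c * (d / (2 * c))) with d in HX2 by (field; lra). nra. }
  destruct (BJ _ Hz) as [B0 B1].
  assert (Q := lom_integral_bound 1 u X ((1 + 2 * G) * e') (lom u X) HX (integrable_lom u X HX)).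
  eapply Rle_trans. apply (fun H1 H2 => Q H1 H2 K BK).
  - intros t Ht. eapply Rle_trans. apply lom_split_bound; trivial. apply Rplus_le_compat_r.
    pose proof (sinh_sq_pos X t HX Ht) as W. specialize (BG _ W). destruct (gam_bound _ W) as [G0 _].
    pose proof (sech_bound t) as [[S1 S2] _]. pose proof (sinh_pos t Ht). pose proof (cosh_ge_1 t).
    assert (SQ : sqrt (X ^ 2 * sinh t ^ 2) = X * sinh t).
    { replace (X ^ 2 * sinh t ^ 2) with ((X * sinh t) * (X * sinh t)) by ring. apply sqrt_square. nra. }
    rewrite SQ in BG. set (g := gam (X ^ 2 * sinh t ^ 2)) in *. set (j0 := J0 (2 * cosh u * X)) in *.
    assert (J2 : Rabs j0 <= 2). { replace j0 with (1 - (1 - j0)) by ring. eapply Rle_trans. apply Rabs_triang. rewrite Rabs_R1, Rabs_Ropp. lra. }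
    assert (A : Rabs (1 - g * j0) <= e' + 2 * (G * (X * sinh t))).
    { replace (1 - g * j0) with ((1 - j0) + (1 - g) * j0) by ring. eapply Rle_trans. apply Rabs_triang. rewrite Rabs_mult, (Rabs_pos_eq (1 - g)) by lra.
      pose proof (Rabs_pos j0). nra. }
    assert (SS : sinh t * sech t <= 1). { replace (sinh t * sech t) with (tanh t) by reflexivity. apply tanh_bound. }
    apply Rle_trans with ((e' + 2 * (G * (X * sinh t))) * (sech t ^ 2)). apply Rmult_le_compat; trivial. apply Rabs_pos. nra. nra.
    assert (0 <= sech t ^ 2 <= sech t) by nra.
    replace ((e' + 2 * (G * (X * sinh t))) * sech t ^ 2) with (e' * sech t ^ 2 + 2 * G * X * (sinh t * sech t) * sech t) by ring.
    replace ((1 + 2 * G) * e' * sech t) with (e' * sech t + 2 * G * e' * 1 * sech t) by ring.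
    apply Rplus_le_compat. apply Rmult_le_compat_l; lra. apply Rmult_le_compat_r. lra. apply Rmult_le_compat; try nra.
  - nra.
  - apply Rle_trans with (T * e').
    + unfold T. pose proof (Rabs_pos (J1 (2 * cosh u * X))).
      assert (cosh u * Rabs (J1 (2 * cosh u * X)) <= c * e') by (apply Rmult_le_compat; lra). nra.
    + apply (Rmult_le_compat_l T) in He2; [|lra]. replace (T * (e / T)) with e in He2 by (field; lra). exact He2.
Qed.
End LommelTransform.

(** The terms with [J0] and [J1] die out with the Bessel functions; what is left of [lom] is the
    constant 1 over its denominator, a quarter of [kerB]. *)
Lemma Psi_large (mu e : R) : 0 < mu -> 0 < e -> exists M, 0 < M /\ forall X u, M < X -> - PI <= u <= PI ->
  Rabs (Psi (2 * mu) X u - Bint mu (cosh u ^ 2) / 4) <= e.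
Proof.
  intros Hmu He. destruct Xkap_bound as [K [HK BK]]. pose proof PI_RGT_0 as HP.
  set (c := cosh PI). assert (Hc1 : 1 <= c) by apply cosh_ge_1.
  set (T := 4 * PI + c * K). assert (HT : 0 < T) by (unfold T; nra).
  set (e' := e / T). assert (He' : 0 < e') by (apply Rdiv_lt_0_compat; lra).
  destruct (J_large e' He') as [Z [HZ BJ]]. exists Z. split; trivial.
  intros X u HX Hu. pose proof (cosh_ge_1 u) as Hc. pose proof (cosh_le_PI u Hu) as Hcu. fold c in Hcu.
  assert (HX0 : 0 < X) by lra. destruct (BJ (2 * cosh u * X)) as [B0 B1]. nra.
  assert (IB : integrable (fun t => / 4 * kerB mu (cosh u ^ 2) t)).
  { apply integrable_scal, integrable_kerB; nra. }
  assert (IL : integrable (lom (2 * mu) u X)) by (apply integrable_lom; lra).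
  replace (Psi (2 * mu) X u - Bint mu (cosh u ^ 2) / 4) with (half_int (fun t => lom (2 * mu) u X t - / 4 * kerB mu (cosh u ^ 2) t)).
  2: { rewrite (half_int_minus (lom (2 * mu) u X)), (half_int_scal (kerB mu (cosh u ^ 2))); trivial. unfold Psi, Bint. field.
       apply integrable_kerB; nra. }
  apply Rle_trans with (4 * PI * e' + cosh u * Rabs (J1 (2 * cosh u * X)) * K).
  - apply lom_integral_bound; trivial; try lra. apply integrable_minus; trivial.
    intros t Ht. pose proof (sinh_sq_pos X t HX0 Ht) as W.
    replace (lom (2 * mu) u X t - / 4 * kerB mu (cosh u ^ 2) t) with
      ((0 + cosh u * X * kap (X ^ 2 * sinh t ^ 2) * J1 (2 * cosh u * X) - gam (X ^ 2 * sinh t ^ 2) * J0 (2 * cosh u * X))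
       / (4 * (sinh t ^ 2 + cosh u ^ 2)) * cos (2 * mu * t + 0)).
    2: { unfold lom, kerB. pose proof (pow2_ge_0 (sinh t)). field. nra. }
    eapply Rle_trans. apply lom_split_bound; trivial. apply Rplus_le_compat_r.
    rewrite Rminus_0_l, Rabs_Ropp, Rabs_mult. pose proof (gam_le_1 _ W). destruct (gam_bound _ W) as [G0 _].
    rewrite Rabs_pos_eq by trivial. pose proof (sech_bound t) as [[S1 S2] _]. set (j := Rabs _) in *. assert (0 <= j) by apply Rabs_pos.
    set (g := gam _) in *. assert (g * j <= e') by nra. assert (0 <= sech t ^ 2 / 4 <= sech t) by nra. nra.
  - apply Rle_trans with (T * e').
    + unfold T. pose proof (Rabs_pos (J1 (2 * cosh u * X))).
      assert (cosh u * Rabs (J1 (2 * cosh u * X)) <= c * e') by (apply Rmult_le_compat; lra). nra.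
    + unfold e'. right. field. lra.
Qed.

(** * The coefficients of the expansion *)

Lemma is_derive_RInt_near (F F1 : R -> R -> R) (a b x r : R) : 0 < r ->
  (forall y t, Rabs (y - x) < r -> is_derive (fun y => F y t) y (F1 y t)) ->
  (forall t, continuity_2d_pt F1 x t) ->
  (forall y, Rabs (y - x) < r -> ex_RInt (F y) a b) ->
  is_derive (fun y => RInt (F y) a b) x (RInt (F1 x) a b).
Proof.
  intros Hr HD HC HI.
  replace (RInt (F1 x) a b) with (RInt (fun t => Derive (fun y => F y t) x) a b).
  2: { apply RInt_ext. intros t _. apply is_derive_unique, HD. rewrite Rminus_diag, Rabs_R0; trivial. }
  apply (is_derive_RInt_param F).
  - exists (mkposreal r Hr). intros y Hy t _. eexists. apply HD. exact Hy.
  - intros t _. apply (continuity_2d_pt_ext_loc F1); trivial.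
    exists (mkposreal r Hr). intros y v Hy _. symmetry. apply is_derive_unique, HD. exact Hy.
  - exists (mkposreal r Hr). intros y Hy. apply HI. exact Hy.
Qed.

Lemma ex_RInt_cont (f : R -> R) (a b : R) : (forall x, continuous f x) -> ex_RInt f a b.
Proof. intros H. apply (ex_RInt_continuous (V := R_CompleteNormedModule)). auto. Qed.

Lemma cont_2d_fst (f : R -> R) (x t : R) : continuous f x -> continuity_2d_pt (fun y _ => f y) x t.
Proof. intros H. apply (continuity_1d_2d_pt_comp f (fun y _ => y)). apply continuity_pt_filterlim, H. apply continuity_2d_pt_id1. Qed.

Lemma cont_2d_snd (f : R -> R) (x t : R) : continuous f t -> continuity_2d_pt (fun _ s => f s) x t.
Proof. intros H. apply (continuity_1d_2d_pt_comp f (fun _ s => s)). apply continuity_pt_filterlim, H. apply continuity_2d_pt_id2. Qed.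

Lemma continuous_cosh (u : R) : continuous cosh u.
Proof. eapply is_derive_continuous, is_derive_cosh. Qed.
Lemma continuous_sinh (u : R) : continuous sinh u.
Proof. eapply is_derive_continuous, is_derive_sinh. Qed.

Lemma cont_2d_bessel (J : R -> R) (x u : R) : (forall z, continuous J z) -> continuity_2d_pt (fun x u => J (2 * cosh u * x)) x u.
Proof.
  intros H. apply (continuity_1d_2d_pt_comp J (fun x u => 2 * cosh u * x)). apply continuity_pt_filterlim, H.
  apply continuity_2d_pt_mult. apply continuity_2d_pt_mult. apply continuity_2d_pt_const. apply cont_2d_snd, continuous_cosh. apply continuity_2d_pt_id1.
Qed.

Lemma is_derive_J0_x (x u : R) : is_derive (fun x => J0 (2 * cosh u * x)) x (- J1 (2 * cosh u * x) * (2 * cosh u)).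
Proof. apply (is_derive_comp_R J0 (fun X => 2 * cosh u * X)). apply is_derive_J0. auto_derive; trivial. ring. Qed.

Lemma is_derive_J0_u (x u : R) : is_derive (fun u => J0 (2 * cosh u * x)) u (- J1 (2 * cosh u * x) * (2 * sinh u * x)).
Proof. apply (is_derive_comp_R J0 (fun u => 2 * cosh u * x)). apply is_derive_J0. auto_derive; trivial. ring. Qed.

Lemma is_derive_times_const (f : R -> R) (x l c : R) : is_derive f x l -> is_derive (fun x => f x * c) x (l * c).
Proof. intros D. auto_derive. exact (ex_intro _ _ D). drw D. ring. Qed.

(** With [p u = g u * sinh (2 * u)] and [g] a component of [psi], [x * bint p x] is that component
    of f. *)
Definition bint (p : R -> R) (x : R) : R := RInt (fun u => J0 (2 * cosh u * x) * p u) (- PI) PI.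

Lemma continuous_J0u (p : R -> R) (x u : R) : continuous p u -> continuous (fun u => J0 (2 * cosh u * x) * p u) u.
Proof.
  intros H. apply (continuous_mult (fun u => J0 (2 * cosh u * x)) p); trivial. eapply is_derive_continuous, is_derive_J0_u.
Qed.

Lemma continuous_bint (p : R -> R) (x : R) : (forall u, continuous p u) -> continuous (bint p) x.
Proof.
  intros Hp. eapply is_derive_continuous. unfold bint.
  apply (is_derive_RInt_near (fun x u => J0 (2 * cosh u * x) * p u) (fun x u => - J1 (2 * cosh u * x) * (2 * cosh u) * p u) (- PI) PI x 1). lra.
  - intros y u _. apply is_derive_times_const, is_derive_J0_x.
  - intros u. apply continuity_2d_pt_mult. apply continuity_2d_pt_mult. apply continuity_2d_pt_opp. apply cont_2d_bessel, continuous_J1.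
    apply continuity_2d_pt_mult. apply continuity_2d_pt_const. apply cont_2d_snd, continuous_cosh. apply cont_2d_snd, Hp.
  - intros y _. apply ex_RInt_cont. intros u. apply continuous_J0u, Hp.
Qed.

Section FiniteFubini.
Variable n : R.
Hypothesis Hn : 0 < n.
Variable p : R -> R.
Hypothesis Hp : forall u, continuous p u.

Lemma continuous_nint (x : R) : 0 < x -> continuous (nint n kap) x.
Proof. intros Hx. eapply is_derive_continuous. apply is_derive_nint0; trivial. Qed.

Lemma Psi_diff (a b u : R) : 0 < a -> 0 < b -> Psi n b u - Psi n a u = RInt (fun x => x / 2 * nint n kap x * J0 (2 * cosh u * x)) a b.
Proof.
  intros Ha Hb. symmetry. apply is_RInt_unique. assert (0 < Rmin a b) by (apply Rmin_glb_lt; trivial).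
  apply (is_RInt_derive (fun X => Psi n X u)).
  - intros x Hx. apply is_derive_Psi; trivial. lra.
  - intros x Hx. apply (continuous_mult (fun x => x / 2 * nint n kap x) (fun x => J0 (2 * cosh u * x))).
    apply (continuous_mult (fun x => x / 2) (nint n kap)). apply (ex_derive_continuous (fun x => x / 2)). auto_derive; trivial.
    apply continuous_nint; lra. eapply is_derive_continuous, is_derive_J0_x.
Qed.

(** Continuity in [u] is read off from the integral over the compact interval between [a] and [b],
    not from the improper integral over [t]. *)
Lemma continuous_Psi_diff (a b u : R) : 0 < a -> 0 < b -> continuous (fun u => Psi n b u - Psi n a u) u.
Proof.
  intros Ha Hb. apply (continuous_ext (fun u => RInt (fun x => x / 2 * nint n kap x * J0 (2 * cosh u * x)) a b)).
  intros; symmetry; apply Psi_diff; trivial.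
  (* Outside of the integration interval the integrand is replaced by a continuous extension. *)
  set (m := Rmin a b). assert (Hm : 0 < m) by (apply Rmin_glb_lt; trivial).
  set (k := fun x => nint n kap (Rmax m x)).
  assert (Ck : forall x, continuous k x).
  { intros x. apply (continuous_comp (Rmax m) (nint n kap)).
    apply (continuous_ext (fun x => (m + x + Rabs (x - m)) * / 2)). intros y. unfold Rmax, Rabs. destruct (Rle_dec m y), (Rcase_abs (y - m)); simpl; lra.
    apply (continuous_mult (fun x => m + x + Rabs (x - m)) (fun _ => / 2)). apply (continuous_plus (fun x => m + x) (fun x => Rabs (x - m))).
    apply (continuous_plus (fun _ => m) (fun x => x)). apply continuous_const. apply continuous_id.
    apply (continuous_comp (fun x => x - m) Rabs). apply (continuous_minus (fun x => x) (fun _ => m)). apply continuous_id. apply continuous_const.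
    apply continuous_Rabs. apply continuous_const.
    apply continuous_nint. eapply Rlt_le_trans. apply Hm. apply Rmax_l. }
  apply (continuous_ext (fun u => RInt (fun x => x / 2 * k x * J0 (2 * cosh u * x)) a b)).
  { intros v. apply RInt_ext. intros x Hx. fold m in Hx. unfold k. rewrite Rmax_right by lra. reflexivity. }
  eapply is_derive_continuous.
  apply (is_derive_RInt_near (fun u x => x / 2 * k x * J0 (2 * cosh u * x)) (fun u x => x / 2 * k x * (- J1 (2 * cosh u * x) * (2 * sinh u * x))) a b u 1). lra.
  - intros v x _. apply (is_derive_scal (fun u => J0 (2 * cosh u * x))). apply is_derive_J0_u.
  - intros x. assert (CB : continuity_2d_pt (fun u x => J1 (2 * cosh u * x)) u x).
    { apply (continuity_1d_2d_pt_comp J1 (fun u x => 2 * cosh u * x)). apply continuity_pt_filterlim, continuous_J1.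
      apply continuity_2d_pt_mult. apply continuity_2d_pt_mult. apply continuity_2d_pt_const. apply cont_2d_fst, continuous_cosh. apply continuity_2d_pt_id2. }
    apply continuity_2d_pt_mult. apply (cont_2d_snd (fun x => x / 2 * k x)). apply (continuous_mult (fun x => x / 2) k); trivial.
    apply (ex_derive_continuous (fun x => x / 2)). auto_derive; trivial.
    apply continuity_2d_pt_mult. apply continuity_2d_pt_opp. exact CB.
    apply continuity_2d_pt_mult. apply continuity_2d_pt_mult. apply continuity_2d_pt_const. apply cont_2d_fst, continuous_sinh. apply continuity_2d_pt_id2.
  - intros v _. apply ex_RInt_cont. intros x. apply (continuous_mult (fun x => x / 2 * k x) (fun x => J0 (2 * cosh v * x))).
    apply (continuous_mult (fun x => x / 2) k); trivial. apply (ex_derive_continuous (fun x => x / 2)). auto_derive; trivial.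
    eapply is_derive_continuous, is_derive_J0_x.
Qed.

(** The right side, as a function of [b], vanishes at [b = a] and has the left integrand as
    derivative; this replaces a Fubini theorem. *)
Lemma finite_fubini (a b : R) : 0 < a -> 0 < b ->
  RInt (fun x => x / 2 * nint n kap x * bint p x) a b = RInt (fun u => (Psi n b u - Psi n a u) * p u) (- PI) PI.
Proof.
  intros Ha Hb. assert (Hm : 0 < Rmin a b) by (apply Rmin_glb_lt; trivial).
  set (G := fun X => RInt (fun u => (Psi n X u - Psi n a u) * p u) (- PI) PI).
  replace (RInt (fun u => (Psi n b u - Psi n a u) * p u) (- PI) PI) with (minus (G b) (G a)).
  2: { replace (G a) with 0. unfold minus, plus, opp; simpl. rewrite Ropp_0, Rplus_0_r. reflexivity.
       unfold G. rewrite (RInt_ext _ (fun _ => 0)). rewrite RInt_const. unfold scal; simpl; unfold mult; simpl. ring.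
       intros u _. assert (Q : (Psi n a u - Psi n a u) * p u = 0) by ring. exact Q. }
  apply is_RInt_unique. apply (is_RInt_derive G).
  - intros x Hx. assert (Hx0 : 0 < x) by lra.
    replace (x / 2 * nint n kap x * bint p x) with (RInt (fun u => x / 2 * nint n kap x * J0 (2 * cosh u * x) * p u) (- PI) PI).
    2: { unfold bint. rewrite <- (RInt_scal (V := R_CompleteNormedModule)). apply RInt_ext. intros; unfold scal; simpl; unfold mult; simpl; ring.
         apply ex_RInt_cont. intros u. apply continuous_J0u, Hp. }
    apply (is_derive_RInt_near (fun X u => (Psi n X u - Psi n a u) * p u) (fun x u => x / 2 * nint n kap x * J0 (2 * cosh u * x) * p u) (- PI) PI x x); trivial.
    + intros y u Hy. apply Rabs_def2 in Hy. pose proof (is_derive_Psi n u y ltac:(lra)) as D.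
      set (P := fun X => Psi n X u) in *. set (l := y / 2 * nint n kap y * J0 (2 * cosh u * y)) in *.
      change (is_derive (fun X => (P X - Psi n a u) * p u) y (l * p u)). change (is_derive P y l) in D. clearbody P l. auto_derive. exact (ex_intro _ _ D). drw D. ring.
    + intros u. apply continuity_2d_pt_mult. apply continuity_2d_pt_mult. apply (cont_2d_fst (fun x => x / 2 * nint n kap x)).
      apply (continuous_mult (fun x => x / 2) (nint n kap)). apply (ex_derive_continuous (fun x => x / 2)). auto_derive; trivial. apply continuous_nint; trivial.
      apply cont_2d_bessel, continuous_J0. apply cont_2d_snd, Hp.
    + intros y Hy. apply Rabs_def2 in Hy. apply ex_RInt_cont. intros u. apply (continuous_mult (fun u => Psi n y u - Psi n a u) p); trivial.
      apply continuous_Psi_diff; lra.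
  - intros x Hx. apply (continuous_mult (fun x => x / 2 * nint n kap x) (bint p)).
    apply (continuous_mult (fun x => x / 2) (nint n kap)). apply (ex_derive_continuous (fun x => x / 2)). auto_derive; trivial. apply continuous_nint; lra.
    apply continuous_bint, Hp.
Qed.
End FiniteFubini.

Lemma RInt_minus_R (f g : R -> R) (a b : R) : ex_RInt f a b -> ex_RInt g a b -> RInt (fun x => f x - g x) a b = RInt f a b - RInt g a b.
Proof. exact (RInt_minus (V := R_CompleteNormedModule) f g a b). Qed.
Lemma RInt_plus_R (f g : R -> R) (a b : R) : ex_RInt f a b -> ex_RInt g a b -> RInt (fun x => f x + g x) a b = RInt f a b + RInt g a b.
Proof. exact (RInt_plus (V := R_CompleteNormedModule) f g a b). Qed.
Lemma RInt_scal_R (f : R -> R) (k a b : R) : ex_RInt f a b -> RInt (fun x => k * f x) a b = k * RInt f a b.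
Proof. exact (RInt_scal (V := R_CompleteNormedModule) f a b k). Qed.

Lemma bounded_on_period (p : R -> R) : (forall u, continuous p u) -> exists B, 0 < B /\ forall u, - PI <= u <= PI -> Rabs (p u) <= B.
Proof.
  intros Hp. pose proof PI_RGT_0. destruct (continuity_ab_maj (fun z => Rabs (p z)) (- PI) PI ltac:(lra)) as [m [Hm _]].
  - intros c _. apply continuity_pt_filterlim. apply (continuous_comp p Rabs). apply Hp. apply continuous_Rabs.
  - exists (Rabs (p m) + 1). pose proof (Rabs_pos (p m)). split. lra. intros u Hu. specialize (Hm u Hu). simpl in Hm. lra.
Qed.

(** By [nicholson] the integrand is [8 / PI ^ 2] times that of [finite_fubini]. The uniform limits
    of [Psi] leave [Bint / 4] under the [u]-integral; [hyperbolic_kernel] makes it a sine, since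
    [sinh (2 u) = 2 sinh u cosh u] cancels the denominator, and [S2_value] supplies the constant. *)
Lemma coefficient_integral (mu : R) (g : R -> R) : 0 < mu -> (forall u, continuous g u) ->
  is_RInt_gen (fun x => Hsq mu x * (x * bint (fun u => g u * sinh (2 * u)) x)) (at_right 0) at_infty
    (2 / (PI * sinh (PI * mu)) * RInt (fun u => g u * sin (2 * mu * u)) (- PI) PI).
Proof.
  intros Hmu Hg. pose proof PI_RGT_0 as HP. set (p := fun u => g u * sinh (2 * u)). set (n := 2 * mu). assert (Hn : 0 < n) by (unfold n; lra).
  assert (Hp : forall u, continuous p u).
  { intros u. apply (continuous_mult g (fun u => sinh (2 * u))). apply Hg. apply (ex_derive_continuous (fun u => sinh (2 * u))). auto_derive; trivial. }
  assert (Hs : 0 < sinh (PI * mu)) by (apply sinh_pos, Rmult_lt_0_compat; lra).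
  assert (EQ : forall x, 0 < x -> Hsq mu x * (x * bint p x) = 8 / PI ^ 2 * (x / 2 * nint n kap x * bint p x)).
  { intros x Hx. rewrite nicholson by trivial. fold n. field. lra. }
  assert (CQ : forall x, 0 < x -> continuous (fun x => x / 2 * nint n kap x * bint p x) x).
  { intros x Hx. apply (continuous_mult (fun x => x / 2 * nint n kap x) (bint p)).
    apply (continuous_mult (fun x => x / 2) (nint n kap)). apply (ex_derive_continuous (fun x => x / 2)). auto_derive; trivial. apply continuous_nint; trivial.
    apply continuous_bint, Hp. }
  apply is_RInt_gen_half.
  - intros x Hx. apply (continuous_ext_loc _ (fun x => 8 / PI ^ 2 * (x / 2 * nint n kap x * bint p x))).
    + exists (mkposreal x Hx). intros y Hy. unfold ball in Hy; simpl in Hy; unfold AbsRing_ball, minus, plus, opp, abs in Hy; simpl in Hy.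
      apply Rabs_def2 in Hy. symmetry. apply EQ. lra.
    + apply (continuous_scal_r (8 / PI ^ 2) (fun x => x / 2 * nint n kap x * bint p x)). auto.
  - destruct (bounded_on_period p Hp) as [B [HB BB]].
    assert (EK : 2 / (PI * sinh (PI * mu)) * RInt (fun u => g u * sin (n * u)) (- PI) PI =
      8 / PI ^ 2 * RInt (fun u => Bint mu (cosh u ^ 2) / 4 * p u) (- PI) PI).
    { rewrite (RInt_ext (fun u => Bint mu (cosh u ^ 2) / 4 * p u) (fun u => scal (PI / (4 * sinh (PI * mu))) (g u * sin (n * u)))).
      - rewrite (RInt_scal (V := R_CompleteNormedModule)). unfold scal; simpl; unfold mult; simpl. field. split; lra.
        apply ex_RInt_cont. intros u. apply (continuous_mult g (fun u => sin (n * u))). apply Hg. apply (ex_derive_continuous (fun u => sin (n * u))). auto_derive; trivial.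
      - intros u _. unfold scal; simpl; unfold mult; simpl. pose proof (hyperbolic_kernel mu u) as HK. pose proof (S2_value mu Hmu) as S2V.
        fold n in HK, S2V. set (S2 := sech_int n 1) in *. unfold p.
        replace (sinh (2 * u)) with (2 * sinh u * cosh u).
        2: { unfold sinh, cosh. replace (2 * u) with (u + u) by ring. replace (- (u + u)) with (- u + - u) by ring. rewrite !exp_plus. field. }
        unfold n in HK at 1. set (b := Bint _ _) in *. fold n in HK.
        replace (PI / (4 * sinh (PI * mu)) * (g u * sin (n * u))) with (g u / (4 * mu) * (S2 * sin (n * u))).
        rewrite <- HK. unfold n, b. match goal with |- @eq _ ?a ?c => change (@eq R a c) end. field. lra.
        assert (ES : S2 = PI * mu / sinh (PI * mu)) by (apply (Rmult_eq_reg_r (sinh (PI * mu))); [rewrite S2V; field; lra|lra]). rewrite ES. field. lra. }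
    rewrite EK.
    apply (lim_at_spec (FF := filter_prod_filter _ _ (at_right 0) at_infty _ _) (filter_prod (at_right 0) at_infty)). intros e He.
    (* The total error is at most [8 / PI^2 * 2 PI * 2 e' B], which is [e / 2]. *)
    set (e' := e * PI / (64 * B)). assert (He' : 0 < e') by (apply Rdiv_lt_0_compat; nra).
    destruct (Psi_small n e' He') as [d [Hd BS]]. destruct (Psi_large mu e' Hmu He') as [M [HM BL]]. fold n in BL.
    apply (Filter_prod _ _ _ (fun t => 0 < t < d) (fun t => M < t)). apply at_right0_lt; trivial. apply at_infty_gt.
    intros a b Ha Hb. simpl.
    assert (Hpos : forall t, Rmin a b < t -> 0 < t). { intros t Ht. eapply Rlt_trans; [|exact Ht]. apply Rmin_glb_lt; lra. }
    rewrite (RInt_ext _ (fun x => scal (8 / PI ^ 2) (x / 2 * nint n kap x * bint p x))) by (intros x Hx; apply EQ, Hpos, Hx).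
    rewrite (RInt_scal (V := R_CompleteNormedModule)).
    2: { apply (ex_RInt_continuous (V := R_CompleteNormedModule)). intros x Hx. apply CQ. eapply Rlt_le_trans; [|apply Hx]. apply Rmin_glb_lt; lra. }
    rewrite finite_fubini by (trivial; lra).
    assert (CB : forall u, continuous (fun u => Bint mu (cosh u ^ 2) / 4) u).
    { intros u. pose proof (cosh_ge_1 u). apply (continuous_mult (fun u => Bint mu (cosh u ^ 2)) (fun _ => / 4)); [|apply continuous_const].
      apply (continuous_comp (fun u => cosh u ^ 2) (Bint mu)). apply (ex_derive_continuous (fun u => cosh u ^ 2)). auto_derive; trivial.
      eapply is_derive_continuous, is_derive_Bint; nra. }
    assert (CP : forall u, continuous (fun u => (Psi n b u - Psi n a u) * p u) u).
    { intros u. apply (continuous_mult (fun u => Psi n b u - Psi n a u) p); trivial. apply continuous_Psi_diff; lra. }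
    assert (CBp : forall u, continuous (fun u => Bint mu (cosh u ^ 2) / 4 * p u) u).
    { intros u. apply (continuous_mult (fun u => Bint mu (cosh u ^ 2) / 4) p); trivial. }
    assert (T : Rabs (RInt (fun u => (Psi n b u - Psi n a u) * p u) (- PI) PI - RInt (fun u => Bint mu (cosh u ^ 2) / 4 * p u) (- PI) PI) <= 2 * PI * (2 * e' * B)).
    { rewrite <- (RInt_minus_R (fun u => (Psi n b u - Psi n a u) * p u) (fun u => Bint mu (cosh u ^ 2) / 4 * p u) _ _ (ex_RInt_cont _ (- PI) PI CP) (ex_RInt_cont _ (- PI) PI CBp)).
      replace (2 * PI * (2 * e' * B)) with ((PI - - PI) * (2 * e' * B)) by ring.
      apply abs_RInt_le_const. lra. apply ex_RInt_cont. intros u. apply (continuous_minus (fun u => (Psi n b u - Psi n a u) * p u) (fun u => Bint mu (cosh u ^ 2) / 4 * p u)); trivial.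
      intros u Hu. replace ((Psi n b u - Psi n a u) * p u - (Bint mu (cosh u ^ 2) / 4 * p u)) with (((Psi n b u - Bint mu (cosh u ^ 2) / 4) - Psi n a u) * p u) by ring.
      rewrite Rabs_mult. apply Rmult_le_compat; try apply Rabs_pos; [|apply BB; trivial]. eapply Rle_trans. apply Rabs_triang. rewrite Rabs_Ropp.
      specialize (BS a u Ha Hu). specialize (BL b u Hb Hu). lra. }
    unfold scal at 1; simpl; unfold mult at 1; simpl. rewrite <- Rmult_minus_distr_l, Rabs_mult, Rabs_pos_eq.
    2: { apply Rlt_le, Rdiv_lt_0_compat; nra. }
    eapply Rle_lt_trans. apply Rmult_le_compat_l; [|exact T]. apply Rlt_le, Rdiv_lt_0_compat; nra.
    unfold e'. apply Rle_lt_trans with (e / 2); [right; field; split; lra|lra].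
Qed.

(** * Sine series *)

Ltac real_eq := match goal with |- @eq _ ?a ?c => change (@eq R a c) end.

Lemma RInt_shift (h : R -> R) (c a b : R) : (forall x, continuous h x) -> RInt (fun y => h (y + c)) a b = RInt h (a + c) (b + c).
Proof.
  intros Ch. pose proof (RInt_comp_lin h 1 c a b (ex_RInt_cont h _ _ Ch)) as E. rewrite !Rmult_1_l in E. rewrite <- E.
  apply RInt_ext. intros x _. unfold scal; simpl; unfold mult; simpl. rewrite !Rmult_1_l. reflexivity.
Qed.

Lemma RInt_Chasles_cont (h : R -> R) (a b c : R) : (forall x, continuous h x) -> RInt h a c = RInt h a b + RInt h b c.
Proof. intros Ch. symmetry. apply (RInt_Chasles (V := R_CompleteNormedModule)); apply ex_RInt_cont, Ch. Qed.

Lemma RInt_periodic (h : R -> R) (T c : R) : (forall x, continuous h x) -> (forall x, h (x + T) = h x) -> RInt h c (c + T) = RInt h 0 T.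
Proof.
  intros Ch Ph. rewrite (RInt_Chasles_cont h c 0), (RInt_Chasles_cont h 0 T (c + T)) by trivial.
  replace (RInt h T (c + T)) with (RInt h 0 c).
  - pose proof (RInt_Chasles_cont h c 0 c Ch) as E. rewrite RInt_point in E. unfold zero in E; simpl in E. lra.
  - rewrite <- (Rplus_0_l T) at 1. rewrite <- RInt_shift by trivial. apply RInt_ext. intros x _. symmetry. apply Ph.
Qed.

(** Partial sum, with [N + 1] terms, of the Fourier series of [(PI - w) / 2] on [(0, 2 PI)]. *)
Definition saw (N : nat) (w : R) : R := sum_n (fun k => sin (INR (S k) * w) / INR (S k)) N.

Definition saw_err (N : nat) (w : R) : R := saw N w - (PI - w) / 2.

Lemma INR_S_pos (k : nat) : 0 < INR (S k).
Proof. apply lt_0_INR. lia. Qed.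

Lemma is_derive_saw (N : nat) (w : R) : is_derive (saw N) w (sum_n (fun k => cos (INR (S k) * w)) N).
Proof.
  unfold saw. apply (is_derive_sum_n (fun k w => sin (INR (S k) * w) / INR (S k)) N w (fun k => cos (INR (S k) * w))).
  intros k _. pose proof (INR_S_pos k) as H. cbv beta. set (m := INR (S k)) in *. clearbody m. auto_derive; trivial. field. lra.
Qed.

(** Each product telescopes; the sum runs over the frequencies 1 to [N + 1], whence the index [S N]
    and the leftover [sin (w / 2)]. *)
Lemma dirichlet_kernel (N : nat) (w : R) :
  2 * sin (w / 2) * sum_n (fun k => cos (INR (S k) * w)) N = sin ((INR (S N) + / 2) * w) - sin (w / 2).
Proof.
  assert (P : forall k, 2 * sin (w / 2) * cos (INR (S k) * w) = sin ((INR (S k) + / 2) * w) - sin ((INR (S k) - / 2) * w)).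
  { intros k. replace ((INR (S k) + / 2) * w) with (INR (S k) * w + w / 2) by field. replace ((INR (S k) - / 2) * w) with (INR (S k) * w - w / 2) by field.
    rewrite sin_plus, sin_minus. ring. }
  induction N as [|N IH].
  - rewrite sum_O, P. simpl INR. replace ((1 - / 2) * w) with (w / 2) by field. reflexivity.
  - rewrite sum_Sn. unfold plus; simpl plus. rewrite Rmult_plus_distr_l, IH, P.
    replace ((INR (S (S N)) - / 2) * w) with ((INR (S N) + / 2) * w). ring. rewrite (S_INR (S N)). field.
Qed.

Lemma is_derive_saw_err (N : nat) (w : R) : 0 < w < 2 * PI ->
  is_derive (saw_err N) w (sin ((INR (S N) + / 2) * w) / (2 * sin (w / 2))).
Proof.
  intros Hw. assert (S : 0 < sin (w / 2)) by (apply sin_gt_0; lra).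
  pose proof (is_derive_saw N w) as D. unfold saw_err.
  replace (sin ((INR (Datatypes.S N) + / 2) * w) / (2 * sin (w / 2))) with (sum_n (fun k => cos (INR (Datatypes.S k) * w)) N + / 2).
  2: { apply (Rmult_eq_reg_l (2 * sin (w / 2))); [|lra]. rewrite Rmult_plus_distr_l, dirichlet_kernel. field. lra. }
  set (l := sum_n _ _) in *. set (s := saw N) in *. clearbody l s. auto_derive. exact (ex_intro _ _ D). drw D. field.
Qed.

Lemma saw_PI (N : nat) : saw N PI = 0.
Proof.
  unfold saw. rewrite (sum_n_ext _ (fun _ => 0)). rewrite sum_n_const. ring.
  intros k. assert (E : sin (INR (S k) * PI) = 0).
  { rewrite <- (Rplus_0_l (INR (S k) * PI)). replace (INR (S k) * PI) with (IZR (Z.of_nat (S k)) * PI) by (rewrite <- INR_IZR_INZ; reflexivity).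
    rewrite Rplus_0_l. apply sin_eq_0_1. eexists; reflexivity. }
  rewrite E. apply Rmult_0_l.
Qed.

Lemma saw_reflect (N : nat) (w : R) : saw N (2 * PI - w) = - saw N w.
Proof.
  assert (P : forall k, sin (INR (S k) * (2 * PI - w)) = - sin (INR (S k) * w)).
  { intros k. replace (INR (S k) * (2 * PI - w)) with (- (INR (S k) * w) + 2 * INR (S k) * PI) by ring. rewrite sin_period, sin_neg. reflexivity. }
  unfold saw. induction N as [|N IH].
  - rewrite !sum_O, P. unfold Rdiv. ring.
  - rewrite !sum_Sn, IH, P. change plus with Rplus. unfold Rdiv. ring.
Qed.

Lemma saw_err_reflect (N : nat) (w : R) : saw_err N (2 * PI - w) = - saw_err N w.
Proof. unfold saw_err. rewrite saw_reflect. field. Qed.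

(* [e + (cos (a w) +- 1) / (2 a sin (w/2))] is monotone on (0, PI], where [a = N + 3/2]. *)
Lemma saw_err_decay (N : nat) (w : R) : 0 < w <= PI -> Rabs (saw_err N w) <= / ((INR (S N) + / 2) * sin (w / 2)).
Proof.
  intros Hw. pose proof PI_RGT_0 as HP. set (a := INR (S N) + / 2). assert (Ha : 0 < a) by (pose proof (INR_S_pos N); unfold a; lra).
  assert (S0 : forall v, 0 < v <= PI -> 0 < sin (v / 2) /\ 0 <= cos (v / 2)).
  { intros v Hv. split. apply sin_gt_0; lra. apply cos_ge_0; lra. }
  destruct (S0 w Hw) as [Sw _].
  assert (D : forall s v, 0 < v <= PI -> is_derive (fun v => saw_err N v + (cos (a * v) + s) / (2 * a * sin (v / 2))) v
    (- (cos (a * v) + s) * (cos (v / 2) / (4 * a * sin (v / 2) ^ 2)))).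
  { intros s v Hv. destruct (S0 v Hv) as [Sv _]. pose proof (is_derive_saw_err N v ltac:(lra)) as D. fold a in D.
    set (e := saw_err N) in *. change (is_derive e v (sin (a * v) / (2 * sin (v / 2)))) in D. clearbody e.
    auto_derive. split. exact (ex_intro _ _ D). split; trivial. nra. drw D. change (v * / 2) with (v / 2). field. split; lra. }
  assert (E1 : saw_err N PI = 0) by (unfold saw_err; rewrite saw_PI; field).
  (* [s = 1] gives a decreasing and [s = -1] an increasing function; comparison with the value at
     [PI], where the error vanishes, bounds the error from below and from above respectively. *)
  assert (M : forall s, s * s = 1 -> exists c, 0 < c <= PI /\ (- s * (saw_err N w + (cos (a * w) + s) / (2 * a * sin (w / 2)))
     = - s * ((cos (a * PI) + s) / (2 * a)) - (PI - w) * (- s * (- (cos (a * c) + s) * (cos (c / 2) / (4 * a * sin (c / 2) ^ 2)))))).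
  { intros s Hs. destruct (MVT_gen (fun v => saw_err N v + (cos (a * v) + s) / (2 * a * sin (v / 2))) w PI
      (fun v => - (cos (a * v) + s) * (cos (v / 2) / (4 * a * sin (v / 2) ^ 2)))) as [c [Hc Ec]].
    - intros v Hv. rewrite Rmin_left, Rmax_right in Hv by lra. apply D. lra.
    - intros v Hv. rewrite Rmin_left, Rmax_right in Hv by lra. apply continuity_pt_filterlim. exact (is_derive_continuous _ _ _ (D s v ltac:(lra))).
    - rewrite Rmin_left, Rmax_right in Hc by lra. exists c. split. lra.
      rewrite E1, sin_PI2, Rplus_0_l, Rmult_1_r in Ec. set (x := saw_err N w + _) in *. set (y := (cos (a * PI) + s) / (2 * a)) in *.
      replace x with (y - (y - x)) by ring. rewrite Ec. ring. }
  assert (C : forall x, -1 <= cos x <= 1) by (intros; apply COS_bound).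
  assert (I : / (a * sin (w / 2)) = 2 * / (2 * a * sin (w / 2))) by (field; lra).
  assert (I0 : 0 < / (2 * a * sin (w / 2))) by (apply Rinv_0_lt_compat, Rmult_lt_0_compat; lra).
  assert (G : forall c, 0 < c <= PI -> 0 <= cos (c / 2) / (4 * a * sin (c / 2) ^ 2)).
  { intros c Hc. destruct (S0 c Hc). apply Rmult_le_pos; trivial. apply Rlt_le, Rinv_0_lt_compat. apply Rmult_lt_0_compat. lra. apply pow_lt; trivial. }
  assert (I2 : 0 < / (2 * a)) by (apply Rinv_0_lt_compat; lra).
  apply Rabs_le. rewrite I. split.
  - destruct (M 1 ltac:(lra)) as [c [Hc Ec]]. specialize (G c Hc). pose proof (C (a * c)). pose proof (C (a * w)). pose proof (C (a * PI)).
    set (q := cos (c / 2) / _) in *. set (i := / (2 * a * sin (w / 2))) in *. set (j := / (2 * a)) in *.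
    match type of Ec with context [?z / (2 * a * sin (w / 2))] => change (z / (2 * a * sin (w / 2))) with (z * i) in Ec end.
    match type of Ec with context [?z / (2 * a)] => change (z / (2 * a)) with (z * j) in Ec end.
    assert (0 <= (PI - w) * ((cos (a * c) + 1) * q)) by (apply Rmult_le_pos; [lra|apply Rmult_le_pos; lra]).
    assert (0 <= (cos (a * PI) + 1) * j) by (apply Rmult_le_pos; lra). nra.
  - destruct (M (-1) ltac:(lra)) as [c [Hc Ec]]. specialize (G c Hc). pose proof (C (a * c)). pose proof (C (a * w)). pose proof (C (a * PI)).
    set (q := cos (c / 2) / _) in *. set (i := / (2 * a * sin (w / 2))) in *. set (j := / (2 * a)) in *.
    match type of Ec with context [?z / (2 * a * sin (w / 2))] => change (z / (2 * a * sin (w / 2))) with (z * i) in Ec end.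
    match type of Ec with context [?z / (2 * a)] => change (z / (2 * a)) with (z * j) in Ec end.
    assert (0 <= (PI - w) * ((1 - cos (a * c)) * q)) by (apply Rmult_le_pos; [lra|apply Rmult_le_pos; lra]).
    assert (0 <= (1 - cos (a * PI)) * j) by (apply Rmult_le_pos; lra). nra.
Qed.

Lemma sin_half_ge (w : R) : 0 <= w <= PI -> w / 8 <= sin (w / 2).
Proof.
  intros Hw. pose proof PI_4 as P4. pose proof PI_RGT_0. pose proof PI2_1 as P2. set (x := w / 2). replace (w / 8) with (x / 4) by (unfold x; field).
  assert (Hx : 0 <= x <= PI / 2) by (unfold x; lra). clearbody x.
  assert (L : forall y, 0 <= y <= 1 -> y / 2 <= sin y).
  { intros y Hy. destruct (MVT_gen sin 0 y cos) as [c [Hc Ec]].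
    - intros z _. apply is_derive_sin.
    - intros z _. apply continuity_pt_filterlim. exact (is_derive_continuous _ _ _ (is_derive_sin z)).
    - rewrite Rmin_left, Rmax_right in Hc by lra. rewrite sin_0 in Ec. pose proof (cos_ge_quadratic c). nra. }
  destruct (Rle_dec x 1). specialize (L x ltac:(lra)). lra.
  specialize (L 1 ltac:(lra)). assert (sin 1 <= sin x) by (apply sin_incr_1; lra). lra.
Qed.

Lemma saw_err_bound (N : nat) (w : R) : 0 < w <= PI -> Rabs (saw_err N w) <= 8 /\ Rabs (saw_err N w) <= 8 / (INR (S N) * w).
Proof.
  intros Hw. pose proof (saw_err_decay N w Hw) as H. pose proof (sin_half_ge w ltac:(lra)) as S. pose proof (INR_S_pos N) as HN.
  assert (B : Rabs (saw_err N w) <= 8 / (INR (Datatypes.S N) * w)).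
  { eapply Rle_trans. apply H. replace (8 / (INR (Datatypes.S N) * w)) with (/ (INR (Datatypes.S N) * (w / 8))) by (field; lra).
    apply Rinv_le_contravar. apply Rmult_lt_0_compat; lra. apply Rmult_le_compat; lra. }
  split; trivial. destruct (Rle_dec 1 (INR (Datatypes.S N) * w)) as [L|L].
  - eapply Rle_trans. apply B. rewrite <- (Rmult_1_r 8) at 2. apply Rmult_le_compat_l. lra. rewrite <- Rinv_1. apply Rinv_le_contravar; lra.
  - unfold saw_err. assert (SB : Rabs (saw N w) <= INR (Datatypes.S N) * w).
    { unfold saw. clear - Hw. induction N as [|N IH].
      - rewrite sum_O. simpl INR. rewrite Rmult_1_l, Rdiv_1_r. apply sin_abs_le. lra.
      - rewrite sum_Sn. unfold plus; simpl plus. eapply Rle_trans. apply Rabs_triang. apply Rle_trans with (INR (S N) * w + w). 2: rewrite (S_INR (S N)); lra. apply Rplus_le_compat; trivial.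
        pose proof (INR_S_pos (S N)). pose proof (sin_abs_le (INR (S (S N)) * w) ltac:(nra)) as B.
        unfold Rdiv. rewrite Rabs_mult, Rabs_inv, (Rabs_pos_eq (INR (S (S N)))) by lra. apply (Rmult_le_reg_r (INR (S (S N)))); trivial.
        rewrite Rmult_assoc, Rinv_l by lra. lra. }
    pose proof PI_4. eapply Rle_trans. apply Rabs_triang. rewrite Rabs_Ropp, (Rabs_pos_eq ((PI - w) / 2)) by lra. lra.
Qed.

Lemma saw_err_bound_period (N : nat) (d w : R) : 0 < d -> d <= w <= 2 * PI - d -> Rabs (saw_err N w) <= 8 / (INR (S N) * d).
Proof.
  intros Hd Hw. pose proof (INR_S_pos N).
  assert (G : forall v, d <= v <= PI -> Rabs (saw_err N v) <= 8 / (INR (S N) * d)).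
  { intros v Hv. eapply Rle_trans. apply saw_err_bound; lra. apply Rmult_le_compat_l. lra. apply Rinv_le_contravar. apply Rmult_lt_0_compat; lra.
    apply Rmult_le_compat_l; lra. }
  destruct (Rle_dec w PI). apply G; lra.
  replace w with (2 * PI - (2 * PI - w)) by ring. rewrite saw_err_reflect, Rabs_Ropp. apply G. lra.
Qed.

Lemma saw_err_le_8 (N : nat) (w : R) : 0 <= w <= 2 * PI -> Rabs (saw_err N w) <= 8.
Proof.
  intros Hw. pose proof PI_RGT_0. pose proof PI_4.
  assert (G : forall v, 0 <= v <= PI -> Rabs (saw_err N v) <= 8).
  { intros v Hv. destruct (Req_dec v 0) as [->|Hv0]; [|apply saw_err_bound; lra].
    unfold saw_err, saw. rewrite (sum_n_ext _ (fun _ => 0)). rewrite sum_n_const, Rmult_0_r. apply Rabs_le. lra.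
    intros k. rewrite Rmult_0_r, sin_0. unfold Rdiv. apply Rmult_0_l. }
  destruct (Rle_dec w PI). apply G; lra.
  replace w with (2 * PI - (2 * PI - w)) by ring. rewrite saw_err_reflect, Rabs_Ropp. apply G. lra.
Qed.

Lemma continuous_saw (N : nat) (w : R) : continuous (saw N) w.
Proof. exact (is_derive_continuous _ _ _ (is_derive_saw N w)). Qed.

Lemma continuous_saw_err (N : nat) (w : R) : continuous (saw_err N) w.
Proof.
  apply (continuous_minus (saw N) (fun w => (PI - w) / 2)). apply continuous_saw.
  apply (ex_derive_continuous (fun w => (PI - w) / 2)). auto_derive; trivial.
Qed.

(** Convergence is not uniform at the jumps: the two end intervals of length [d] cost [16 * B * d]
    by the uniform bound, and on the rest the error tends to 0 uniformly. [N0] is fixed before [h],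
    which later yields uniformity in [u]. *)
Lemma saw_err_L1 (e : R) : 0 < e -> exists N0, forall N, (N0 <= N)%nat -> forall (h : R -> R) (B : R),
  (forall w, continuous h w) -> (forall w, Rabs (h w) <= B) ->
  Rabs (RInt (fun w => h w * saw_err N w) 0 (2 * PI)) <= B * e.
Proof.
  intros He. pose proof PI_RGT_0 as HP. set (d := Rmin PI (e / 32)).
  assert (Hd : 0 < d) by (apply Rmin_glb_lt; lra). assert (Hd1 : d <= PI) by apply Rmin_l. assert (Hd2 : d <= e / 32) by apply Rmin_r.
  destruct (nfloor_ex (32 * PI / (e * d))) as [N0 [_ HN0]]. apply Rlt_le, Rdiv_lt_0_compat; nra.
  exists N0. intros N HN h B Ch Bh.
  assert (HB : 0 <= B) by (eapply Rle_trans; [apply Rabs_pos|apply (Bh 0)]).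
  assert (C : forall w, continuous (fun w => h w * saw_err N w) w).
  { intros w. apply (continuous_mult h (saw_err N)); trivial. apply continuous_saw_err. }
  assert (HNR : 32 * PI / (e * d) < INR (S N)). { eapply Rlt_le_trans. apply HN0. rewrite <- S_INR. apply le_INR. lia. }
  pose proof (INR_S_pos N).
  assert (HQ : 8 / (INR (S N) * d) <= e / (4 * PI)).
  { apply (Rmult_le_reg_r (INR (S N) * d)). apply Rmult_lt_0_compat; lra. unfold Rdiv at 1. rewrite Rmult_assoc, Rinv_l, Rmult_1_r.
    apply (Rmult_lt_compat_r (e * d / (4 * PI))) in HNR; [|apply Rdiv_lt_0_compat; nra].
    replace (32 * PI / (e * d) * (e * d / (4 * PI))) with 8 in HNR by (field; repeat split; lra).
    replace (e / (4 * PI) * (INR (S N) * d)) with (INR (S N) * (e * d / (4 * PI))) by (field; lra). lra. nra. }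
  rewrite (RInt_Chasles_cont _ 0 d (2 * PI)), (RInt_Chasles_cont _ d (2 * PI - d) (2 * PI)) by trivial.
  assert (P1 : Rabs (RInt (fun w => h w * saw_err N w) 0 d) <= (d - 0) * (B * 8)).
  { apply abs_RInt_le_const. lra. apply ex_RInt_cont, C. intros w Hw. rewrite Rabs_mult. apply Rmult_le_compat; try apply Rabs_pos; trivial. apply saw_err_le_8. lra. }
  assert (P2 : Rabs (RInt (fun w => h w * saw_err N w) d (2 * PI - d)) <= (2 * PI - d - d) * (B * (e / (4 * PI)))).
  { apply abs_RInt_le_const. lra. apply ex_RInt_cont, C. intros w Hw. rewrite Rabs_mult. apply Rmult_le_compat; try apply Rabs_pos; trivial.
    eapply Rle_trans; [|exact HQ]. apply saw_err_bound_period; trivial. }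
  assert (P3 : Rabs (RInt (fun w => h w * saw_err N w) (2 * PI - d) (2 * PI)) <= (2 * PI - (2 * PI - d)) * (B * 8)).
  { apply abs_RInt_le_const. lra. apply ex_RInt_cont, C. intros w Hw. rewrite Rabs_mult. apply Rmult_le_compat; try apply Rabs_pos; trivial. apply saw_err_le_8. lra. }
  eapply Rle_trans. apply Rabs_triang. eapply Rle_trans. apply Rplus_le_compat_l, Rabs_triang.
  assert ((2 * PI - d - d) * (B * (e / (4 * PI))) <= B * (e / 2)).
  { replace (B * (e / 2)) with (2 * PI * (B * (e / (4 * PI)))) by (field; lra). apply Rmult_le_compat_r. apply Rmult_le_pos; trivial.
    apply Rlt_le, Rdiv_lt_0_compat; lra. lra. }
  assert (B * d <= B * (e / 32)) by (apply Rmult_le_compat_l; trivial). nra.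
Qed.

(** * Sine expansion of a smooth odd function integrated against a continuous periodic one *)

Section SineSeries.
Variables g F F1 : R -> R.
Hypothesis Cg : forall x, continuous g x.
Hypothesis Pg : forall x, g (x + 2 * PI) = g x.
Hypothesis DF : forall x, is_derive F x (F1 x).
Hypothesis CF1 : forall x, continuous F1 x.
Hypothesis OF : forall x, F (- x) = - F x.

Definition sine_mean (n : R) : R := RInt (fun v => g v * sin (n * v)) (- PI) PI.
(** Integrated against [sin (k w)] over a period, this symmetrised translate gives [cos (k u)] times
    the k-th sine integral of [g]; integrated against [saw N], it sums the cosine series in [u]. *)
Definition sym (u w : R) : R := / 2 * (g (w - u) + g (w + u)).
Definition saw_conv (u : R) : R := RInt (fun w => sym u w * ((PI - w) / 2)) 0 (2 * PI).

Lemma continuous_shift (f : R -> R) (c x : R) : (forall x, continuous f x) -> continuous (fun x => f (x + c)) x.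
Proof.
  intros Cf. apply (continuous_comp (fun x => x + c) f). apply (continuous_plus (fun x => x) (fun _ => c)). apply continuous_id. apply continuous_const. apply Cf.
Qed.

Lemma continuous_sym (u w : R) : continuous (sym u) w.
Proof.
  apply (continuous_scal_r (/ 2) (fun w => g (w - u) + g (w + u))). apply (continuous_plus (fun w => g (w - u)) (fun w => g (w + u))); apply continuous_shift, Cg.
Qed.

Lemma period_INR (k : nat) (x : R) : sin (INR k * (x + 2 * PI)) = sin (INR k * x).
Proof. replace (INR k * (x + 2 * PI)) with (INR k * x + 2 * INR k * PI) by ring. apply sin_period. Qed.

Lemma continuous_sin_scal (n x : R) : continuous (fun x => sin (n * x)) x.
Proof. apply (ex_derive_continuous (fun x => sin (n * x))). auto_derive; trivial. Qed.

Lemma sym_sine (k : nat) (u : R) : RInt (fun w => sym u w * sin (INR k * w)) 0 (2 * PI) = cos (INR k * u) * sine_mean (INR k).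
Proof.
  pose proof PI_RGT_0.
  assert (T : forall c, RInt (fun w => g (w + c) * sin (INR k * w)) 0 (2 * PI) = RInt (fun v => g v * sin (INR k * (v - c))) (- PI) PI).
  { intros c. set (h := fun v => g v * sin (INR k * (v - c))).
    assert (Ch : forall v, continuous h v).
    { intros v. apply (continuous_mult g (fun v => sin (INR k * (v - c)))); trivial. apply (continuous_shift (fun v => sin (INR k * v))), continuous_sin_scal. }
    assert (Ph : forall v, h (v + 2 * PI) = h v). { intros v. unfold h. rewrite Pg. replace (v + 2 * PI - c) with (v - c + 2 * PI) by ring. rewrite period_INR. reflexivity. }
    rewrite (RInt_ext _ (fun w => h (w + c))).
    2: { intros w _. unfold h. replace (w + c - c) with w by ring. reflexivity. }
    rewrite RInt_shift by trivial. rewrite Rplus_0_l, (Rplus_comm (2 * PI)), RInt_periodic by trivial.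
    replace PI with (- PI + 2 * PI) at 3 by ring. rewrite RInt_periodic by trivial. reflexivity. }
  assert (Cs : forall c w, continuous (fun w => g (w + c) * sin (INR k * w)) w).
  { intros c w. apply (continuous_mult (fun w => g (w + c)) (fun w => sin (INR k * w))). apply continuous_shift, Cg. apply continuous_sin_scal. }
  rewrite (RInt_ext _ (fun w => / 2 * (g (w + - u) * sin (INR k * w) + g (w + u) * sin (INR k * w)))).
  2: { intros w _. unfold sym, Rminus. rewrite Rmult_assoc, Rmult_plus_distr_r. reflexivity. }
  rewrite RInt_scal_R by (apply ex_RInt_cont; intros w; apply (continuous_plus (fun w => g (w + - u) * sin (INR k * w)) (fun w => g (w + u) * sin (INR k * w))); apply Cs).
  rewrite RInt_plus_R by (apply ex_RInt_cont, Cs). rewrite !T.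
  assert (Cv : forall c v, continuous (fun v => g v * sin (INR k * (v - c))) v).
  { intros c v. apply (continuous_mult g (fun v => sin (INR k * (v - c)))); trivial. apply (continuous_shift (fun v => sin (INR k * v))), continuous_sin_scal. }
  rewrite <- RInt_plus_R by (apply ex_RInt_cont, Cv). unfold sine_mean.
  rewrite <- !RInt_scal_R.
  - apply RInt_ext. intros v _. replace (INR k * (v - - u)) with (INR k * v + INR k * u) by ring. replace (INR k * (v - u)) with (INR k * v - INR k * u) by ring.
    rewrite sin_plus, sin_minus. real_eq. field.
  - apply ex_RInt_cont. intros v. apply (continuous_mult g (fun v => sin (INR k * v))); trivial. apply continuous_sin_scal.
  - apply ex_RInt_cont. intros v. apply (continuous_plus (fun v => g v * sin (INR k * (v - - u))) (fun v => g v * sin (INR k * (v - u)))); apply Cv.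
Qed.

Definition partial (N : nat) (u : R) : R := sum_n (fun k => cos (INR (S k) * u) / INR (S k) * sine_mean (INR (S k))) N.

Lemma partial_saw (N : nat) (u : R) : partial N u = RInt (fun w => sym u w * saw N w) 0 (2 * PI).
Proof.
  assert (Ct : forall k w, continuous (fun w => sym u w * sin (INR k * w)) w).
  { intros k w. apply (continuous_mult (sym u) (fun w => sin (INR k * w))). apply continuous_sym. apply continuous_sin_scal. }
  assert (T : forall k, cos (INR (S k) * u) / INR (S k) * sine_mean (INR (S k)) = RInt (fun w => / INR (S k) * (sym u w * sin (INR (S k) * w))) 0 (2 * PI)).
  { intros k. rewrite RInt_scal_R by apply ex_RInt_cont, Ct. rewrite sym_sine. unfold Rdiv. ring. }
  unfold partial, saw. induction N as [|N IH].
  - rewrite sum_O, T. apply RInt_ext. intros w _. rewrite sum_O. real_eq. unfold Rdiv. ring.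
  - rewrite sum_Sn, IH, T. change plus with Rplus. rewrite <- RInt_plus_R.
    + apply RInt_ext. intros w _. rewrite sum_Sn. change plus with Rplus. real_eq. unfold Rdiv. ring.
    + apply ex_RInt_cont. intros w. apply (continuous_mult (sym u) (saw N)). apply continuous_sym. apply continuous_saw.
    + apply ex_RInt_cont. intros w. apply (continuous_scal_r (/ INR (S (S N))) (fun w => sym u w * sin (INR (S (S N)) * w))). apply Ct.
Qed.

(** A bound for [g] bounds [sym u] for all [u] at once, so L^1 convergence of the sawtooth sums
    gives convergence uniform in [u]. *)
Lemma partial_limit (e : R) : 0 < e -> exists N0, forall N u, (N0 <= N)%nat -> Rabs (partial N u - saw_conv u) <= e.
Proof.
  intros He. pose proof PI_RGT_0.
  destruct (bounded_on_period g Cg) as [B [HB BB]].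
  assert (BG : forall x, Rabs (g x) <= B).
  { intros x. assert (Q : forall k y, g (y + INR k * (2 * PI)) = g y).
    { induction k as [|k IH]; intros y. simpl. rewrite Rmult_0_l, Rplus_0_r; trivial. rewrite S_INR. replace (y + (INR k + 1) * (2 * PI)) with (y + INR k * (2 * PI) + 2 * PI) by ring. rewrite Pg. apply IH. }
    assert (G : forall y, 0 <= y -> Rabs (g y) <= B).
    { intros y Hy. destruct (nfloor_ex ((y + PI) / (2 * PI))) as [k [K1 K2]]. apply Rlt_le, Rdiv_lt_0_compat; lra.
      replace y with (y - INR k * (2 * PI) + INR k * (2 * PI)) by ring. rewrite Q. apply BB.
      apply (Rmult_le_compat_r (2 * PI)) in K1; [|lra]. apply (Rmult_lt_compat_r (2 * PI)) in K2; [|lra].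
      replace ((y + PI) / (2 * PI) * (2 * PI)) with (y + PI) in K1, K2 by (field; lra). lra. }
    destruct (Rle_dec 0 x). apply G; trivial. destruct (nfloor_ex (- x / (2 * PI))) as [k [K1 K2]]. apply Rlt_le, Rdiv_lt_0_compat; lra.
    apply (Rmult_lt_compat_r (2 * PI)) in K2; [|lra]. replace (- x / (2 * PI) * (2 * PI)) with (- x) in K2 by (field; lra).
    rewrite <- (Q (S k)). apply G. rewrite S_INR. lra. }
  assert (BS : forall u w, Rabs (sym u w) <= B).
  { intros u w. unfold sym. rewrite Rabs_mult, (Rabs_pos_eq (/ 2)) by lra. pose proof (Rabs_triang (g (w - u)) (g (w + u))). pose proof (BG (w - u)). pose proof (BG (w + u)). lra. }
  assert (HeB : 0 < e / B) by (apply Rdiv_lt_0_compat; trivial).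
  destruct (saw_err_L1 (e / B) HeB) as [N0 H0]. exists N0. intros N u HN. rewrite partial_saw. unfold saw_conv. rewrite <- RInt_minus_R.
  - rewrite (RInt_ext _ (fun w => sym u w * saw_err N w)).
    + eapply Rle_trans. apply (H0 N HN (sym u) B). apply continuous_sym. apply BS. right. field. lra.
    + intros w _. unfold saw_err. real_eq. ring.
  - apply ex_RInt_cont. intros w. apply (continuous_mult (sym u) (saw N)). apply continuous_sym. apply continuous_saw.
  - apply ex_RInt_cont. intros w. apply (continuous_mult (sym u) (fun w => (PI - w) / 2)). apply continuous_sym.
    apply (ex_derive_continuous (fun w => (PI - w) / 2)). auto_derive; trivial.
Qed.

Lemma is_derive_RInt_0 (h : R -> R) (x : R) : (forall x, continuous h x) -> is_derive (fun x => RInt h 0 x) x (h x).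
Proof.
  intros Ch. apply (is_derive_RInt h (fun x => RInt h 0 x) 0). 2: apply Ch.
  apply filter_forall. intros y. apply (RInt_correct (V := R_CompleteNormedModule)), ex_RInt_cont, Ch.
Qed.

(** [g] is merely continuous and cannot be differentiated; the shift is moved to the limits of
    integration, where periodicity and the fundamental theorem apply. *)
Lemma is_derive_saw_conv (u : R) : is_derive saw_conv u (PI / 2 * (g (- u) - g u)).
Proof.
  set (I := RInt g 0 (2 * PI)). set (H := fun x => RInt (fun y => y * g y) 0 x).
  assert (Cy : forall y, continuous (fun y => y * g y) y). { intros y. apply (continuous_mult (fun y => y) g); trivial. apply continuous_id. }
  assert (DH : forall x, is_derive H x (x * g x)) by (intros x; apply (is_derive_RInt_0 (fun y => y * g y)); trivial).
  (* After [y = w + c] the weight is [(PI + c - y) / 2]: its part without [y] integrates over a full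
     period to a multiple of [I], the rest is a difference of values of [H]. *)
  set (L := fun c => (PI + c) / 2 * I - / 2 * (H (c + 2 * PI) - H c)).
  assert (EL : forall c, RInt (fun w => g (w + c) * ((PI - w) / 2)) 0 (2 * PI) = L c).
  { intros c. rewrite (RInt_ext _ (fun w => (fun y => (PI + c) / 2 * g y - / 2 * (y * g y)) (w + c))).
    2: { intros w _. real_eq. field. }
    assert (C1 : forall y, continuous (fun y => (PI + c) / 2 * g y) y) by (intros y; apply (continuous_scal_r ((PI + c) / 2) g), Cg).
    assert (C2 : forall y, continuous (fun y => / 2 * (y * g y)) y) by (intros y; apply (continuous_scal_r (/ 2) (fun y => y * g y)), Cy).
    rewrite (RInt_shift (fun y => (PI + c) / 2 * g y - / 2 * (y * g y))).
    2: { intros y. apply (continuous_minus (fun y => (PI + c) / 2 * g y) (fun y => / 2 * (y * g y))); trivial. }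
    rewrite RInt_minus_R by (apply ex_RInt_cont; trivial). rewrite (RInt_scal_R g), (RInt_scal_R (fun y => y * g y)) by (apply ex_RInt_cont; trivial).
    rewrite Rplus_0_l, (Rplus_comm (2 * PI)), RInt_periodic by trivial. fold I. unfold L, H.
    pose proof (RInt_Chasles_cont (fun y => y * g y) 0 c (c + 2 * PI) Cy). simpl in *. nra. }
  assert (DL : forall c, is_derive L c (I / 2 - PI * g c)).
  { intros c. pose proof (DH c) as D0. pose proof (DH (c + 2 * PI)) as D1. unfold L. rewrite Pg in D1. clearbody H. auto_derive.
    repeat split; first [exact (ex_intro _ _ D0)|exact (ex_intro _ _ D1)]. drw D0. drw D1. field. }
  apply (is_derive_ext (fun u => / 2 * (L (- u) + L u))).
  { intros v. rewrite <- !EL. unfold saw_conv, sym. rewrite <- RInt_plus_R, <- RInt_scal_R.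
    - apply RInt_ext. intros w _. real_eq. replace (w + - v) with (w - v) by ring. field.
    - apply ex_RInt_cont. intros w. apply (continuous_plus (fun w => g (w + - v) * ((PI - w) / 2)) (fun w => g (w + v) * ((PI - w) / 2)));
      [apply (continuous_mult (fun w => g (w + - v)) (fun w => (PI - w) / 2))|apply (continuous_mult (fun w => g (w + v)) (fun w => (PI - w) / 2))];
      try apply continuous_shift, Cg; apply (ex_derive_continuous (fun w => (PI - w) / 2)); auto_derive; trivial.
    - apply ex_RInt_cont. intros w. apply (continuous_mult (fun w => g (w + - v)) (fun w => (PI - w) / 2)). apply continuous_shift, Cg.
      apply (ex_derive_continuous (fun w => (PI - w) / 2)); auto_derive; trivial.
    - apply ex_RInt_cont. intros w. apply (continuous_mult (fun w => g (w + v)) (fun w => (PI - w) / 2)). apply continuous_shift, Cg.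
      apply (ex_derive_continuous (fun w => (PI - w) / 2)); auto_derive; trivial. }
  pose proof (DL u) as D0. pose proof (DL (- u)) as D1. clearbody L. auto_derive. repeat split; first [exact (ex_intro _ _ D0)|exact (ex_intro _ _ D1)].
  drw D0. drw D1. field.
Qed.

Lemma continuous_F (u : R) : continuous F u.
Proof. exact (is_derive_continuous _ _ _ (DF u)). Qed.

Lemma F_0 : F 0 = 0.
Proof. pose proof (OF 0) as E. rewrite Ropp_0 in E. lra. Qed.

Definition sine_coef (n : R) : R := RInt (fun u => F u * sin (n * u)) 0 PI.

(** The factor [/ n] gained here is what turns the sine series into the series of [partial];
    [F 0 = 0] removes the boundary term at 0. *)
Lemma sine_coef_by_parts (n : R) : n <> 0 -> sine_coef n = - F PI * (cos (n * PI) / n) + RInt (fun u => F1 u * (cos (n * u) / n)) 0 PI.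
Proof.
  intros Hn.
  assert (C1 : forall u, continuous (fun u => F1 u * (cos (n * u) / n)) u).
  { intros u. apply (continuous_mult F1 (fun u => cos (n * u) / n)); trivial. apply (ex_derive_continuous (fun u => cos (n * u) / n)). auto_derive; trivial. }
  assert (C2 : forall u, continuous (fun u => F u * sin (n * u)) u).
  { intros u. apply (continuous_mult F (fun u => sin (n * u))). apply continuous_F. apply continuous_sin_scal. }
  assert (E : RInt (fun u => F1 u * (cos (n * u) / n) - F u * sin (n * u)) 0 PI = F PI * (cos (n * PI) / n) - F 0 * (cos (n * 0) / n)).
  { apply is_RInt_unique. apply (is_RInt_derive (fun u => F u * (cos (n * u) / n))).
    - intros u _. pose proof (DF u) as D. set (f := F) in *. clearbody f. auto_derive. exact (ex_intro _ _ D). drw D. field. trivial.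
    - intros u _. apply (continuous_minus (fun u => F1 u * (cos (n * u) / n)) (fun u => F u * sin (n * u))); trivial. }
  rewrite RInt_minus_R, F_0, Rmult_0_l in E by (apply ex_RInt_cont; trivial). unfold sine_coef. simpl in *. lra.
Qed.

Lemma continuous_partial (N : nat) (u : R) : continuous (partial N) u.
Proof.
  eapply is_derive_continuous. apply (is_derive_sum_n (fun k u => cos (INR (S k) * u) / INR (S k) * sine_mean (INR (S k))) N u (fun k => - sin (INR (S k) * u) * sine_mean (INR (S k)))).
  intros k _. pose proof (INR_S_pos k) as H. cbv beta. set (m := INR (S k)) in *. clearbody m. auto_derive; trivial. field. lra.
Qed.

Lemma sum_by_parts (N : nat) : sum_n (fun k => sine_mean (INR (S k)) * sine_coef (INR (S k))) N
  = - F PI * partial N PI + RInt (fun u => F1 u * partial N u) 0 PI.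
Proof.
  assert (T : forall k, sine_mean (INR (S k)) * sine_coef (INR (S k)) = - F PI * (cos (INR (S k) * PI) / INR (S k) * sine_mean (INR (S k))) +
    RInt (fun u => sine_mean (INR (S k)) * (F1 u * (cos (INR (S k) * u) / INR (S k)))) 0 PI).
  { intros k. pose proof (INR_S_pos k). rewrite RInt_scal_R. rewrite sine_coef_by_parts by lra. real_eq. ring.
    apply ex_RInt_cont. intros u. apply (continuous_mult F1 (fun u => cos (INR (S k) * u) / INR (S k))); trivial.
    apply (ex_derive_continuous (fun u => cos (INR (S k) * u) / INR (S k))). set (m := INR (S k)) in *. clearbody m. auto_derive; trivial. }
  assert (C : forall k u, continuous (fun u => sine_mean (INR (S k)) * (F1 u * (cos (INR (S k) * u) / INR (S k)))) u).
  { intros k u. apply (continuous_scal_r (sine_mean (INR (S k))) (fun u => F1 u * (cos (INR (S k) * u) / INR (S k)))).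
    apply (continuous_mult F1 (fun u => cos (INR (S k) * u) / INR (S k))); trivial.
    apply (ex_derive_continuous (fun u => cos (INR (S k) * u) / INR (S k))). set (m := INR (S k)) in *. clearbody m. auto_derive; trivial. }
  assert (CP : forall N u, continuous (fun u => F1 u * partial N u) u).
  { intros M u. apply (continuous_mult F1 (partial M)); trivial. apply continuous_partial. }
  induction N as [|N IH].
  - rewrite sum_O, T. unfold partial. rewrite sum_O. f_equal. apply RInt_ext. intros u _. rewrite sum_O. real_eq. ring.
  - rewrite sum_Sn, IH, T. unfold partial at 3. rewrite sum_Sn. fold (partial N PI). change plus with Rplus.
    rewrite (RInt_ext (fun u => F1 u * partial (S N) u) (fun u => F1 u * partial N u + sine_mean (INR (S (S N))) * (F1 u * (cos (INR (S (S N)) * u) / INR (S (S N)))))).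
    + rewrite RInt_plus_R by (apply ex_RInt_cont; first [exact (CP N)|exact (C (S N))]). real_eq. ring.
    + intros u _. unfold partial. rewrite sum_Sn. change plus with Rplus. real_eq. ring.
Qed.

(** Undoes the integration by parts with the derivative of [saw_conv]; oddness of [F] then unfolds
    the half period to [[-PI, PI]]. *)
Lemma sine_series_value : - F PI * saw_conv PI + RInt (fun u => F1 u * saw_conv u) 0 PI = PI / 2 * RInt (fun u => F u * g u) (- PI) PI.
Proof.
  assert (CA : forall u, continuous saw_conv u) by (intros u; exact (is_derive_continuous _ _ _ (is_derive_saw_conv u))).
  assert (Cm : forall u, continuous (fun u => g (- u)) u).
  { intros u. apply (continuous_comp Ropp g). apply (ex_derive_continuous Ropp). auto_derive; trivial. apply Cg. }
  assert (C1 : forall u, continuous (fun u => F1 u * saw_conv u) u) by (intros u; apply (continuous_mult F1 saw_conv); trivial).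
  assert (C2 : forall u, continuous (fun u => F u * (PI / 2 * (g (- u) - g u))) u).
  { intros u. apply (continuous_mult F (fun u => PI / 2 * (g (- u) - g u))). apply continuous_F. apply (continuous_scal_r (PI / 2) (fun u => g (- u) - g u)).
    apply (continuous_minus (fun u => g (- u)) g); trivial. }
  assert (C3 : forall u, continuous (fun u => F u * g u) u) by (intros u; apply (continuous_mult F g); trivial; apply continuous_F).
  assert (C4 : forall u, continuous (fun u => F u * g (- u)) u) by (intros u; apply (continuous_mult F (fun u => g (- u))); trivial; apply continuous_F).
  assert (E : RInt (fun u => F1 u * saw_conv u + F u * (PI / 2 * (g (- u) - g u))) 0 PI = F PI * saw_conv PI - F 0 * saw_conv 0).
  { apply is_RInt_unique. apply (is_RInt_derive (fun u => F u * saw_conv u)).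
    - intros u _. pose proof (DF u) as D. pose proof (is_derive_saw_conv u) as DA. set (f := F) in *. set (A := saw_conv) in *. set (l := PI / 2 * _) in *.
      clearbody f A l. auto_derive. repeat split; first [exact (ex_intro _ _ D)|exact (ex_intro _ _ DA)]. drw D. drw DA. ring.
    - intros u _. apply (continuous_plus (fun u => F1 u * saw_conv u) (fun u => F u * (PI / 2 * (g (- u) - g u)))); trivial. }
  rewrite RInt_plus_R, F_0, Rmult_0_l in E by (apply ex_RInt_cont; trivial).
  rewrite (RInt_ext (fun u => F u * (PI / 2 * (g (- u) - g u))) (fun u => PI / 2 * (F u * g (- u) - F u * g u))) in E by (intros; real_eq; ring).
  rewrite RInt_scal_R in E by (apply ex_RInt_cont; intros u; apply (continuous_minus (fun u => F u * g (- u)) (fun u => F u * g u)); trivial).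
  rewrite RInt_minus_R in E by (apply ex_RInt_cont; trivial).
  rewrite (RInt_Chasles_cont _ (- PI) 0 PI) by trivial.
  assert (EO : RInt (fun u => F u * g u) (- PI) 0 = - RInt (fun u => F u * g (- u)) 0 PI).
  { pose proof (RInt_comp_lin (fun u => F u * g u) (-1) 0 0 PI (ex_RInt_cont _ _ _ C3)) as Q.
    rewrite (RInt_ext _ (fun u => F u * g (- u))) in Q.
    - replace (-1 * 0 + 0) with 0 in Q by ring. replace (-1 * PI + 0) with (- PI) in Q by ring. rewrite Q. symmetry.
      apply (opp_RInt_swap (V := R_CompleteNormedModule)). apply ex_RInt_cont; trivial.
    - intros u _. replace (-1 * u + 0) with (- u) by ring. rewrite OF. unfold scal; simpl; unfold mult; simpl. real_eq. ring. }
  rewrite EO. simpl in *. lra.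
Qed.

Lemma sine_series_limit (e : R) : 0 < e -> exists N0, forall N, (N0 <= N)%nat ->
  Rabs (sum_n (fun k => sine_mean (INR (S k)) * sine_coef (INR (S k))) N - PI / 2 * RInt (fun u => F u * g u) (- PI) PI) <= e.
Proof.
  intros He. pose proof PI_RGT_0. destruct (bounded_on_period F1 CF1) as [B [HB BB]].
  set (D := Rabs (F PI) + PI * B). assert (HD : 0 < D). { unfold D. pose proof (Rabs_pos (F PI)). nra. }
  assert (HeD : 0 < e / D) by (apply Rdiv_lt_0_compat; trivial).
  destruct (partial_limit (e / D) HeD) as [N0 HN0]. exists N0. intros N HN.
  assert (CA : forall u, continuous saw_conv u) by (intros u; exact (is_derive_continuous _ _ _ (is_derive_saw_conv u))).
  rewrite sum_by_parts, <- sine_series_value.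
  assert (C1 : forall u, continuous (fun u => F1 u * partial N u) u) by (intros u; apply (continuous_mult F1 (partial N)); trivial; apply continuous_partial).
  assert (C2 : forall u, continuous (fun u => F1 u * saw_conv u) u) by (intros u; apply (continuous_mult F1 saw_conv); trivial).
  assert (T : Rabs (RInt (fun u => F1 u * partial N u) 0 PI - RInt (fun u => F1 u * saw_conv u) 0 PI) <= (PI - 0) * (B * (e / D))).
  { rewrite <- RInt_minus_R by (apply ex_RInt_cont; trivial). apply abs_RInt_le_const. lra.
    apply ex_RInt_cont. intros u. apply (continuous_minus (fun u => F1 u * partial N u) (fun u => F1 u * saw_conv u)); trivial.
    intros u Hu. rewrite <- Rmult_minus_distr_l, Rabs_mult. apply Rmult_le_compat; try apply Rabs_pos. apply BB. lra. apply HN0; trivial. }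
  set (I1 := RInt _ 0 PI) in *. set (I2 := RInt (fun u => F1 u * saw_conv u) 0 PI) in *.
  replace (- F PI * partial N PI + I1 - (- F PI * saw_conv PI + I2)) with (- F PI * (partial N PI - saw_conv PI) + (I1 - I2)) by ring.
  eapply Rle_trans. apply Rabs_triang. rewrite Rabs_mult, Rabs_Ropp.
  apply Rle_trans with (Rabs (F PI) * (e / D) + PI * (B * (e / D))). apply Rplus_le_compat. apply Rmult_le_compat_l. apply Rabs_pos. apply HN0; trivial.
  rewrite Rminus_0_r in T. exact T. right. replace (Rabs (F PI) * (e / D) + PI * (B * (e / D))) with (D * (e / D)) by (unfold D; ring). field. lra.
Qed.
End SineSeries.

(** * The expansion *)

(** J_0 and J^2 + Y^2 take real values here, so all complex integrals split along the two components
    of [psi]. *)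
Lemma RInt_pair (f : R -> C) (f1 f2 : R -> R) (a b : R) : (forall x, f x = (f1 x, f2 x)) ->
  (forall x, continuous f1 x) -> (forall x, continuous f2 x) ->
  RInt (V := C_R_CompleteNormedModule) f a b = (RInt f1 a b, RInt f2 a b).
Proof.
  intros E C1 C2. apply (is_RInt_unique (V := C_R_CompleteNormedModule)).
  apply (is_RInt_ext (V := C_R_NormedModule) (fun x => (f1 x, f2 x))). intros; symmetry; apply E.
  apply (is_RInt_fct_extend_pair (fun x => (f1 x, f2 x))); apply (RInt_correct (V := R_CompleteNormedModule)), ex_RInt_cont; trivial.
Qed.

Lemma is_RInt_gen_pair (f1 f2 : R -> R) (Fa Fb : (R -> Prop) -> Prop) {FFa : Filter Fa} {FFb : Filter Fb} (l1 l2 : R) :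
  is_RInt_gen f1 Fa Fb l1 -> is_RInt_gen f2 Fa Fb l2 ->
  is_RInt_gen (V := C_R_NormedModule) (fun x => (f1 x, f2 x)) Fa Fb (l1, l2).
Proof.
  intros H1 H2 P [e He].
  assert (Q1 : locally l1 (fun y => ball l1 e y)) by (exists e; auto). assert (Q2 : locally l2 (fun y => ball l2 e y)) by (exists e; auto).
  apply H1 in Q1. apply H2 in Q2. unfold filtermapi in *. generalize (filter_and _ _ Q1 Q2). apply filter_imp. intros [a b] [[y1 [I1 B1]] [y2 [I2 B2]]].
  exists (y1, y2). split. apply (is_RInt_fct_extend_pair (fun x => (f1 x, f2 x))); assumption.
  apply He. split; assumption.
Qed.

Lemma is_series_pair (a : nat -> C) (l1 l2 : R) :
  filterlim (fun N => sum_n (fun k => fst (a k)) N) eventually (locally l1) ->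
  filterlim (fun N => sum_n (fun k => snd (a k)) N) eventually (locally l2) ->
  is_series (K := R_AbsRing) (V := C_R_NormedModule) a (l1, l2).
Proof.
  intros H1 H2.
  assert (E : forall N, sum_n (G := C_R_NormedModule) a N = (sum_n (fun k => fst (a k)) N, sum_n (fun k => snd (a k)) N)).
  { induction N as [|N IH]. rewrite !sum_O. apply surjective_pairing. rewrite !sum_Sn, IH. reflexivity. }
  intros P [e He].
  assert (Q1 : locally l1 (fun y => ball l1 e y)) by (exists e; auto). assert (Q2 : locally l2 (fun y => ball l2 e y)) by (exists e; auto).
  apply H1 in Q1. apply H2 in Q2. unfold filtermap in *. generalize (filter_and _ _ Q1 Q2). apply filter_imp. intros N [B1 B2].
  apply He. rewrite E. split; assumption.
Qed.

Lemma periodic_INR (g : R -> R) (T : R) : (forall u, g (u + T) = g u) -> forall k u, g (u + INR k * T) = g u.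
Proof.
  intros Pg. induction k as [|k IH]; intros u. simpl. rewrite Rmult_0_l, Rplus_0_r; trivial.
  rewrite S_INR. replace (u + (INR k + 1) * T) with (u + INR k * T + T) by ring. rewrite Pg. apply IH.
Qed.

(** One shift [c], chosen before [g] and [v], so that a point and its neighbours can be moved
    together. *)
Lemma period_representative (T u : R) : 0 < T -> exists c,
  (- T / 2 <= u + c < T / 2) /\ forall g : R -> R, (forall u, g (u + T) = g u) -> forall v, g (v + c) = g v.
Proof.
  intros HT. destruct (Rle_dec 0 (u + T / 2)) as [H|H].
  - destruct (nfloor_ex ((u + T / 2) / T)) as [k [K1 K2]]. apply Rle_div_r; lra. exists (- (INR k * T)). split.
    + apply (Rmult_le_compat_r T) in K1; [|lra]. apply (Rmult_lt_compat_r T) in K2; [|lra].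
      replace ((u + T / 2) / T * T) with (u + T / 2) in K1, K2 by (field; lra). lra.
    + intros g Pg v. rewrite <- (periodic_INR g T Pg k (v + - (INR k * T))). f_equal. ring.
  - destruct (nfloor_ex (- (u + T / 2) / T)) as [k [K1 K2]]. apply Rle_div_r; lra.
    apply (Rmult_le_compat_r T) in K1; [|lra]. apply (Rmult_lt_compat_r T) in K2; [|lra].
    replace (- (u + T / 2) / T * T) with (- (u + T / 2)) in K1, K2 by (field; lra).
    destruct (Req_dec (INR k * T) (- (u + T / 2))) as [Q|Q].
    + exists (INR k * T). split. lra. intros g Pg v. apply periodic_INR; trivial.
    + exists (INR (S k) * T). rewrite S_INR. split. lra. intros g Pg v. rewrite <- S_INR. apply periodic_INR; trivial.
Qed.

(** The Lipschitz bound is available on [[-PI, PI]] only. A neighbour lying beyond an endpoint is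
    compared through that endpoint, where [g (- PI) = g PI], and the two distances add up. *)
Lemma periodic_lipschitz_continuous (g : R -> R) (K : R) : 0 < K -> (forall u, g (u + 2 * PI) = g u) ->
  (forall u v, - PI <= u <= PI -> - PI <= v <= PI -> Rabs (g u - g v) <= K * Rabs (u - v)) ->
  forall u, continuous g u.
Proof.
  intros HK Pg L u. pose proof PI_RGT_0 as HP.
  assert (G : forall v, Rabs (v - u) < PI -> Rabs (g v - g u) <= K * Rabs (v - u)).
  { intros v Hv. destruct (period_representative (2 * PI) u ltac:(lra)) as [c [Hc Pc]]. specialize (Pc g Pg).
    rewrite <- (Pc u), <- (Pc v). replace (v - u) with ((v + c) - (u + c)) in * by ring.
    set (a := u + c) in *. set (b := v + c) in *. clearbody a b. apply Rabs_def2 in Hv.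
    assert (E : g (- PI) = g PI). { rewrite <- (Pg (- PI)). f_equal. ring. }
    destruct (Rlt_dec PI b) as [H1|H1]; [|destruct (Rlt_dec b (- PI)) as [H2|H2]].
    - replace (g b) with (g (b - 2 * PI)) by (rewrite <- Pg; f_equal; ring).
      pose proof (L (b - 2 * PI) (- PI) ltac:(lra) ltac:(lra)) as L1. pose proof (L PI a ltac:(lra) ltac:(lra)) as L2. rewrite E in L1.
      rewrite (Rabs_pos_eq (_ - a)) in L2 by lra. rewrite (Rabs_pos_eq (_ - - PI)) in L1 by lra. rewrite (Rabs_pos_eq (b - a)) by lra.
      replace (g (b - 2 * PI) - g a) with ((g (b - 2 * PI) - g PI) + (g PI - g a)) by ring. eapply Rle_trans. apply Rabs_triang. nra.
    - rewrite <- (Pg b).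
      pose proof (L (b + 2 * PI) PI ltac:(lra) ltac:(lra)) as L1. pose proof (L (- PI) a ltac:(lra) ltac:(lra)) as L2. rewrite E in L2.
      rewrite (Rabs_left1 (_ - a)) in L2 by lra. rewrite (Rabs_left1 (_ - PI)) in L1 by lra. rewrite (Rabs_left1 (b - a)) by lra.
      replace (g (b + 2 * PI) - g a) with ((g (b + 2 * PI) - g PI) + (g PI - g a)) by ring. eapply Rle_trans. apply Rabs_triang. nra.
    - apply L; lra. }
  apply lim_at_spec. apply locally_filter. intros e He.
  assert (Hd : 0 < Rmin PI (e / (2 * K))) by (apply Rmin_glb_lt; [lra|apply Rdiv_lt_0_compat; lra]).
  exists (mkposreal _ Hd). intros v Hv. change (Rabs (v - u) < Rmin PI (e / (2 * K))) in Hv.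
  assert (H1 : Rabs (v - u) < PI) by (eapply Rlt_le_trans; [exact Hv|apply Rmin_l]).
  assert (H2 : Rabs (v - u) < e / (2 * K)) by (eapply Rlt_le_trans; [exact Hv|apply Rmin_r]).
  eapply Rle_lt_trans. apply G; trivial. apply (Rmult_lt_compat_l K) in H2; trivial. replace (K * (e / (2 * K))) with (e / 2) in H2 by (field; lra). lra.
Qed.

Lemma continuous_sinh2 (g : R -> R) : (forall u, continuous g u) -> forall u, continuous (fun u => g u * sinh (2 * u)) u.
Proof.
  intros Hg u. apply (continuous_mult g (fun u => sinh (2 * u))). apply Hg. apply (ex_derive_continuous (fun u => sinh (2 * u))). auto_derive; trivial.
Qed.

Section Expansion.
Variable psi : R -> C.
Let g1 (u : R) : R := fst (psi u).
Let g2 (u : R) : R := snd (psi u).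
Hypothesis C1 : forall u, continuous g1 u.
Hypothesis C2 : forall u, continuous g2 u.

Lemma f_of_pair (x : R) : f_of psi x = (x * bint (fun u => g1 u * sinh (2 * u)) x, x * bint (fun u => g2 u * sinh (2 * u)) x).
Proof.
  unfold f_of, bint.
  rewrite (RInt_pair _ (fun u => J0 (2 * cosh u * x) * (g1 u * sinh (2 * u))) (fun u => J0 (2 * cosh u * x) * (g2 u * sinh (2 * u)))).
  - unfold Cmult, RtoC; simpl. f_equal; ring.
  - intros u. rewrite besselJ_0. unfold phi, g1, g2. destruct (psi u) as [a b]. replace (2 * x * cosh u) with (2 * cosh u * x) by ring.
    unfold Cmult, RtoC; simpl. f_equal; ring.
  - intros u. apply continuous_J0u, (continuous_sinh2 g1 C1).
  - intros u. apply continuous_J0u, (continuous_sinh2 g2 C2).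
Qed.

(** This is [coefficient_integral] at [mu = n / 2], where the frequency [2 * mu] is [n]. Orders
    start at [S k] because the quotient defining [besselY] needs a nonzero order. *)
Lemma a_coef_pair (k : nat) :
  a_coef psi (S k) = (2 / (PI * sinh (PI * INR (S k) / 2)) * sine_mean g1 (INR (S k)), 2 / (PI * sinh (PI * INR (S k) / 2)) * sine_mean g2 (INR (S k))).
Proof.
  pose proof (INR_S_pos k) as H. unfold a_coef, iord, sine_mean. set (n := INR (S k)) in *. clearbody n. assert (Hmu : 0 < n / 2) by lra.
  pose proof (coefficient_integral (n / 2) g1 Hmu C1) as I1. pose proof (coefficient_integral (n / 2) g2 Hmu C2) as I2.
  replace (PI * (n / 2)) with (PI * n / 2) in I1, I2 by field. replace (2 * (n / 2)) with n in I1, I2 by field.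
  apply (is_RInt_gen_unique (V := C_R_CompleteNormedModule)).
  generalize (is_RInt_gen_pair _ _ _ _ _ _ I1 I2). apply (is_RInt_gen_ext (V := C_R_NormedModule)).
  apply filter_forall. intros ab x _. rewrite besselJY_square by trivial. rewrite f_of_pair. unfold Cmult, RtoC; simpl. f_equal; ring.
Qed.
End Expansion.

(** The odd smooth function to which the sine expansion is applied: [Phi_n n x] is [x] times its
    n-th sine coefficient. *)
Definition osc (x u : R) : R := J0 (2 * cosh u * x) * sinh (2 * u).
Definition osc1 (x u : R) : R := - J1 (2 * cosh u * x) * (2 * sinh u * x) * sinh (2 * u) + J0 (2 * cosh u * x) * (2 * cosh (2 * u)).

Lemma is_derive_osc (x u : R) : is_derive (osc x) u (osc1 x u).
Proof.
  pose proof (is_derive_J0_u x u) as D. unfold osc, osc1. set (j := fun u => J0 (2 * cosh u * x)) in *. set (l := - J1 (2 * cosh u * x) * (2 * sinh u * x)) in *.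
  change (is_derive j u l) in D. change (is_derive (fun u => j u * sinh (2 * u)) u (l * sinh (2 * u) + j u * (2 * cosh (2 * u)))).
  clearbody j l. auto_derive. exact (ex_intro _ _ D). drw D. ring.
Qed.

Lemma continuous_osc1 (x u : R) : continuous (osc1 x) u.
Proof.
  assert (CJ : continuous (fun u => J1 (2 * cosh u * x)) u).
  { apply (continuous_comp (fun u => 2 * cosh u * x) J1). apply (ex_derive_continuous (fun u => 2 * cosh u * x)). auto_derive; trivial. apply continuous_J1. }
  unfold osc1. apply (continuous_plus (fun u => - J1 (2 * cosh u * x) * (2 * sinh u * x) * sinh (2 * u)) (fun u => J0 (2 * cosh u * x) * (2 * cosh (2 * u)))).
  - apply (continuous_mult (fun u => - J1 (2 * cosh u * x) * (2 * sinh u * x)) (fun u => sinh (2 * u))).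
    apply (continuous_mult (fun u => - J1 (2 * cosh u * x)) (fun u => 2 * sinh u * x)). apply (continuous_opp (fun u => J1 (2 * cosh u * x))); trivial.
    apply (ex_derive_continuous (fun u => 2 * sinh u * x)). auto_derive; trivial.
    apply (ex_derive_continuous (fun u => sinh (2 * u))). auto_derive; trivial.
  - apply (continuous_J0u (fun u => 2 * cosh (2 * u))). apply (ex_derive_continuous (fun u => 2 * cosh (2 * u))). auto_derive; trivial.
Qed.

Lemma osc_odd (x u : R) : osc x (- u) = - osc x u.
Proof.
  unfold osc. replace (cosh (- u)) with (cosh u) by (unfold cosh; rewrite Ropp_involutive; field).
  replace (sinh (2 * - u)) with (- sinh (2 * u)). ring. unfold sinh. replace (2 * - u) with (- (2 * u)) by ring. rewrite Ropp_involutive. field.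
Qed.

Lemma Phi_n_value (n : nat) (x : R) : Phi_n n x = RtoC (x * sine_coef (osc x) (INR n)).
Proof.
  unfold Phi_n, sine_coef. rewrite (RInt_pair _ (fun u => osc x u * sin (INR n * u)) (fun _ => 0)).
  - rewrite RInt_const. unfold scal, Cmult, RtoC; simpl; unfold mult; simpl. f_equal; ring.
  - intros u. rewrite besselJ_0. unfold osc. replace (2 * x * cosh u) with (2 * cosh u * x) by ring. unfold Cmult, RtoC; simpl. f_equal; ring.
  - intros u. apply (continuous_mult (osc x) (fun u => sin (INR n * u))). exact (is_derive_continuous _ _ _ (is_derive_osc x u)). apply continuous_sin_scal.
  - intros u. apply continuous_const.
Qed.

(** The factor [2 / PI] is what [sinh (PI n / 2)] times the constant of [a_coef_pair] leaves; it
    cancels the [PI / 2] of [sine_series_limit]. *)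
Lemma expansion_limit (g : R -> R) (x : R) : (forall u, continuous g u) -> (forall u, g (u + 2 * PI) = g u) ->
  filterlim (fun N => sum_n (fun k => 2 * x / PI * (sine_mean g (INR (S k)) * sine_coef (osc x) (INR (S k)))) N) eventually
    (locally (x * bint (fun u => g u * sinh (2 * u)) x)).
Proof.
  intros Cg Pg. pose proof PI_RGT_0.
  set (a := fun k => sine_mean g (INR (S k)) * sine_coef (osc x) (INR (S k))).
  assert (E : x * bint (fun u => g u * sinh (2 * u)) x = 2 * x / PI * (PI / 2 * RInt (fun u => osc x u * g u) (- PI) PI)).
  { unfold bint. rewrite (RInt_ext (fun u => J0 (2 * cosh u * x) * (g u * sinh (2 * u))) (fun u => osc x u * g u)). real_eq. field. lra.
    intros u _. unfold osc. real_eq. ring. }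
  rewrite E. apply (filterlim_ext (fun N => 2 * x / PI * sum_n a N)).
  { intros N. symmetry. apply (sum_n_mult_l (K := R_Ring) (2 * x / PI) a N). }
  apply (lim_scal eventually (2 * x / PI)). apply lim_at_spec; [apply eventually_filter|]. intros e He.
  destruct (sine_series_limit g (osc x) (osc1 x) Cg Pg (is_derive_osc x) (continuous_osc1 x) (osc_odd x) (e / 2) ltac:(lra)) as [N0 HN].
  exists N0. intros N HN'. specialize (HN N HN'). fold a in HN. lra.
Qed.

(** [is_series] asserts convergence together with the value; its k-th term is the one for n = k +
    1. *)
Theorem theorem2 (psi : R -> C) (Cst : R) :
  0 < Cst ->
  (forall u, psi (u + 2 * PI) = psi u) ->
  (forall u v, - PI <= u <= PI -> - PI <= v <= PI ->
     Cmod (Cminus (psi u) (psi v)) <= Cst * Rabs (u - v)) ->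
  forall x, 0 < x ->
    is_series (K := R_AbsRing) (V := C_R_NormedModule)
      (fun k => Cmult (RtoC (sinh (PI * INR (S k) / 2)))
                      (Cmult (Phi_n (S k) x) (a_coef psi (S k))))
      (f_of psi x).
Proof.
  intros HC Pp Lp x Hx. pose proof PI_RGT_0 as HP.
  set (g1 := fun u => fst (psi u)). set (g2 := fun u => snd (psi u)).
  assert (P1 : forall u, g1 (u + 2 * PI) = g1 u) by (intros u; unfold g1; rewrite Pp; reflexivity).
  assert (P2 : forall u, g2 (u + 2 * PI) = g2 u) by (intros u; unfold g2; rewrite Pp; reflexivity).
  assert (C1 : forall u, continuous g1 u).
  { apply (periodic_lipschitz_continuous g1 Cst); trivial. intros u v Hu Hv. eapply Rle_trans; [|apply Lp; trivial].
    eapply Rle_trans; [|apply Rmax_Cmod]. apply (Rmax_l (Rabs (fst (psi u - psi v)%C))). }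
  assert (C2 : forall u, continuous g2 u).
  { apply (periodic_lipschitz_continuous g2 Cst); trivial. intros u v Hu Hv. eapply Rle_trans; [|apply Lp; trivial].
    eapply Rle_trans; [|apply Rmax_Cmod]. apply (Rmax_r (Rabs (fst (psi u - psi v)%C)) (Rabs (snd (psi u - psi v)%C))). }
  rewrite (f_of_pair psi C1 C2).
  (* The hyperbolic sine cancels against the one in [a_coef], so each component of a term is
     [2 * x / PI] times a product of a [sine_mean] and a [sine_coef]. *)
  assert (T : forall k, Cmult (RtoC (sinh (PI * INR (S k) / 2))) (Cmult (Phi_n (S k) x) (a_coef psi (S k)))
     = (2 * x / PI * (sine_mean g1 (INR (S k)) * sine_coef (osc x) (INR (S k))), 2 * x / PI * (sine_mean g2 (INR (S k)) * sine_coef (osc x) (INR (S k))))).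
  { intros k. rewrite Phi_n_value, (a_coef_pair psi C1 C2). fold g1 g2. pose proof (INR_S_pos k) as Hk.
    assert (Hs : 0 < sinh (PI * INR (S k) / 2)). { apply sinh_pos. apply Rdiv_lt_0_compat; nra. }
    set (s := sinh _) in *. clearbody s. set (n := INR (S k)) in *. unfold Cmult, RtoC; cbn [fst snd]. f_equal; field; lra. }
  apply is_series_pair.
  - apply (filterlim_ext (fun N => sum_n (fun k => 2 * x / PI * (sine_mean g1 (INR (S k)) * sine_coef (osc x) (INR (S k)))) N)).
    intros N. apply sum_n_ext. intros k. rewrite T. reflexivity. apply expansion_limit; trivial.
  - apply (filterlim_ext (fun N => sum_n (fun k => 2 * x / PI * (sine_mean g2 (INR (S k)) * sine_coef (osc x) (INR (S k)))) N)).
    intros N. apply sum_n_ext. intros k. rewrite T. reflexivity. apply expansion_limit; trivial.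
Qed.
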